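(* Let $n\geq 0$ be an integer and let $a_0,a_1,\dots,a_n$ be complex numbers, not all zero. Define \[ \phi_F(t)=e^{-2\pi\cosh t}\Bigg(\sum_{m=0}^{n}a_m e^{-2\pi m e^{t}}\Bigg)\Bigg(\sum_{m=0}^{n}\overline{a_m}\, e^{-2\pi m e^{-t}}\Bigg),\qquad t\in\mathbb{R}, \] the entire function $\Xi_F(s)=\int_{-\infty}^{\infty}\phi_F(t)e^{ist}\,dt$, and $C_F(s)=\Xi_F(-is)$. For $T>0$ let $\overline{N}(T,C_F)$ be the number of zeros $s$ of $C_F$ with $|\operatorname{Im} s|<T$, counted with multiplicity, and let $\overline{N_1}(T,C_F)$ be the number of simple zeros $s$ of $C_F$ with $\operatorname{Re} s=0$ and $|\operatorname{Im} s|<T$. Then for $T\geq 2$, \[ 0\leq \overline{N}(T,C_F)-\overline{N_1}(T,C_F)\leq \bigg(32n+\frac{32\ln(2n+1)}{\pi}\bigg)T+O(1), \] where the implied constant in $O(1)$ may depend on $a_0,\dots,a_n$ but not on $T$.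
   Context: The functions $\Xi_F$ are approximations (introduced by H. Ki) of the Ramanujan $\Xi$-function. $O(1)$ denotes a quantity bounded in absolute value by a constant independent of $T$. *)

(* Defs.v *)
From Stdlib Require Import Reals List.
From Coquelicot Require Import Coquelicot.
Open Scope R_scope.

Definition cexp (z : C) : C :=
  (exp (fst z) * cos (snd z), exp (fst z) * sin (snd z)).

Fixpoint Cpow (z : C) (k : nat) : C :=
  match k with O => 1%C | S k' => (z * Cpow z k')%C end.

Definition Csum (n : nat) (f : nat -> C) : C :=
  fold_right (fun m acc => (f m + acc)%C) 0%C (seq 0 (S n)).

Definition phiF (n : nat) (a : nat -> C) (t : R) : C :=
  (RtoC (exp (- 2 * PI * cosh t))
   * Csum n (fun m => a m * RtoC (exp (- 2 * PI * INR m * exp t)))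
   * Csum n (fun m => Cconj (a m) * RtoC (exp (- 2 * PI * INR m * exp (- t)))))%C.

Definition XiF (n : nat) (a : nat -> C) (s : C) : C :=
  RInt_gen (V := C_R_CompleteNormedModule)
    (fun t => (phiF n a t * cexp (Ci * s * RtoC t))%C)
    (Rbar_locally m_infty) (Rbar_locally p_infty).

Definition CF (n : nat) (a : nat -> C) (s : C) : C := XiF n a (- Ci * s)%C.

Definition zero_order (f : C -> C) (s : C) (k : nat) : Prop :=
  (1 <= k)%nat /\
  exists r : R, 0 < r /\ exists g : C -> C,
    g s <> 0%C /\
    forall z : C, Cmod (z - s) < r ->
      ex_derive (K := C_AbsRing) (V := C_NormedModule) g z /\
      f z = (Cpow (z - s) k * g z)%C.

Definition sum_nat_list (l : list nat) : nat := fold_right Nat.add O l.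

(* Main.v *)
(** Write [al m = pi (2 m + 1)].  Expanding the product in [phiF] makes [CF] a finite sum of
    the Bessel-type integrals [X s x = int exp (- e^t - x e^(-t) + s t) dt].  Since
    [X s 0 = Gamma s], solving the Bessel equation gives on the imaginary axis
    [y CF (i y) = 2 Im (Gamma (1 + i y) Pline (i y))] for an explicit combination [Pline] of
    hypergeometric series.  The phase of [Gamma (1 + i y)] is at least [y ln y - y - pi / 2].
    After rotating [Pline] by [(pi sqrt (2 n + 1))^(i y)], between two consecutive points where
    the remaining phase crosses [pi Z + alpha] either [CF] has a zero or the comparison function
    [h], an entire version of [Im (e^(i alpha) Pline) sinh (pi y) / y], has one.

    Now apply Jensen's formula on a common circle to [CF], counting off-axis and repeated zeros
    with weight at least [ln 2], and to [h], whose growth is only exponential.  The axis zeros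
    supplied by the crossings use up the main term [(2 / pi) V ln V] of the growth of [CF], so
    the remaining zeros number [O(V)] with an explicit constant.  All zeros lie in the sector
    [|Re s| < max (|Im s|, C0)], so those in the strip lie in a disc of radius [O(T)].

    For [n = 0] the constant leaves no room for such losses, but there [CF s] is a multiple of
    [J s pi] with [J s (e^u)] a solution of [f'' = (4 e^(2u) + s^2) f] decaying at infinity, and a
    Sturm-Liouville (Wronskian) argument shows that its zeros in [s] are imaginary and simple.

    Entire functions are represented as locally uniform limits of polynomials. *)
Require Import Defs.
From Stdlib Require Import Reals Arith List Lra Lia ClassicalEpsilon FunctionalExtensionality FinFun.
From Coquelicot Require Import Coquelicot.
Open Scope R_scope.

(** The proof is a budget: the bound leaves no room for [T ln T], so the [V ln V] terms of Jensen's
    formula for [CF] and of the crossings must cancel exactly. The growth of [CF] depends on [Re s]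
    only, like [|Re s| ln |Re s|], and the mean [2 / pi] of [|cos|] gives [(2 / pi) V ln V]; the
    crossings, at least about [(1 / pi) y ln y] up to height [y] on each half axis, give the same.
    The comparison function is needed because nothing is known about the sign of [Pline] on the
    axis; the multiplier [sin (pi s) / s] removes its poles and costs [pi |Im s|]. The number
    [pi sqrt (2 n + 1)] is the geometric mean of [al 0] and [al n]; it centers the frequencies and
    produces [ln (2 n + 1)]. With [V] about [3 T] the loss per unit of [T] is
    [24 + 24 / pi + 30 ln (2 n + 1) / pi], and [24 + 24 / pi <= 32 <= 32 n] closes the budget for
    [n >= 1]. Circle averages are taken over roots of unity, where polynomials average exactly;
    limits of polynomials thus give Cauchy's estimates without contour integrals. *)

Lemma C_ext (z w : C) : fst z = fst w -> snd z = snd w -> z = w.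
Proof. destruct z, w; simpl; congruence. Qed.

Lemma Cpow_def (z : C) (k : nat) : Defs.Cpow z k = (z ^ k)%C.
Proof. induction k as [|k IH]; simpl; [reflexivity | now rewrite IH]. Qed.

Lemma Cpow_mult_distr (z w : C) (k : nat) : ((z * w) ^ k = z ^ k * w ^ k)%C.
Proof. induction k as [|k IH]; simpl; [ring | rewrite IH; ring]. Qed.

Lemma Cpow_S (z : C) (k : nat) : (z ^ S k = z * z ^ k)%C.
Proof. reflexivity. Qed.

Lemma Cmod_sub_sym (z w : C) : Cmod (z - w) = Cmod (w - z).
Proof. rewrite <- Cmod_opp. f_equal. ring. Qed.

Lemma Cmod_sub_le (z w : C) : Cmod z - Cmod w <= Cmod (z - w).
Proof.
  pose proof (Cmod_triangle (z - w) w) as H.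
  replace (z - w + w)%C with z in H by ring. lra.
Qed.

Lemma Cmod_sub_triangle (z w : C) : Cmod (z - w) <= Cmod z + Cmod w.
Proof. eapply Rle_trans; [apply Cmod_triangle|]. rewrite Cmod_opp. lra. Qed.

Lemma Cmod_sub_trans (a b c : C) : Cmod (a - c) <= Cmod (a - b) + Cmod (b - c).
Proof. replace (a - c)%C with ((a - b) + (b - c))%C by ring. apply Cmod_triangle. Qed.

Lemma Cmod_RtoC_pos (x : R) : 0 <= x -> Cmod (RtoC x) = x.
Proof. intros H. rewrite Cmod_R. now apply Rabs_pos_eq. Qed.

Lemma Cmod_pos (z : C) : z <> 0%C -> 0 < Cmod z.
Proof. apply Cmod_gt_0. Qed.

Lemma Cmod_le_0 (z : C) : Cmod z <= 0 -> z = 0%C.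
Proof. intros H. apply Cmod_eq_0. pose proof (Cmod_ge_0 z). lra. Qed.

Lemma Cmod_small_eq (z w : C) : (forall e, 0 < e -> Cmod (z - w) <= e) -> z = w.
Proof.
  intros H.
  assert (Hz : (z - w)%C = 0%C).
  { apply Cmod_le_0. destruct (Rle_lt_dec (Cmod (z - w)) 0) as [h|h]; [exact h|].
    specialize (H (Cmod (z - w) / 2)). lra. }
  replace z with ((z - w) + w)%C by ring. rewrite Hz. ring.
Qed.

Lemma im_le_Cmod (z : C) : Rabs (Im z) <= Cmod z.
Proof. eapply Rle_trans; [apply Rmax_r|apply Rmax_Cmod]. Qed.

Lemma Cmod_le_re_im (z : C) : Cmod z <= Rabs (Re z) + Rabs (Im z).
Proof.
  destruct z as [x y]. unfold Re, Im; simpl.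
  replace (x, y) with (RtoC x + RtoC y * Ci)%C
    by (apply C_ext; simpl; ring).
  eapply Rle_trans; [apply Cmod_triangle|].
  rewrite Cmod_mult, Cmod_Ci, !Cmod_R. lra.
Qed.

Lemma Cmult_eq_0 (z w : C) : (z * w = 0)%C -> z = 0%C \/ w = 0%C.
Proof.
  intros H. destruct (classic (z = 0%C)) as [h|h]; [now left|right].
  replace w with (/ z * (z * w))%C by (field; exact h). rewrite H. ring.
Qed.

Lemma Cmult_neq_0' (z w : C) : z <> 0%C -> w <> 0%C -> (z * w)%C <> 0%C.
Proof. intros Hz Hw H. destruct (Cmult_eq_0 _ _ H); auto. Qed.

Lemma RtoC_neq_0 (x : R) : x <> 0 -> RtoC x <> 0%C.
Proof. intros H E. apply H. now apply RtoC_inj. Qed.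

Lemma Csub_eq_0 (z w : C) : (z - w = 0)%C -> z = w.
Proof. intros H. replace z with ((z - w) + w)%C by ring. rewrite H. ring. Qed.

(** * Finite sums and products *)

(** Sums and products run over [k < n], whereas [Csum] includes the index [n]; this is the origin of
    the many bounds [S n]. *)
Fixpoint CS (f : nat -> C) (n : nat) : C :=
  match n with O => 0%C | S k => (CS f k + f k)%C end.

Fixpoint RS (f : nat -> R) (n : nat) : R :=
  match n with O => 0 | S k => RS f k + f k end.

Fixpoint CP (f : nat -> C) (n : nat) : C :=
  match n with O => 1%C | S k => (CP f k * f k)%C end.

Lemma CS_S f n : CS f (S n) = (CS f n + f n)%C. Proof. reflexivity. Qed.

Lemma RS_S f n : RS f (S n) = RS f n + f n. Proof. reflexivity. Qed.

Lemma CP_S f n : CP f (S n) = (CP f n * f n)%C. Proof. reflexivity. Qed.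

Lemma CS_ext (f g : nat -> C) n : (forall k, (k < n)%nat -> f k = g k) -> CS f n = CS g n.
Proof. intros H. induction n as [|n IH]; simpl; [reflexivity|]. rewrite IH, H; auto; lia. Qed.

Lemma RS_ext (f g : nat -> R) n : (forall k, (k < n)%nat -> f k = g k) -> RS f n = RS g n.
Proof. intros H. induction n as [|n IH]; simpl; [reflexivity|]. rewrite IH, H; auto; lia. Qed.

Lemma CS_plus (f g : nat -> C) n : CS (fun k => f k + g k)%C n = (CS f n + CS g n)%C.
Proof. induction n as [|n IH]; simpl; [ring|rewrite IH; ring]. Qed.

Lemma CS_scal c (f : nat -> C) n : CS (fun k => c * f k)%C n = (c * CS f n)%C.
Proof. induction n as [|n IH]; simpl; [ring|rewrite IH; ring]. Qed.

Lemma CS_scal_r c (f : nat -> C) n : CS (fun k => f k * c)%C n = (CS f n * c)%C.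
Proof. induction n as [|n IH]; simpl; [ring|rewrite IH; ring]. Qed.

Lemma RS_plus f g n : RS (fun k => f k + g k) n = RS f n + RS g n.
Proof. induction n as [|n IH]; simpl; [ring|rewrite IH; ring]. Qed.

Lemma RS_scal c (f : nat -> R) n : RS (fun k => c * f k) n = c * RS f n.
Proof. induction n as [|n IH]; simpl; [ring|rewrite IH; ring]. Qed.

Lemma CS_zero (f : nat -> C) n : (forall k, (k < n)%nat -> f k = 0%C) -> CS f n = 0%C.
Proof. intros H. induction n as [|n IH]; simpl; [reflexivity|]. rewrite IH, H; auto. ring. Qed.

Lemma RS_const c n : RS (fun _ => c) n = INR n * c.
Proof. induction n as [|n IH]; [simpl; ring|]. rewrite S_INR. simpl RS. rewrite IH. ring. Qed.

Lemma CS_conj (f : nat -> C) n : Cconj (CS f n) = CS (fun k => Cconj (f k)) n.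
Proof.
  induction n as [|n IH]; simpl.
  - apply C_ext; simpl; ring.
  - rewrite Cplus_conj, IH. reflexivity.
Qed.

Lemma CS_swap (f : nat -> nat -> C) n m :
  CS (fun i => CS (fun j => f i j) m) n = CS (fun j => CS (fun i => f i j) n) m.
Proof.
  induction n as [|n IH]; simpl.
  - symmetry. apply CS_zero. reflexivity.
  - rewrite IH. rewrite <- CS_plus. reflexivity.
Qed.

Lemma CS_shift (f : nat -> C) n : CS f (S n) = (f O + CS (fun k => f (S k)) n)%C.
Proof. induction n as [|n IH]; [simpl; ring|]. change (CS f (S (S n))) with (CS f (S n) + f (S n))%C. rewrite IH. simpl. ring. Qed.

Lemma RS_le f g n : (forall k, (k < n)%nat -> f k <= g k) -> RS f n <= RS g n.
Proof. intros H. induction n as [|n IH]; simpl; [lra|]. apply Rplus_le_compat; [apply IH; intros; apply H; lia|apply H; lia]. Qed.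

Lemma RS_nonneg f n : (forall k, (k < n)%nat -> 0 <= f k) -> 0 <= RS f n.
Proof. intros H. induction n as [|n IH]; simpl; [lra|]. apply Rplus_le_le_0_compat; [apply IH; intros; apply H; lia|apply H; lia]. Qed.

Lemma CS_Cmod (f : nat -> C) n : Cmod (CS f n) <= RS (fun k => Cmod (f k)) n.
Proof.
  induction n as [|n IH]; simpl; [rewrite Cmod_0; lra|].
  eapply Rle_trans; [apply Cmod_triangle|]. lra.
Qed.

Lemma CS_Cmod_le (f : nat -> C) (g : nat -> R) n : (forall k, (k < n)%nat -> Cmod (f k) <= g k) -> Cmod (CS f n) <= RS g n.
Proof. intros H. eapply Rle_trans; [apply CS_Cmod|now apply RS_le]. Qed.

Lemma Re_plus (z w : C) : Re (z + w) = Re z + Re w.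
Proof. reflexivity. Qed.

Lemma Im_plus (z w : C) : Im (z + w) = Im z + Im w.
Proof. reflexivity. Qed.

Lemma Csum_CS n f : Csum n f = CS f (S n).
Proof.
  unfold Csum.
  assert (H : forall m k, fold_right (fun m acc => (f m + acc)%C) 0%C (seq k m) = CS (fun j => f (k + j)%nat) m).
  { induction m as [|m IH]; intros k; [reflexivity|].
    rewrite CS_shift. simpl. rewrite IH. rewrite Nat.add_0_r. f_equal.
    apply CS_ext. intros j _. f_equal. lia. }
  rewrite H. apply CS_ext. reflexivity.
Qed.

Lemma CP_Cmod_ge (f : nat -> C) n B : 0 <= B -> (forall k, (k < n)%nat -> B <= Cmod (f k)) -> B ^ n <= Cmod (CP f n).
Proof.
  intros HB H. induction n as [|n IH]; simpl; [rewrite Cmod_1; lra|].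
  rewrite Cmod_mult, Rmult_comm. apply Rmult_le_compat; try lra; [apply pow_le; lra|apply IH; intros; apply H; lia|apply H; lia].
Qed.

Lemma CP_neq_0 (f : nat -> C) n : (forall k, (k < n)%nat -> f k <> 0%C) -> CP f n <> 0%C.
Proof.
  intros H. induction n as [|n IH]; simpl.
  - apply RtoC_neq_0. lra.
  - apply Cmult_neq_0'; [apply IH; intros; apply H; lia|apply H; lia].
Qed.

(** * The complex exponential *)

Lemma cexp_plus (z w : C) : cexp (z + w)%C = (cexp z * cexp w)%C.
Proof.
  destruct z as [a b], w as [c d]. unfold cexp; simpl.
  rewrite exp_plus, cos_plus, sin_plus. apply C_ext; simpl; ring.
Qed.

Lemma cexp_0 : cexp 0%C = 1%C.
Proof. unfold cexp; simpl. rewrite exp_0, cos_0, sin_0. apply C_ext; simpl; ring. Qed.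

Lemma Cmod_cexp z : Cmod (cexp z) = exp (Re z).
Proof.
  destruct z as [a b]. unfold cexp, Cmod, Re; simpl.
  replace (exp a * cos b * (exp a * cos b * 1) + exp a * sin b * (exp a * sin b * 1))
    with ((exp a)² * ((sin b)² + (cos b)²)) by (unfold Rsqr; ring).
  rewrite sin2_cos2, Rmult_1_r. apply sqrt_Rsqr. left; apply exp_pos.
Qed.

Lemma cexp_neq_0 (z : C) : cexp z <> 0%C.
Proof. apply Cmod_gt_0. rewrite Cmod_cexp. apply exp_pos. Qed.

Lemma cexp_R x : cexp (RtoC x) = RtoC (exp x).
Proof. unfold cexp, RtoC; simpl. rewrite cos_0, sin_0. apply C_ext; simpl; ring. Qed.

Lemma cexp_opp (z : C) : cexp (- z)%C = (/ cexp z)%C.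
Proof.
  assert (H : (cexp (- z)%C * cexp z = 1)%C).
  { rewrite <- cexp_plus. replace (- z + z)%C with (RtoC 0) by ring. apply cexp_0. }
  pose proof (cexp_neq_0 z) as Hz.
  replace (cexp (- z)%C) with (cexp (- z)%C * cexp z * / cexp z)%C by (field; exact Hz).
  rewrite H. ring.
Qed.

Lemma cexp_conj z : Cconj (cexp z) = cexp (Cconj z).
Proof. destruct z as [a b]; unfold cexp, Cconj; simpl. rewrite cos_neg, sin_neg. apply C_ext; simpl; ring. Qed.

Lemma cexp_pow z k : (cexp z ^ k = cexp (RtoC (INR k) * z))%C.
Proof.
  induction k as [|k IH].
  - simpl. replace (RtoC 0 * z)%C with (RtoC 0) by ring. now rewrite cexp_0.
  - rewrite Cpow_S, IH, <- cexp_plus, S_INR, RtoC_plus. f_equal. ring.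
Qed.

Definition unit (t : R) : C := (cos t, sin t).

Lemma unit_cexp t : unit t = cexp (Ci * RtoC t).
Proof.
  unfold unit, cexp; simpl. replace (0 * t - 1 * 0) with 0 by ring.
  replace (0 * 0 + 1 * t) with t by ring. rewrite exp_0. apply C_ext; simpl; ring.
Qed.

Lemma Cmod_unit t : Cmod (unit t) = 1.
Proof. rewrite unit_cexp, Cmod_cexp. unfold Re; simpl. replace (0 * t - 1 * 0) with 0 by ring. apply exp_0. Qed.

Lemma unit_plus s t : unit (s + t) = (unit s * unit t)%C.
Proof. unfold unit. rewrite cos_plus, sin_plus. apply C_ext; simpl; ring. Qed.

Lemma unit_pow t k : (unit t ^ k)%C = unit (INR k * t).
Proof.
  induction k as [|k IH].
  - rewrite Rmult_0_l. unfold unit. rewrite cos_0, sin_0. reflexivity.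
  - rewrite Cpow_S, IH, <- unit_plus, S_INR. f_equal. ring.
Qed.

(* Polar form; at [z = 0] any angle works. *)
Lemma polar (z : C) : exists t, z = (RtoC (Cmod z) * unit t)%C.
Proof.
  destruct (classic (z = 0%C)) as [->|Hz].
  - exists 0. rewrite Cmod_0. ring.
  - pose proof (Cmod_pos z Hz) as Hm. destruct z as [x y].
    set (r := Cmod (x, y)) in *.
    assert (Hr : x * x + y * y = r * r).
    { unfold r, Cmod. simpl fst; simpl snd. rewrite sqrt_sqrt; [ring|nra]. }
    assert (Hc : -1 <= x / r <= 1).
    { pose proof (re_le_Cmod (x, y)) as H. unfold Re in H; simpl in H. fold r in H.
      apply Rabs_le_between in H.
      split; [apply Rmult_le_reg_r with r|apply Rmult_le_reg_r with r]; try lra; unfold Rdiv; rewrite Rmult_assoc, Rinv_l; lra. }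
    destruct (Rle_lt_dec 0 y) as [hy|hy].
    + exists (acos (x / r)). apply C_ext; simpl.
      * rewrite cos_acos by exact Hc. field. lra.
      * rewrite sin_acos by exact Hc.
        replace (1 - (x / r)²) with ((y / r)²).
        { rewrite sqrt_Rsqr. cbn. field; lra. apply Rmult_le_pos; [lra|left; apply Rinv_0_lt_compat; lra]. }
        unfold Rsqr. apply Rmult_eq_reg_r with (r * r); [|nra].
        replace (y / r * (y / r) * (r * r)) with (y * y) by (field; lra).
        replace ((1 - x / r * (x / r)) * (r * r)) with (r * r - x * x) by (field; lra). lra.
    + exists (- acos (x / r)). unfold unit. rewrite cos_neg, sin_neg. apply C_ext; simpl.
      * rewrite cos_acos by exact Hc. field. lra.
      * rewrite sin_acos by exact Hc.
        replace (1 - (x / r)²) with ((- y / r)²).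
        { rewrite sqrt_Rsqr. cbn. field; lra. apply Rmult_le_pos; [lra|left; apply Rinv_0_lt_compat; lra]. }
        unfold Rsqr. apply Rmult_eq_reg_r with (r * r); [|nra].
        replace (- y / r * (- y / r) * (r * r)) with (y * y) by (field; lra).
        replace ((1 - x / r * (x / r)) * (r * r)) with (r * r - x * x) by (field; lra). lra.
Qed.

(** * Polynomials and locally uniform limits of polynomials *)

Fixpoint peval (l : list C) (s : C) : C :=
  match l with nil => RtoC 0 | a :: l' => (a + s * peval l' s)%C end.

Lemma peval_plus l1 : forall l2, exists l, forall s, peval l s = (peval l1 s + peval l2 s)%C.
Proof.
  induction l1 as [|a l1 IH]; intros l2.
  - exists l2. intros s. simpl. ring.
  - destruct l2 as [|b l2].
    + exists (a :: l1). intros s. simpl. ring.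
    + destruct (IH l2) as [l Hl]. exists ((a + b)%C :: l). intros s. simpl. rewrite Hl. ring.
Qed.

Lemma peval_scal c l1 : exists l, forall s, peval l s = (c * peval l1 s)%C.
Proof.
  induction l1 as [|a l1 [l Hl]].
  - exists nil. intros s. simpl. ring.
  - exists ((c * a)%C :: l). intros s. simpl. rewrite Hl. ring.
Qed.

Lemma peval_mult l1 l2 : exists l, forall s, peval l s = (peval l1 s * peval l2 s)%C.
Proof.
  induction l1 as [|a l1 [l Hl]].
  - exists nil. intros s. simpl. ring.
  - destruct (peval_scal a l2) as [l3 H3]. destruct (peval_plus l3 (RtoC 0 :: l)) as [l4 H4].
    exists l4. intros s. rewrite H4, H3. simpl. rewrite Hl. ring.
Qed.

Lemma peval_comp l1 l2 : exists l, forall s, peval l s = peval l1 (peval l2 s).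
Proof.
  induction l1 as [|a l1 [l Hl]].
  - exists nil. intros s. reflexivity.
  - destruct (peval_mult l2 l) as [l3 H3]. destruct (peval_plus (a :: nil) l3) as [l4 H4].
    exists l4. intros s. rewrite H4, H3. simpl. rewrite Hl. ring.
Qed.

Lemma peval_factor l z : exists q, forall s, (peval l s - peval l z = (s - z) * peval q s)%C.
Proof.
  induction l as [|a l [q Hq]].
  - exists nil. intros s. simpl. ring.
  - destruct (peval_plus (RtoC 0 :: q) (peval l z :: nil)) as [r Hr].
    exists r. intros s. rewrite Hr. simpl.
    replace (a + s * peval l s - (a + z * peval l z))%C
      with (s * (peval l s - peval l z) + (s - z) * peval l z)%C by ring.
    rewrite Hq. ring.
Qed.

Lemma peval_bounded l r : exists B, 0 < B /\ forall s, Cmod s <= r -> Cmod (peval l s) <= B.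
Proof.
  induction l as [|a l [B [HB H]]].
  - exists 1. split; [lra|]. intros s _. simpl. rewrite Cmod_0. lra.
  - exists (Cmod a + 1 + Rabs r * B). split.
    + pose proof (Cmod_ge_0 a). pose proof (Rabs_pos r). nra.
    + intros s Hs. simpl. eapply Rle_trans; [apply Cmod_triangle|]. rewrite Cmod_mult.
      assert (Cmod s * Cmod (peval l s) <= Rabs r * B).
      { apply Rmult_le_compat; try apply Cmod_ge_0; [|now apply H].
        eapply Rle_trans; [exact Hs|apply RRle_abs]. }
      lra.
Qed.

Lemma CS_geom q n : ((q - 1) * CS (fun k => q ^ k) n = q ^ n - 1)%C.
Proof.
  induction n as [|n IH]; [simpl; ring|].
  change (CS (fun k => q ^ k) (S n))%C with (CS (fun k => q ^ k) n + q ^ n)%C.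
  replace ((q - 1) * (CS (fun k => q ^ k) n + q ^ n))%C with ((q - 1) * CS (fun k => q ^ k) n + (q - 1) * q ^ n)%C by ring.
  rewrite IH, Cpow_S. ring.
Qed.

(** Averages over a circle are replaced by averages over the [M]-th roots of unity, which are exact
    on polynomials of degree below [M]. *)
Definition rootu (M k : nat) : C := unit (2 * PI * INR k / INR M).

Lemma rootu_sum M j : (1 <= j < M)%nat -> CS (fun k => rootu M k ^ j)%C M = RtoC 0.
Proof.
  intros Hj. set (w := unit (2 * (PI * INR j / INR M))).
  assert (HM : 0 < INR M) by (apply lt_0_INR; lia).
  assert (Hw : forall k, (rootu M k ^ j = w ^ k)%C).
  { intros k. unfold rootu, w. rewrite !unit_pow. f_equal. field. lra. }
  rewrite (CS_ext _ (fun k => w ^ k)%C) by (intros; apply Hw).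
  (* The angle is written with a factor 2 for the half-angle formula: the real part of [w] is
     [1 - 2 sin^2 (pi j / M)], and [0 < pi j / M < pi]. *)
  assert (H1 : (w - 1)%C <> RtoC 0).
  { intros E. apply Csub_eq_0 in E. apply (f_equal fst) in E. simpl in E.
    rewrite cos_2a_sin in E.
    assert (0 < sin (PI * INR j / INR M)).
    { apply sin_gt_0.
      - apply Rdiv_lt_0_compat; [|exact HM]. apply Rmult_lt_0_compat; [apply PI_RGT_0|apply lt_0_INR; lia].
      - apply Rmult_lt_reg_r with (INR M); [exact HM|].
        unfold Rdiv. rewrite Rmult_assoc, Rinv_l by lra. rewrite Rmult_1_r.
        apply Rmult_lt_compat_l; [apply PI_RGT_0|apply lt_INR; lia]. }
    nra. }
  pose proof (CS_geom w M) as G.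
  replace (w ^ M)%C with (RtoC 1) in G.
  - replace (1 - 1)%C with (RtoC 0) in G by ring. destruct (Cmult_eq_0 _ _ G); [contradiction|assumption].
  - unfold w. rewrite unit_pow.
    replace (INR M * (2 * (PI * INR j / INR M))) with (0 + 2 * INR j * PI) by (field; lra).
    unfold unit. rewrite cos_period, sin_period, cos_0, sin_0. reflexivity.
Qed.

Lemma peval_root_avg l r : forall M j, (1 <= j)%nat -> (j + length l <= M)%nat ->
  CS (fun k => (RtoC r * rootu M k) ^ j * peval l (RtoC r * rootu M k))%C M = RtoC 0.
Proof.
  induction l as [|a l IH]; intros M j H1 H2.
  - apply CS_zero. intros k _. simpl. ring.
  - simpl in H2.
    rewrite (CS_ext _ (fun k => (a * RtoC r ^ j) * rootu M k ^ j
       + (RtoC r * rootu M k) ^ (S j) * peval l (RtoC r * rootu M k))%C).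
    + rewrite CS_plus, CS_scal, rootu_sum, IH by lia. ring.
    + intros k _. rewrite Cpow_S, !Cpow_mult_distr. simpl. ring.
Qed.

(** With more roots of unity than the degree, the average over them leaves only the constant
    term. *)
Lemma peval_center0 l r B :
  (forall t, Cmod (peval l (RtoC r * unit t)) <= B) -> Cmod (peval l (RtoC 0)) <= B.
Proof.
  intros H. destruct l as [|a l].
  - exact (H 0).
  - set (M := S (length l)).
    assert (HM : 0 < INR M) by (apply lt_0_INR; lia).
    assert (E : CS (fun k => peval (a :: l) (RtoC r * rootu M k)) M = (RtoC (INR M) * a)%C).
    { rewrite (CS_ext _ (fun k => a * 1 + (RtoC r * rootu M k) ^ 1 * peval l (RtoC r * rootu M k))%C).
      - rewrite CS_plus, peval_root_avg by (subst M; lia).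
        rewrite CS_scal. replace (CS (fun _ => RtoC 1) M) with (RtoC (INR M)); [ring|].
        clear. induction M as [|M IH]; [reflexivity|].
        rewrite S_INR, RtoC_plus, IH. reflexivity.
      - intros k _. simpl. ring. }
    replace (peval (a :: l) (RtoC 0)) with a by (simpl; ring).
    assert (Hle : Cmod (RtoC (INR M) * a) <= INR M * B).
    { rewrite <- E, <- RS_const. apply CS_Cmod_le. intros k _. apply H. }
    rewrite Cmod_mult, Cmod_RtoC_pos in Hle by lra.
    apply Rmult_le_reg_l with (INR M); assumption.
Qed.

(** * Entire functions and the center bound *)

Definition ent (f : C -> C) : Prop :=
  forall r e, 0 < e -> exists l, forall s, Cmod s <= r -> Cmod (f s - peval l s) <= e.

Lemma ent_peval l : ent (peval l).
Proof. intros r e He. exists l. intros s _. replace (peval l s - peval l s)%C with (RtoC 0) by ring. rewrite Cmod_0. lra. Qed.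

Lemma ent_ext f g : (forall s, f s = g s) -> ent f -> ent g.
Proof. intros E H r e He. destruct (H r e He) as [l Hl]. exists l. intros s Hs. rewrite <- E. auto. Qed.

Lemma ent_const c : ent (fun _ => c).
Proof. apply ent_ext with (peval (c :: nil)); [intros; simpl; ring|apply ent_peval]. Qed.

Lemma ent_id : ent (fun s => s).
Proof. apply ent_ext with (peval (RtoC 0 :: RtoC 1 :: nil)); [intros; simpl; ring|apply ent_peval]. Qed.

Lemma ent_bounded f r : ent f -> exists B, 0 < B /\ forall s, Cmod s <= r -> Cmod (f s) <= B.
Proof.
  intros H. destruct (H r 1 Rlt_0_1) as [l Hl]. destruct (peval_bounded l r) as [B [HB Hb]].
  exists (1 + B). split; [lra|]. intros s Hs.
  replace (f s) with ((f s - peval l s) + peval l s)%C by ring.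
  eapply Rle_trans; [apply Cmod_triangle|]. apply Rplus_le_compat; auto.
Qed.

Lemma ent_plus f g : ent f -> ent g -> ent (fun s => f s + g s)%C.
Proof.
  intros Hf Hg r e He. destruct (Hf r (e / 2)) as [l1 H1]; [lra|]. destruct (Hg r (e / 2)) as [l2 H2]; [lra|].
  destruct (peval_plus l1 l2) as [l Hl]. exists l. intros s Hs. rewrite Hl.
  replace (f s + g s - (peval l1 s + peval l2 s))%C with ((f s - peval l1 s) + (g s - peval l2 s))%C by ring.
  eapply Rle_trans; [apply Cmod_triangle|]. specialize (H1 s Hs). specialize (H2 s Hs). lra.
Qed.

Lemma ent_mult f g : ent f -> ent g -> ent (fun s => f s * g s)%C.
Proof.
  intros Hf Hg r e He. destruct (ent_bounded g r Hg) as [Bg [HBg Hbg]].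
  destruct (ent_bounded f r Hf) as [Bf [HBf Hbf]].
  (* The total error is [Bf d + d Bg + d d], at most [d (1 + Bf + Bg)] as soon as [d <= 1]. *)
  set (d := Rmin 1 (e / (1 + Bf + Bg))).
  assert (Hd : 0 < d).
  { apply Rmin_glb_lt; [lra|]. apply Rdiv_lt_0_compat; lra. }
  assert (Hd1 : d <= 1) by apply Rmin_l.
  assert (Hd2 : d * (1 + Bf + Bg) <= e).
  { apply Rle_trans with (e / (1 + Bf + Bg) * (1 + Bf + Bg)).
    - apply Rmult_le_compat_r; [lra|apply Rmin_r].
    - right. field. lra. }
  destruct (Hf r d Hd) as [l1 H1]. destruct (Hg r d Hd) as [l2 H2].
  destruct (peval_mult l1 l2) as [l Hl]. exists l. intros s Hs. rewrite Hl.
  specialize (H1 s Hs). specialize (H2 s Hs). specialize (Hbg s Hs). specialize (Hbf s Hs).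
  replace (f s * g s - peval l1 s * peval l2 s)%C
    with (f s * (g s - peval l2 s) + ((f s - peval l1 s) * g s - (f s - peval l1 s) * (g s - peval l2 s)))%C by ring.
  eapply Rle_trans; [apply Cmod_triangle|].
  apply Rle_trans with (Bf * d + (d * Bg + d * d)).
  - apply Rplus_le_compat.
    + rewrite Cmod_mult. apply Rmult_le_compat; try apply Cmod_ge_0; auto.
    + eapply Rle_trans; [apply Cmod_sub_triangle|]. rewrite !Cmod_mult.
      apply Rplus_le_compat; apply Rmult_le_compat; try apply Cmod_ge_0; auto.
  - nra.
Qed.

Lemma ent_scal c f : ent f -> ent (fun s => c * f s)%C.
Proof. intros H. apply (ent_mult (fun _ => c)); [apply ent_const|exact H]. Qed.

Lemma ent_minus f g : ent f -> ent g -> ent (fun s => f s - g s)%C.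
Proof.
  intros Hf Hg. apply ent_ext with (fun s => f s + (- (1)) * g s)%C; [intros; ring|].
  apply ent_plus; [exact Hf|now apply ent_scal].
Qed.

Lemma ent_sub_const z : ent (fun s => s - z)%C.
Proof. apply ent_minus; [apply ent_id|apply ent_const]. Qed.

Lemma ent_pow f k : ent f -> ent (fun s => f s ^ k)%C.
Proof.
  intros H. induction k as [|k IH].
  - exact (ent_const (RtoC 1)).
  - apply ent_ext with (fun s => f s * f s ^ k)%C; [reflexivity|now apply ent_mult].
Qed.

Lemma ent_CS (f : nat -> C -> C) n : (forall k, (k < n)%nat -> ent (f k)) -> ent (fun s => CS (fun k => f k s) n).
Proof.
  intros H. induction n as [|n IH]; simpl.
  - apply (ent_const _).
  - apply ent_plus; [apply IH; intros; apply H; lia|apply H; lia].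
Qed.

Lemma ent_CP (f : nat -> C -> C) n : (forall k, (k < n)%nat -> ent (f k)) -> ent (fun s => CP (fun k => f k s) n).
Proof.
  intros H. induction n as [|n IH]; simpl.
  - apply (ent_const _).
  - apply ent_mult; [apply IH; intros; apply H; lia|apply H; lia].
Qed.

Lemma ent_comp_affine f a b : ent f -> ent (fun s => f (a * s + b)%C).
Proof.
  intros H r e He. destruct (H (Cmod a * Rabs r + Cmod b) e He) as [l Hl].
  destruct (peval_comp l (b :: a :: nil)) as [l' Hl']. exists l'. intros s Hs. rewrite Hl'.
  replace (peval (b :: a :: nil) s) with (a * s + b)%C by (simpl; ring).
  apply Hl. eapply Rle_trans; [apply Cmod_triangle|]. rewrite Cmod_mult.
  apply Rplus_le_compat_r. apply Rmult_le_compat_l; [apply Cmod_ge_0|].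
  eapply Rle_trans; [exact Hs|apply RRle_abs].
Qed.

Lemma ent_lim f : (forall r e, 0 < e -> exists g, ent g /\ forall s, Cmod s <= r -> Cmod (f s - g s) <= e) -> ent f.
Proof.
  intros H r e He. destruct (H r (e / 2)) as [g [Hg Hfg]]; [lra|].
  destruct (Hg r (e / 2)) as [l Hl]; [lra|]. exists l. intros s Hs.
  eapply Rle_trans; [apply (Cmod_sub_trans _ (g s))|].
  specialize (Hfg s Hs). specialize (Hl s Hs). lra.
Qed.

(** The substitute for Cauchy's integral formula throughout: polynomial approximations carry
    [peval_center0] over to any center and any real [r]. *)
Lemma ent_center f c r B : ent f ->
  (forall t, Cmod (f (c + RtoC r * unit t)%C) <= B) -> Cmod (f c) <= B.
Proof.
  intros Hf H.
  apply le_epsilon. intros e He.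
  destruct (Hf (Cmod c + Rabs r) (e / 2)) as [l Hl]; [lra|].
  destruct (peval_comp l (c :: RtoC 1 :: nil)) as [l' Hl'].
  assert (Hb : Cmod (peval l' (RtoC 0)) <= B + e / 2).
  { apply (peval_center0 l' r). intros t. rewrite Hl'.
    replace (peval (c :: RtoC 1 :: nil) (RtoC r * unit t)%C) with (c + RtoC r * unit t)%C by (simpl; ring).
    assert (Hm : Cmod (c + RtoC r * unit t) <= Cmod c + Rabs r).
    { eapply Rle_trans; [apply Cmod_triangle|]. rewrite Cmod_mult, Cmod_unit, Cmod_R. lra. }
    specialize (Hl _ Hm). specialize (H t).
    pose proof (Cmod_sub_le (peval l (c + RtoC r * unit t)%C) (f (c + RtoC r * unit t)%C)).
    rewrite Cmod_sub_sym in Hl. lra. }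
  rewrite Hl' in Hb. replace (peval (c :: RtoC 1 :: nil) (RtoC 0)) with c in Hb by (simpl; ring).
  assert (Hc : Cmod c <= Cmod c + Rabs r) by (pose proof (Rabs_pos r); lra).
  specialize (Hl c Hc). pose proof (Cmod_sub_le (f c) (peval l c)). lra.
Qed.

(** * Limits of complex sequences, and division of entire functions by linear factors *)

Definition is_lim_C (u : nat -> C) (l : C) : Prop := is_lim_seq (fun n => Cmod (u n - l)) 0.

Lemma pow2_inv_pos n : 0 < (/ 2) ^ n.
Proof. apply pow_lt. lra. Qed.

Lemma is_lim_pow2 K : is_lim_seq (fun n => K * (/ 2) ^ n) 0.
Proof.
  replace 0 with (K * 0) by ring. apply (is_lim_seq_scal_l (fun n => (/ 2) ^ n) K 0).
  apply is_lim_seq_geom. rewrite Rabs_pos_eq; lra.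
Qed.

Lemma is_lim_C_le (u : nat -> C) l (v : nat -> R) :
  (exists N, forall n, (N <= n)%nat -> Cmod (u n - l) <= v n) -> is_lim_seq v 0 -> is_lim_C u l.
Proof.
  intros [N H] Hv. apply is_lim_seq_le_le_loc with (fun _ => 0) v; [|apply is_lim_seq_const|exact Hv].
  exists N. intros n Hn. split; [apply Cmod_ge_0|now apply H].
Qed.

Lemma is_lim_C_eps u l : is_lim_C u l <-> (forall e, 0 < e -> exists N, forall n, (N <= n)%nat -> Cmod (u n - l) <= e).
Proof.
  split.
  - intros H e He. apply is_lim_seq_spec in H. destruct (H (mkposreal e He)) as [N HN].
    exists N. intros n Hn. specialize (HN n Hn). simpl in HN. rewrite Rminus_0_r, Rabs_pos_eq in HN by apply Cmod_ge_0. lra.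
  - intros H. apply is_lim_seq_spec. intros e.
    destruct (H (e / 2)) as [N HN]; [destruct e; simpl; lra|].
    exists N. intros n Hn. specialize (HN n Hn). rewrite Rminus_0_r, Rabs_pos_eq by apply Cmod_ge_0.
    destruct e; simpl in *; lra.
Qed.

Lemma is_lim_C_unique u l1 l2 : is_lim_C u l1 -> is_lim_C u l2 -> l1 = l2.
Proof.
  rewrite !is_lim_C_eps. intros H1 H2. apply Cmod_small_eq. intros e He.
  destruct (H1 (e / 2)) as [N1 h1]; [lra|]. destruct (H2 (e / 2)) as [N2 h2]; [lra|].
  specialize (h1 (N1 + N2)%nat ltac:(lia)). specialize (h2 (N1 + N2)%nat ltac:(lia)).
  eapply Rle_trans; [apply (Cmod_sub_trans _ (u (N1 + N2)%nat))|]. rewrite Cmod_sub_sym in h1. lra.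
Qed.

Lemma is_lim_C_ext u v l : (forall n, u n = v n) -> is_lim_C u l -> is_lim_C v l.
Proof. intros E H. apply is_lim_seq_ext with (2 := H). intros n. now rewrite E. Qed.

Lemma is_lim_C_plus u v a b : is_lim_C u a -> is_lim_C v b -> is_lim_C (fun n => u n + v n)%C (a + b)%C.
Proof.
  rewrite !is_lim_C_eps. intros Hu Hv e He.
  destruct (Hu (e / 2)) as [N1 h1]; [lra|]. destruct (Hv (e / 2)) as [N2 h2]; [lra|].
  exists (N1 + N2)%nat. intros n Hn. specialize (h1 n ltac:(lia)). specialize (h2 n ltac:(lia)).
  replace (u n + v n - (a + b))%C with ((u n - a) + (v n - b))%C by ring.
  eapply Rle_trans; [apply Cmod_triangle|]. lra.
Qed.

Lemma is_lim_C_scal c u a : is_lim_C u a -> is_lim_C (fun n => c * u n)%C (c * a)%C.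
Proof.
  intros H. apply is_lim_C_le with (fun n => Cmod c * Cmod (u n - a)).
  - exists O. intros n _. right. rewrite <- Cmod_mult. f_equal. ring.
  - replace 0 with (Cmod c * 0) by ring. now apply (is_lim_seq_scal_l _ (Cmod c) 0).
Qed.

Lemma is_lim_C_bound u l B : is_lim_C u l -> (exists N, forall n, (N <= n)%nat -> Cmod (u n) <= B) -> Cmod l <= B.
Proof.
  rewrite is_lim_C_eps. intros H [N HN]. apply le_epsilon. intros e He.
  destruct (H e He) as [N2 h2]. specialize (h2 (N + N2)%nat ltac:(lia)). specialize (HN (N + N2)%nat ltac:(lia)).
  pose proof (Cmod_sub_le l (u (N + N2)%nat)). rewrite Cmod_sub_sym in h2. lra.
Qed.

Lemma is_lim_C_re_im u l : is_lim_seq (fun n => Re (u n)) (Re l) -> is_lim_seq (fun n => Im (u n)) (Im l) -> is_lim_C u l.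
Proof.
  intros H1 H2.
  apply is_lim_C_le with (fun n => Rabs (Re (u n) - Re l) + Rabs (Im (u n) - Im l)).
  - exists O. intros n _. eapply Rle_trans; [apply Cmod_le_re_im|]. right. reflexivity.
  - assert (A : forall (v : nat -> R) (x : R), is_lim_seq v x -> is_lim_seq (fun n => Rabs (v n - x)) 0).
    { intros v x Hv. apply -> is_lim_seq_abs_0. replace 0 with (x - x) by ring.
      apply is_lim_seq_minus'; [exact Hv|apply is_lim_seq_const]. }
    replace 0 with (0 + 0) by ring. apply is_lim_seq_plus'; apply A; assumption.
Qed.

Lemma C_cauchy_geom (u : nat -> C) N B : (forall n, (N <= n)%nat -> Cmod (u (S n) - u n) <= B * (/ 2) ^ n) ->
  exists l, forall n, (N <= n)%nat -> Cmod (u n - l) <= 2 * B * (/ 2) ^ n.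
Proof.
  intros H.
  assert (Hk : forall n k, (N <= n)%nat -> Cmod (u (n + k)%nat - u n) <= 2 * B * (/ 2) ^ n).
  { intros n k Hn.
    assert (Cmod (u (n + k)%nat - u n) <= 2 * B * (/ 2) ^ n - 2 * B * (/ 2) ^ (n + k)).
    { induction k as [|k IH].
      - rewrite Nat.add_0_r. replace (u n - u n)%C with (RtoC 0) by ring. rewrite Cmod_0. lra.
      - eapply Rle_trans; [apply (Cmod_sub_trans _ (u (n + k)%nat))|].
        rewrite Nat.add_succ_r. specialize (H (n + k)%nat ltac:(lia)).
        replace ((/ 2) ^ S (n + k)) with (/ 2 * (/ 2) ^ (n + k)) by reflexivity. lra. }
    assert (0 <= 2 * B * (/ 2) ^ (n + k)).
    { specialize (H n Hn). pose proof (Cmod_ge_0 (u (S n) - u n)).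
      pose proof (pow2_inv_pos n). pose proof (pow2_inv_pos (n + k)).
      assert (0 <= B) by (apply Rmult_le_reg_r with ((/ 2) ^ n); lra).
      apply Rmult_le_pos; lra. }
    lra. }
  assert (HC : forall p : C -> R, (forall z w, Rabs (p z - p w) <= Cmod (z - w)) ->
     exists l : R, is_lim_seq (fun n => p (u n)) l).
  { intros p Hp.
    assert (E : ex_finite_lim_seq (fun n => p (u n))).
    { apply ex_lim_seq_cauchy_corr. intros e.
      pose proof (is_lim_pow2 (4 * B)) as HL. apply is_lim_seq_spec in HL. destruct (HL e) as [M HM].
      exists (N + M)%nat. intros n m Hn Hm.
      specialize (HM (N + M)%nat ltac:(lia)).
      assert (A : forall k, (N + M <= k)%nat -> Cmod (u k - u (N + M)%nat) <= 2 * B * (/ 2) ^ (N + M)).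
      { intros k Hk'. replace k with ((N + M) + (k - (N + M)))%nat by lia. apply Hk. lia. }
      eapply Rle_lt_trans; [apply Hp|].
      eapply Rle_lt_trans; [apply (Cmod_sub_trans _ (u (N + M)%nat))|].
      pose proof (A n Hn). pose proof (A m Hm) as Am. rewrite Cmod_sub_sym in Am.
      pose proof (RRle_abs (4 * B * (/ 2) ^ (N + M) - 0)). lra. }
    destruct E as [l Hl]. exists l. exact Hl. }
  destruct (HC Re) as [x Hx].
  { intros z w. apply (re_le_Cmod (z - w)). }
  destruct (HC Im) as [y Hy].
  { intros z w. apply (im_le_Cmod (z - w)). }
  exists (x, y). intros n Hn.
  assert (HL : is_lim_C u (x, y)) by (apply is_lim_C_re_im; assumption).
  apply le_epsilon. intros e He. rewrite is_lim_C_eps in HL. destruct (HL e He) as [M HM].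
  specialize (HM (n + M)%nat ltac:(lia)). specialize (Hk n M Hn).
  eapply Rle_trans; [apply (Cmod_sub_trans _ (u (n + M)%nat))|]. rewrite Cmod_sub_sym in Hk. lra.
Qed.

(** Weierstrass' theorem for geometric convergence; [B] and [N] may depend on the disc, and the
    limit function is collected by choice. *)
Lemma ent_complete (f : nat -> C -> C) :
  (forall k, ent (f k)) ->
  (forall r, exists B N, forall n s, (N <= n)%nat -> Cmod s <= r -> Cmod (f (S n) s - f n s) <= B * (/ 2) ^ n) ->
  exists g, ent g /\ forall s, is_lim_C (fun n => f n s) (g s).
Proof.
  intros Hf HB.
  assert (HL : forall s, exists l, is_lim_C (fun n => f n s) l).
  { intros s. destruct (HB (Cmod s)) as [B [N H]].
    destruct (C_cauchy_geom (fun n => f n s) N B) as [l Hl].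
    - intros n Hn. apply H; [exact Hn|lra].
    - exists l. apply is_lim_C_le with (fun n => 2 * B * (/ 2) ^ n); [now exists N|apply is_lim_pow2]. }
  apply choice in HL. destruct HL as [g Hg]. exists g. split; [|exact Hg].
  apply ent_lim. intros r e He. destruct (HB r) as [B [N H]].
  pose proof (is_lim_pow2 (2 * B)) as L. apply is_lim_seq_spec in L. destruct (L (mkposreal e He)) as [M HM].
  exists (f (N + M)%nat). split; [apply Hf|]. intros s Hs.
  destruct (C_cauchy_geom (fun n => f n s) N B) as [l Hl].
  { intros n Hn. now apply H. }
  assert (El : l = g s).
  { apply is_lim_C_unique with (fun n => f n s); [|apply Hg].
    apply is_lim_C_le with (fun n => 2 * B * (/ 2) ^ n); [now exists N|apply is_lim_pow2]. }
  subst l. rewrite Cmod_sub_sym. eapply Rle_trans; [apply Hl; lia|].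
  specialize (HM (N + M)%nat ltac:(lia)). simpl in HM. rewrite Rminus_0_r in HM.
  pose proof (RRle_abs (2 * B * (/ 2) ^ (N + M))). lra.
Qed.

Lemma INR_unbounded (x : R) : exists N, x <= INR N.
Proof.
  destruct (Rle_lt_dec x 0) as [h|h]; [exists O; exact h|].
  destruct (nfloor_ex x) as [N [_ HN]]; [lra|]. exists (S N). rewrite S_INR. lra.
Qed.

(* Near [z] the difference quotient is controlled through the center bound on a circle of radius 2, which stays away from [z]. *)
Lemma ent_factor f z : ent f -> exists q, ent q /\ forall s, (f s - f z = (s - z) * q s)%C.
Proof.
  intros Hf.
  assert (HP : forall N, exists l, forall s, Cmod s <= INR N -> Cmod (f s - peval l s) <= (/ 2) ^ N)
    by (intros N; apply Hf, pow2_inv_pos).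
  apply choice in HP. destruct HP as [P HP].
  destruct (choice (fun N q => forall s, (peval (P N) s - peval (P N) z = (s - z) * peval q s)%C)) as [Q HQ].
  { intros N. apply peval_factor. }
  destruct (ent_complete (fun N => peval (Q N))) as [q [Hq Hlim]].
  - intros N. apply ent_peval.
  (* Large enough that [z] and the circle of radius 2 about [s] lie in the disc on which [P N] is
     close to [f]. *)
  - intros r. destruct (INR_unbounded (Rabs r + Cmod z + 3)) as [N0 HN0].
    exists 4, N0. intros N s HN Hs.
    assert (HNN : INR N0 <= INR N) by (apply le_INR; lia).
    assert (HNS : INR N <= INR (S N)) by (apply le_INR; lia).
    assert (Hr : r <= Rabs r) by apply RRle_abs.
    assert (Hz0 : 0 <= Cmod z) by apply Cmod_ge_0.
    assert (Hr0 : 0 <= Rabs r) by apply Rabs_pos.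
    assert (Hd : forall w, Cmod w <= INR N -> Cmod (peval (P (S N)) w - peval (P N) w) <= 2 * (/ 2) ^ N).
    { intros w Hw. eapply Rle_trans; [apply (Cmod_sub_trans _ (f w))|].
      pose proof (HP N w Hw). assert (Hw' : Cmod w <= INR (S N)) by lra. pose proof (HP (S N) w Hw') as H2.
      rewrite Cmod_sub_sym in H2. replace ((/ 2) ^ S N) with (/ 2 * (/ 2) ^ N) in H2 by reflexivity.
      pose proof (pow2_inv_pos N). lra. }
    assert (Hfar : forall w, Cmod w <= INR N -> 1 <= Cmod (w - z) ->
       Cmod (peval (Q (S N)) w - peval (Q N) w) <= 4 * (/ 2) ^ N).
    { intros w Hw H1.
      assert (E : ((w - z) * (peval (Q (S N)) w - peval (Q N) w)
         = (peval (P (S N)) w - peval (P N) w) - (peval (P (S N)) z - peval (P N) z))%C).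
      { replace ((w - z) * (peval (Q (S N)) w - peval (Q N) w))%C
          with ((w - z) * peval (Q (S N)) w - (w - z) * peval (Q N) w)%C by ring.
        rewrite <- !HQ. ring. }
      apply (f_equal Cmod) in E. rewrite Cmod_mult in E.
      pose proof (Cmod_sub_triangle (peval (P (S N)) w - peval (P N) w) (peval (P (S N)) z - peval (P N) z)) as T.
      pose proof (Hd w Hw). assert (Hzn : Cmod z <= INR N) by lra. pose proof (Hd z Hzn).
      pose proof (Cmod_ge_0 (peval (Q (S N)) w - peval (Q N) w)). nra. }
    destruct (Rle_lt_dec 1 (Cmod (s - z))) as [h|h].
    + apply Hfar; lra.
    + apply (ent_center (fun w => peval (Q (S N)) w - peval (Q N) w)%C s 2).
      * apply ent_minus; apply ent_peval.
      * intros t. apply Hfar.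
        -- eapply Rle_trans; [apply Cmod_triangle|]. rewrite Cmod_mult, Cmod_unit, Cmod_RtoC_pos by lra. lra.
        -- replace (s + 2 * unit t - z)%C with (2 * unit t - (z - s))%C by ring.
           pose proof (Cmod_sub_le (2 * unit t)%C (z - s)%C) as T. rewrite Cmod_mult, Cmod_unit, Cmod_RtoC_pos in T by lra.
           rewrite Cmod_sub_sym in h. lra.
  - exists q. split; [exact Hq|]. intros s.
    assert (HfP : forall w, is_lim_C (fun N => peval (P N) w) (f w)).
    { intros w. destruct (INR_unbounded (Cmod w)) as [N0 HN0].
      apply is_lim_C_le with (fun N => 1 * (/ 2) ^ N); [|apply is_lim_pow2].
      exists N0. intros N HN. rewrite Cmod_sub_sym, Rmult_1_l. apply HP.
      apply Rle_trans with (INR N0); [exact HN0|apply le_INR; lia]. }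
    apply is_lim_C_unique with (fun N => peval (P N) s + (- (1)) * peval (P N) z)%C.
    + replace (f s - f z)%C with (f s + (- (1)) * f z)%C by ring.
      apply is_lim_C_plus; [apply HfP|apply is_lim_C_scal, HfP].
    + apply is_lim_C_ext with (fun N => (s - z) * peval (Q N) s)%C.
      * intros N. rewrite <- HQ. ring.
      * apply is_lim_C_scal, Hlim.
Qed.

Lemma ent_lipschitz f z : ent f -> exists B, 0 < B /\ forall s, Cmod (s - z) <= 1 -> Cmod (f s - f z) <= B * Cmod (s - z).
Proof.
  intros Hf. destruct (ent_factor f z Hf) as [q [Hq H]].
  destruct (ent_bounded q (Cmod z + 1) Hq) as [B [HB Hb]].
  exists B. split; [exact HB|]. intros s Hs. rewrite H, Cmod_mult, Rmult_comm.
  apply Rmult_le_compat_r; [apply Cmod_ge_0|]. apply Hb. pose proof (Cmod_sub_le s z). lra.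
Qed.

(** The derivative is [q z] for the quotient [q] of [ent_factor]: the remainder
    [(w - z) (q w - q z)] is quadratic because [q] is Lipschitz at [z]. *)
Lemma ent_ex_derive f z : ent f -> ex_derive (K := C_AbsRing) (V := C_NormedModule) f z.
Proof.
  intros Hf. destruct (ent_factor f z Hf) as [q [Hq H]].
  destruct (ent_lipschitz q z Hq) as [B [HB Hb]].
  exists (q z). split.
  - apply is_linear_scal_l.
  - intros x Hx.
    assert (Ex : x = z) by (symmetry; apply (is_filter_lim_locally_unique (V := AbsRing_NormedModule C_AbsRing)); exact Hx).
    subst x. intros e.
    assert (Hd : 0 < Rmin 1 (e / B)).
    { apply Rmin_glb_lt; [lra|]. apply Rdiv_lt_0_compat; [apply cond_pos|exact HB]. }
    apply (locally_norm_le_locally (V := AbsRing_NormedModule C_AbsRing)). exists (mkposreal _ Hd). intros w Hw.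
    assert (Hw1 : Cmod (w - z) < 1) by (eapply Rlt_le_trans; [exact Hw|apply Rmin_l]).
    assert (Hw2 : Cmod (w - z) < e / B) by (eapply Rlt_le_trans; [exact Hw|apply Rmin_r]).
    change (Cmod ((f w - f z) - (w - z) * q z) <= e * Cmod (w - z)).
    rewrite H. replace ((w - z) * q w - (w - z) * q z)%C with ((w - z) * (q w - q z))%C by ring.
    rewrite Cmod_mult, Rmult_comm. apply Rmult_le_compat_r; [apply Cmod_ge_0|].
    apply Rle_trans with (B * Cmod (w - z)); [apply Hb; lra|].
    apply Rle_trans with (B * (e / B)); [apply Rmult_le_compat_l; lra|]. right. field. lra.
Qed.

(** With [d = |s - z|], the circle of radius [3 d] about [s] stays at distance [2 d] from [z]. Hence
    [|g s| <= B / (2 d)^k], and [|f s| = d^k |g s| <= B / 2^k] for every [k]. *)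
Lemma ent_infinite_order f z : ent f ->
  (forall k, exists g, ent g /\ forall s, (f s = (s - z) ^ k * g s)%C) -> forall s, f s = RtoC 0.
Proof.
  intros Hf H.
  assert (H0 : forall s, s <> z -> f s = RtoC 0).
  { intros s Hs. set (d := Cmod (s - z)).
    assert (Hd : 0 < d).
    { apply Cmod_pos. intros E. apply Hs. now apply Csub_eq_0. }
    destruct (ent_bounded f (Cmod s + 3 * d) Hf) as [B [HB Hb]].
    apply Cmod_le_0.
    assert (HL : is_lim_seq (fun k => B * (/ 2) ^ k) 0) by apply is_lim_pow2.
    assert (Hk : forall k, Cmod (f s) <= B * (/ 2) ^ k).
    { intros k. destruct (H k) as [g [Hg Hfg]].
      assert (Hgs : Cmod (g s) <= B * / (2 * d) ^ k).
      { apply (ent_center g s (3 * d)); [exact Hg|]. intros t. set (w := (s + RtoC (3 * d) * unit t)%C).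
        assert (Hw : Cmod w <= Cmod s + 3 * d).
        { eapply Rle_trans; [apply Cmod_triangle|]. rewrite Cmod_mult, Cmod_unit, Cmod_RtoC_pos by lra. lra. }
        assert (Hwz : 2 * d <= Cmod (w - z)).
        { replace (w - z)%C with (RtoC (3 * d) * unit t - (z - s))%C by (unfold w; ring).
          pose proof (Cmod_sub_le (RtoC (3 * d) * unit t)%C (z - s)%C) as T.
          rewrite Cmod_mult, Cmod_unit, Cmod_RtoC_pos in T by lra. rewrite (Cmod_sub_sym z s) in T. fold d in T. lra. }
        pose proof (Hb w Hw) as Hfw. rewrite Hfg, Cmod_mult, Cmod_pow in Hfw.
        assert (Hp : (2 * d) ^ k <= Cmod (w - z) ^ k) by (apply pow_incr; lra).
        assert (Hp0 : 0 < (2 * d) ^ k) by (apply pow_lt; lra).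
        apply Rmult_le_reg_r with ((2 * d) ^ k); [exact Hp0|].
        rewrite Rmult_assoc, Rinv_l, Rmult_1_r by lra.
        nra. }
      rewrite Hfg, Cmod_mult, Cmod_pow.
      apply Rle_trans with (d ^ k * (B * / (2 * d) ^ k)).
      - apply Rmult_le_compat_l; [apply pow_le; lra|exact Hgs].
      - right. rewrite Rpow_mult_distr, pow_inv.
        field. split; apply pow_nonzero; lra. }
    apply (is_lim_seq_le (fun _ => Cmod (f s)) (fun k => B * (/ 2) ^ k) (Cmod (f s)) 0 Hk (is_lim_seq_const _) HL). }
  intros s. destruct (classic (s = z)) as [->|Hs]; [|now apply H0].
  destruct (H 1%nat) as [g [_ Hg]]. rewrite Hg. ring.
Qed.

(** Otherwise [s - z] could be divided out forever, and [ent_infinite_order] would force [f = 0]. *)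
Lemma ent_zero_order f z : ent f -> (exists s, f s <> RtoC 0) ->
  exists k g, ent g /\ g z <> RtoC 0 /\ forall s, (f s = (s - z) ^ k * g s)%C.
Proof.
  intros Hf [s0 Hs0]. apply NNPP. intros Hn. apply Hs0.
  apply (ent_infinite_order f z Hf). intros k. induction k as [|k [g [Hg IH]]].
  - exists f. split; [exact Hf|]. intros s. ring.
  - destruct (ent_factor g z Hg) as [q [Hq Hgq]]. exists q. split; [exact Hq|].
    assert (Hgz : g z = RtoC 0).
    { apply NNPP. intros h. apply Hn. exists k, g. auto. }
    intros s. rewrite IH, Cpow_S.
    replace (g s) with ((s - z) * q s)%C by (rewrite <- Hgq, Hgz; ring). ring.
Qed.

(** * Jensen's inequality *)

Lemma is_lim_seq_ge_const (c : R) (v : nat -> R) (l : R) : (forall n, c <= v n) -> is_lim_seq v l -> c <= l.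
Proof. intros H L. exact (is_lim_seq_le (fun _ => c) v c l H (is_lim_seq_const c) L). Qed.

Lemma is_lim_seq_le_const (c : R) (v : nat -> R) (l : R) : (forall n, v n <= c) -> is_lim_seq v l -> l <= c.
Proof. intros H L. exact (is_lim_seq_le v (fun _ => c) l c H L (is_lim_seq_const c)). Qed.

Lemma exp_mono x y : x <= y -> exp x <= exp y.
Proof. intros [h| ->]; [left; now apply exp_increasing|lra]. Qed.

Lemma continuous_Rabs_cos x : continuous (fun u => Rabs (cos u)) x.
Proof. apply (continuous_comp cos Rabs); [apply continuous_cos|apply continuous_Rabs]. Qed.

Lemma ex_RInt_abs_cos a b : ex_RInt (fun u => Rabs (cos u)) a b.
Proof. apply (ex_RInt_continuous (V := R_CompleteNormedModule)). intros; apply continuous_Rabs_cos. Qed.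

Lemma RInt_cos a b : RInt cos a b = sin b - sin a.
Proof.
  apply is_RInt_unique. apply (is_RInt_derive sin cos).
  - intros x _. apply is_derive_Reals, derivable_pt_lim_sin.
  - intros x _. apply continuous_cos.
Qed.

Lemma ex_RInt_cos a b : ex_RInt cos a b.
Proof. apply (ex_RInt_continuous (V := R_CompleteNormedModule)). intros; apply continuous_cos. Qed.

Lemma RInt_abs_cos_2PI : RInt (fun u => Rabs (cos u)) 0 (2 * PI) = 4.
Proof.
  pose proof PI_RGT_0 as HP.
  rewrite <- (RInt_Chasles (V := R_CompleteNormedModule) _ 0 (PI / 2)) by apply ex_RInt_abs_cos.
  rewrite <- (RInt_Chasles (V := R_CompleteNormedModule) _ (PI / 2) (3 * (PI / 2))) by apply ex_RInt_abs_cos.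
  rewrite (RInt_ext _ cos 0 (PI / 2)).
  2:{ intros x Hx. rewrite Rmin_left, Rmax_right in Hx by lra. apply Rabs_pos_eq, cos_ge_0; lra. }
  rewrite (RInt_ext _ (fun x => - cos x) (PI / 2) (3 * (PI / 2))).
  2:{ intros x Hx. rewrite Rmin_left, Rmax_right in Hx by lra. apply Rabs_left1, cos_le_0; lra. }
  rewrite (RInt_ext _ cos (3 * (PI / 2)) (2 * PI)).
  2:{ intros x Hx. rewrite Rmin_left, Rmax_right in Hx by lra. apply Rabs_pos_eq.
      apply cos_ge_0_3PI2; lra. }
  rewrite (RInt_opp (V := R_CompleteNormedModule) cos) by apply ex_RInt_cos.
  rewrite !RInt_cos, sin_0, sin_PI2, sin_2PI, sin_3PI2.
  cbn. ring.
Qed.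

Lemma RInt_abs_cos_period a : RInt (fun u => Rabs (cos u)) a (a + 2 * PI) = 4.
Proof.
  rewrite <- RInt_abs_cos_2PI.
  rewrite <- (RInt_Chasles (V := R_CompleteNormedModule) _ a 0) by apply ex_RInt_abs_cos.
  rewrite <- (RInt_Chasles (V := R_CompleteNormedModule) _ 0 (2 * PI) (a + 2 * PI)) by apply ex_RInt_abs_cos.
  replace (RInt (fun u => Rabs (cos u)) (2 * PI) (a + 2 * PI)) with (RInt (fun u => Rabs (cos u)) 0 a).
  - rewrite <- (opp_RInt_swap (V := R_CompleteNormedModule) _ a 0) by apply ex_RInt_abs_cos.
    unfold plus, opp; simpl. ring.
  - pose proof (RInt_comp_lin (V := R_CompleteNormedModule) (fun u => Rabs (cos u)) 1 (2 * PI) 0 a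
      (ex_RInt_abs_cos _ _)) as E.
    replace (1 * 0 + 2 * PI) with (2 * PI) in E by ring.
    replace (1 * a + 2 * PI) with (a + 2 * PI) in E by ring. rewrite <- E.
    apply RInt_ext. intros x _. rewrite Rmult_1_l, Rmult_1_l.
    f_equal. rewrite <- (cos_period x 1). f_equal. simpl. ring.
Qed.

(** With [d = pi / M], each [|cos x| 2 sin d] is the modulus of the integral of [cos] over
    [[x - d, x + d]]. These intervals tile one period, over which [|cos|] has integral 4. *)
Lemma sum_abs_cos phi M : (2 <= M)%nat ->
  RS (fun k => Rabs (cos (phi + 2 * PI * INR k / INR M))) M <= 2 / sin (PI / INR M).
Proof.
  intros HM. set (d := PI / INR M).
  assert (HM0 : 2 <= INR M) by (apply (le_INR 2); lia).
  pose proof PI_RGT_0 as HP.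
  assert (Hd : 0 < d < PI).
  { unfold d. split; [apply Rdiv_lt_0_compat; lra|].
    apply Rmult_lt_reg_r with (INR M); [lra|]. unfold Rdiv. rewrite Rmult_assoc, Rinv_l; nra. }
  assert (Hs : 0 < sin d) by (apply sin_gt_0; lra).
  apply Rmult_le_reg_r with (2 * sin d); [lra|].
  replace (2 / sin d * (2 * sin d)) with 4 by (field; lra).
  assert (H : forall K, (RS (fun k => Rabs (cos (phi + 2 * PI * INR k / INR M))) K) * (2 * sin d)
     <= RInt (fun u => Rabs (cos u)) (phi - d) (phi - d + 2 * d * INR K)).
  { induction K as [|K IH].
    - rewrite Rmult_0_r, Rplus_0_r, RInt_point. unfold zero; simpl. lra.
    - simpl RS. rewrite S_INR.
      rewrite <- (RInt_Chasles (V := R_CompleteNormedModule) _ (phi - d) (phi - d + 2 * d * INR K)) by apply ex_RInt_abs_cos.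
      rewrite Rmult_plus_distr_r. apply Rplus_le_compat; [exact IH|].
      set (x := phi + 2 * PI * INR K / INR M).
      replace (phi - d + 2 * d * INR K) with (x - d) by (unfold x, d; field; lra).
      replace (phi - d + 2 * d * (INR K + 1)) with (x + d) by (unfold x, d; field; lra).
      replace (Rabs (cos x) * (2 * sin d)) with (Rabs (RInt cos (x - d) (x + d))).
      + apply abs_RInt_le; [lra|apply ex_RInt_cos].
      + rewrite RInt_cos, sin_plus, sin_minus.
        replace (sin x * cos d + cos x * sin d - (sin x * cos d - cos x * sin d)) with (cos x * (2 * sin d)) by ring.
        rewrite Rabs_mult, (Rabs_pos_eq (2 * sin d)) by lra. reflexivity. }
  eapply Rle_trans; [apply H|].
  replace (phi - d + 2 * d * INR M) with (phi - d + 2 * PI) by (unfold d; field; lra).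
  rewrite RInt_abs_cos_period. lra.
Qed.

(** The limit is the mean of [|cos|]. The index is shifted by two because [sum_abs_cos] needs at
    least two points. *)
Lemma is_lim_seq_mean_cos : is_lim_seq (fun M => 2 / (INR (S (S M)) * sin (PI / INR (S (S M))))) (2 / PI).
Proof.
  pose proof PI_RGT_0 as HP.
  assert (Hx : is_lim_seq (fun M => PI / INR (S (S M))) 0).
  { apply (is_lim_seq_ext (fun M => PI * / INR (S (S M)))); [reflexivity|].
    replace (Finite 0) with (Rbar_mult PI (Finite 0)) by (simpl; f_equal; ring).
    apply is_lim_seq_scal_l.
    apply (is_lim_seq_ext (fun n => / INR (n + 2))); [intros; f_equal; f_equal; lia|].
    apply (proj1 (is_lim_seq_incr_n (fun n => / INR n) 2 0)).
    apply (is_lim_seq_inv INR p_infty); [apply is_lim_seq_INR|discriminate]. }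
  assert (Hs : is_lim_seq (fun M => sin (PI / INR (S (S M))) / (PI / INR (S (S M)))) 1).
  { apply (is_lim_comp_seq (fun x => sin x / x) (fun M => PI / INR (S (S M))) 0 1).
    - apply is_lim_sinc_0.
    - exists O. intros n _ E. apply (f_equal real) in E. change (PI / INR (S (S n)) = 0) in E.
      assert (0 < PI / INR (S (S n))) by (apply Rdiv_lt_0_compat; [lra|apply lt_0_INR; lia]). lra.
    - exact Hx. }
  apply (is_lim_seq_ext (fun M => 2 / PI * / (sin (PI / INR (S (S M))) / (PI / INR (S (S M)))))).
  - intros M. set (n := INR (S (S M))).
    assert (Hn : 2 <= n) by (unfold n; apply (le_INR 2); lia).
    assert (0 < sin (PI / n)).
    { apply sin_gt_0; [apply Rdiv_lt_0_compat; lra|].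
      apply Rmult_lt_reg_r with n; [lra|]. unfold Rdiv. rewrite Rmult_assoc, Rinv_l; nra. }
    field. lra.
  - replace (Finite (2 / PI)) with (Rbar_mult (2 / PI) (Finite (/ 1))) by (simpl; f_equal; field; lra).
    apply is_lim_seq_scal_l.
    apply (is_lim_seq_inv _ 1); [exact Hs|]. intros E. injection E. lra.
Qed.

(* Applying the center bound to the product of the rotates of [q] by the [M]-th roots of unity turns it into a bound by a Riemann sum. *)
Lemma ent_log_mean q r A B D : ent q -> 0 <= A -> 0 <= B ->
  (forall t, Cmod (q (RtoC r * unit t)%C) <= exp (A * Rabs (cos t) + B * Rabs (sin t) + D)) ->
  Cmod (q (RtoC 0)) <= exp (2 / PI * (A + B) + D).
Proof.
  intros Hq HA HB H.
  destruct (Rle_lt_dec (Cmod (q (RtoC 0))) 0) as [h0|h0].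
  { eapply Rle_trans; [exact h0|left; apply exp_pos]. }
  rewrite <- (exp_ln (Cmod (q (RtoC 0)))) by exact h0.
  assert (Hle : ln (Cmod (q (RtoC 0))) <= 2 / PI * (A + B) + D).
  2:{ now apply exp_mono. }
  assert (HM : forall M, ln (Cmod (q (RtoC 0))) <= (A + B) * (2 / (INR (S (S M)) * sin (PI / INR (S (S M))))) + D).
  { intros M'. set (M := S (S M')).
    assert (HM0 : 0 < INR M) by (apply lt_0_INR; lia).
    pose proof PI_RGT_0 as HP.
    assert (Hsin : 0 < sin (PI / INR M)).
    { assert (2 <= INR M) by (apply (le_INR 2); lia).
      apply sin_gt_0; [apply Rdiv_lt_0_compat; lra|].
      apply Rmult_lt_reg_r with (INR M); [lra|]. unfold Rdiv. rewrite Rmult_assoc, Rinv_l; nra. }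
    set (G := fun s => CP (fun k => q (rootu M k * s + RtoC 0)%C) M).
    assert (HG : ent G).
    { apply ent_CP. intros k _. now apply ent_comp_affine. }
    set (E := (A + B) * (2 / sin (PI / INR M)) + INR M * D).
    assert (HGb : Cmod (G (RtoC 0)) <= exp E).
    { apply (ent_center G (RtoC 0) r); [exact HG|]. intros t.
      assert (HPr : forall K, Cmod (CP (fun k => q (rootu M k * (RtoC 0 + RtoC r * unit t) + RtoC 0)%C) K)
          <= exp (RS (fun k => A * Rabs (cos (t + 2 * PI * INR k / INR M))
                   + B * Rabs (cos ((t - PI / 2) + 2 * PI * INR k / INR M)) + D) K)).
      { induction K as [|K IH]; [simpl; rewrite Cmod_1, exp_0; lra|].
        rewrite CP_S, RS_S, Cmod_mult, exp_plus. apply Rmult_le_compat; try apply Cmod_ge_0; [exact IH|].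
        replace (rootu M K * (0 + r * unit t) + 0)%C with (RtoC r * unit (t + 2 * PI * INR K / INR M))%C
          by (unfold rootu; rewrite unit_plus; ring).
        eapply Rle_trans; [apply H|].
        (* The sine is a cosine shifted by a quarter turn, so [sum_abs_cos] serves both terms. *)
        replace (cos (t - PI / 2 + 2 * PI * INR K / INR M)) with (sin (t + 2 * PI * INR K / INR M)); [lra|].
        rewrite sin_cos. rewrite <- cos_neg.
        replace (t - PI / 2 + 2 * PI * INR K / INR M) with ((t + 2 * PI * INR K / INR M) - PI / 2) by ring.
        rewrite cos_minus, cos_PI2, sin_PI2.
        rewrite cos_neg, cos_plus, cos_PI2, sin_PI2. ring. }
      eapply Rle_trans; [apply HPr|].
      assert (Hs : RS (fun k => A * Rabs (cos (t + 2 * PI * INR k / INR M))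
                   + B * Rabs (cos ((t - PI / 2) + 2 * PI * INR k / INR M)) + D) M <= E).
      { rewrite RS_plus, RS_plus, !RS_scal, RS_const.
        pose proof (sum_abs_cos t M ltac:(lia)). pose proof (sum_abs_cos (t - PI / 2) M ltac:(lia)).
        unfold E. nra. }
      now apply exp_mono. }
    assert (HG0 : Cmod (G (RtoC 0)) = exp (INR M * ln (Cmod (q (RtoC 0))))).
    { unfold G. generalize M at 2 3. intros K. induction K as [|K IH].
      - simpl. rewrite Cmod_1, Rmult_0_l, exp_0. reflexivity.
      - rewrite S_INR. simpl CP. rewrite Cmod_mult, IH, Rmult_plus_distr_r, exp_plus, Rmult_1_l, exp_ln by exact h0.
        do 3 f_equal. ring. }
    rewrite HG0 in HGb.
    assert (HE : INR M * ln (Cmod (q (RtoC 0))) <= E).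
    { destruct (Rle_lt_dec (INR M * ln (Cmod (q (RtoC 0)))) E) as [l|l]; [exact l|].
      apply exp_increasing in l. lra. }
    apply Rmult_le_reg_l with (INR M); [exact HM0|].
    eapply Rle_trans; [exact HE|]. right. unfold E. field. lra. }
  apply (is_lim_seq_ge_const _ _ _ HM).
  replace (2 / PI * (A + B) + D) with ((A + B) * (2 / PI) + D) by ring.
  apply is_lim_seq_plus'; [|apply is_lim_seq_const].
  apply (is_lim_seq_scal_l _ (A + B) (Finite (2 / PI))). apply is_lim_seq_mean_cos.
Qed.

(** Zeros are kept in lists that repeat each zero according to its multiplicity; [LP l] is what such
    a list divides out of a function. *)
Fixpoint LP (l : list C) (s : C) : C :=
  match l with nil => RtoC 1 | z :: l' => ((s - z) * LP l' s)%C end.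

Fixpoint LS (w : C -> R) (l : list C) : R :=
  match l with nil => 0 | z :: l' => w z + LS w l' end.

Lemma ent_LP l : ent (LP l).
Proof.
  induction l as [|z l IH]; simpl.
  - apply ent_const.
  - apply ent_mult; [apply ent_sub_const|exact IH].
Qed.

Lemma LP_app l1 l2 s : LP (l1 ++ l2) s = (LP l1 s * LP l2 s)%C.
Proof. induction l1 as [|z l IH]; simpl; [ring|rewrite IH; ring]. Qed.

Lemma LP_repeat z k s : LP (repeat z k) s = ((s - z) ^ k)%C.
Proof. induction k as [|k IH]; simpl; [reflexivity|now rewrite IH]. Qed.

Lemma LP_neq_0 l s : ~ In s l -> LP l s <> RtoC 0.
Proof.
  induction l as [|z l IH]; simpl; intros H.
  - apply RtoC_neq_0. lra.
  - apply Cmult_neq_0'; [|tauto]. intros E. apply H. left. symmetry. now apply Csub_eq_0.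
Qed.

Lemma LP_in_0 l s : In s l -> LP l s = RtoC 0.
Proof.
  induction l as [|z l IH]; simpl; [tauto|]. intros [->|H]; [ring|]. rewrite IH by exact H. ring.
Qed.

(* The numerators of the Blaschke factors of the disc of radius [r]. *)
Fixpoint blaschke (r : R) (l : list C) (s : C) : C :=
  match l with nil => RtoC 1 | z :: l' => ((RtoC r - Cconj z / RtoC r * s) * blaschke r l' s)%C end.

Lemma ent_blaschke r l : ent (blaschke r l).
Proof.
  induction l as [|z l IH]; simpl.
  - apply ent_const.
  - apply ent_mult; [|exact IH]. apply ent_minus; [apply ent_const|]. apply ent_scal, ent_id.
Qed.

(** For [|u| = 1] one has [r - conj z u = u conj (r u - z)], so every factor keeps its modulus on
    the circle. *)
Lemma blaschke_circle r l t : 0 < r -> Cmod (blaschke r l (RtoC r * unit t)%C) = Cmod (LP l (RtoC r * unit t)%C).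
Proof.
  intros Hr. assert (Hr' : RtoC r <> RtoC 0) by (apply RtoC_neq_0; lra).
  induction l as [|z l IH]; simpl; [reflexivity|].
  rewrite !Cmod_mult, IH. f_equal.
  assert (Hu : (unit t * Cconj (unit t) = 1)%C).
  { apply C_ext; simpl; pose proof (sin2_cos2 t) as S; unfold Rsqr in S; nra. }
  replace (r - Cconj z / r * (r * unit t))%C with (unit t * Cconj (RtoC r * unit t - z))%C.
  - rewrite Cmod_mult, Cmod_unit, Cmod_conj. ring.
  - rewrite Cminus_conj, Cmult_conj.
    replace (Cconj (RtoC r)) with (RtoC r) by (apply C_ext; simpl; ring).
    replace (unit t * (r * Cconj (unit t) - Cconj z))%C with (RtoC r * (unit t * Cconj (unit t)) - unit t * Cconj z)%C by ring.
    rewrite Hu. field. exact Hr'.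
Qed.

Lemma blaschke_center r l : 0 < r -> (forall z, In z l -> 0 < Cmod z) ->
  0 < Cmod (LP l (RtoC 0)) /\
  ln (Cmod (blaschke r l (RtoC 0))) = LS (fun z => ln (r / Cmod z)) l + ln (Cmod (LP l (RtoC 0))) /\
  0 < Cmod (blaschke r l (RtoC 0)).
Proof.
  intros Hr. induction l as [|z l IH]; intros Hl; simpl.
  - rewrite Cmod_1, ln_1. repeat split; lra.
  - destruct IH as [H1 [H2 H3]]; [intros; apply Hl; now right|].
    assert (Hz : 0 < Cmod z) by (apply Hl; now left).
    rewrite !Cmod_mult.
    replace (0 - z)%C with (- z)%C by ring. rewrite Cmod_opp.
    replace (r - Cconj z / r * 0)%C with (RtoC r) by ring. rewrite Cmod_RtoC_pos by lra.
    split; [nra|]. split; [|nra].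
    rewrite !ln_mult by assumption. rewrite H2. unfold Rdiv.
    rewrite ln_mult, ln_Rinv by (try apply Rinv_0_lt_compat; assumption). ring.
Qed.

(** The product of [blaschke r l] and [g] has the modulus of [f] on the circle, while at 0 it
    exceeds [|f 0|] by the factors [r / |z|]. Applying [ent_log_mean] to this product gives the
    inequality, with no integral of [ln |f|]. *)
Lemma jensen f g l r A B D : ent g -> (forall s, f s = (LP l s * g s)%C) -> 0 < r ->
  0 <= A -> 0 <= B -> f (RtoC 0) <> RtoC 0 ->
  (forall t, Cmod (f (RtoC r * unit t)%C) <= exp (A * Rabs (cos t) + B * Rabs (sin t) + D)) ->
  LS (fun z => ln (r / Cmod z)) l + ln (Cmod (f (RtoC 0))) <= 2 / PI * (A + B) + D.
Proof.
  intros Hg Hf Hr HA HB Hf0 Hb.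
  assert (Hl : forall z, In z l -> 0 < Cmod z).
  { intros z Hz. apply Cmod_pos. intros ->. apply Hf0. rewrite Hf, LP_in_0 by exact Hz. ring. }
  destruct (blaschke_center r l Hr Hl) as [H1 [H2 H3]].
  assert (Hg0 : 0 < Cmod (g (RtoC 0))).
  { apply Cmod_pos. intros E. apply Hf0. rewrite Hf, E. ring. }
  pose proof (ent_log_mean (fun s => blaschke r l s * g s)%C r A B D) as HM.
  cbv beta in HM. rewrite Cmod_mult in HM.
  assert (HM' : Cmod (blaschke r l (RtoC 0)) * Cmod (g (RtoC 0)) <= exp (2 / PI * (A + B) + D)).
  { apply HM; try assumption.
    - apply ent_mult; [apply ent_blaschke|exact Hg].
    - intros t. rewrite Cmod_mult, blaschke_circle, <- Cmod_mult, <- Hf by exact Hr. apply Hb. }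
  apply ln_le in HM'; [|nra]. rewrite ln_exp, ln_mult, H2 in HM' by assumption.
  rewrite Hf, Cmod_mult, ln_mult by assumption. lra.
Qed.

(** * Zero lists *)

Lemma ent_unit_bound f r : ent f -> exists D, forall t, Cmod (f (RtoC r * unit t)%C) <= exp D.
Proof.
  intros Hf. destruct (ent_bounded f (Rabs r) Hf) as [B [HB Hb]]. exists (ln B). intros t. rewrite exp_ln by exact HB.
  apply Hb. rewrite Cmod_mult, Cmod_unit, Cmod_R. lra.
Qed.

Lemma LS_ge_const w l c : (forall z, In z l -> c <= w z) -> INR (length l) * c <= LS w l.
Proof.
  induction l as [|z l IH]; intros H; [simpl; lra|].
  change (length (z :: l)) with (S (length l)). rewrite S_INR. simpl LS.
  assert (c <= w z) by (apply H; now left).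
  assert (INR (length l) * c <= LS w l) by (apply IH; intros; apply H; now right). lra.
Qed.

(** The order at 0 is divided out first, since Jensen's inequality needs a nonzero value there. On
    the circle of radius [2 r] every extracted zero weighs at least [ln 2], which bounds the length
    of any list; so the extraction of zeros in [U] must stop. *)
Lemma ent_zero_list f (U : C -> Prop) r : ent f -> (exists s, f s <> RtoC 0) -> 0 < r -> (forall z, U z -> Cmod z <= r) ->
  exists l g, ent g /\ (forall s, f s = (LP l s * g s)%C) /\ (forall z, In z l -> U z) /\
    (forall z, U z -> g z <> RtoC 0).
Proof.
  intros Hf Hf1 Hr HU.
  destruct (ent_zero_order f (RtoC 0) Hf Hf1) as [k [f1 [Hf1e [Hf10 Hfk]]]].
  assert (Hlen : exists L, forall l g, ent g -> (forall s, f1 s = (LP l s * g s)%C) -> (forall z, In z l -> Cmod z <= r) ->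
      INR (length l) <= L).
  { destruct (ent_unit_bound f1 (2 * r) Hf1e) as [D HD].
    exists ((D - ln (Cmod (f1 (RtoC 0)))) / ln 2). intros l g Hg Hfg Hl.
    assert (Hln2 : 0 < ln 2) by (rewrite <- ln_1; apply ln_increasing; lra).
    assert (HJ := jensen f1 g l (2 * r) 0 0 D Hg Hfg ltac:(lra) ltac:(lra) ltac:(lra) Hf10).
    assert (HJ' : LS (fun z => ln (2 * r / Cmod z)) l + ln (Cmod (f1 (RtoC 0))) <= 2 / PI * (0 + 0) + D).
    { apply HJ. intros t. eapply Rle_trans; [apply HD|]. apply exp_mono. lra. }
    assert (HL : INR (length l) * ln 2 <= LS (fun z => ln (2 * r / Cmod z)) l).
    { apply LS_ge_const. intros z Hz.
      assert (Hz0 : 0 < Cmod z).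
      { apply Cmod_pos. intros ->. apply Hf10. rewrite Hfg, LP_in_0 by exact Hz. ring. }
      apply ln_le; [lra|]. apply Rmult_le_reg_r with (Cmod z); [exact Hz0|].
      unfold Rdiv. rewrite Rmult_assoc, Rinv_l by lra. specialize (Hl z Hz). lra. }
    apply Rmult_le_reg_r with (ln 2); [exact Hln2|].
    unfold Rdiv. rewrite Rmult_assoc, Rinv_l by lra. lra. }
  assert (H1 : exists l g, ent g /\ (forall s, f1 s = (LP l s * g s)%C) /\ (forall z, In z l -> U z /\ z <> RtoC 0) /\
    (forall z, U z -> z <> RtoC 0 -> g z <> RtoC 0)).
  (* If every cofactor still had a zero in [U], factorizations with lists of all lengths would
     exist, against [L]. *)
  { apply NNPP. intros Hn. destruct Hlen as [L HL].
    assert (Hall : forall m, exists l g, length l = m /\ ent g /\ (forall s, f1 s = (LP l s * g s)%C) /\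
       (forall z, In z l -> U z /\ z <> RtoC 0)).
    { induction m as [|m [l [g [Hm [Hg [Hfg Hl]]]]]].
      - exists nil, f1. repeat split; try assumption; try (intros; simpl; ring); intros; contradiction.
      - assert (Hz : exists z, U z /\ z <> RtoC 0 /\ g z = RtoC 0).
        { apply NNPP. intros h. apply Hn. exists l, g. repeat split; try assumption; try apply Hl; try assumption.
          intros z Hz1 Hz2 Hz3. apply h. now exists z. }
        destruct Hz as [z [Hz1 [Hz2 Hz3]]].
        destruct (ent_factor g z Hg) as [q [Hq Hgq]].
        exists (z :: l), q. split; [simpl; now rewrite Hm|]. split; [exact Hq|]. split.
        + intros s. rewrite Hfg. replace (g s) with ((s - z) * q s)%C by (rewrite <- Hgq, Hz3; ring). simpl. ring.
        + intros y [<-|Hy]; [auto|now apply Hl]. }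
    destruct (INR_unbounded (L + 1)) as [m Hm].
    destruct (Hall m) as [l [g [Hlm [Hg [Hfg Hl]]]]].
    specialize (HL l g Hg Hfg). rewrite Hlm in HL.
    assert (INR m <= L) by (apply HL; intros z Hz; apply HU, Hl, Hz). lra. }
  destruct H1 as [l [g [Hg [Hfg [Hl Hgz]]]]].
  destruct (classic (U (RtoC 0))) as [h0|h0].
  - exists (repeat (RtoC 0) k ++ l), g. split; [exact Hg|]. split.
    + intros s. rewrite LP_app, LP_repeat, Hfk, Hfg. ring.
    + split.
      * intros z Hz. apply in_app_or in Hz. destruct Hz as [Hz|Hz]; [|now apply Hl].
        apply repeat_spec in Hz. now subst.
      * intros z Hz. destruct (classic (z = RtoC 0)) as [->|hz]; [|now apply Hgz].
        intros E. apply Hf10. rewrite Hfg, E. ring.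
  (* When 0 lies outside [U], the power of [s] stays in the cofactor. *)
  - exists l, (fun s => (s - RtoC 0) ^ k * g s)%C. split; [|split; [|split]].
    + apply ent_mult; [apply ent_pow, ent_sub_const|exact Hg].
    + intros s. rewrite Hfk, Hfg. ring.
    + intros z Hz. now apply Hl.
    + intros z Hz. assert (hz : z <> RtoC 0) by (intros ->; contradiction).
      apply Cmult_neq_0'; [|now apply Hgz].
      apply Cmod_gt_0. rewrite Cmod_pow. apply pow_lt. apply Cmod_pos.
      intros E. apply hz. replace z with (z - 0)%C by ring. exact E.
Qed.

Definition C_dec (z w : C) : {z = w} + {z <> w} := excluded_middle_informative (z = w).

Lemma LP_remove l z s : LP l s = ((s - z) ^ count_occ C_dec l z * LP (remove C_dec z l) s)%C.
Proof.
  induction l as [|y l IH]; simpl; [ring|].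
  destruct (C_dec y z) as [E|h]; destruct (C_dec z y) as [E'|h']; try congruence.
  - subst y. rewrite IH, Cpow_S. ring.
  - rewrite IH. simpl. ring.
Qed.

(** The local cofactor is [LP (remove C_dec z l)] times [g], nonzero at [z] since all copies of [z]
    are gone. The factorization is global, so the radius 1 is arbitrary. *)
Lemma zero_order_list f l g z : ent g -> (forall s, f s = (LP l s * g s)%C) -> In z l -> g z <> RtoC 0 ->
  zero_order f z (count_occ C_dec l z).
Proof.
  intros Hg Hf Hz Hgz. split; [apply (count_occ_In C_dec) in Hz; lia|].
  exists 1. split; [lra|]. exists (fun s => LP (remove C_dec z l) s * g s)%C.
  split.
  - apply Cmult_neq_0'; [|exact Hgz]. apply LP_neq_0, remove_In.
  - intros s _. split.
    + apply ent_ex_derive. apply ent_mult; [apply ent_LP|exact Hg].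
    + rewrite Cpow_def, Hf, (LP_remove l z s). ring.
Qed.

Lemma LS_ext w1 w2 l : (forall z, In z l -> w1 z = w2 z) -> LS w1 l = LS w2 l.
Proof.
  induction l as [|z l IH]; simpl; intros H; [reflexivity|]. rewrite H, IH; auto.
Qed.

Lemma LS_le w1 w2 l : (forall z, In z l -> w1 z <= w2 z) -> LS w1 l <= LS w2 l.
Proof.
  induction l as [|z l IH]; simpl; intros H; [lra|]. apply Rplus_le_compat; auto.
Qed.

Lemma LS_plus w1 w2 l : LS (fun z => w1 z + w2 z) l = LS w1 l + LS w2 l.
Proof. induction l as [|z l IH]; simpl; [ring|rewrite IH; ring]. Qed.

Lemma LS_scal c w l : LS (fun z => c * w z) l = c * LS w l.
Proof. induction l as [|z l IH]; simpl; [ring|rewrite IH; ring]. Qed.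

Lemma LS_app w l1 l2 : LS w (l1 ++ l2) = LS w l1 + LS w l2.
Proof. induction l1 as [|z l IH]; simpl; [ring|rewrite IH; ring]. Qed.

Lemma LS_nonneg w l : (forall z, In z l -> 0 <= w z) -> 0 <= LS w l.
Proof. induction l as [|z l IH]; simpl; intros H; [lra|]. apply Rplus_le_le_0_compat; auto. Qed.

Lemma LS_single zs z c : NoDup zs -> In z zs -> LS (fun y => if C_dec z y then c else 0) zs = c.
Proof.
  induction zs as [|y zs IH]; simpl; intros Hn Hz; [tauto|]. inversion Hn as [|? ? Hy Hn']; subst.
  destruct (C_dec z y) as [->|h].
  - replace (LS _ zs) with 0; [ring|]. symmetry.
    transitivity (LS (fun _ => 0 * 0) zs); [|rewrite LS_scal; ring].
    apply LS_ext. intros x Hx. destruct (C_dec y x) as [->|_]; [contradiction|ring].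
  - destruct Hz as [->|Hz]; [congruence|]. rewrite IH by assumption. ring.
Qed.

Lemma LS_count w l zs : NoDup zs -> incl l zs ->
  LS w l = LS (fun z => INR (count_occ C_dec l z) * w z) zs.
Proof.
  intros Hn. induction l as [|y l IH]; intros Hi.
  - simpl. symmetry. transitivity (LS (fun _ => 0 * 0) zs); [apply LS_ext; intros; simpl; ring|rewrite LS_scal; ring].
  - simpl LS at 1. rewrite IH by (intros x Hx; apply Hi; now right).
    rewrite <- (LS_single zs y (w y) Hn) at 1 by (apply Hi; now left). rewrite <- LS_plus.
    apply LS_ext. intros z _. simpl. destruct (C_dec y z) as [->|h]; [rewrite S_INR; ring|ring].
Qed.

Lemma LS_incl w l zs : NoDup l -> NoDup zs -> incl l zs -> (forall z, In z zs -> 0 <= w z) -> LS w l <= LS w zs.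
Proof.
  intros Hl Hz Hi Hw. rewrite (LS_count w l zs Hz Hi). apply LS_le. intros z Hz'.
  assert (count_occ C_dec l z <= 1)%nat by (apply (NoDup_count_occ C_dec); exact Hl).
  specialize (Hw z Hz'). assert (INR (count_occ C_dec l z) <= 1) by (apply (le_INR _ 1); lia). nra.
Qed.

Lemma LS_filter w (p : C -> bool) l : LS w (filter p l) = LS (fun z => if p z then w z else 0) l.
Proof. induction l as [|z l IH]; simpl; [reflexivity|]. destruct (p z); simpl; rewrite IH; ring. Qed.

(** * Integrals over the real line *)

Definition contR (g : R -> R) : Prop := forall t, continuous g t.
Definition expdecay (g : R -> R) : Prop := exists B d, 0 < d /\ forall t, Rabs (g t) <= B * exp (- d * Rabs t).
Definition goodR (g : R -> R) : Prop := contR g /\ expdecay g.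
(** The improper integral as a total function, a limit over the intervals [[-n, n]]; its value is
    meaningful for [goodR] integrands, whose exponential decay makes the limit finite. *)
Definition IntR (g : R -> R) : R := real (Lim_seq (fun n => RInt g (- INR n) (INR n))).

Lemma contR_derive (g : R -> R) : (forall t : R, ex_derive g t) -> contR g.
Proof. intros H t. apply (ex_derive_continuous g), H. Qed.

Lemma contR_ex_RInt g a b : contR g -> ex_RInt g a b.
Proof. intros H. apply (ex_RInt_continuous (V := R_CompleteNormedModule)). intros; apply H. Qed.

Lemma RInt_exp_decay B d a b : 0 < d -> is_RInt (fun t => B * exp (- d * t)) a b (B / d * (exp (- d * a) - exp (- d * b))).
Proof.
  intros Hd.
  replace (B / d * (exp (- d * a) - exp (- d * b))) with (minus (- B / d * exp (- d * b)) (- B / d * exp (- d * a))).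
  - apply (is_RInt_derive (fun t => - B / d * exp (- d * t)) (fun t => B * exp (- d * t))).
    + intros t _. auto_derive; [trivial|]. field. lra.
    + intros t _. apply (ex_derive_continuous (fun t => B * exp (- d * t))). auto_derive. trivial.
  - unfold minus, plus, opp; simpl. field. lra.
Qed.

Lemma goodR_opp g : goodR g -> goodR (fun t => g (- t)).
Proof.
  intros [Hc [B [d [Hd H]]]]. split.
  - intros t. apply (continuous_comp Ropp g); [|apply Hc].
    apply (ex_derive_continuous Ropp). auto_derive. trivial.
  - exists B, d. split; [exact Hd|]. intros t. rewrite <- (Rabs_Ropp t). apply H.
Qed.

Lemma RInt_opp_arg g a b : contR g -> RInt (fun t => g (- t)) a b = RInt g (- b) (- a).
Proof.
  intros H.
  pose proof (RInt_comp_lin (V := R_CompleteNormedModule) g (-1) 0 a b (contR_ex_RInt g _ _ H)) as E.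
  replace (-1 * a + 0) with (- a) in E by ring. replace (-1 * b + 0) with (- b) in E by ring.
  rewrite <- (opp_RInt_swap (V := R_CompleteNormedModule) g (- a) (- b)) by now apply contR_ex_RInt.
  rewrite <- E.
  rewrite <- (RInt_opp (V := R_CompleteNormedModule)).
  - apply RInt_ext. intros x _. change (g (- x) = - (-1 * g (-1 * x + 0))).
    replace (-1 * x + 0) with (- x) by ring. ring.
  - apply (ex_RInt_comp_lin (V := R_CompleteNormedModule) g (-1) 0 a b). now apply contR_ex_RInt.
Qed.

Lemma RInt_shift_arg g c a b : contR g -> RInt (fun t => g (t + c)) a b = RInt g (a + c) (b + c).
Proof.
  intros H.
  pose proof (RInt_comp_lin (V := R_CompleteNormedModule) g 1 c a b (contR_ex_RInt g _ _ H)) as E.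
  replace (1 * a + c) with (a + c) in E by ring. replace (1 * b + c) with (b + c) in E by ring.
  rewrite <- E. apply RInt_ext. intros x _. change (g (x + c) = 1 * g (1 * x + c)).
  replace (1 * x + c) with (x + c) by ring. ring.
Qed.

Lemma RInt_tail_right g B d x b : contR g -> 0 < d -> (forall t, Rabs (g t) <= B * exp (- d * Rabs t)) ->
  0 <= x -> x <= b -> Rabs (RInt g x b) <= B / d * exp (- d * x).
Proof.
  intros Hc Hd H Hx Hb.
  assert (HB : 0 <= B).
  { specialize (H 0). pose proof (Rabs_pos (g 0)). rewrite Rabs_R0, Rmult_0_r, exp_0 in H. lra. }
  eapply Rle_trans; [apply abs_RInt_le; [exact Hb|now apply contR_ex_RInt]|].
  eapply Rle_trans.
  - apply (RInt_le (fun t => Rabs (g t)) (fun t => B * exp (- d * t))); [exact Hb| | |].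
    + apply contR_ex_RInt. intros t. apply (continuous_comp g Rabs); [apply Hc|apply continuous_Rabs].
    + eexists. now apply RInt_exp_decay.
    + intros t Ht. specialize (H t). rewrite (Rabs_pos_eq t) in H by lra. exact H.
  - rewrite (is_RInt_unique _ _ _ _ (RInt_exp_decay B d x b Hd)).
    apply Rmult_le_compat_l; [apply Rmult_le_pos; [exact HB|left; now apply Rinv_0_lt_compat]|].
    pose proof (exp_pos (- d * b)). lra.
Qed.

Lemma RInt_tail g B d : contR g -> 0 < d -> (forall t, Rabs (g t) <= B * exp (- d * Rabs t)) ->
  forall x a b a' b', 0 <= x -> a <= - x -> x <= b -> a' <= - x -> x <= b' ->
  Rabs (RInt g a b - RInt g a' b') <= 4 * (B / d * exp (- d * x)).
Proof.
  intros Hc Hd H x a b a' b' Hx Ha Hb Ha' Hb'.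
  assert (Hr : forall b, x <= b -> Rabs (RInt g x b) <= B / d * exp (- d * x)) by (intros; now apply RInt_tail_right).
  assert (Hl : forall a, a <= - x -> Rabs (RInt g a (- x)) <= B / d * exp (- d * x)).
  { intros c Hcx. replace (RInt g c (- x)) with (RInt g (- - c) (- x)) by (f_equal; ring).
    rewrite <- RInt_opp_arg by exact Hc.
    apply (RInt_tail_right (fun t => g (- t)) B d x (- c)); try assumption; try lra.
    - intros t. apply (continuous_comp Ropp g); [|apply Hc].
      apply (ex_derive_continuous Ropp). auto_derive. trivial.
    - intros t. rewrite <- (Rabs_Ropp t). apply H. }
  assert (E : forall a b, RInt g a b = RInt g a (- x) + RInt g (- x) x + RInt g x b).
  { intros u v.
    rewrite <- (RInt_Chasles (V := R_CompleteNormedModule) g u (- x) v) by now apply contR_ex_RInt.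
    rewrite <- (RInt_Chasles (V := R_CompleteNormedModule) g (- x) x v) by now apply contR_ex_RInt.
    unfold plus; simpl. ring. }
  rewrite (E a b), (E a' b').
  pose proof (Hr b Hb) as h1. pose proof (Hr b' Hb') as h2. pose proof (Hl a Ha) as h3. pose proof (Hl a' Ha') as h4.
  apply Rabs_le_between in h1, h2, h3, h4. apply Rabs_le_between. lra.
Qed.

Lemma is_lim_exp_decay K d : 0 < d -> is_lim_seq (fun n => K * exp (- d * INR n)) 0.
Proof.
  intros Hd. apply (is_lim_seq_ext (fun n => K * (exp (- d)) ^ n)).
  - intros n. f_equal. induction n as [|n IH]; [simpl; now rewrite Rmult_0_r, exp_0|].
    simpl pow. rewrite IH, S_INR, <- exp_plus. f_equal. ring.
  - replace 0 with (K * 0) by ring. apply (is_lim_seq_scal_l _ K 0). apply is_lim_seq_geom.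
    rewrite Rabs_pos_eq by (left; apply exp_pos). rewrite <- exp_0. apply exp_increasing. lra.
Qed.

(** The endpoints are arbitrary, not symmetric: shifts, reflections and the two-sided [RInt_gen] all
    rest on this tail bound. *)
Lemma IntR_tail g : goodR g -> exists K d, 0 < d /\
  forall x a b, 0 <= x -> a <= - x -> x <= b -> Rabs (RInt g a b - IntR g) <= K * exp (- d * x).
Proof.
  intros [Hc [B [d [Hd H]]]].
  pose proof (RInt_tail g B d Hc Hd H) as HT.
  assert (EL : ex_finite_lim_seq (fun n => RInt g (- INR n) (INR n))).
  { apply ex_lim_seq_cauchy_corr. intros e.
    pose proof (is_lim_exp_decay (4 * (B / d)) d Hd) as HL. apply is_lim_seq_spec in HL.
    destruct (HL e) as [M HM]. exists M. intros n m Hn Hm.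
    specialize (HM M (Nat.le_refl M)).
    assert (INR M <= INR n) by now apply le_INR. assert (INR M <= INR m) by now apply le_INR.
    pose proof (pos_INR M).
    eapply Rle_lt_trans; [apply (HT (INR M)); lra|].
    pose proof (RRle_abs (4 * (B / d) * exp (- d * INR M) - 0)). lra. }
  assert (EL' : is_lim_seq (fun n => RInt g (- INR n) (INR n)) (IntR g)).
  { apply Lim_seq_correct'. exact EL. }
  exists (4 * (B / d)), d. split; [exact Hd|]. intros x a b Hx Ha Hb.
  destruct (INR_unbounded x) as [N HN].
  apply le_epsilon. intros e He. apply is_lim_seq_spec in EL'. destruct (EL' (mkposreal e He)) as [M HM].
  specialize (HM (N + M)%nat ltac:(lia)). simpl in HM.
  assert (INR N <= INR (N + M)) by (apply le_INR; lia).
  pose proof (HT x a b (- INR (N + M)) (INR (N + M))) as h.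
  assert (h' : Rabs (RInt g a b - RInt g (- INR (N + M)) (INR (N + M))) <= 4 * (B / d * exp (- d * x))) by (apply h; lra).
  apply Rabs_le_between in h'. apply Rabs_lt_between in HM. apply Rabs_le_between. lra.
Qed.

Lemma IntR_lim g (a b : nat -> R) : goodR g ->
  (exists c, forall n, a n <= c - INR n /\ INR n - c <= b n) -> is_lim_seq (fun n => RInt g (a n) (b n)) (IntR g).
Proof.
  intros Hg [c Hab]. destruct (IntR_tail g Hg) as [K [d [Hd H]]].
  apply is_lim_seq_spec. intros e.
  pose proof (is_lim_exp_decay (K * exp (d * c)) d Hd) as HL. apply is_lim_seq_spec in HL. destruct (HL e) as [M HM].
  destruct (INR_unbounded c) as [N HN].
  exists (N + M)%nat. intros n Hn. destruct (Hab n) as [Ha Hb].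
  assert (INR N <= INR n) by (apply le_INR; lia).
  eapply Rle_lt_trans; [apply (H (INR n - c)); lra|].
  specialize (HM n ltac:(lia)).
  replace (- d * (INR n - c)) with (d * c + - d * INR n) by ring. rewrite exp_plus.
  pose proof (RRle_abs (K * exp (d * c) * exp (- d * INR n) - 0)). lra.
Qed.

Lemma IntR_correct g : goodR g -> is_lim_seq (fun n => RInt g (- INR n) (INR n)) (IntR g).
Proof. intros H. apply IntR_lim; [exact H|]. exists 0. intros n. lra. Qed.

Lemma IntR_unique g (l : R) : is_lim_seq (fun n => RInt g (- INR n) (INR n)) l -> IntR g = l.
Proof. intros H. unfold IntR. now rewrite (is_lim_seq_unique _ _ H). Qed.

Lemma contR_plus f g : contR f -> contR g -> contR (fun t => f t + g t).
Proof. intros Hf Hg t. apply (continuous_plus f g); auto. Qed.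

Lemma contR_mult f g : contR f -> contR g -> contR (fun t => f t * g t).
Proof. intros Hf Hg t. apply (continuous_mult f g); auto. Qed.

Lemma contR_const c : contR (fun _ => c).
Proof. intros t. apply continuous_const. Qed.

Lemma expdecay_nonneg_const g : expdecay g -> exists B d, 0 < d /\ 0 <= B /\ forall t, Rabs (g t) <= B * exp (- d * Rabs t).
Proof.
  intros [B [d [Hd H]]]. exists B, d. split; [exact Hd|]. split; [|exact H].
  specialize (H 0). pose proof (Rabs_pos (g 0)). rewrite Rabs_R0, Rmult_0_r, exp_0 in H. lra.
Qed.

Lemma goodR_plus f g : goodR f -> goodR g -> goodR (fun t => f t + g t).
Proof.
  intros [Hf Df] [Hg Dg]. split; [now apply contR_plus|].
  apply expdecay_nonneg_const in Df. apply expdecay_nonneg_const in Dg.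
  destruct Df as [B1 [d1 [Hd1 [HB1 H1]]]]. destruct Dg as [B2 [d2 [Hd2 [HB2 H2]]]].
  exists (B1 + B2), (Rmin d1 d2). split; [now apply Rmin_glb_lt|]. intros t.
  eapply Rle_trans; [apply Rabs_triang|]. rewrite Rmult_plus_distr_r. specialize (H1 t). specialize (H2 t).
  assert (E : forall d, Rmin d1 d2 <= d -> exp (- d * Rabs t) <= exp (- Rmin d1 d2 * Rabs t)).
  { intros d Hd. apply exp_mono. pose proof (Rabs_pos t). nra. }
  pose proof (E d1 (Rmin_l _ _)). pose proof (E d2 (Rmin_r _ _)). nra.
Qed.

Lemma goodR_scal c f : goodR f -> goodR (fun t => c * f t).
Proof.
  intros [Hf [B [d [Hd H]]]]. split; [apply contR_mult; [apply contR_const|exact Hf]|].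
  exists (Rabs c * B), d. split; [exact Hd|]. intros t. rewrite Rabs_mult, Rmult_assoc.
  apply Rmult_le_compat_l; [apply Rabs_pos|apply H].
Qed.

Lemma goodR_le f g : contR f -> goodR g -> (forall t, Rabs (f t) <= g t) -> goodR f.
Proof.
  intros Hf [_ [B [d [Hd H]]]] Hle. split; [exact Hf|]. exists B, d. split; [exact Hd|]. intros t.
  eapply Rle_trans; [apply Hle|]. eapply Rle_trans; [apply RRle_abs|apply H].
Qed.

Lemma goodR_shift c f : goodR f -> goodR (fun t => f (t + c)).
Proof.
  intros [Hf Df]. apply expdecay_nonneg_const in Df. destruct Df as [B [d [Hd [HB H]]]]. split.
  - intros t. apply (continuous_comp (fun t => t + c) f); [|apply Hf].
    apply (ex_derive_continuous (fun t => t + c)). auto_derive. trivial.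
  - exists (B * exp (d * Rabs c)), d. split; [exact Hd|]. intros t. eapply Rle_trans; [apply H|].
    rewrite Rmult_assoc. apply Rmult_le_compat_l; [exact HB|]. rewrite <- exp_plus. apply exp_mono.
    pose proof (Rabs_triang (t + c) (- c)) as T. rewrite Rabs_Ropp in T. replace (t + c + - c) with t in T by ring. nra.
Qed.

Lemma IntR_plus f g : goodR f -> goodR g -> IntR (fun t => f t + g t) = IntR f + IntR g.
Proof.
  intros Hf Hg. apply IntR_unique.
  apply (is_lim_seq_ext (fun n => RInt f (- INR n) (INR n) + RInt g (- INR n) (INR n))).
  - intros n. symmetry. apply (RInt_plus (V := R_CompleteNormedModule)); apply contR_ex_RInt; [apply Hf|apply Hg].
  - apply is_lim_seq_plus'; now apply IntR_correct.
Qed.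

Lemma IntR_scal c f : goodR f -> IntR (fun t => c * f t) = c * IntR f.
Proof.
  intros Hf. apply IntR_unique.
  apply (is_lim_seq_ext (fun n => c * RInt f (- INR n) (INR n))).
  - intros n. symmetry. apply (RInt_scal (V := R_CompleteNormedModule)). apply contR_ex_RInt, Hf.
  - apply (is_lim_seq_scal_l _ c (Finite (IntR f))). now apply IntR_correct.
Qed.

Lemma IntR_ext f g : (forall t, f t = g t) -> IntR f = IntR g.
Proof. intros H. f_equal. now apply functional_extensionality. Qed.

Lemma IntR_le f g : goodR f -> goodR g -> (forall t, f t <= g t) -> IntR f <= IntR g.
Proof.
  intros Hf Hg H.
  apply (is_lim_seq_le (fun n => RInt f (- INR n) (INR n)) (fun n => RInt g (- INR n) (INR n)) (IntR f) (IntR g));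
    try now apply IntR_correct.
  intros n. pose proof (pos_INR n). apply RInt_le; try (apply contR_ex_RInt; [apply Hf || apply Hg]); try lra.
  intros; apply H.
Qed.

Lemma goodR_lin3 a b c f g h : goodR f -> goodR g -> goodR h -> goodR (fun t => a * f t + (b * g t + c * h t)).
Proof.
  intros Hf Hg Hh. apply (goodR_plus (fun t => a * f t) (fun t => b * g t + c * h t)); [now apply goodR_scal|].
  apply (goodR_plus (fun t => b * g t) (fun t => c * h t)); now apply goodR_scal.
Qed.

Lemma IntR_lin3 a b c f g h : goodR f -> goodR g -> goodR h ->
  IntR (fun t => a * f t + (b * g t + c * h t)) = a * IntR f + (b * IntR g + c * IntR h).
Proof.
  intros Hf Hg Hh. rewrite (IntR_plus (fun t => a * f t) (fun t => b * g t + c * h t)).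
  - rewrite (IntR_plus (fun t => b * g t) (fun t => c * h t)) by now apply goodR_scal.
    rewrite (IntR_scal a f), (IntR_scal b g), (IntR_scal c h) by assumption. reflexivity.
  - now apply goodR_scal.
  - apply (goodR_plus (fun t => b * g t) (fun t => c * h t)); now apply goodR_scal.
Qed.

Lemma IntR_shift c f : goodR f -> IntR (fun t => f (t + c)) = IntR f.
Proof.
  intros Hf. apply IntR_unique.
  apply (is_lim_seq_ext (fun n => RInt f (- INR n + c) (INR n + c))).
  - intros n. symmetry. apply RInt_shift_arg, Hf.
  - apply IntR_lim; [exact Hf|]. exists (Rabs c). intros n.
    pose proof (RRle_abs c). pose proof (RRle_abs (- c)). rewrite Rabs_Ropp in *. lra.
Qed.

Lemma IntR_opp_arg f : goodR f -> IntR (fun t => f (- t)) = IntR f.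
Proof.
  intros Hf. apply IntR_unique.
  apply (is_lim_seq_ext (fun n => RInt f (- INR n) (- - INR n))).
  - intros n. symmetry. apply RInt_opp_arg, Hf.
  - apply IntR_lim; [exact Hf|]. exists 0. intros n. lra.
Qed.

Lemma IntR_derive F f : (forall t, is_derive F t (f t)) -> contR f -> expdecay F -> IntR f = 0.
Proof.
  intros HF Hf HD. apply expdecay_nonneg_const in HD. destruct HD as [B [d [Hd [HB HD]]]]. apply IntR_unique.
  apply (is_lim_seq_ext (fun n => F (INR n) - F (- INR n))).
  - intros n. symmetry. apply is_RInt_unique. apply (is_RInt_derive F f); intros; [apply HF|apply Hf].
  - apply (proj2 (is_lim_seq_abs_0 _)).
    apply (is_lim_seq_le_le (fun _ => 0) _ (fun n => 2 * B * exp (- d * INR n))).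
    + intros n. split; [apply Rabs_pos|]. pose proof (HD (INR n)) as h1. pose proof (HD (- INR n)) as h2.
      rewrite Rabs_Ropp in h2. rewrite (Rabs_pos_eq (INR n)) in h1, h2 by apply pos_INR.
      apply Rabs_le_between in h1, h2. apply Rabs_le_between. lra.
    + apply is_lim_seq_const.
    + now apply is_lim_exp_decay.
Qed.

Lemma IntR_zero : IntR (fun _ => 0) = 0.
Proof.
  apply IntR_unique. apply (is_lim_seq_ext (fun _ => 0)); [|apply is_lim_seq_const].
  intros n. rewrite RInt_const. unfold scal; simpl; unfold mult; simpl. ring.
Qed.

Lemma IntR_pos f : goodR f -> (forall t, 0 < f t) -> 0 < IntR f.
Proof.
  intros Hf H. apply Rlt_le_trans with (RInt f 0 1).
  - apply RInt_gt_0; [lra|intros; apply H|intros; apply Hf].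
  - apply (is_lim_seq_ge_const _ (fun n => RInt f (- INR (S n)) (INR (S n)))).
    + intros n. assert (Hn : 1 <= INR (S n)) by (apply (le_INR 1); lia).
      assert (Ec : forall a b, ex_RInt f a b) by (intros; apply contR_ex_RInt, Hf).
      rewrite <- (RInt_Chasles (V := R_CompleteNormedModule) f (- INR (S n)) 0) by apply Ec.
      rewrite <- (RInt_Chasles (V := R_CompleteNormedModule) f 0 1 (INR (S n))) by apply Ec.
      unfold plus; simpl plus.
      assert (0 <= RInt f (- INR (S n)) 0) by (apply RInt_ge_0; [lra|apply Ec|intros; left; apply H]).
      assert (0 <= RInt f 1 (INR (S n))) by (apply RInt_ge_0; [lra|apply Ec|intros; left; apply H]).
      unfold AbelianMonoid.plus in *; simpl in *; lra.
    + apply (proj1 (is_lim_seq_incr_1 (fun n => RInt f (- INR n) (INR n)) (IntR f))). now apply IntR_correct.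
Qed.

(** * Integrals of complex-valued functions over the real line *)

Definition contC (f : R -> C) : Prop := contR (fun t => Re (f t)) /\ contR (fun t => Im (f t)).
Definition goodC (f : R -> C) : Prop := goodR (fun t => Re (f t)) /\ goodR (fun t => Im (f t)).
Definition IntC (f : R -> C) : C := (IntR (fun t => Re (f t)), IntR (fun t => Im (f t))).

Lemma goodC_le f h : contC f -> goodR h -> (forall t, Cmod (f t) <= h t) -> goodC f.
Proof.
  intros [H1 H2] Hh H. split; apply goodR_le with h; try assumption; intros t; eapply Rle_trans.
  - apply re_le_Cmod.
  - apply H.
  - apply im_le_Cmod.
  - apply H.
Qed.

Lemma goodC_contC f : goodC f -> contC f.
Proof. intros [[H1 _] [H2 _]]. now split. Qed.

Lemma contC_plus f g : contC f -> contC g -> contC (fun t => f t + g t)%C.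
Proof. intros [A B] [C D]. split; [apply (contR_plus _ _ A C)|apply (contR_plus _ _ B D)]. Qed.

Lemma contR_opp f : contR f -> contR (fun t => - f t).
Proof. intros H t. apply (continuous_opp f), H. Qed.

Lemma contC_mult f g : contC f -> contC g -> contC (fun t => f t * g t)%C.
Proof.
  intros [A B] [C D]. split.
  - apply (contR_plus _ _ (contR_mult _ _ A C) (contR_opp _ (contR_mult _ _ B D))).
  - apply (contR_plus _ _ (contR_mult _ _ A D) (contR_mult _ _ B C)).
Qed.

Lemma contC_const c : contC (fun _ => c).
Proof. split; [exact (contR_const (Re c))|exact (contR_const (Im c))]. Qed.

Lemma contC_RtoC g : contR g -> contC (fun t => RtoC (g t)).
Proof. intros H. split; [exact H|exact (contR_const 0)]. Qed.

Lemma contC_cexp f : contC f -> contC (fun t => cexp (f t)).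
Proof.
  intros [A B].
  assert (E : contR (fun t => exp (Re (f t)))) by (intros t; apply (continuous_comp (fun t => Re (f t)) exp); [apply A|apply continuous_exp]).
  split; apply contR_mult; try exact E; intros t.
  - apply (continuous_comp (fun t => Im (f t)) cos); [apply B|apply continuous_cos].
  - apply (continuous_comp (fun t => Im (f t)) sin); [apply B|apply continuous_sin].
Qed.

Lemma goodC_plus f g : goodC f -> goodC g -> goodC (fun t => f t + g t)%C.
Proof. intros [A B] [C D]. split; [apply (goodR_plus _ _ A C)|apply (goodR_plus _ _ B D)]. Qed.

Lemma goodC_scal c f : goodC f -> goodC (fun t => c * f t)%C.
Proof.
  intros [A B]. split.
  - pose proof (goodR_plus _ _ (goodR_scal (Re c) _ A) (goodR_scal (- Im c) _ B)) as H.
    replace (fun t => Re (c * f t)) with (fun t => Re c * Re (f t) + - Im c * Im (f t)); [exact H|].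
    apply functional_extensionality. intros t. unfold Re, Im; simpl. ring.
  - pose proof (goodR_plus _ _ (goodR_scal (Re c) _ B) (goodR_scal (Im c) _ A)) as H.
    replace (fun t => Im (c * f t)) with (fun t => Re c * Im (f t) + Im c * Re (f t)); [exact H|].
    apply functional_extensionality. intros t. unfold Re, Im; simpl. ring.
Qed.

Lemma goodC_zero : goodC (fun _ => RtoC 0).
Proof.
  assert (H : goodR (fun _ => 0)).
  { split; [apply contR_const|]. exists 0, 1. split; [lra|]. intros t. rewrite Rabs_R0. lra. }
  split; exact H.
Qed.

Lemma goodC_CS (f : nat -> R -> C) n : (forall k, (k < n)%nat -> goodC (f k)) -> goodC (fun t => CS (fun k => f k t) n).
Proof.
  intros H. induction n as [|n IH]; simpl; [apply goodC_zero|].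
  apply goodC_plus; [apply IH; intros; apply H; lia|apply H; lia].
Qed.

Lemma goodC_ext f g : (forall t, f t = g t) -> goodC f -> goodC g.
Proof. intros E H. replace g with f; [exact H|now apply functional_extensionality]. Qed.

Lemma IntC_ext f g : (forall t, f t = g t) -> IntC f = IntC g.
Proof. intros H. f_equal. now apply functional_extensionality. Qed.

Lemma IntC_plus f g : goodC f -> goodC g -> IntC (fun t => f t + g t)%C = (IntC f + IntC g)%C.
Proof. intros [A B] [C D]. apply C_ext; [apply (IntR_plus _ _ A C)|apply (IntR_plus _ _ B D)]. Qed.

Lemma IntC_scal c f : goodC f -> IntC (fun t => c * f t)%C = (c * IntC f)%C.
Proof.
  intros [A B]. apply C_ext; simpl.
  - transitivity (IntR (fun t => Re c * Re (f t) + - Im c * Im (f t))).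
    + apply IntR_ext. intros t. unfold Re, Im; simpl. ring.
    + rewrite IntR_plus, !IntR_scal by (try apply goodR_scal; assumption). unfold Re, Im; simpl. ring.
  - transitivity (IntR (fun t => Re c * Im (f t) + Im c * Re (f t))).
    + apply IntR_ext. intros t. unfold Re, Im; simpl. ring.
    + rewrite IntR_plus, !IntR_scal by (try apply goodR_scal; assumption). unfold Re, Im; simpl. ring.
Qed.

Lemma IntC_zero : IntC (fun _ => RtoC 0) = RtoC 0.
Proof. apply C_ext; simpl; apply IntR_zero. Qed.

Lemma IntC_minus f g : goodC f -> goodC g -> IntC (fun t => f t - g t)%C = (IntC f - IntC g)%C.
Proof.
  intros Hf Hg. transitivity (IntC (fun t => f t + (- (1)) * g t)%C).
  - apply IntC_ext. intros t. ring.
  - rewrite IntC_plus, IntC_scal by (try apply goodC_scal; assumption). ring.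
Qed.

Lemma IntC_CS (f : nat -> R -> C) n : (forall k, (k < n)%nat -> goodC (f k)) ->
  IntC (fun t => CS (fun k => f k t) n) = CS (fun k => IntC (f k)) n.
Proof.
  intros H. induction n as [|n IH].
  - apply IntC_zero.
  - rewrite CS_S, <- IH by (intros; apply H; lia).
    apply (IntC_plus (fun t => CS (fun k => f k t) n)); [apply goodC_CS; intros; apply H; lia|apply H; lia].
Qed.

Lemma IntC_conj f : goodC f -> Cconj (IntC f) = IntC (fun t => Cconj (f t)).
Proof.
  intros [A B]. apply C_ext; simpl; [reflexivity|].
  replace (- IntR (fun t => Im (f t))) with (-1 * IntR (fun t => Im (f t))) by ring.
  rewrite <- IntR_scal by exact B. apply IntR_ext. intros t. unfold Im; simpl. ring.
Qed.

(** Multiplication by the conjugate phase of the integral makes it real and nonnegative, and only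
    real parts have to be compared. *)
Lemma IntC_bound f h : goodC f -> goodR h -> (forall t, Cmod (f t) <= h t) -> Cmod (IntC f) <= IntR h.
Proof.
  intros Hf Hh H. destruct (polar (IntC f)) as [u Hu]. set (m := Cmod (IntC f)) in *.
  assert (E : (Cconj (unit u) * IntC f = RtoC m)%C).
  { rewrite Hu. replace (Cconj (unit u) * (m * unit u))%C with (m * (unit u * Cconj (unit u)))%C by ring.
    rewrite <- Cmod2_conj, Cmod_unit. replace (RtoC (1 ^ 2)) with (RtoC 1) by (f_equal; ring). ring. }
  rewrite <- IntC_scal in E by exact Hf. apply (f_equal fst) in E.
  change (IntR (fun t => Re (Cconj (unit u) * f t)%C) = m) in E. rewrite <- E.
  apply IntR_le; [apply (goodC_scal _ _ Hf)|exact Hh|]. intros t.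
  eapply Rle_trans; [apply RRle_abs|]. eapply Rle_trans; [apply re_le_Cmod|].
  rewrite Cmod_mult, Cmod_conj, Cmod_unit, Rmult_1_l. apply H.
Qed.

Lemma IntC_shift c f : goodC f -> IntC (fun t => f (t + c)) = IntC f.
Proof. intros [A B]. apply C_ext; simpl; [apply (IntR_shift c _ A)|apply (IntR_shift c _ B)]. Qed.

Lemma IntC_opp_arg f : goodC f -> IntC (fun t => f (- t)) = IntC f.
Proof. intros [A B]. apply C_ext; simpl; [apply (IntR_opp_arg _ A)|apply (IntR_opp_arg _ B)]. Qed.

Lemma goodC_shift c f : goodC f -> goodC (fun t => f (t + c)).
Proof. intros [A B]. split; [apply (goodR_shift c _ A)|apply (goodR_shift c _ B)]. Qed.

Lemma goodC_opp_arg f : goodC f -> goodC (fun t => f (- t)).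
Proof. intros [A B]. split; [apply (goodR_opp _ A)|apply (goodR_opp _ B)]. Qed.

Lemma goodC_lin2 a b f g : goodC f -> goodC g -> goodC (fun t => a * f t + b * g t)%C.
Proof. intros Hf Hg. apply (goodC_plus (fun t => a * f t)%C (fun t => b * g t)%C); now apply goodC_scal. Qed.

Lemma goodC_lin3 a b c f g h : goodC f -> goodC g -> goodC h -> goodC (fun t => a * f t + (b * g t + c * h t))%C.
Proof.
  intros Hf Hg Hh. apply (goodC_plus (fun t => a * f t)%C (fun t => b * g t + c * h t)%C);
  [now apply goodC_scal|now apply goodC_lin2].
Qed.

Lemma IntC_lin2 a b f g : goodC f -> goodC g -> IntC (fun t => a * f t + b * g t)%C = (a * IntC f + b * IntC g)%C.
Proof.
  intros Hf Hg. rewrite (IntC_plus (fun t => a * f t)%C (fun t => b * g t)%C) by now apply goodC_scal.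
  rewrite (IntC_scal a f), (IntC_scal b g) by assumption. reflexivity.
Qed.

Lemma IntC_lin3 a b c f g h : goodC f -> goodC g -> goodC h ->
  IntC (fun t => a * f t + (b * g t + c * h t))%C = (a * IntC f + (b * IntC g + c * IntC h))%C.
Proof.
  intros Hf Hg Hh. rewrite (IntC_plus (fun t => a * f t)%C (fun t => b * g t + c * h t)%C);
    [|now apply goodC_scal|now apply goodC_lin2].
  rewrite (IntC_scal a f), (IntC_lin2 b c g h) by assumption. reflexivity.
Qed.

(** The bridge from the [RInt_gen] in the definition of [XiF] to [IntC], where all computations take
    place. *)
Lemma IntC_RInt_gen f : goodC f ->
  RInt_gen (V := C_R_CompleteNormedModule) f (Rbar_locally m_infty) (Rbar_locally p_infty) = IntC f.
Proof.
  intros [A B]. apply is_RInt_gen_unique.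
  destruct (IntR_tail _ A) as [K1 [d1 [Hd1 H1]]]. destruct (IntR_tail _ B) as [K2 [d2 [Hd2 H2]]].
  intros P [e He].
  assert (Hx : exists x, 0 <= x /\ K1 * exp (- d1 * x) < e /\ K2 * exp (- d2 * x) < e).
  { pose proof (is_lim_exp_decay K1 d1 Hd1) as L1. pose proof (is_lim_exp_decay K2 d2 Hd2) as L2.
    apply is_lim_seq_spec in L1, L2. destruct (L1 e) as [N1 h1]. destruct (L2 e) as [N2 h2].
    exists (INR (N1 + N2)). split; [apply pos_INR|].
    specialize (h1 (N1 + N2)%nat ltac:(lia)). specialize (h2 (N1 + N2)%nat ltac:(lia)).
    rewrite Rminus_0_r in h1, h2. split; eapply Rle_lt_trans; try apply RRle_abs; eassumption. }
  destruct Hx as [x [Hx [Hx1 Hx2]]].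
  apply (Filter_prod _ _ _ (fun a => a < - x) (fun b => x < b)).
  - exists (- x). auto.
  - exists x. auto.
  - intros a b Ha Hb.
    exists (RInt (fun t => Re (f t)) a b, RInt (fun t => Im (f t)) a b). split.
    + apply (is_RInt_fct_extend_pair (U := R_NormedModule) (V := R_NormedModule) f).
      * apply (RInt_correct (V := R_CompleteNormedModule)). apply contR_ex_RInt, A.
      * apply (RInt_correct (V := R_CompleteNormedModule)). apply contR_ex_RInt, B.
    + apply He. split; simpl.
      * apply Rle_lt_trans with (K1 * exp (- d1 * x)); [|exact Hx1]. apply H1; lra.
      * apply Rle_lt_trans with (K2 * exp (- d2 * x)); [|exact Hx2]. apply H2; lra.
Qed.

(** * Derivatives of complex-valued functions of a real variable *)

Definition isD (f : R -> C) (x : R) (l : C) : Prop :=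
  is_derive (fun u => Re (f u)) x (Re l) /\ is_derive (fun u => Im (f u)) x (Im l).

Lemma isD_plus f g x a b : isD f x a -> isD g x b -> isD (fun u => f u + g u)%C x (a + b)%C.
Proof.
  intros [A B] [C D]. split; [exact (is_derive_plus _ _ _ _ _ A C)|exact (is_derive_plus _ _ _ _ _ B D)].
Qed.

Lemma is_derive_Rmult (f g : R -> R) (x a b : R) : is_derive f x a -> is_derive g x b ->
  is_derive (fun u => f u * g u) x (a * g x + f x * b).
Proof. intros Hf Hg. exact (is_derive_mult f g x a b Hf Hg Rmult_comm). Qed.

Lemma is_derive_eq (f : R -> R) (x a b : R) : is_derive f x a -> a = b -> is_derive f x b.
Proof. now intros H <-. Qed.

Lemma isD_eq f x a b : isD f x a -> a = b -> isD f x b.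
Proof. now intros H <-. Qed.

Lemma isD_mult f g x a b : isD f x a -> isD g x b -> isD (fun u => f u * g u)%C x (a * g x + f x * b)%C.
Proof.
  intros [A B] [C D]. split.
  - eapply is_derive_eq; [exact (is_derive_minus _ _ _ _ _ (is_derive_Rmult _ _ _ _ _ A C) (is_derive_Rmult _ _ _ _ _ B D))|].
    unfold minus, plus, opp, Re, Im; simpl. ring.
  - eapply is_derive_eq; [exact (is_derive_plus _ _ _ _ _ (is_derive_Rmult _ _ _ _ _ A D) (is_derive_Rmult _ _ _ _ _ B C))|].
    unfold minus, plus, opp, Re, Im; simpl. ring.
Qed.

Lemma isD_const c x : isD (fun _ => c) x (RtoC 0).
Proof. split; exact (is_derive_const _ x). Qed.

Lemma isD_scal c f x a : isD f x a -> isD (fun u => c * f u)%C x (c * a)%C.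
Proof. intros H. eapply isD_eq; [exact (isD_mult _ _ _ _ _ (isD_const c x) H)|]. simpl. ring. Qed.

Lemma isD_RtoC (g : R -> R) x l : is_derive g x l -> isD (fun u => RtoC (g u)) x (RtoC l).
Proof. intros H. split; [exact H|exact (is_derive_const _ x)]. Qed.

Lemma isD_cexp f x a : isD f x a -> isD (fun u => cexp (f u)) x (a * cexp (f x))%C.
Proof.
  intros [A B].
  assert (E : is_derive (fun u => exp (Re (f u))) x (Re a * exp (Re (f x)))).
  { apply (is_derive_comp exp (fun u => Re (f u)) x (exp (Re (f x))) (Re a)); [|exact A]. apply is_derive_Reals, derivable_pt_lim_exp. }
  assert (Co : is_derive (fun u => cos (Im (f u))) x (Im a * - sin (Im (f x)))).
  { apply (is_derive_comp cos (fun u => Im (f u)) x (- sin (Im (f x))) (Im a)); [|exact B]. apply is_derive_Reals, derivable_pt_lim_cos. }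
  assert (Si : is_derive (fun u => sin (Im (f u))) x (Im a * cos (Im (f x)))).
  { apply (is_derive_comp sin (fun u => Im (f u)) x (cos (Im (f x))) (Im a)); [|exact B]. apply is_derive_Reals, derivable_pt_lim_sin. }
  split.
  - eapply is_derive_eq; [exact (is_derive_Rmult _ _ _ _ _ E Co)|]. unfold cexp, Re, Im; simpl. ring.
  - eapply is_derive_eq; [exact (is_derive_Rmult _ _ _ _ _ E Si)|]. unfold cexp, Re, Im; simpl. ring.
Qed.

Lemma isD_ext f g x a : (forall u, f u = g u) -> isD f x a -> isD g x a.
Proof. intros E H. replace g with f; [exact H|now apply functional_extensionality]. Qed.

Lemma isD_CS (f : nat -> R -> C) (d : nat -> C) x n : (forall k, isD (f k) x (d k)) -> isD (fun u => CS (fun k => f k u) n) x (CS d n).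
Proof. intros H. induction n as [|n IH]; simpl; [apply isD_const|now apply isD_plus]. Qed.

(** A quadratic remainder is the shape in which integrals depending on a parameter deliver their
    differentiability. *)
Lemma isD_quadratic f x l K d : 0 < d ->
  (forall h, Rabs h <= d -> Cmod (f (x + h) - f x - RtoC h * l) <= K * h ^ 2) -> isD f x l.
Proof.
  intros Hd H.
  assert (A : forall (g : R -> R) m, (forall h, Rabs h <= d -> Rabs (g (x + h) - g x - h * m) <= K * h ^ 2) -> is_derive g x m).
  { intros g m Hg. apply is_derive_Reals. intros e He.
    assert (HK : 0 <= K).
    { specialize (Hg d). rewrite Rabs_pos_eq in Hg by lra. specialize (Hg (Rle_refl _)).
      pose proof (Rabs_pos (g (x + d) - g x - d * m)). assert (0 < d ^ 2) by (apply pow_lt; lra). nra. }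
    assert (Hm : 0 < Rmin d (e / (K + 1))) by (apply Rmin_glb_lt; [exact Hd|apply Rdiv_lt_0_compat; lra]).
    exists (mkposreal _ Hm). intros h Hh Hhm.
    assert (h1 : Rabs h < d) by (eapply Rlt_le_trans; [exact Hhm|apply Rmin_l]).
    assert (h2 : Rabs h < e / (K + 1)) by (eapply Rlt_le_trans; [exact Hhm|apply Rmin_r]).
    replace ((g (x + h) - g x) / h - m) with ((g (x + h) - g x - h * m) / h) by (field; exact Hh).
    assert (hp : 0 < Rabs h) by now apply Rabs_pos_lt.
    unfold Rdiv. rewrite Rabs_mult, Rabs_inv.
    specialize (Hg h (Rlt_le _ _ h1)). rewrite <- pow2_abs in Hg.
    apply Rle_lt_trans with (K * Rabs h).
    - apply Rmult_le_reg_r with (Rabs h); [exact hp|]. rewrite Rmult_assoc, Rinv_l, Rmult_1_r by lra. nra.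
    - assert ((K + 1) * Rabs h < e).
      { apply Rlt_le_trans with ((K + 1) * (e / (K + 1))); [apply Rmult_lt_compat_l; lra|]. right. field. lra. }
      nra. }
  split; apply A; intros h Hh; (eapply Rle_trans; [|apply (H h Hh)]).
  - eapply Rle_trans; [|apply re_le_Cmod]. right. f_equal. unfold Re; simpl. ring.
  - eapply Rle_trans; [|apply im_le_Cmod]. right. f_equal. unfold Im; simpl. ring.
Qed.

(** A mean value inequality with a majorant: after rotating [f b - f a] onto the positive axis by
    [c], the function [H - Re (c f)] is nondecreasing. *)
Lemma isD_mean_value f f' (H h : R -> R) a b : a <= b ->
  (forall u, a <= u <= b -> isD f u (f' u)) -> (forall u, a <= u <= b -> is_derive H u (h u)) ->
  (forall u, a <= u <= b -> Cmod (f' u) <= h u) -> Cmod (f b - f a) <= H b - H a.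
Proof.
  intros Hab Hf HH Hle. destruct (polar (f b - f a)) as [t Ht]. set (m := Cmod (f b - f a)) in *.
  set (c := Cconj (unit t)).
  assert (E : (c * (f b - f a) = RtoC m)%C).
  { rewrite Ht. unfold c. replace (Cconj (unit t) * (m * unit t))%C with (m * (unit t * Cconj (unit t)))%C by ring.
    rewrite <- Cmod2_conj, Cmod_unit. replace (RtoC (1 ^ 2)) with (RtoC 1) by (f_equal; ring). ring. }
  set (g := fun u => H u - Re (c * f u)).
  assert (Hg : forall u, a <= u <= b -> is_derive g u (h u - Re (c * f' u))).
  { intros u Hu. exact (is_derive_minus _ _ _ _ _ (HH u Hu) (proj1 (isD_scal c f u _ (Hf u Hu)))). }
  assert (Hm : g a <= g b).
  { destruct (MVT_gen g a b (fun u => h u - Re (c * f' u))) as [u [Hu Eu]].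
    - intros u Hu. rewrite Rmin_left, Rmax_right in Hu by exact Hab. apply Hg. lra.
    - intros u Hu. rewrite Rmin_left, Rmax_right in Hu by exact Hab.
      apply derivable_continuous_pt. exists (h u - Re (c * f' u)). apply is_derive_Reals, Hg, Hu.
    - rewrite Rmin_left, Rmax_right in Hu by exact Hab.
      assert (Re (c * f' u) <= h u).
      { eapply Rle_trans; [apply RRle_abs|]. eapply Rle_trans; [apply re_le_Cmod|].
        rewrite Cmod_mult. unfold c. rewrite Cmod_conj, Cmod_unit, Rmult_1_l. now apply Hle. }
      nra. }
  apply (f_equal Re) in E. unfold g in Hm.
  replace (c * (f b - f a))%C with (c * f b - c * f a)%C in E by ring.
  change (Re (c * f b) - Re (c * f a) = m) in E. lra.
Qed.

Lemma isD_zero_const f a b : a <= b -> (forall u, a <= u <= b -> isD f u (RtoC 0)) -> f b = f a.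
Proof.
  intros Hab H. apply Csub_eq_0, Cmod_le_0.
  eapply Rle_trans.
  - apply (isD_mean_value f (fun _ => RtoC 0) (fun _ => 0) (fun _ => 0) a b Hab H).
    + intros u _. exact (is_derive_const 0 u).
    + intros u _. rewrite Cmod_0. lra.
  - lra.
Qed.

Lemma IntC_derive F f : (forall t, isD F t (f t)) -> contC f -> expdecay (fun t => Cmod (F t)) -> IntC f = RtoC 0.
Proof.
  intros HF [A B] [K [d [Hd HD]]]. apply C_ext; simpl.
  - apply (IntR_derive (fun t => Re (F t))); [intros t; apply HF|exact A|].
    exists K, d. split; [exact Hd|]. intros t. eapply Rle_trans; [apply re_le_Cmod|].
    eapply Rle_trans; [|apply HD]. apply RRle_abs.
  - apply (IntR_derive (fun t => Im (F t))); [intros t; apply HF|exact B|].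
    exists K, d. split; [exact Hd|]. intros t. eapply Rle_trans; [apply im_le_Cmod|].
    eapply Rle_trans; [|apply HD]. apply RRle_abs.
Qed.

(** * Taylor remainders of the exponential *)

Definition expT (n : nat) (z : C) : C := CS (fun k => RtoC (/ INR (fact k)) * z ^ k)%C n.

Lemma is_derive_pow_scal c k v : is_derive (fun v => v ^ S k * c) v (INR (S k) * v ^ k * c).
Proof.
  apply (is_derive_ext (fun v => c * v ^ S k)); [intros; apply Rmult_comm|].
  eapply is_derive_eq.
  - apply (is_derive_scal (fun v => v ^ S k) v c (INR (S k) * v ^ pred (S k))).
    apply is_derive_Reals, derivable_pt_lim_pow.
  - change (c * (INR (S k) * v ^ k) = INR (S k) * v ^ k * c). ring.
Qed.

(** Induction on [n] along the segment [u z]: the derivative in [u] of one remainder is [z] times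
    the preceding remainder. The bound [M] for the exponential on the segment allows [exp |z|] in
    general and 1 when [Re z <= 0]. *)
Lemma cexp_taylor z M n : (forall u, 0 <= u <= 1 -> exp (u * Re z) <= M) ->
  Cmod (cexp z - expT n z) <= Cmod z ^ n / INR (fact n) * M.
Proof.
  intros HM.
  assert (HT : forall n u, 0 <= u <= 1 ->
     Cmod (cexp (RtoC u * z) - CS (fun k => RtoC (u ^ k / INR (fact k)) * z ^ k)%C n) <= Cmod z ^ n / INR (fact n) * M * u ^ n).
  { clear n. induction n as [|n IH]; intros u Hu.
    - simpl. replace (cexp (u * z) - 0)%C with (cexp (RtoC u * z)) by ring. rewrite Cmod_cexp.
      replace (Re (u * z)) with (u * Re z) by (unfold Re; simpl; ring).
      specialize (HM u Hu). lra.
    - set (f := fun v => (cexp (RtoC v * z) - CS (fun k => RtoC (v ^ k / INR (fact k)) * z ^ k) (S n))%C).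
      set (f' := fun v => (z * (cexp (RtoC v * z) - CS (fun k => RtoC (v ^ k / INR (fact k)) * z ^ k) n))%C).
      assert (Hf : forall v, isD f v (f' v)).
      { intros v.
        assert (HDe : isD (fun v => cexp (RtoC v * z)) v (z * cexp (RtoC v * z))%C).
        { apply (isD_cexp (fun v => RtoC v * z)%C). eapply isD_eq.
          - apply (isD_mult (fun v => RtoC v) (fun _ => z)); [apply (isD_RtoC (fun v => v)), (is_derive_id v)|apply isD_const].
          - unfold one; simpl. ring. }
        assert (HDs : isD (fun v => CS (fun k => RtoC (v ^ k / INR (fact k)) * z ^ k)%C (S n)) v
             (z * CS (fun k => RtoC (v ^ k / INR (fact k)) * z ^ k) n)%C).
        { apply (isD_ext (fun v => RtoC 1 + CS (fun k => RtoC (v ^ S k / INR (fact (S k))) * z ^ S k) n)%C).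
          - intros w. rewrite CS_shift. f_equal. simpl. replace (1 / 1) with 1 by field. ring.
          - eapply isD_eq.
            + apply isD_plus; [apply isD_const|].
              apply (isD_CS (fun k v => RtoC (v ^ S k / INR (fact (S k))) * z ^ S k)%C
                 (fun k => z * (RtoC (v ^ k / INR (fact k)) * z ^ k))%C).
              intros k. eapply isD_eq.
              * apply (isD_mult (fun v => RtoC (v ^ S k / INR (fact (S k)))) (fun _ => z ^ S k)%C); [|apply isD_const].
                apply isD_RtoC. exact (is_derive_pow_scal _ k v).
              * rewrite Cpow_S. replace (INR (S k) * v ^ k * / INR (fact (S k))) with (v ^ k / INR (fact k)); [ring|].
                rewrite fact_simpl, mult_INR. field. split; [apply INR_fact_neq_0|apply not_0_INR; lia].
            + rewrite CS_scal. ring. }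
        apply (isD_ext (fun v => cexp (RtoC v * z) + (- (1)) * CS (fun k => RtoC (v ^ k / INR (fact k)) * z ^ k) (S n))%C).
        - intros w. unfold f. ring.
        - eapply isD_eq; [apply isD_plus; [exact HDe|apply isD_scal; exact HDs]|]. unfold f'. ring. }
      assert (H0 : f 0 = RtoC 0).
      { unfold f. rewrite CS_shift, CS_zero.
        - replace (RtoC 0 * z)%C with (RtoC 0) by ring. rewrite cexp_0. simpl. replace (1 / 1) with 1 by field. ring.
        - intros k _. simpl. replace (0 * 0 ^ k / INR (fact k + k * fact k)) with 0 by (unfold Rdiv; ring). ring. }
      replace (cexp (u * z) - CS (fun k => RtoC (u ^ k / INR (fact k)) * z ^ k) (S n))%C with (f u - f 0)%C by (rewrite H0; unfold f; ring).
      eapply Rle_trans.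
      + apply (isD_mean_value f f' (fun v => Cmod z ^ S n / INR (fact (S n)) * M * v ^ S n)
            (fun v => Cmod z * (Cmod z ^ n / INR (fact n) * M * v ^ n)) 0 u); [lra|intros; apply Hf| |].
        * intros v _. apply (is_derive_ext (fun v => v ^ S n * (Cmod z ^ S n / INR (fact (S n)) * M))); [intros; apply Rmult_comm|].
          eapply is_derive_eq; [apply is_derive_pow_scal|]. rewrite fact_simpl, mult_INR.
          simpl pow. field. split; [apply INR_fact_neq_0|apply not_0_INR; lia].
        * intros v Hv. unfold f'. rewrite Cmod_mult. apply Rmult_le_compat_l; [apply Cmod_ge_0|]. apply IH. lra.
      + simpl pow. lra. }
  specialize (HT n 1 ltac:(lra)). rewrite pow1, Rmult_1_r in HT.
  replace (cexp z - expT n z)%C with (cexp (RtoC 1 * z) - CS (fun k => RtoC (1 ^ k / INR (fact k)) * z ^ k) n)%C; [exact HT|].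
  replace (RtoC 1 * z)%C with z by ring. f_equal. apply CS_ext. intros k _. rewrite pow1.
  unfold Rdiv. now rewrite Rmult_1_l.
Qed.

Lemma cexp_taylor_abs z n : Cmod (cexp z - expT n z) <= Cmod z ^ n / INR (fact n) * exp (Cmod z).
Proof.
  apply cexp_taylor. intros u Hu. apply exp_mono. pose proof (re_le_Cmod z). pose proof (RRle_abs (Re z)).
  pose proof (Cmod_ge_0 z). nra.
Qed.

Lemma cexp_taylor_neg z n : Re z <= 0 -> Cmod (cexp z - expT n z) <= Cmod z ^ n / INR (fact n).
Proof.
  intros Hz. rewrite <- Rmult_1_r. apply cexp_taylor. intros u Hu. rewrite <- exp_0. apply exp_mono. nra.
Qed.

Lemma exp_partial_sum n : forall y, 0 <= y -> RS (fun k => y ^ k / INR (fact k)) n <= exp y.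
Proof.
  induction n as [|n IH]; intros y Hy; [simpl; left; apply exp_pos|].
    assert (HE : forall v, is_derive (fun v => exp v - RS (fun k => v ^ k / INR (fact k)) (S n)) v
       (exp v - RS (fun k => v ^ k / INR (fact k)) n)).
    { intros v. apply (is_derive_minus exp (fun v => RS (fun k => v ^ k / INR (fact k)) (S n))).
      - apply is_derive_Reals, derivable_pt_lim_exp.
      - clear. induction n as [|n IH].
        + eapply is_derive_eq; [apply (is_derive_const (0 + 1 / 1))|]. reflexivity.
        + eapply is_derive_eq.
          * apply (is_derive_plus (fun v => RS (fun k => v ^ k / INR (fact k)) (S n)) (fun v => v ^ S n / INR (fact (S n)))); [exact IH|].
            exact (is_derive_pow_scal _ n v).
          * rewrite RS_S. apply (f_equal2 Rplus); [reflexivity|].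
            rewrite fact_simpl, mult_INR. field. split; [apply INR_fact_neq_0|apply not_0_INR; lia]. }
    destruct (MVT_gen (fun v => exp v - RS (fun k => v ^ k / INR (fact k)) (S n)) 0 y
        (fun v => exp v - RS (fun k => v ^ k / INR (fact k)) n)) as [u [Hu Eu]].
    - intros u _. apply HE.
    - intros u _. apply derivable_continuous_pt. eexists. apply is_derive_Reals, HE.
    - rewrite Rmin_left, Rmax_right in Hu by exact Hy. specialize (IH u ltac:(lra)).
      assert (E0 : RS (fun k => 0 ^ k / INR (fact k)) (S n) = 1).
      { clear. induction n as [|n IH]; [simpl; field|]. rewrite RS_S, IH. simpl. unfold Rdiv. ring. }
      rewrite E0, exp_0 in Eu. nra.
Qed.

Lemma pow_fact_le_exp x n : 0 <= x -> x ^ n / INR (fact n) <= exp x.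
Proof.
  intros Hx. eapply Rle_trans; [|apply (exp_partial_sum (S n) x Hx)]. rewrite RS_S.
  assert (0 <= RS (fun k => x ^ k / INR (fact k)) n).
  { apply RS_nonneg. intros k _. apply Rmult_le_pos; [now apply pow_le|left; apply Rinv_0_lt_compat, INR_fact_lt_0]. }
  lra.
Qed.

(** * Bessel-type integrals *)

(** The modulus of the kernel [ker]. For [a, b > 0] the integral of [ker a b s] is the Macdonald
    function [2 (b / a)^(s/2) K_s(2 sqrt (a b))]; for [b = 0] and [Re s > 0] it is
    [a^(-s) Gamma(s)]. *)
Definition kerR (a b c t : R) : R := exp (- a * exp t - b * exp (- t) + c * t).
Definition ker (a b : R) (s : C) (t : R) : C := cexp (RtoC (- a * exp t - b * exp (- t)) + s * RtoC t)%C.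

(** From [e^t >= t^2 / 2] for [t >= 0] by completing the square; the rate [d] is free. *)
Lemma exp_quad a c d t : 0 < a -> 0 <= t -> - a * exp t + c * t <= (c + d) ^ 2 / (2 * a) - d * t.
Proof.
  intros Ha Ht. pose proof (pow_fact_le_exp t 2 Ht) as H. simpl in H.
  assert (E : (c + d) ^ 2 / (2 * a) - (c + d) * t + a * (t ^ 2 / 2) = a / 2 * (t - (c + d) / a) ^ 2) by (field; lra).
  assert (0 <= a / 2 * (t - (c + d) / a) ^ 2) by (apply Rmult_le_pos; [lra|apply pow2_ge_0]).
  assert (a * (t ^ 2 / 2) <= a * exp t) by (apply Rmult_le_compat_l; lra). lra.
Qed.

Lemma contR_kerR a b c : contR (kerR a b c).
Proof. apply contR_derive. intros t. unfold kerR. auto_derive. trivial. Qed.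

Lemma kerR_pos a b c t : 0 < kerR a b c t.
Proof. apply exp_pos. Qed.

(* Super-exponential decay: with [b > 0] any rate [d] is available. *)
Lemma kerR_decay a b c d : 0 < a -> 0 < b -> exists B, 0 < B /\ forall t, kerR a b c t <= B * exp (- d * Rabs t).
Proof.
  intros Ha Hb. exists (exp ((c + d) ^ 2 / (2 * a)) + exp ((- c + d) ^ 2 / (2 * b))).
  pose proof (exp_pos ((c + d) ^ 2 / (2 * a))). pose proof (exp_pos ((- c + d) ^ 2 / (2 * b))).
  split; [lra|]. intros t. pose proof (exp_pos (- d * Rabs t)).
  destruct (Rle_lt_dec 0 t) as [h|h].
  - rewrite Rabs_pos_eq in * by exact h. apply Rle_trans with (exp ((c + d) ^ 2 / (2 * a)) * exp (- d * t)).
    + rewrite <- exp_plus. apply exp_mono. pose proof (exp_quad a c d t Ha h). pose proof (exp_pos (- t)). nra.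
    + nra.
  - rewrite Rabs_left in * by exact h. apply Rle_trans with (exp ((- c + d) ^ 2 / (2 * b)) * exp (- d * - t)).
    + rewrite <- exp_plus. apply exp_mono. pose proof (exp_quad b (- c) d (- t) Hb ltac:(lra)). pose proof (exp_pos t). nra.
    + nra.
Qed.

(** Integrability of the kernel: at minus infinity the decay comes from [b > 0] or, for the Gamma
    integral with [b = 0], from [e^(c t)] with [c > 0]. *)
Definition kcond (a b c : R) : Prop := 0 < a /\ (0 < b \/ (0 <= b /\ 0 < c)).

Lemma goodR_kerR a b c : kcond a b c -> goodR (kerR a b c).
Proof.
  intros [Ha Hb]. split; [apply contR_kerR|]. destruct Hb as [Hb|[Hb Hc]].
  - destruct (kerR_decay a b c 1 Ha Hb) as [B [_ H]]. exists B, 1. split; [lra|]. intros t.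
    rewrite Rabs_pos_eq by (left; apply kerR_pos). apply H.
  - exists (1 + exp ((c + c) ^ 2 / (2 * a))), c. split; [exact Hc|]. intros t.
    rewrite Rabs_pos_eq by (left; apply kerR_pos). pose proof (exp_pos ((c + c) ^ 2 / (2 * a))).
    pose proof (exp_pos (- c * Rabs t)). pose proof (exp_pos t). pose proof (exp_pos (- t)).
    destruct (Rle_lt_dec 0 t) as [h|h].
    + rewrite Rabs_pos_eq in * by exact h. apply Rle_trans with (exp ((c + c) ^ 2 / (2 * a)) * exp (- c * t)); [|nra].
      rewrite <- exp_plus. apply exp_mono. pose proof (exp_quad a c c t Ha h). nra.
    + rewrite Rabs_left in * by exact h. apply Rle_trans with (1 * exp (- c * - t)); [|nra].
      rewrite Rmult_1_l. apply exp_mono. nra.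
Qed.

Lemma Cmod_ker a b s t : Cmod (ker a b s t) = kerR a b (Re s) t.
Proof. unfold ker, kerR. rewrite Cmod_cexp. f_equal. unfold Re; simpl. ring. Qed.

Lemma contC_ker a b s : contC (ker a b s).
Proof.
  apply contC_cexp. apply contC_plus.
  - apply contC_RtoC. apply contR_derive. intros t. auto_derive. trivial.
  - apply contC_mult; [apply contC_const|]. apply contC_RtoC. apply contR_derive. intros t. auto_derive. trivial.
Qed.

Lemma goodC_ker a b s : kcond a b (Re s) -> goodC (ker a b s).
Proof.
  intros H. apply goodC_le with (kerR a b (Re s)); [apply contC_ker|now apply goodR_kerR|].
  intros t. rewrite Cmod_ker. lra.
Qed.

Lemma ker_shift_s a b s c t : (cexp (RtoC (c * t)) * ker a b s t)%C = ker a b (s + RtoC c)%C t.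
Proof. unfold ker. rewrite <- cexp_plus. f_equal. rewrite RtoC_mult. ring. Qed.

Lemma isD_ker a b s t : isD (ker a b s) t (s * ker a b s t - (RtoC a * ker a b (s + RtoC 1) t - RtoC b * ker a b (s + RtoC (-1)) t))%C.
Proof.
  eapply isD_eq.
  - apply (isD_cexp (fun t => RtoC (- a * exp t - b * exp (- t)) + s * RtoC t)%C).
    apply isD_plus; [apply isD_RtoC|apply isD_scal, isD_RtoC].
    + auto_derive; [trivial|reflexivity].
    + apply (is_derive_id t).
  - rewrite <- !ker_shift_s, !cexp_R. fold (ker a b s t).
    replace (1 * t) with t by ring. replace (-1 * t) with (- t) by ring. unfold one; simpl.
    replace (1 * (- a * exp t) - -1 * exp (- t) * b) with (- a * exp t + b * exp (- t)) by ring.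
    rewrite ?RtoC_plus, ?RtoC_minus, ?RtoC_mult, ?RtoC_opp, ?RtoC_mult.
    apply C_ext; simpl; ring.
Qed.

Lemma goodR_Cmod_ker a b s : kcond a b (Re s) -> goodR (fun t => Cmod (ker a b s t)).
Proof.
  intros H. replace (fun t => Cmod (ker a b s t)) with (kerR a b (Re s)); [now apply goodR_kerR|].
  apply functional_extensionality. intros t. now rewrite Cmod_ker.
Qed.

Definition X (s : C) (x : R) : C := IntC (ker 1 x s).
Definition XR (c x : R) : R := IntR (kerR 1 x c).

Lemma kcond_pos x c : 0 < x -> kcond 1 x c.
Proof. intros H. split; [lra|now left]. Qed.

Lemma kcond_0 c : 0 < c -> kcond 1 0 c.
Proof. intros H. split; [lra|right; lra]. Qed.

(** The derivative of the kernel integrates to zero, which is the three-term recurrence of the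
    Bessel function. The same computation at [x = 0] gives the functional equation of Gamma. *)
Lemma X_rec s x : 0 < x -> (s * X s x = X (s + RtoC 1) x - RtoC x * X (s + RtoC (-1)) x)%C.
Proof.
  intros Hx. assert (G : forall s, goodC (ker 1 x s)) by (intros; apply goodC_ker, kcond_pos, Hx).
  set (k1 := ker 1 x (s + RtoC 1)). set (k2 := ker 1 x (s + RtoC (-1))). set (k0 := ker 1 x s).
  assert (D : forall t, isD k0 t (s * k0 t + (RtoC (-1) * k1 t + RtoC x * k2 t))%C).
  { intros t. eapply isD_eq; [apply isD_ker|]. fold k0 k1 k2. ring. }
  pose proof (IntC_derive k0 (fun t => s * k0 t + (RtoC (-1) * k1 t + RtoC x * k2 t))%C D) as H.
  rewrite (IntC_lin3 s (RtoC (-1)) (RtoC x) k0 k1 k2) in H by apply G.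
  change (X s x) with (IntC k0). change (X (s + RtoC 1) x) with (IntC k1). change (X (s + RtoC (-1)) x) with (IntC k2).
  apply Csub_eq_0. rewrite <- H.
  - ring.
  - apply goodC_contC, goodC_lin3; apply G.
  - apply goodR_Cmod_ker, kcond_pos, Hx.
Qed.

Lemma X_rec0 s : 0 < Re s -> (s * X s 0 = X (s + RtoC 1) 0)%C.
Proof.
  intros Hs.
  set (k0 := ker 1 0 s). set (k1 := ker 1 0 (s + RtoC 1)).
  assert (G : goodC k0) by now apply goodC_ker, kcond_0.
  assert (G1 : goodC k1) by (apply goodC_ker, kcond_0; unfold Re in *; simpl; lra).
  assert (D : forall t, isD k0 t (s * k0 t + RtoC (-1) * k1 t)%C).
  { intros t. eapply isD_eq; [apply isD_ker|]. fold k0 k1. ring. }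
  pose proof (IntC_derive k0 (fun t => s * k0 t + RtoC (-1) * k1 t)%C D) as H.
  rewrite (IntC_lin2 s (RtoC (-1)) k0 k1) in H by assumption.
  change (X s 0) with (IntC k0). change (X (s + RtoC 1) 0) with (IntC k1).
  apply Csub_eq_0. rewrite <- H.
  - ring.
  - now apply goodC_contC, goodC_lin2.
  - now apply goodR_Cmod_ker, kcond_0.
Qed.

Definition Rcpow (x : R) (s : C) : C := cexp (s * RtoC (ln x))%C.

Lemma Rcpow_plus x s w : Rcpow x (s + w)%C = (Rcpow x s * Rcpow x w)%C.
Proof. unfold Rcpow. rewrite <- cexp_plus. f_equal. ring. Qed.

Lemma Rcpow_opp x s : Rcpow x (- s)%C = (/ Rcpow x s)%C.
Proof. unfold Rcpow. rewrite <- cexp_opp. f_equal. ring. Qed.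

Lemma Cmod_Rcpow x s : Cmod (Rcpow x s) = exp (Re s * ln x).
Proof. unfold Rcpow. rewrite Cmod_cexp. f_equal. unfold Re; simpl. ring. Qed.

Lemma Rcpow_neq_0 x s : Rcpow x s <> RtoC 0.
Proof. apply cexp_neq_0. Qed.

Lemma Rcpow_R x c : 0 < x -> Rcpow x (RtoC c) = RtoC (exp (c * ln x)).
Proof. intros H. unfold Rcpow. rewrite <- RtoC_mult. apply cexp_R. Qed.

Lemma Rcpow_mult x y s : 0 < x -> 0 < y -> Rcpow (x * y) s = (Rcpow x s * Rcpow y s)%C.
Proof. intros Hx Hy. unfold Rcpow. rewrite <- cexp_plus, ln_mult by assumption. f_equal. rewrite RtoC_plus. ring. Qed.

Lemma Rcpow_conj x s : Cconj (Rcpow x s) = Rcpow x (Cconj s).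
Proof. unfold Rcpow. rewrite cexp_conj. f_equal. apply C_ext; simpl; ring. Qed.

(** Translating [t] by [ln a] normalizes the first parameter to 1 and moves it into the product
    [a b]. *)
Lemma IntC_ker_scale a b s : 0 < a -> kcond a b (Re s) -> IntC (ker a b s) = (Rcpow a (- s) * X s (a * b))%C.
Proof.
  intros Ha H.
  assert (G : goodC (ker 1 (a * b) s)).
  { apply goodC_ker. destruct H as [_ [H|[H1 H2]]]; split; try lra; [left|right]; nra. }
  unfold X. rewrite <- (IntC_shift (ln a) (ker 1 (a * b) s)) by exact G.
  rewrite <- (IntC_scal (Rcpow a (- s)) (fun t => ker 1 (a * b) s (t + ln a))) by now apply goodC_shift.
  apply IntC_ext. intros t. unfold Rcpow, ker. rewrite <- cexp_plus. f_equal.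
  replace (- (t + ln a)) with (- t + - ln a) by ring.
  rewrite !exp_plus, (exp_Ropp (ln a)), (exp_ln a) by exact Ha.
  replace (- (1) * (exp t * a) - a * b * (exp (- t) * / a)) with (- a * exp t - b * exp (- t)) by (field; lra).
  rewrite RtoC_plus. ring.
Qed.

(** The substitution [t -> ln x - t] exchanges [e^t] with [x e^(-t)]; this is the symmetry
    [K_s = K_(-s)]. *)
Lemma X_reflect s x : 0 < x -> X s x = (Rcpow x s * X (- s) x)%C.
Proof.
  intros Hx. assert (G : forall s, goodC (ker 1 x s)) by (intros; apply goodC_ker, kcond_pos, Hx).
  unfold X. rewrite <- (IntC_opp_arg (ker 1 x s)) by apply G.
  rewrite <- (IntC_shift (- ln x) (fun t => ker 1 x s (- t))) by (apply goodC_opp_arg, G).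
  rewrite <- (IntC_scal (Rcpow x s) (ker 1 x (- s))) by apply G. apply IntC_ext. intros t.
  unfold ker, Rcpow. rewrite <- cexp_plus. f_equal.
  replace (- (t + - ln x)) with (- t + ln x) by ring.
  replace (- (- t + ln x)) with (t + - ln x) by ring.
  rewrite !exp_plus, (exp_Ropp (ln x)), exp_ln by exact Hx.
  replace (- (1) * (exp (- t) * x) - x * (exp t * / x)) with (- (1) * exp t - x * exp (- t)) by (field; lra).
  rewrite RtoC_plus, RtoC_opp. ring.
Qed.

Lemma ker_conj a b s t : Cconj (ker a b s t) = ker a b (Cconj s) t.
Proof. unfold ker. rewrite cexp_conj. f_equal. apply C_ext; simpl; ring. Qed.

Lemma X_conj s x : kcond 1 x (Re s) -> Cconj (X s x) = X (Cconj s) x.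
Proof.
  intros H. unfold X. rewrite IntC_conj by now apply goodC_ker. apply IntC_ext. intros t. apply ker_conj.
Qed.

Lemma XR_pos c x : kcond 1 x c -> 0 < XR c x.
Proof. intros H. apply IntR_pos; [now apply goodR_kerR|]. intros t. apply kerR_pos. Qed.

Lemma X_real c x : X (RtoC c) x = RtoC (XR c x).
Proof.
  apply C_ext; simpl.
  - apply IntR_ext. intros t. unfold ker, cexp, kerR, Re; simpl.
    replace (0 + (c * 0 + 0 * t)) with 0 by ring. rewrite cos_0, Rmult_1_r. f_equal. ring.
  - transitivity (IntR (fun _ => 0)); [|apply IntR_zero]. apply IntR_ext. intros t.
    replace (0 + (c * 0 + 0 * t)) with 0 by ring. rewrite sin_0. ring.
Qed.

(** Differentiation under the integral when the parameter enters as [exp (- y p)]: the Taylor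
    remainder of order two is at most [u^2 p^2 exp (d p)], whence the majorant taken at [x - d]. It
    serves both [X_derive] and [J_derive]. *)
Lemma IntC_param (q : R -> C) (p : R -> R) x d : 0 < d -> contC q -> contR p -> (forall t, 0 <= p t) ->
  goodR (fun t => Cmod (q t) * (p t) ^ 2 * exp (- (x - d) * p t)) ->
  (forall y, Rabs (y - x) <= d -> goodC (fun t => q t * RtoC (exp (- y * p t)))%C) ->
  goodC (fun t => RtoC (p t) * (q t * RtoC (exp (- x * p t))))%C ->
  isD (fun y => IntC (fun t => q t * RtoC (exp (- y * p t)))%C) x
      (- IntC (fun t => RtoC (p t) * (q t * RtoC (exp (- x * p t)))))%C.
Proof.
  intros Hd Hq Hp Hp0 Hh Hg1 Hg2.
  set (h := fun t => Cmod (q t) * (p t) ^ 2 * exp (- (x - d) * p t)) in *.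
  apply isD_quadratic with (IntR h) d; [exact Hd|]. intros u Hu.
  assert (G1 : goodC (fun t => q t * RtoC (exp (- (x + u) * p t)))%C) by (apply Hg1; replace (x + u - x) with u by ring; exact Hu).
  assert (G0 : goodC (fun t => q t * RtoC (exp (- x * p t)))%C) by (apply Hg1; replace (x - x) with 0 by ring; rewrite Rabs_R0; lra).
  set (f1 := fun t => (q t * RtoC (exp (- (x + u) * p t)))%C) in *.
  set (f0 := fun t => (q t * RtoC (exp (- x * p t)))%C) in *.
  set (f2 := fun t => (RtoC (p t) * (q t * RtoC (exp (- x * p t))))%C) in *.
  replace (IntC f1 - IntC f0 - RtoC u * - IntC f2)%C with (RtoC 1 * IntC f1 + (RtoC (-1) * IntC f0 + RtoC u * IntC f2))%C by ring.
  rewrite <- (IntC_lin3 (RtoC 1) (RtoC (-1)) (RtoC u) f1 f0 f2) by assumption.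
  rewrite Rmult_comm, <- (IntR_scal (u ^ 2) h) by exact Hh.
  apply IntC_bound.
  - now apply goodC_lin3.
  - now apply goodR_scal.
  - intros t.
    replace (RtoC 1 * f1 t + (RtoC (-1) * f0 t + RtoC u * f2 t))%C
      with (q t * RtoC (exp (- x * p t)) * (cexp (RtoC (- u * p t)) - expT 2 (RtoC (- u * p t))))%C.
    2:{ unfold f1, f0, f2. rewrite cexp_R. unfold expT; simpl. replace (- (x + u) * p t) with (- x * p t + - u * p t) by ring.
        rewrite exp_plus, !RtoC_mult, RtoC_opp. replace (/ 1) with 1 by field.
        rewrite !Cmult_1_r, ?Cmult_1_l. ring. }
    rewrite !Cmod_mult, (Cmod_RtoC_pos (exp (- x * p t))) by (left; apply exp_pos).
    unfold h.
    pose proof (cexp_taylor_abs (RtoC (- u * p t)) 2) as T. rewrite Cmod_R in T. simpl in T.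
    assert (Hup : Rabs (- u * p t) <= d * p t).
    { rewrite Rabs_mult, Rabs_Ropp, (Rabs_pos_eq (p t)) by apply Hp0. apply Rmult_le_compat_r; [apply Hp0|exact Hu]. }
    assert (Hsq : Rabs (- u * p t) * (Rabs (- u * p t) * 1) = u ^ 2 * p t ^ 2).
    { replace (Rabs (- u * p t) * (Rabs (- u * p t) * 1)) with (Rabs (- u * p t) ^ 2) by ring. rewrite pow2_abs. ring. }
    rewrite Hsq in T. replace (1 + 1) with 2 in T by ring.
    assert (HT : Cmod (cexp (RtoC (- u * p t)) - expT 2 (RtoC (- u * p t))) <= u ^ 2 * p t ^ 2 * exp (d * p t)).
    { eapply Rle_trans; [exact T|].
      pose proof (exp_mono _ _ Hup). pose proof (exp_pos (Rabs (- u * p t))).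
      apply Rmult_le_compat; try lra; nra. }
    replace (- (x - d) * p t) with (- x * p t + d * p t) by ring. rewrite exp_plus.
    replace (u ^ 2 * (Cmod (q t) * p t ^ 2 * (exp (- x * p t) * exp (d * p t))))
      with (Cmod (q t) * exp (- x * p t) * (u ^ 2 * p t ^ 2 * exp (d * p t))) by ring.
    apply Rmult_le_compat_l; [|exact HT].
    apply Rmult_le_pos; [apply Cmod_ge_0|left; apply exp_pos].
Qed.

Lemma ker_split b s t : ker 1 b s t = (ker 1 0 s t * RtoC (exp (- b * exp (- t))))%C.
Proof. unfold ker. rewrite <- cexp_R, <- cexp_plus. f_equal. apply C_ext; simpl; ring. Qed.

Lemma X_derive s x : 0 < x -> isD (X s) x (- X (s + RtoC (-1)) x)%C.
Proof.
  intros Hx.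
  pose proof (IntC_param (ker 1 0 s) (fun t => exp (- t)) x (x / 2) ltac:(lra) (contC_ker _ _ _)) as H.
  apply (isD_ext (fun y => IntC (fun t => ker 1 0 s t * RtoC (exp (- y * exp (- t))))%C)).
  { intros u. apply IntC_ext. intros t. symmetry. apply ker_split. }
  eapply isD_eq; [apply H; clear H|].
  - apply contR_derive. intros t. auto_derive. trivial.
  - intros t. left. apply exp_pos.
  - replace (fun t => Cmod (ker 1 0 s t) * exp (- t) ^ 2 * exp (- (x - x / 2) * exp (- t))) with (kerR 1 (x / 2) (Re s - 2)).
    + apply goodR_kerR, kcond_pos. lra.
    + apply functional_extensionality. intros t. rewrite Cmod_ker. unfold kerR. simpl. rewrite Rmult_1_r, <- !exp_plus. f_equal. field.
  - intros y Hy. apply Rabs_le_between in Hy.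
    apply goodC_ext with (ker 1 y s); [intros t; apply ker_split|]. apply goodC_ker, kcond_pos. lra.
  - apply goodC_ext with (ker 1 x (s + RtoC (-1))); [|apply goodC_ker, kcond_pos; lra].
    intros t. rewrite <- ker_split, <- ker_shift_s, cexp_R. do 3 f_equal. ring.
  - f_equal. apply IntC_ext. intros t. rewrite <- ker_split, <- ker_shift_s, cexp_R. do 3 f_equal. ring.
Qed.

(** With [v^2 = x e^(-t)] one has [1 - exp (- v^2) <= v], so the error has order [sqrt x] and costs
    half a unit of [Re s]. A first-order estimate would cost a full unit and fail at [1 + s] for
    imaginary [s]. *)
Lemma X_at_0 s x : / 2 < Re s -> 0 < x -> Cmod (X s x - X s 0) <= sqrt x * XR (Re s - / 2) 0.
Proof.
  intros Hs Hx.
  assert (G : goodC (ker 1 x s)) by now apply goodC_ker, kcond_pos.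
  assert (G0 : goodC (ker 1 0 s)) by (apply goodC_ker, kcond_0; lra).
  unfold X. rewrite <- (IntC_minus (ker 1 x s) (ker 1 0 s)) by assumption.
  assert (Hh : goodR (kerR 1 0 (Re s - / 2))) by (apply goodR_kerR, kcond_0; lra).
  unfold XR. rewrite <- (IntR_scal (sqrt x)) by exact Hh. apply IntC_bound.
  - apply goodC_ext with (fun t => RtoC 1 * ker 1 x s t + RtoC (-1) * ker 1 0 s t)%C; [intros; ring|].
    now apply goodC_lin2.
  - now apply goodR_scal.
  - intros t. rewrite (ker_split x).
    replace (ker 1 0 s t * exp (- x * exp (- t)) - ker 1 0 s t)%C with (ker 1 0 s t * RtoC (exp (- x * exp (- t)) - 1))%C
      by (rewrite RtoC_minus; ring).
    rewrite Cmod_mult, Cmod_ker, Cmod_R.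
    replace (kerR 1 0 (Re s - / 2) t) with (kerR 1 0 (Re s) t * exp (- t / 2)).
    2:{ unfold kerR. rewrite <- exp_plus. f_equal. field. }
    replace (sqrt x * (kerR 1 0 (Re s) t * exp (- t / 2))) with (kerR 1 0 (Re s) t * (sqrt x * exp (- t / 2))) by ring.
    apply Rmult_le_compat_l; [left; apply kerR_pos|].
    set (v := sqrt x * exp (- t / 2)).
    assert (Hv : 0 < v) by (apply Rmult_lt_0_compat; [now apply sqrt_lt_R0|apply exp_pos]).
    assert (Ev : v * v = x * exp (- t)).
    { unfold v. replace (sqrt x * exp (- t / 2) * (sqrt x * exp (- t / 2))) with ((sqrt x * sqrt x) * (exp (- t / 2) * exp (- t / 2))) by ring.
      rewrite sqrt_sqrt, <- exp_plus by lra. do 2 f_equal. field. }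
    replace (- x * exp (- t)) with (- (v * v)) by (rewrite Ev; ring).
    pose proof (exp_ineq1_le (- (v * v))). pose proof (exp_pos (- (v * v))).
    assert (exp (- (v * v)) <= 1) by (rewrite <- exp_0; apply exp_mono; nra).
    rewrite Rabs_left1 by lra.
    destruct (Rle_lt_dec v 1); nra.
Qed.

(** Expanding [exp (- x e^(-t))] turns [X] into shifted Gamma values. The exponent is nonpositive,
    so by [cexp_taylor_neg] the remainder is at most the modulus of the next term. *)
Lemma X_taylor s x J : INR J < Re s -> 0 < x ->
  Cmod (X s x - CS (fun j => RtoC ((- x) ^ j / INR (fact j)) * X (s + RtoC (- INR j)) 0)%C J)
    <= x ^ J / INR (fact J) * XR (Re s - INR J) 0.
Proof.
  intros HJ Hx.
  assert (Gj : forall j, (j <= J)%nat -> goodC (ker 1 0 (s + RtoC (- INR j)))).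
  { intros j Hj. apply goodC_ker, kcond_0. apply le_INR in Hj. unfold Re in *; simpl. lra. }
  assert (G : goodC (ker 1 x s)) by now apply goodC_ker, kcond_pos.
  set (F := fun j t => (RtoC ((- x) ^ j / INR (fact j)) * ker 1 0 (s + RtoC (- INR j)) t)%C).
  assert (Gs : goodC (fun t => CS (fun j => F j t) J)).
  { apply goodC_CS. intros j Hj. apply (goodC_scal _ (ker 1 0 (s + RtoC (- INR j)))), Gj. lia. }
  replace (CS (fun j => RtoC ((- x) ^ j / INR (fact j)) * X (s + RtoC (- INR j)) 0)%C J)
    with (IntC (fun t => CS (fun j => F j t) J)).
  2:{ rewrite (IntC_CS F).
      - apply CS_ext. intros j Hj. apply (IntC_scal _ (ker 1 0 (s + RtoC (- INR j)))), Gj. lia.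
      - intros j Hj. apply (goodC_scal _ (ker 1 0 (s + RtoC (- INR j)))), Gj. lia. }
  unfold X. rewrite <- (IntC_minus (ker 1 x s) (fun t => CS (fun j => F j t) J)) by assumption.
  assert (Hh : goodR (kerR 1 0 (Re s - INR J))) by (apply goodR_kerR, kcond_0; lra).
  unfold XR. rewrite <- (IntR_scal (x ^ J / INR (fact J))) by exact Hh. apply IntC_bound.
  - apply goodC_ext with (fun t => RtoC 1 * ker 1 x s t + RtoC (-1) * CS (fun j => F j t) J)%C; [intros; ring|].
    now apply (goodC_lin2 _ _ (ker 1 x s) (fun t => CS (fun j => F j t) J)).
  - now apply goodR_scal.
  - intros t. set (z := RtoC (- x * exp (- t))).
    replace (ker 1 x s t - CS (fun j => F j t) J)%C
      with (ker 1 0 s t * (cexp z - expT J z))%C.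
    + rewrite Cmod_mult, Cmod_ker.
      pose proof (exp_pos (- t)) as Ht.
      assert (Hz : Cmod z = x * exp (- t)).
      { unfold z. rewrite Cmod_R, Rabs_mult, Rabs_Ropp, !Rabs_pos_eq by lra. reflexivity. }
      eapply Rle_trans; [apply Rmult_le_compat_l; [left; apply kerR_pos|apply cexp_taylor_neg]|].
      * unfold z, Re; simpl. nra.
      * rewrite Hz, Rpow_mult_distr. right.
        replace (kerR 1 0 (Re s - INR J) t) with (kerR 1 0 (Re s) t * exp (- t) ^ J).
        -- field. apply INR_fact_neq_0.
        -- assert (E : forall k, exp (- t) ^ k = exp (- INR k * t)).
           { induction k as [|k IH]; [simpl; replace (-0 * t) with 0 by ring; now rewrite exp_0|].
             rewrite S_INR. simpl pow. rewrite IH, <- exp_plus. f_equal. ring. }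
           rewrite E. unfold kerR. rewrite <- exp_plus. f_equal. ring.
    + rewrite (ker_split x). unfold z at 1. rewrite cexp_R.
      replace (ker 1 0 s t * (exp (- x * exp (- t)) - expT J z))%C
        with (ker 1 0 s t * exp (- x * exp (- t)) - ker 1 0 s t * expT J z)%C by ring.
      f_equal. unfold expT. rewrite <- CS_scal. apply CS_ext. intros j _. unfold F.
      rewrite <- ker_shift_s. replace (- INR j * t) with (INR j * - t) by ring.
      rewrite RtoC_mult, <- cexp_pow, cexp_R. unfold z.
      rewrite (RtoC_mult (- x)), Cpow_mult_distr. unfold Rdiv. rewrite RtoC_mult, <- RtoC_pow. ring.
Qed.

(** * The Gamma function: modulus and phase *)

Definition Gam (s : C) : C := X s 0.
Definition GamR (c : R) : R := XR c 0.

Lemma Gam_rec s : 0 < Re s -> Gam (s + RtoC 1) = (s * Gam s)%C.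
Proof. intros H. symmetry. exact (X_rec0 s H). Qed.

Lemma GamR_pos c : 0 < c -> 0 < GamR c.
Proof. intros H. exact (XR_pos c 0 (kcond_0 c H)). Qed.

Lemma GamR_rec c : 0 < c -> GamR (c + 1) = c * GamR c.
Proof.
  intros H. apply RtoC_inj. rewrite RtoC_mult. unfold GamR. rewrite <- !X_real, RtoC_plus.
  symmetry. exact (X_rec0 (RtoC c) H).
Qed.

Lemma two_cosh_ge t : t ^ 2 <= exp t + exp (- t) - 2.
Proof.
  assert (H : forall u, 0 <= u -> u ^ 2 <= exp u + exp (- u) - 2).
  { intros u Hu. set (x := u / 2).
    assert (Ha : 1 + x + x ^ 2 / 2 <= exp x).
    {
      set (f := fun v => exp v - (1 + v + v ^ 2 / 2)).
      assert (Hf : forall v, is_derive f v (exp v - (1 + v))).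
      { intros v. unfold f. auto_derive; [trivial|]. field. }
      destruct (MVT_gen f 0 x (fun v => exp v - (1 + v))) as [c [Hc Ec]].
      - intros v _. apply Hf.
      - intros v _. apply derivable_continuous_pt. eexists. apply is_derive_Reals, Hf.
      - rewrite Rmin_left, Rmax_right in Hc by (unfold x; lra).
        pose proof (exp_ineq1_le c). unfold f in Ec. rewrite exp_0 in Ec.
        nra. }
    pose proof (exp_pos x) as Hp.
    assert (E1 : exp x * exp (- x) = 1) by (rewrite <- exp_plus, Rplus_opp_r; apply exp_0).
    assert (E2 : exp u = exp x * exp x) by (rewrite <- exp_plus; f_equal; unfold x; field).
    assert (E3 : exp (- u) = exp (- x) * exp (- x)) by (rewrite <- exp_plus; f_equal; unfold x; field).
    rewrite E2, E3. replace u with (2 * x) by (unfold x; field).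
    assert (Hx : 0 <= x) by (unfold x; lra).
    assert (Hd : 2 * x <= exp x - exp (- x)).
    { apply Rmult_le_reg_r with (exp x); [exact Hp|].
      replace ((exp x - exp (- x)) * exp x) with (exp x * exp x - 1) by (rewrite <- E1; ring).
      set (a := 1 + x + x ^ 2 / 2) in *.
      assert (2 * x * a <= a * a - 1).
      { assert (E : a * a - 1 - 2 * x * a = (x ^ 2) ^ 2 / 4) by (unfold a; field).
        pose proof (pow2_ge_0 (x ^ 2)). lra. }
      assert (x <= a) by (unfold a; pose proof (pow2_ge_0 x); lra). nra. }
    nra. }
  destruct (Rle_lt_dec 0 t) as [h|h]; [now apply H|].
  specialize (H (- t) ltac:(lra)). rewrite Ropp_involutive in H. replace (t ^ 2) with ((- t) ^ 2) by ring. lra.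
Qed.

Lemma unit_sub_1 t : Cmod (unit t - 1) <= Rabs t.
Proof.
  rewrite unit_cexp. pose proof (cexp_taylor_neg (Ci * RtoC t)%C 1) as H.
  assert (H0 : Re (Ci * RtoC t)%C <= 0) by (unfold Re; simpl; lra). specialize (H H0).
  unfold expT in H. simpl in H. rewrite Cmod_mult, Cmod_Ci, Cmod_R in H.
  replace (0 + (/ 1)%R * 1)%C with (RtoC 1) in H by (replace (/ 1) with 1 by field; ring). lra.
Qed.

Lemma unit_sub a b : Cmod (unit a - unit b) <= Rabs (a - b).
Proof.
  replace (unit a - unit b)%C with (unit b * (unit (a - b) - 1))%C.
  - rewrite Cmod_mult, Cmod_unit, Rmult_1_l. apply unit_sub_1.
  - replace a with (b + (a - b)) at 2 by ring. rewrite unit_plus. ring.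
Qed.

(* Concentration of the Gamma density at [ln N]: the mean of [tau^2 <= 2 cosh tau - 2], tau = t - ln N, is O(1/N). *)
Lemma Gam_asymp sg y N d : 0 <= sg -> (1 <= N)%nat -> 0 < d ->
  Cmod (Gam (RtoC (INR N + 1 + sg) + Ci * RtoC y) * unit (- y * ln (INR N)) - RtoC (GamR (INR N + 1 + sg)))
   <= Rabs y * (d / 2 + (1 + sg) / INR N / (2 * d)) * GamR (INR N + 1 + sg).
Proof.
  intros Hsg HN Hd. set (c := INR N + 1 + sg). set (s := (RtoC c + Ci * RtoC y)%C).
  assert (HN' : 1 <= INR N) by now apply (le_INR 1).
  assert (Hc : Re s = c) by (unfold s, Re; simpl; ring).
  assert (Gk : forall u, 0 < Re u -> goodC (ker 1 0 u)) by (intros; now apply goodC_ker, kcond_0).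
  assert (Gr : forall u, 0 < u -> goodR (kerR 1 0 u)) by (intros; now apply goodR_kerR, kcond_0).
  assert (Hc0 : 2 <= c) by (unfold c; lra).
  assert (G1 : goodC (ker 1 0 s)) by (apply Gk; lra).
  assert (G2 : goodC (ker 1 0 (RtoC c))) by (apply Gk; unfold Re; simpl; lra).
  unfold GamR. rewrite <- X_real. unfold Gam, X.
  set (k1 := ker 1 0 s) in *. set (k2 := ker 1 0 (RtoC c)) in *. set (w := unit (- y * ln (INR N))).
  replace (IntC k1 * w - IntC k2)%C with (w * IntC k1 + RtoC (-1) * IntC k2)%C by ring.
  rewrite <- (IntC_lin2 w (RtoC (-1)) k1 k2) by assumption.
  (* From [|tau| <= d / 2 + tau^2 / (2 d)] and [tau^2 <= 2 cosh tau - 2]; the factors [e^tau] and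
     [e^(-tau)] shift [c] by one, so the majorant integrates to Gamma values. *)
  set (h := fun t => Rabs y * ((d / 2 - 1 / d) * kerR 1 0 c t + (1 / (2 * d * INR N) * kerR 1 0 (c + 1) t + INR N / (2 * d) * kerR 1 0 (c - 1) t))).
  assert (Gc : goodR (kerR 1 0 c)) by (apply Gr; lra).
  assert (Gc1 : goodR (kerR 1 0 (c + 1))) by (apply Gr; lra).
  assert (Gc2 : goodR (kerR 1 0 (c - 1))) by (apply Gr; lra).
  pose proof (goodR_lin3 (d / 2 - 1 / d) (1 / (2 * d * INR N)) (INR N / (2 * d)) _ _ _ Gc Gc1 Gc2) as Gl.
  assert (Gh : goodR h) by exact (goodR_scal (Rabs y) _ Gl).
  assert (E : IntR h <= Rabs y * (d / 2 + (1 + sg) / INR N / (2 * d)) * XR c 0).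
  { unfold h. rewrite (IntR_scal (Rabs y) _ Gl). rewrite (IntR_lin3 _ _ _ _ _ _ Gc Gc1 Gc2).
    change (IntR (kerR 1 0 c)) with (GamR c). change (IntR (kerR 1 0 (c + 1))) with (GamR (c + 1)).
    change (IntR (kerR 1 0 (c - 1))) with (GamR (c - 1)). change (XR c 0) with (GamR c).
    rewrite GamR_rec by lra.
    assert (Eg : GamR c = (c - 1) * GamR (c - 1)).
    { replace c with ((c - 1) + 1) at 1 by ring. rewrite GamR_rec by lra. reflexivity. }
    rewrite Eg. pose proof (GamR_pos (c - 1) ltac:(lra)) as Hg.
    rewrite (Rmult_assoc (Rabs y) (d / 2 + (1 + sg) / INR N / (2 * d))). apply Rmult_le_compat_l; [apply Rabs_pos|].
    apply Rle_trans with ((d / 2 + (1 + sg) / INR N / (2 * d)) * ((c - 1) * GamR (c - 1)) - sg / (2 * d) * GamR (c - 1)).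
    - right. unfold c. field. lra.
    - assert (0 <= sg / (2 * d) * GamR (c - 1)).
      { apply Rmult_le_pos; [|lra]. apply Rmult_le_pos; [lra|left; apply Rinv_0_lt_compat; lra]. }
      lra. }
  eapply Rle_trans; [|exact E]. apply IntC_bound; [|exact Gh|].
  - now apply goodC_lin2.
  - intros t. set (tau := t - ln (INR N)).
    replace (w * k1 t + RtoC (-1) * k2 t)%C with (ker 1 0 (RtoC c) t * (unit (y * tau) - 1))%C.
    2:{ unfold w, k1, k2. replace (y * tau) with (- y * ln (INR N) + y * t) by (unfold tau; ring). rewrite unit_plus.
        replace (ker 1 0 s t) with (ker 1 0 (RtoC c) t * unit (y * t))%C; [ring|].
        rewrite unit_cexp. unfold ker. rewrite <- cexp_plus. f_equal. unfold s. rewrite RtoC_mult. ring. }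
    rewrite Cmod_mult, Cmod_ker.
    assert (Hk1 : kerR 1 0 (c + 1) t = kerR 1 0 c t * (INR N * exp tau)).
    { unfold kerR, tau. rewrite <- (exp_ln (INR N)) at 1 by lra. rewrite <- !exp_plus. f_equal. ring. }
    assert (Hk2 : kerR 1 0 (c - 1) t = kerR 1 0 c t * (/ INR N * exp (- tau))).
    { unfold kerR, tau. rewrite <- (exp_ln (INR N)) at 1 by lra. rewrite <- exp_Ropp, <- !exp_plus. f_equal. ring. }
    unfold h. rewrite Hk1, Hk2.
    replace (Rabs y * ((d / 2 - 1 / d) * kerR 1 0 c t + (1 / (2 * d * INR N) * (kerR 1 0 c t * (INR N * exp tau))
       + INR N / (2 * d) * (kerR 1 0 c t * (/ INR N * exp (- tau))))))
      with (kerR 1 0 c t * (Rabs y * (d / 2 + (exp tau + exp (- tau) - 2) / (2 * d)))) by (field; lra).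
    apply Rmult_le_compat_l; [left; apply kerR_pos|].
    eapply Rle_trans; [apply unit_sub_1|]. rewrite Rabs_mult. apply Rmult_le_compat_l; [apply Rabs_pos|].
    apply Rle_trans with (d / 2 + tau ^ 2 / (2 * d)).
    + apply Rmult_le_reg_r with (2 * d); [lra|].
      replace ((d / 2 + tau ^ 2 / (2 * d)) * (2 * d)) with (d ^ 2 + tau ^ 2) by (field; lra).
      rewrite <- (pow2_abs tau). pose proof (pow2_ge_0 (Rabs tau - d)). nra.
    + apply Rplus_le_compat_l. apply Rmult_le_compat_r; [left; apply Rinv_0_lt_compat; lra|apply two_cosh_ge].
Qed.

Lemma Gam_asymp_eps sg y eta : 0 <= sg -> 0 < eta -> exists N0, forall N, (N0 <= N)%nat -> (1 <= N)%nat ->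
  Cmod (Gam (RtoC (INR N + 1 + sg) + Ci * RtoC y) * unit (- y * ln (INR N)) - RtoC (GamR (INR N + 1 + sg)))
   <= eta * GamR (INR N + 1 + sg).
Proof.
  intros Hsg He. set (Y := Rabs y + 1). assert (HY : 1 <= Y) by (unfold Y; pose proof (Rabs_pos y); lra).
  (* This balances the two error terms: each is at most [d / 2] once [N >= (1 + sg) / d^2], and
     [Y d = eta]. *)
  set (d := eta / Y). assert (Hd : 0 < d) by (apply Rdiv_lt_0_compat; lra).
  destruct (INR_unbounded ((1 + sg) / (d * d))) as [N0 HN0]. exists N0. intros N HN HN1.
  eapply Rle_trans; [apply (Gam_asymp sg y N d Hsg HN1 Hd)|].
  assert (HNr : 1 <= INR N) by now apply (le_INR 1).
  apply Rmult_le_compat_r; [left; apply GamR_pos; lra|].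
  assert (INR N0 <= INR N) by now apply le_INR.
  assert (H1 : (1 + sg) / INR N <= d * d).
  { apply Rmult_le_reg_r with (INR N); [lra|]. unfold Rdiv at 1. rewrite Rmult_assoc, Rinv_l, Rmult_1_r by lra.
    apply Rle_trans with (d * d * ((1 + sg) / (d * d))); [right; field; lra|]. apply Rmult_le_compat_l; nra. }
  assert (H2 : (1 + sg) / INR N / (2 * d) <= d / 2).
  { apply Rmult_le_reg_r with (2 * d); [lra|]. unfold Rdiv at 1. rewrite Rmult_assoc, Rinv_l, Rmult_1_r by lra.
    replace (d / 2 * (2 * d)) with (d * d) by field. exact H1. }
  apply Rle_trans with (Y * d); [|right; unfold d; field; lra].
  assert (Rabs y <= Y) by (unfold Y; lra). pose proof (Rabs_pos y).
  apply Rmult_le_compat; try lra.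
  apply Rplus_le_le_0_compat; [lra|]. apply Rmult_le_pos; [|left; apply Rinv_0_lt_compat; lra].
  apply Rmult_le_pos; [lra|left; apply Rinv_0_lt_compat; lra].
Qed.

Lemma Gam_prod s N : 0 <= Re s ->
  Gam (RtoC (INR N + 1) + s)%C = (Gam (RtoC 1 + s) * CP (fun k => RtoC (INR (S k)) + s) N)%C.
Proof.
  intros Hs. induction N as [|N IH].
  - simpl. replace (RtoC (0 + 1) + s)%C with (RtoC 1 + s)%C by (rewrite Rplus_0_l; reflexivity). ring.
  - rewrite CP_S, Cmult_assoc, <- IH, S_INR.
    replace (RtoC (INR N + 1 + 1) + s)%C with ((RtoC (INR N + 1) + s) + RtoC 1)%C by (rewrite (RtoC_plus (INR N + 1)); ring).
    rewrite Gam_rec; [ring|]. pose proof (pos_INR N). unfold Re in *; simpl; lra.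
Qed.

Fixpoint RP (f : nat -> R) (n : nat) : R :=
  match n with O => 1 | S k => RP f k * f k end.

Lemma RP_pos f n : (forall k, 0 < f k) -> 0 < RP f n.
Proof. intros H. induction n as [|n IH]; simpl; [lra|]. now apply Rmult_lt_0_compat. Qed.

Lemma GamR_prod c N : 0 <= c -> GamR (INR N + 1 + c) = GamR (1 + c) * RP (fun k => INR (S k) + c) N.
Proof.
  intros Hc. induction N as [|N IH].
  - simpl. replace (0 + 1 + c) with (1 + c) by ring. ring.
  - replace (INR (S N) + 1 + c) with ((INR N + 1 + c) + 1) by (rewrite S_INR; ring).
    rewrite GamR_rec by (pose proof (pos_INR N); lra).
    change (RP (fun k => INR (S k) + c) (S N)) with (RP (fun k => INR (S k) + c) N * (INR (S N) + c)).
    rewrite IH, S_INR. ring.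
Qed.

Lemma Cmod_sqr (z : C) : Cmod z ^ 2 = Re z ^ 2 + Im z ^ 2.
Proof. apply Cmod2_alt. Qed.

(** [|a + i y|^2 = a^2 (1 + y^2 / a^2)] and [1 / a^2 <= 1 / (a - 1) - 1 / a]; the exponent is
    written as a difference so that products over [a] telescope. *)
Lemma factor_bound a y : 1 < a -> Cmod (RtoC a + Ci * RtoC y)%C <= a * exp (y ^ 2 / 2 * (/ (a - 1) - / a)).
Proof.
  intros Ha. set (v := y ^ 2 / 2 * (/ (a - 1) - / a)).
  assert (Hp : 0 < a * exp v) by (apply Rmult_lt_0_compat; [lra|apply exp_pos]).
  apply Rsqr_incr_0; [|apply Cmod_ge_0|lra]. unfold Rsqr.
  replace (Cmod (a + Ci * y) * Cmod (a + Ci * y)) with (Cmod (RtoC a + Ci * RtoC y) ^ 2) by ring.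
  rewrite Cmod_sqr. replace (Re (a + Ci * y)) with a by (unfold Re; simpl; ring).
  replace (Im (a + Ci * y)) with y by (unfold Im; simpl; ring).
  replace (a * exp v * (a * exp v)) with (a ^ 2 * exp (v + v)) by (rewrite exp_plus; ring).
  pose proof (exp_ineq1_le (v + v)) as E.
  assert (Hv : y ^ 2 / a ^ 2 <= v + v).
  { unfold v. replace (y ^ 2 / 2 * (/ (a - 1) - / a) + y ^ 2 / 2 * (/ (a - 1) - / a)) with (y ^ 2 * / ((a - 1) * a)) by (field; lra).
    apply Rmult_le_compat_l; [apply pow2_ge_0|]. apply Rinv_le_contravar; nra. }
  assert (y ^ 2 = a ^ 2 * (y ^ 2 / a ^ 2)) by (field; lra). nra.
Qed.

Lemma CP_factor_bound sg y N : 0 < sg ->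
  Cmod (CP (fun k => RtoC (INR (S k)) + (RtoC sg + Ci * RtoC y)) N)%C
   <= RP (fun k => INR (S k) + sg) N * exp (y ^ 2 / 2 * (/ sg - / (INR N + sg))).
Proof.
  intros Hs. induction N as [|N IH].
  - simpl. rewrite Cmod_1. replace (y * (y * 1) / 2 * (/ sg - / (0 + sg))) with 0; [rewrite exp_0; lra|].
    rewrite Rplus_0_l. ring.
  - rewrite CP_S, Cmod_mult.
    change (RP (fun k => INR (S k) + sg) (S N)) with (RP (fun k => INR (S k) + sg) N * (INR (S N) + sg)).
    pose proof (pos_INR N) as HN.
    replace (RtoC (INR (S N)) + (RtoC sg + Ci * RtoC y))%C with (RtoC (INR (S N) + sg) + Ci * RtoC y)%C
      by (rewrite RtoC_plus; ring).
    pose proof (factor_bound (INR (S N) + sg) y ltac:(rewrite S_INR; lra)) as F.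
    eapply Rle_trans; [apply Rmult_le_compat; [apply Cmod_ge_0|apply Cmod_ge_0|exact IH|exact F]|].
    right. replace (INR (S N) + sg - 1) with (INR N + sg) by (rewrite S_INR; ring).
    replace (y ^ 2 / 2 * (/ sg - / (INR (S N) + sg)))
      with (y ^ 2 / 2 * (/ sg - / (INR N + sg)) + y ^ 2 / 2 * (/ (INR N + sg) - / (INR (S N) + sg))) by ring.
    rewrite exp_plus. ring.
Qed.

(** In [Gam (N + 1 + s) = Gam (1 + s) prod (k + s)] the left side has nearly the modulus of its
    value on the real line, and the product is bounded above by [CP_factor_bound]; hence
    [Gam (1 + s)] cannot be small. *)
Lemma Gam_lower sg y : 0 < sg -> GamR (1 + sg) * exp (- (y ^ 2 / (2 * sg))) <= Cmod (Gam (RtoC 1 + (RtoC sg + Ci * RtoC y))%C).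
Proof.
  intros Hs. set (s := (RtoC sg + Ci * RtoC y)%C).
  assert (Hre : Re s = sg) by (unfold s, Re; simpl; ring).
  apply le_epsilon. intros e He.
  set (B := GamR (1 + sg) * exp (- (y ^ 2 / (2 * sg)))).
  assert (HB : 0 < B) by (apply Rmult_lt_0_compat; [apply GamR_pos; lra|apply exp_pos]).
  set (eta := e / B). assert (Heta : 0 < eta) by (apply Rdiv_lt_0_compat; lra).
  destruct (Gam_asymp_eps sg y eta ltac:(lra) Heta) as [N0 HN].
  specialize (HN (S N0) ltac:(lia) ltac:(lia)). set (N := S N0) in *.
  pose proof (pos_INR N) as HNp.
  set (g := GamR (INR N + 1 + sg)) in *.
  assert (Hg : 0 < g) by (apply GamR_pos; lra).
  replace (RtoC (INR N + 1 + sg) + Ci * RtoC y)%C with (RtoC (INR N + 1) + s)%C in HN by (unfold s; rewrite (RtoC_plus (INR N + 1)); ring).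
  rewrite Gam_prod in HN by lra.
  set (Gs := Gam (RtoC 1 + s)) in *. set (P := CP (fun k => RtoC (INR (S k)) + s)%C N) in *.
  assert (H1 : g * (1 - eta) <= Cmod Gs * Cmod P).
  { pose proof (Cmod_sub_le (RtoC g) (Gs * P * unit (- y * ln (INR N)))%C) as T.
    rewrite Cmod_sub_sym, Cmod_mult, Cmod_unit, Cmod_RtoC_pos, Cmod_mult in T by lra. lra. }
  pose proof (CP_factor_bound sg y N Hs) as H2. fold s in H2. fold P in H2.
  pose proof (GamR_prod sg N ltac:(lra)) as H3. fold g in H3.
  set (Q := RP (fun k => INR (S k) + sg) N) in *.
  assert (HQ : 0 < Q) by (apply RP_pos; intros k; pose proof (pos_INR (S k)); lra).
  assert (H4 : exp (y ^ 2 / 2 * (/ sg - / (INR N + sg))) <= exp (y ^ 2 / (2 * sg))).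
  { apply exp_mono. assert (0 < / (INR N + sg)) by (apply Rinv_0_lt_compat; lra).
    replace (y ^ 2 / (2 * sg)) with (y ^ 2 / 2 * / sg) by (field; lra). nra. }
  pose proof (exp_pos (y ^ 2 / (2 * sg))) as HE.
  assert (H5 : Cmod P <= Q * exp (y ^ 2 / (2 * sg))) by nra.
  assert (H6 : GamR (1 + sg) * (1 - eta) <= Cmod Gs * exp (y ^ 2 / (2 * sg))).
  { apply Rmult_le_reg_l with Q; [exact HQ|].
    assert (Cmod Gs * Cmod P <= Cmod Gs * (Q * exp (y ^ 2 / (2 * sg)))) by (apply Rmult_le_compat_l; [apply Cmod_ge_0|exact H5]).
    rewrite H3 in H1. lra. }
  assert (H7 : B * (1 - eta) <= Cmod Gs).
  { unfold B. apply Rmult_le_reg_r with (exp (y ^ 2 / (2 * sg))); [exact HE|].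
    replace (GamR (1 + sg) * exp (- (y ^ 2 / (2 * sg))) * (1 - eta) * exp (y ^ 2 / (2 * sg)))
      with (GamR (1 + sg) * (1 - eta) * (exp (- (y ^ 2 / (2 * sg))) * exp (y ^ 2 / (2 * sg)))) by ring.
    rewrite <- exp_plus, Rplus_opp_l, exp_0. lra. }
  assert (B * eta = e) by (unfold eta; field; lra). lra.
Qed.

(** [Gam_lower] asks for [sg > 0], so it is applied at [2 + i y] and brought down by the
    recurrence. *)
Lemma Gam_1_iy_neq_0 y : Gam (RtoC 1 + Ci * RtoC y)%C <> RtoC 0.
Proof.
  intros E. pose proof (Gam_lower 1 y ltac:(lra)) as L.
  pose proof (GamR_pos (1 + 1) ltac:(lra)). pose proof (exp_pos (- (y ^ 2 / (2 * 1)))).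
  replace (RtoC 1 + (RtoC 1 + Ci * RtoC y))%C with ((RtoC 1 + Ci * RtoC y) + RtoC 1)%C in L by ring.
  rewrite Gam_rec, E in L by (unfold Re; simpl; lra).
  rewrite Cmult_0_r, Cmod_0 in L. nra.
Qed.

(* The continuous argument of [Gam (1 + iy)]. *)
Definition thN (N : nat) (y : R) : R := y * ln (INR N) - RS (fun k => atan (y / INR (S k))) N.

Definition th (y : R) : R := real (Lim_seq (fun N => thN (S N) y)).

Lemma atan_diff_ge a b : 0 <= a -> a <= b -> (b - a) / (1 + b ^ 2) <= atan b - atan a.
Proof.
  intros ha Hab.
  destruct (MVT_gen atan a b (fun x => / (1 + x ^ 2))) as [c [Hc Ec]].
  - intros x _. apply is_derive_Reals. exact (derivable_pt_lim_atan x).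
  - intros x _. apply derivable_continuous_pt, derivable_pt_atan.
  - rewrite Rmin_left, Rmax_right in Hc by lra. rewrite Ec. unfold Rdiv. rewrite Rmult_comm.
    apply Rmult_le_compat_r; [lra|]. apply Rinv_le_contravar; nra.
Qed.

Lemma atan_diff_le a b : a <= b -> 0 <= atan b - atan a <= b - a.
Proof.
  intros Hab.
  destruct (MVT_gen atan a b (fun x => / (1 + x ^ 2))) as [c [Hc Ec]].
  - intros x _. apply is_derive_Reals. exact (derivable_pt_lim_atan x).
  - intros x _. apply derivable_continuous_pt, derivable_pt_atan.
  - rewrite Ec. assert (0 < / (1 + c ^ 2) <= 1).
    { split; [apply Rinv_0_lt_compat; nra|]. rewrite <- Rinv_1. apply Rinv_le_contravar; nra. }
    nra.
Qed.

Lemma ln_step N : (1 <= N)%nat -> / INR (S N) <= ln (INR (S N)) - ln (INR N) <= / INR N.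
Proof.
  intros HN. assert (H1 : 1 <= INR N) by now apply (le_INR 1). rewrite S_INR.
  assert (E : ln (INR N + 1) - ln (INR N) = ln (1 + / INR N)).
  { unfold Rminus. rewrite <- ln_Rinv, <- ln_mult by (try apply Rinv_0_lt_compat; lra). f_equal. field. lra. }
  assert (E2 : ln (INR N + 1) - ln (INR N) = - ln (1 + - / (INR N + 1))).
  { replace (1 + - / (INR N + 1)) with (INR N * / (INR N + 1)) by (field; lra).
    rewrite ln_mult, ln_Rinv by (try apply Rinv_0_lt_compat; lra). ring. }
  assert (Hln : forall v, 0 < 1 + v -> ln (1 + v) <= v).
  { intros v Hv. rewrite <- (ln_exp v) at 2. apply ln_le; [exact Hv|apply exp_ineq1_le]. }
  assert (Hi : 0 < / (INR N + 1) < 1).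
  { split; [apply Rinv_0_lt_compat; lra|]. rewrite <- Rinv_1. apply Rinv_lt_contravar; lra. }
  split.
  - rewrite E2. pose proof (Hln (- / (INR N + 1)) ltac:(lra)). lra.
  - rewrite E. apply Hln. assert (0 < / INR N) by (apply Rinv_0_lt_compat; lra). lra.
Qed.

(** One step in [N] adds [y (ln a - ln b) - atan (y / a)], with [a = b + 1]. This is nondecreasing
    in [y], and its variation has a telescoping bound. The case [y = 0] gives convergence, the
    general case the Lipschitz estimate of the limit. *)
Lemma thN_diff y y' N : 0 <= y -> y <= y' ->
  0 <= (thN (S (S N)) y' - thN (S (S N)) y) - (thN (S N) y' - thN (S N) y)
    <= (y' - y) * (1 + y' ^ 2) * (/ INR (S N) - / INR (S (S N))).
Proof.
  intros Hy Hyy. unfold thN. rewrite !(RS_S _ (S N)).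
  set (A := RS _ (S N)). set (A' := RS (fun k => atan (y / INR (S k))) (S N)).
  pose proof (ln_step (S N) ltac:(lia)) as L.
  set (a := INR (S (S N))) in *. set (b := INR (S N)) in *.
  assert (Hab : a = b + 1) by (unfold a, b; now rewrite (S_INR (S N))).
  assert (Hb : 1 <= b) by (apply (le_INR 1); lia).
  assert (Ha : 0 < / a) by (apply Rinv_0_lt_compat; lra).
  assert (Hle : y / a <= y' / a) by (apply Rmult_le_compat_r; lra).
  pose proof (atan_diff_le _ _ Hle) as U.
  assert (Hya : 0 <= y / a) by (apply Rmult_le_pos; lra).
  pose proof (atan_diff_ge _ _ Hya Hle) as D.
  replace (y' * ln a - (A + atan (y' / a)) - (y * ln a - (A' + atan (y / a))) - (y' * ln b - A - (y * ln b - A')))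
    with ((y' - y) * (ln a - ln b) - (atan (y' / a) - atan (y / a))) by ring.
  replace (y' / a - y / a) with ((y' - y) * / a) in * by (unfold Rdiv; ring).
  split.
  - assert ((y' - y) * / a <= (y' - y) * (ln a - ln b)) by (apply Rmult_le_compat_l; lra). lra.
  - assert (H1 : (y' - y) * (ln a - ln b) <= (y' - y) * / b) by (apply Rmult_le_compat_l; lra).
    (* By [1 / (1 + q) >= 1 - q]: the linear part then nearly cancels against the logarithm, and
       what remains is cubic in [1 / a]. *)
    assert (H2 : (y' - y) * / a * (1 - (y' / a) ^ 2) <= (y' - y) * / a / (1 + (y' / a) ^ 2)).
    { apply Rmult_le_compat_l; [apply Rmult_le_pos; lra|].
      set (q := (y' / a) ^ 2). assert (0 <= q) by apply pow2_ge_0.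
      apply Rmult_le_reg_r with (1 + q); [lra|]. rewrite Rinv_l by lra. nra. }
    assert (H3 : / a * (/ a * / a) <= / b - / a).
    { replace (/ b - / a) with (/ (b * a)) by (rewrite Hab; field; lra).
      rewrite <- !Rinv_mult. apply Rinv_le_contravar; nra. }
    assert (H4 : (y' - y) * y' ^ 2 * (/ a * (/ a * / a)) <= (y' - y) * y' ^ 2 * (/ b - / a)).
    { apply Rmult_le_compat_l; [apply Rmult_le_pos; [lra|apply pow2_ge_0]|exact H3]. }
    replace ((y' - y) * / a * (1 - (y' / a) ^ 2)) with ((y' - y) * / a - (y' - y) * y' ^ 2 * (/ a * (/ a * / a))) in H2
      by (unfold Rdiv; ring).
    lra.
Qed.

Lemma thN_diff_bounds y y' N : 0 <= y -> y <= y' ->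
  - (y' - y) <= thN (S N) y' - thN (S N) y <= (y' - y) * (1 + y' ^ 2).
Proof.
  intros Hy Hyy.
  assert (H : - (y' - y) <= thN (S N) y' - thN (S N) y <= (y' - y) * (1 + y' ^ 2) * (1 - / INR (S N))).
  { induction N as [|N IH].
    - unfold thN. simpl. rewrite ln_1, Rinv_1. replace (y' / 1) with y' by field. replace (y / 1) with y by field.
      pose proof (atan_diff_le _ _ Hyy). lra.
    - pose proof (thN_diff y y' N Hy Hyy) as D.
      replace ((y' - y) * (1 + y' ^ 2) * (1 - / INR (S (S N)))) with
        ((y' - y) * (1 + y' ^ 2) * (1 - / INR (S N)) + (y' - y) * (1 + y' ^ 2) * (/ INR (S N) - / INR (S (S N)))) by ring.
      lra. }
  split; [apply H|]. eapply Rle_trans; [apply H|].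
  assert (0 < / INR (S N)) by (apply Rinv_0_lt_compat, lt_0_INR; lia).
  assert (0 <= (y' - y) * (1 + y' ^ 2)) by (apply Rmult_le_pos; [lra|pose proof (pow2_ge_0 y'); lra]). nra.
Qed.

Lemma thN_0 N : thN N 0 = 0.
Proof.
  unfold thN. rewrite (RS_ext _ (fun _ => 0)).
  - rewrite RS_const. ring.
  - intros k _. unfold Rdiv. rewrite Rmult_0_l. apply atan_0.
Qed.

Lemma th_lim y : 0 <= y -> is_lim_seq (fun N => thN (S N) y) (th y).
Proof.
  intros Hy. apply Lim_seq_correct'. apply ex_finite_lim_seq_incr with (y * (1 + y ^ 2)).
  - intros N. pose proof (thN_diff 0 y N (Rle_refl 0) Hy) as D. rewrite !thN_0 in D. lra.
  - intros N. pose proof (thN_diff_bounds 0 y N (Rle_refl 0) Hy) as D. rewrite thN_0 in D. lra.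
Qed.

Lemma th_lip y y' : 0 <= y -> y <= y' -> Rabs (th y' - th y) <= (y' - y) * (1 + y' ^ 2).
Proof.
  intros Hy Hyy.
  assert (L : is_lim_seq (fun N => thN (S N) y' - thN (S N) y) (th y' - th y)).
  { apply is_lim_seq_minus'; apply th_lim; lra. }
  apply Rabs_le. split.
  - apply Rle_trans with (- (y' - y)).
    + nra.
    + apply (is_lim_seq_ge_const _ _ _ (fun N => proj1 (thN_diff_bounds y y' N Hy Hyy)) L).
  - apply (is_lim_seq_le_const _ _ _ (fun N => proj2 (thN_diff_bounds y y' N Hy Hyy)) L).
Qed.

Lemma th_0 : th 0 = 0.
Proof.
  pose proof (th_lim 0 (Rle_refl 0)) as L.
  apply is_lim_seq_unique in L.
  assert (L0 : is_lim_seq (fun N => thN (S N) 0) 0).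
  { apply (is_lim_seq_ext (fun _ => 0)); [intros; symmetry; apply thN_0|apply is_lim_seq_const]. }
  apply is_lim_seq_unique in L0. rewrite L0 in L. injection L. auto.
Qed.

Lemma factor_polar k y : (RtoC (INR (S k)) + Ci * RtoC y)%C =
  (RtoC (INR (S k) * sqrt (1 + (y / INR (S k)) ^ 2)) * unit (atan (y / INR (S k))))%C.
Proof.
  set (a := INR (S k)). assert (Ha : 0 < a) by (apply lt_0_INR; lia).
  assert (Hq : 0 < sqrt (1 + (y / a) ^ 2)) by (apply sqrt_lt_R0; pose proof (pow2_ge_0 (y / a)); lra).
  unfold unit. rewrite cos_atan, sin_atan.
  replace (1 + (y / a)²) with (1 + (y / a) ^ 2) by (unfold Rsqr; ring).
  apply C_ext; simpl; simpl in Hq; field; lra.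
Qed.

Lemma CP_polar y N : exists r, 0 < r /\
  CP (fun k => RtoC (INR (S k)) + Ci * RtoC y)%C N = (RtoC r * unit (RS (fun k => atan (y / INR (S k))) N))%C.
Proof.
  induction N as [|N [r [Hr IH]]].
  - exists 1. split; [lra|]. simpl. unfold unit. rewrite cos_0, sin_0. apply C_ext; simpl; ring.
  - exists (r * (INR (S N) * sqrt (1 + (y / INR (S N)) ^ 2))). split.
    + apply Rmult_lt_0_compat; [exact Hr|]. apply Rmult_lt_0_compat; [apply lt_0_INR; lia|].
      apply sqrt_lt_R0. pose proof (pow2_ge_0 (y / INR (S N))). lra.
    + rewrite CP_S, IH, factor_polar, RS_S, unit_plus, !RtoC_mult. ring.
Qed.

(** For large [N] the phase of [Gam (N + 1 + i y)] is close to [y ln N], while that of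
    [prod (k + i y)] is the sum of the arctangents. Dividing, the phase of [Gam (1 + i y)] is the
    limit of [thN]. *)
Lemma Gam_phase y : 0 <= y -> Gam (RtoC 1 + Ci * RtoC y)%C = (RtoC (Cmod (Gam (RtoC 1 + Ci * RtoC y))) * unit (th y))%C.
Proof.
  intros Hy. set (G := Gam (RtoC 1 + Ci * RtoC y)).
  assert (HG : 0 < Cmod G) by apply Cmod_pos, Gam_1_iy_neq_0.
  assert (E : (G * unit (- th y) = RtoC (Cmod G))%C).
  { apply Cmod_small_eq. intros e He.
    (* The bound [1 / 2] ensures [p <= 2 |G|]. The three errors are [|G| eta], [eta p] and [eta p],
       in all at most [5 |G| eta], which is below [e]. *)
    set (eta := Rmin (/ 2) (e / (8 * Cmod G))).
    assert (Heta : 0 < eta) by (apply Rmin_glb_lt; [lra|apply Rdiv_lt_0_compat; lra]).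
    assert (Heta1 : eta <= / 2) by apply Rmin_l.
    assert (Heta2 : 8 * Cmod G * eta <= e).
    { apply Rle_trans with (8 * Cmod G * (e / (8 * Cmod G))); [apply Rmult_le_compat_l; [lra|apply Rmin_r]|]. right. field. lra. }
    destruct (Gam_asymp_eps 0 y eta ltac:(lra) Heta) as [N0 HN].
    pose proof (th_lim y Hy) as L. apply is_lim_seq_spec in L. destruct (L (mkposreal _ Heta)) as [N1 HN1].
    specialize (HN1 (N0 + N1)%nat ltac:(lia)).
    set (N := S (N0 + N1)) in *. specialize (HN N ltac:(unfold N; lia) ltac:(unfold N; lia)).
    set (g := GamR (INR N + 1 + 0)) in *. pose proof (pos_INR N) as HNp.
    assert (Hg : 0 < g) by (apply GamR_pos; lra).
    replace (RtoC (INR N + 1 + 0) + Ci * RtoC y)%C with (RtoC (INR N + 1) + Ci * RtoC y)%C in HN by (rewrite Rplus_0_r; reflexivity).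
    rewrite Gam_prod in HN by (unfold Re; simpl; lra). fold G in HN.
    destruct (CP_polar y N) as [r [Hr EP]]. rewrite EP in HN.
    replace (G * (RtoC r * unit (RS (fun k => atan (y / INR (S k))) N)) * unit (- y * ln (INR N)))%C
      with (RtoC r * (G * unit (- thN N y)))%C in HN.
    2:{ replace (- thN N y) with (RS (fun k => atan (y / INR (S k))) N + - y * ln (INR N)) by (unfold thN; ring).
        rewrite unit_plus. ring. }
    set (p := g / r). assert (Hp : 0 < p) by (apply Rdiv_lt_0_compat; lra).
    assert (H1 : Cmod (G * unit (- thN N y) - RtoC p) <= eta * p).
    { apply Rmult_le_reg_l with r; [exact Hr|].
      replace (r * (eta * p)) with (eta * g) by (unfold p; field; lra).
      rewrite <- (Cmod_RtoC_pos r) at 1 by lra. rewrite <- Cmod_mult.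
      replace (r * (G * unit (- thN N y) - p))%C with (RtoC r * (G * unit (- thN N y)) - RtoC g)%C; [exact HN|].
      replace (RtoC g) with (RtoC r * RtoC p)%C by (rewrite <- RtoC_mult; f_equal; unfold p; field; lra). ring. }
    assert (H2 : Rabs (Cmod G - p) <= eta * p).
    { pose proof (Cmod_sub_le (G * unit (- thN N y)) (RtoC p)) as T1.
      pose proof (Cmod_sub_le (RtoC p) (G * unit (- thN N y))) as T2. rewrite Cmod_sub_sym in T2.
      rewrite Cmod_mult, Cmod_unit, Cmod_RtoC_pos in T1, T2 by lra. apply Rabs_le. lra. }
    apply Rabs_le_between in H2.
    assert (Hp2 : p <= 2 * Cmod G) by nra.
    assert (H3 : Cmod (G * unit (- th y) - G * unit (- thN N y)) <= Cmod G * eta).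
    { replace (G * unit (- th y) - G * unit (- thN N y))%C with (G * (unit (- th y) - unit (- thN N y)))%C by ring.
      rewrite Cmod_mult. apply Rmult_le_compat_l; [lra|]. eapply Rle_trans; [apply unit_sub|].
      replace (- th y - - thN N y) with (thN N y - th y) by ring. left. exact HN1. }
    assert (H4 : Cmod (RtoC p - RtoC (Cmod G)) <= eta * p).
    { rewrite <- RtoC_minus, Cmod_R. apply Rabs_le. lra. }
    eapply Rle_trans; [apply (Cmod_sub_trans _ (G * unit (- thN N y)))|].
    eapply Rle_trans; [apply Rplus_le_compat_l, (Cmod_sub_trans _ (RtoC p))|].
    assert (eta * p <= eta * (2 * Cmod G)) by (apply Rmult_le_compat_l; lra). lra. }
  rewrite <- E at 1. rewrite <- Cmult_assoc, <- unit_plus, Rplus_opp_l.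
  unfold unit at 1. rewrite cos_0, sin_0. apply C_ext; simpl; ring.
Qed.

(** The terms [atan (y / k)] decrease in [k], so their sum is compared with the integral of
    [atan (y / x)], whose antiderivative is [A]; the first term costs the [pi / 2]. *)
Lemma th_lower y : 0 < y -> y * ln y - y - PI / 2 <= th y.
Proof.
  intros Hy.
  set (A := fun x => x * atan (y / x) + y / 2 * ln (x ^ 2 + y ^ 2)).
  assert (HA : forall x, 0 < x -> is_derive A x (atan (y / x))).
  { intros x Hx. unfold A. auto_derive.
    - repeat split; [lra|]. nra.
    - replace (y / x) with (y * / x) by reflexivity. generalize (atan (y * / x)). intros w. field.
      repeat split; nra. }
  set (SA := fun N => RS (fun k => atan (y / INR (S k))) N).
  assert (HS : forall N, SA (S N) <= PI / 2 + A (INR (S N)) - A 1).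
  { induction N as [|N IH].
    - unfold SA. simpl. replace (y / 1) with y by field. pose proof (atan_bound y). lra.
    - unfold SA in *. rewrite RS_S.
      assert (HN : 1 <= INR (S N)) by (apply (le_INR 1); lia).
      assert (HNS : INR (S (S N)) = INR (S N) + 1) by apply (S_INR (S N)).
      destruct (MVT_gen A (INR (S N)) (INR (S (S N))) (fun x => atan (y / x))) as [c [Hc Ec]].
      + intros x Hx. rewrite Rmin_left in Hx by lra. apply HA. lra.
      + intros x Hx. rewrite Rmin_left in Hx by lra. apply derivable_continuous_pt.
        exists (atan (y / x)). apply is_derive_Reals, HA. lra.
      + rewrite Rmin_left, Rmax_right in Hc by lra.
        assert (y / INR (S (S N)) <= y / c) by (apply Rmult_le_compat_l; [lra|apply Rinv_le_contravar; lra]).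
        pose proof (atan_diff_le _ _ H). nra. }
  assert (HA1 : y * ln y <= A 1).
  { unfold A. replace (y / 1) with y by field.
    assert (0 < atan y) by (rewrite <- atan_0; now apply atan_increasing).
    assert (ln (y ^ 2) <= ln (1 ^ 2 + y ^ 2)) by (apply ln_le; nra).
    assert (E : ln (y ^ 2) = 2 * ln y) by (simpl; rewrite Rmult_1_r, ln_mult by exact Hy; ring).
    rewrite E in *. nra. }
  assert (HAN : forall N, A (INR (S N)) <= y + y * ln (INR (S N)) + y ^ 3 * / INR (S N)).
  { intros N. assert (HN : 1 <= INR (S N)) by (apply (le_INR 1); lia). set (m := INR (S N)) in *. unfold A.
    assert (H1 : m * atan (y / m) <= y).
    { assert (0 <= y / m) by (apply Rmult_le_pos; [lra|left; apply Rinv_0_lt_compat; lra]).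
      pose proof (atan_diff_le _ _ H) as D. rewrite atan_0 in D.
      apply Rle_trans with (m * (y / m)); [apply Rmult_le_compat_l; lra|]. right. field. lra. }
    assert (H2 : ln (m ^ 2 + y ^ 2) <= 2 * ln m + (y / m) ^ 2).
    { replace (m ^ 2 + y ^ 2) with (m * m * (1 + (y / m) ^ 2)) by (field; lra).
      pose proof (pow2_ge_0 (y / m)).
      rewrite !ln_mult by nra.
      assert (ln (1 + (y / m) ^ 2) <= (y / m) ^ 2).
      { rewrite <- (ln_exp ((y / m) ^ 2)) at 2. apply ln_le; [lra|apply exp_ineq1_le]. }
      lra. }
    assert (H3 : y / 2 * (y / m) ^ 2 <= y ^ 3 * / m).
    { replace (y / 2 * (y / m) ^ 2) with (y ^ 3 * (/ 2 * (/ m * / m))) by (field; lra).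
      apply Rmult_le_compat_l; [apply pow_le; lra|].
      assert (0 < / m) by (apply Rinv_0_lt_compat; lra).
      assert (/ m <= 1) by (rewrite <- Rinv_1; apply Rinv_le_contravar; lra). nra. }
    nra. }
  apply (is_lim_seq_le (fun N => (y * ln y - y - PI / 2) - y ^ 3 * / INR (S N)) (fun N => thN (S N) y)
     (y * ln y - y - PI / 2) (th y)).
  - intros N. unfold thN. specialize (HS N). specialize (HAN N). unfold SA in HS. lra.
  - replace (y * ln y - y - PI / 2) with ((y * ln y - y - PI / 2) - y ^ 3 * 0) at 1 by ring.
    apply is_lim_seq_minus'; [apply is_lim_seq_const|].
    apply (is_lim_seq_scal_l _ (y ^ 3) (Finite 0)).
    apply (proj1 (is_lim_seq_incr_1 (fun n => / INR n) 0)).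
    apply (is_lim_seq_inv INR p_infty); [apply is_lim_seq_INR|discriminate].
  - apply th_lim. lra.
Qed.

(** * The connection formula for the Bessel-type integral on the imaginary axis *)

(** The coefficients are complex but the argument is real, so that the theory of [PSeries] applies
    to each component. *)
Definition Ser (a : nat -> C) (x : R) : C := (PSeries (fun j => Re (a j)) x, PSeries (fun j => Im (a j)) x).
Definition factdecay (a : nat -> C) : Prop := exists K, 0 <= K /\ forall j, Cmod (a j) <= K / INR (fact j).

Lemma CV_radius_fact (a : nat -> R) K : (forall j, Rabs (a j) <= K / INR (fact j)) -> CV_radius a = p_infty.
Proof.
  intros H. destruct (CV_radius_bounded a) as [HU _].
  assert (HK : 0 <= K).
  { specialize (H O). simpl in H. pose proof (Rabs_pos (a O)). lra. }
  assert (Hr : forall r : R, Rbar_le r (CV_radius a)).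
  { intros r. apply HU. exists (K * exp (Rabs r)). intros n. rewrite Rabs_mult, <- RPow_abs.
    pose proof (pow_fact_le_exp (Rabs r) n (Rabs_pos r)) as E.
    apply Rle_trans with (K / INR (fact n) * Rabs r ^ n).
    - apply Rmult_le_compat_r; [apply pow_le, Rabs_pos|apply H].
    - replace (K / INR (fact n) * Rabs r ^ n) with (K * (Rabs r ^ n / INR (fact n))) by (unfold Rdiv; ring).
      now apply Rmult_le_compat_l. }
  destruct (CV_radius a) as [c| |]; [|reflexivity|].
  - specialize (Hr (c + 1)). simpl in Hr. lra.
  - specialize (Hr 0). contradiction.
Qed.

Lemma factdecay_re a : factdecay a -> CV_radius (fun j => Re (a j)) = p_infty.
Proof. intros [K [_ H]]. apply (CV_radius_fact _ K). intros j. eapply Rle_trans; [apply re_le_Cmod|apply H]. Qed.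

Lemma factdecay_im a : factdecay a -> CV_radius (fun j => Im (a j)) = p_infty.
Proof. intros [K [_ H]]. apply (CV_radius_fact _ K). intros j. eapply Rle_trans; [apply im_le_Cmod|apply H]. Qed.

Definition dcoef (a : nat -> C) (j : nat) : C := (RtoC (INR (S j)) * a (S j))%C.

Lemma Ser_derive a x : factdecay a -> isD (Ser a) x (Ser (dcoef a) x).
Proof.
  intros H. split.
  - apply (is_derive_eq _ _ (PSeries (PS_derive (fun j => Re (a j))) x)).
    + apply is_derive_PSeries. rewrite factdecay_re by exact H. exact I.
    + apply PSeries_ext. intros j. unfold PS_derive, dcoef, Re; cbn [fst snd RtoC Cmult]. ring.
  - apply (is_derive_eq _ _ (PSeries (PS_derive (fun j => Im (a j))) x)).
    + apply is_derive_PSeries. rewrite factdecay_im by exact H. exact I.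
    + apply PSeries_ext. intros j. unfold PS_derive, dcoef, Im; cbn [fst snd RtoC Cmult]. ring.
Qed.

Lemma sum_n_RS (f : nat -> R) n : sum_n f n = RS f (S n).
Proof.
  induction n as [|n IH].
  - rewrite sum_O. simpl. ring.
  - rewrite sum_Sn, IH. reflexivity.
Qed.

Lemma Ser_lim a x : factdecay a -> is_lim_C (fun n => CS (fun j => a j * RtoC (x ^ j))%C n) (Ser a x).
Proof.
  intros H.
  assert (A : forall b : nat -> R, CV_radius b = p_infty -> is_lim_seq (fun n => RS (fun j => b j * x ^ j) n) (PSeries b x)).
  { intros b Hb.
    assert (E : is_pseries b x (PSeries b x)).
    { apply PSeries_correct. apply CV_radius_inside. rewrite Hb. exact I. }
    apply is_pseries_R in E.
    apply (is_lim_seq_incr_1 (fun n => RS (fun j => b j * x ^ j) n) (PSeries b x)).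
    apply (is_lim_seq_ext (sum_n (fun n => b n * x ^ n))); [intros n; apply sum_n_RS|exact E]. }
  apply is_lim_C_re_im.
  - apply (is_lim_seq_ext (fun n => RS (fun j => Re (a j) * x ^ j) n)).
    + intros n. induction n as [|n IH]; [reflexivity|]. rewrite RS_S, CS_S, Re_plus, IH. f_equal. unfold Re; simpl. ring.
    + now apply A, factdecay_re.
  - apply (is_lim_seq_ext (fun n => RS (fun j => Im (a j) * x ^ j) n)).
    + intros n. induction n as [|n IH]; [reflexivity|]. rewrite RS_S, CS_S, Im_plus, IH. f_equal. unfold Im; simpl. ring.
    + now apply A, factdecay_im.
Qed.

Lemma Ser_bound_uniform a : factdecay a -> exists K, 0 <= K /\ forall x, 0 <= x <= 1 -> Cmod (Ser a x) <= K.
Proof.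
  intros H. destruct H as [K [HK H]]. exists (K * exp 1). split; [apply Rmult_le_pos; [exact HK|left; apply exp_pos]|].
  intros x Hx. apply (is_lim_C_bound (fun n => CS (fun j => a j * RtoC (x ^ j))%C n)); [apply Ser_lim; now exists K|].
  exists O. intros n _. eapply Rle_trans.
  - apply (CS_Cmod_le _ (fun j => K * (1 ^ j / INR (fact j)))). intros j _.
    rewrite Cmod_mult, Cmod_RtoC_pos by (apply pow_le; lra). rewrite pow1.
    assert (0 <= x ^ j <= 1). { split; [apply pow_le; lra|]. rewrite <- (pow1 j). apply pow_incr. lra. }
    pose proof (Cmod_ge_0 (a j)). specialize (H j). unfold Rdiv in *. rewrite Rmult_1_l. nra.
  - rewrite RS_scal. apply Rmult_le_compat_l; [exact HK|]. apply exp_partial_sum. lra.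
Qed.

Lemma factdecay_shift a : factdecay a -> factdecay (fun j => a (S j)).
Proof.
  intros [K [HK H]]. exists K. split; [exact HK|]. intros j. eapply Rle_trans; [apply H|].
  apply Rmult_le_compat_l; [exact HK|]. apply Rinv_le_contravar; [apply INR_fact_lt_0|]. apply le_INR, fact_le. lia.
Qed.

Lemma factdecay_dcoef a : factdecay a -> factdecay (dcoef a).
Proof.
  intros [K [HK H]]. exists K. split; [exact HK|]. intros j. unfold dcoef. rewrite Cmod_mult, Cmod_RtoC_pos by apply pos_INR.
  specialize (H (S j)). rewrite fact_simpl, mult_INR in H.
  assert (0 < INR (S j)) by (apply lt_0_INR; lia). pose proof (INR_fact_lt_0 j).
  apply Rle_trans with (INR (S j) * (K / (INR (S j) * INR (fact j)))); [apply Rmult_le_compat_l; lra|].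
  right. field. lra.
Qed.

Lemma Ser_unfold a x : factdecay a -> Ser a x = (a O + RtoC x * Ser (fun j => a (S j)) x)%C.
Proof.
  intros H. apply C_ext; simpl.
  - rewrite (PSeries_decr_1 (fun j => Re (a j))) by (apply CV_radius_inside; rewrite factdecay_re by exact H; exact I).
    unfold PS_decr_1. unfold Re. ring.
  - rewrite (PSeries_decr_1 (fun j => Im (a j))) by (apply CV_radius_inside; rewrite factdecay_im by exact H; exact I).
    unfold PS_decr_1. unfold Im. ring.
Qed.

Lemma Ser_ext a b x : (forall j, a j = b j) -> Ser a x = Ser b x.
Proof. intros H. unfold Ser. f_equal; apply PSeries_ext; intros j; now rewrite H. Qed.

Lemma factdecay_lin a b (u v : C) : factdecay a -> factdecay b -> factdecay (fun j => u * a j + v * b j)%C.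
Proof.
  intros [K1 [HK1 H1]] [K2 [HK2 H2]]. exists (Cmod u * K1 + Cmod v * K2).
  pose proof (Cmod_ge_0 u). pose proof (Cmod_ge_0 v). split; [nra|]. intros j.
  eapply Rle_trans; [apply Cmod_triangle|]. rewrite !Cmod_mult. unfold Rdiv. rewrite Rmult_plus_distr_r, !Rmult_assoc.
  apply Rplus_le_compat; apply Rmult_le_compat_l; auto; apply H1 || apply H2.
Qed.

Lemma Ser_lin a b (u v : C) x : factdecay a -> factdecay b ->
  Ser (fun j => u * a j + v * b j)%C x = (u * Ser a x + v * Ser b x)%C.
Proof.
  intros Ha Hb.
  assert (Hc := factdecay_lin a b u v Ha Hb).
  apply is_lim_C_unique with (fun n => CS (fun j => (u * a j + v * b j) * RtoC (x ^ j))%C n); [now apply Ser_lim|].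
  apply is_lim_C_ext with (fun n => u * CS (fun j => a j * RtoC (x ^ j))%C n + v * CS (fun j => b j * RtoC (x ^ j))%C n)%C.
  - intros n. rewrite <- !CS_scal, <- CS_plus. apply CS_ext. intros j _. ring.
  - apply is_lim_C_plus; apply is_lim_C_scal; now apply Ser_lim.
Qed.

Definition poch (c : C) (j : nat) : C := CP (fun i => c + RtoC (INR i))%C j.
Definition fc (c : C) (j : nat) : C := (/ (RtoC (INR (fact j)) * poch c j))%C.
(** The hypergeometric function [0F1(; c; x)]. Up to an elementary factor, [F01 (1 + s) x] is the
    modified Bessel function [I_s(2 sqrt x)]. *)
Definition F01 (c : C) (x : R) : C := Ser (fc c) x.

Lemma poch_ge c j : 1 <= Re c -> 1 <= Cmod (poch c j).
Proof.
  intros Hc. rewrite <- (pow1 j). apply CP_Cmod_ge; [lra|]. intros k _.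
  eapply Rle_trans; [|apply re_le_Cmod]. eapply Rle_trans; [|apply RRle_abs].
  pose proof (pos_INR k). unfold Re in *; simpl; lra.
Qed.

Lemma poch_neq_0 c j : 1 <= Re c -> poch c j <> RtoC 0.
Proof. intros Hc. apply Cmod_gt_0. pose proof (poch_ge c j Hc). lra. Qed.

Lemma INR_fact_C j : RtoC (INR (fact j)) <> RtoC 0.
Proof. apply RtoC_neq_0, INR_fact_neq_0. Qed.

Lemma factdecay_fc c : 1 <= Re c -> factdecay (fc c).
Proof.
  intros Hc. exists 1. split; [lra|]. intros j. unfold fc.
  rewrite Cmod_inv by (apply Cmult_neq_0'; [apply INR_fact_C|now apply poch_neq_0]).
  rewrite Cmod_mult, Cmod_RtoC_pos by apply pos_INR.
  pose proof (poch_ge c j Hc). pose proof (INR_fact_lt_0 j). unfold Rdiv. rewrite Rmult_1_l.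
  apply Rinv_le_contravar; [lra|]. nra.
Qed.

Lemma fc_rec c j : 1 <= Re c -> (RtoC (INR (S j)) * (c + RtoC (INR j)) * fc c (S j) = fc c j)%C.
Proof.
  intros Hc. unfold fc. rewrite fact_simpl, mult_INR, RtoC_mult.
  assert (H1 : RtoC (INR (S j)) <> RtoC 0) by (apply RtoC_neq_0, not_0_INR; lia).
  assert (H2 := INR_fact_C j). assert (H3 := poch_neq_0 c j Hc). assert (H4 := poch_neq_0 c (S j) Hc).
  unfold poch in *. rewrite CP_S in *.
  assert (H5 : (c + RtoC (INR j))%C <> RtoC 0).
  { intros E. apply H4. rewrite E. ring. }
  field. repeat split; assumption.
Qed.

(** The equation [x y'' + c y' = y] compared coefficientwise: [e] holds the coefficients of
    [y - c y'], and by [fc_rec] its [j]-th one is [j] times that of [y']. *)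
Lemma F01_ode c x : 1 <= Re c ->
  (RtoC x * Ser (dcoef (dcoef (fc c))) x + c * Ser (dcoef (fc c)) x = F01 c x)%C.
Proof.
  intros Hc. assert (H := factdecay_fc c Hc). assert (H1 := factdecay_dcoef _ H).
  unfold F01.
  set (e := fun j => (RtoC 1 * fc c j + (- c) * dcoef (fc c) j)%C).
  assert (He : forall j, (e j = RtoC (INR j) * dcoef (fc c) j)%C).
  { intros j. unfold e. rewrite <- (fc_rec c j Hc). unfold dcoef. ring. }
  assert (Hed : factdecay e) by now apply factdecay_lin.
  assert (E : Ser e x = (RtoC x * Ser (dcoef (dcoef (fc c))) x)%C).
  { rewrite (Ser_unfold e x Hed), (Ser_ext (fun j => e (S j)) (dcoef (dcoef (fc c))) x) by (intros j; apply He).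
    rewrite He. simpl INR. ring. }
  rewrite <- E. unfold e. rewrite (Ser_lin (fc c) (dcoef (fc c)) (RtoC 1) (- c)%C x H H1). ring.
Qed.

Lemma isD_Rcpow s x : 0 < x -> isD (fun x => Rcpow x s) x (s * RtoC (/ x) * Rcpow x s)%C.
Proof.
  intros Hx. eapply isD_eq.
  - apply (isD_cexp (fun x => s * RtoC (ln x))%C). apply isD_scal, isD_RtoC.
    apply is_derive_Reals, derivable_pt_lim_ln, Hx.
  - reflexivity.
Qed.

(* The Bessel equation as a trace-free first-order system, satisfied by [U = X (1 + s)] and [W = X (1 - s)]. *)
Definition bsys (s : C) (U W : R -> C) : Prop := forall x, 0 < x ->
  isD U x ((- U x + Rcpow x s * W x) / s)%C /\ isD W x ((- (U x / Rcpow x s) + W x) / s)%C.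

(** The derivative of a Wronskian is the trace times the Wronskian, here zero. *)
Lemma bsys_wronskian s U1 W1 U2 W2 x : s <> RtoC 0 -> bsys s U1 W1 -> bsys s U2 W2 -> 0 < x ->
  isD (fun x => U1 x * W2 x - U2 x * W1 x)%C x (RtoC 0).
Proof.
  intros Hs H1 H2 Hx. destruct (H1 x Hx) as [A1 B1]. destruct (H2 x Hx) as [A2 B2].
  apply (isD_ext (fun x => U1 x * W2 x + RtoC (-1) * (U2 x * W1 x))%C); [intros; ring|].
  eapply isD_eq.
  - apply isD_plus; [apply isD_mult; [exact A1|exact B2]|apply isD_scal, isD_mult; [exact A2|exact B1]].
  - pose proof (Rcpow_neq_0 x s). field. now split.
Qed.

(** By this symmetry one hypergeometric solution yields the second, with [s] replaced by [- s]. *)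
Lemma bsys_swap s U W : s <> RtoC 0 -> bsys s U W -> bsys (- s) W U.
Proof.
  intros Hs H x Hx. destruct (H x Hx) as [A B]. pose proof (Rcpow_neq_0 x s) as Hp. rewrite Rcpow_opp.
  split; (eapply isD_eq; [eassumption|]); field; repeat split; assumption.
Qed.

(** Both derivatives are multiples of [X s x], and the recurrence together with the reflection
    writes [s X s x] as [U - x^s W]. *)
Lemma bsys_X s : s <> RtoC 0 -> bsys s (X (RtoC 1 + s)) (X (RtoC 1 - s)).
Proof.
  intros Hs x Hx. pose proof (Rcpow_neq_0 x s) as Hp.
  assert (Hx' : RtoC x <> RtoC 0) by (apply RtoC_neq_0; lra).
  assert (E : forall s, (s * X s x = X (RtoC 1 + s) x - Rcpow x s * X (RtoC 1 - s) x)%C).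
  { intros u. rewrite X_rec by exact Hx. rewrite (X_reflect (u + RtoC (-1)) x Hx).
    replace (- (u + RtoC (-1)))%C with (RtoC 1 - u)%C by ring. rewrite Rcpow_plus.
    replace (Rcpow x (RtoC (-1))) with (/ RtoC x)%C.
    - replace (u + RtoC 1)%C with (RtoC 1 + u)%C by ring. field. exact Hx'.
    - rewrite Rcpow_R by exact Hx. replace (-1 * ln x) with (- ln x) by ring. rewrite exp_Ropp, exp_ln, RtoC_inv by lra. reflexivity. }
  split; (eapply isD_eq; [apply X_derive, Hx|]).
  - replace (RtoC 1 + s + RtoC (-1))%C with s by ring.
    replace (- X (RtoC 1 + s) x + Rcpow x s * X (RtoC 1 - s) x)%C with (- (s * X s x))%C by (rewrite E; ring).
    field. exact Hs.
  - replace (RtoC 1 - s + RtoC (-1))%C with (- s)%C by ring.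
    rewrite (X_reflect (- s) x Hx). replace (- - s)%C with s by ring. rewrite Rcpow_opp.
    replace (- (X (RtoC 1 + s) x / Rcpow x s) + X (RtoC 1 - s) x)%C with (- (s * X s x) / Rcpow x s)%C
      by (rewrite E; field; exact Hp).
    field. now split.
Qed.

(** The solution for which [U - x^s W], equal to [s X s] for the pair built from [X], is
    [s 0F1(; 1 - s; x)]; the system then determines both components. *)
Definition solU (s : C) (x : R) : C := (s * F01 (RtoC 1 - s) x - RtoC x * Ser (dcoef (fc (RtoC 1 - s))) x)%C.
Definition solW (s : C) (x : R) : C := (- (RtoC x * Ser (dcoef (fc (RtoC 1 - s))) x / Rcpow x s))%C.

Lemma bsys_F s : s <> RtoC 0 -> 1 <= Re (RtoC 1 - s)%C -> bsys s (solU s) (solW s).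
Proof.
  intros Hs Hc x Hx. set (c := (RtoC 1 - s)%C) in *. pose proof (Rcpow_neq_0 x s) as Hp.
  assert (Hx' : RtoC x <> RtoC 0) by (apply RtoC_neq_0; lra).
  assert (H := factdecay_fc c Hc). assert (H1 := factdecay_dcoef _ H).
  pose proof (F01_ode c x Hc) as O.
  assert (DA : isD (F01 c) x (Ser (dcoef (fc c)) x)) by exact (Ser_derive (fc c) x H).
  assert (DA1 : isD (Ser (dcoef (fc c))) x (Ser (dcoef (dcoef (fc c))) x)) by exact (Ser_derive _ x H1).
  assert (Dx : isD (fun x => RtoC x) x (RtoC 1)) by (apply isD_RtoC; exact (is_derive_id x)).
  set (A := F01 c) in *. set (A1 := Ser (dcoef (fc c))) in *. set (A2 := Ser (dcoef (dcoef (fc c))) x) in *.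
  assert (DxA : isD (fun x => RtoC x * A1 x)%C x (RtoC 1 * A1 x + RtoC x * A2)%C) by (apply isD_mult; assumption).
  split.
  - apply (isD_ext (fun x => s * A x + RtoC (-1) * (RtoC x * A1 x))%C); [intros; unfold solU; fold c; fold A; fold A1; ring|].
    eapply isD_eq; [apply isD_plus; apply isD_scal; [exact DA|exact DxA]|].
    unfold solU, solW. fold c; fold A; fold A1. rewrite <- O. unfold c. field. now split.
  - apply (isD_ext (fun x => RtoC (-1) * ((RtoC x * A1 x) * Rcpow x (- s)))%C).
    { intros u. unfold solW. fold c; fold A1. rewrite Rcpow_opp. field. apply Rcpow_neq_0. }
    eapply isD_eq; [apply isD_scal, isD_mult; [exact DxA|apply isD_Rcpow, Hx]|].
    unfold solU, solW. fold c; fold A; fold A1. rewrite Rcpow_opp, <- O, RtoC_inv by lra. unfold c. field. repeat split; assumption.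
Qed.

(** A limit at 0 with the rate [sqrt x] supplied by [X_at_0]; fixing the rate makes sums and
    products immediate. *)
Definition lim0 (f : R -> C) (l : C) : Prop := exists K, 0 <= K /\ forall x, 0 < x <= 1 -> Cmod (f x - l) <= K * sqrt x.

Lemma sqrt_le_1' x : 0 < x <= 1 -> 0 <= sqrt x <= 1 /\ x <= sqrt x.
Proof.
  intros Hx. assert (H : sqrt x <= 1) by (rewrite <- sqrt_1; apply sqrt_le_1; lra).
  pose proof (sqrt_pos x). split; [lra|]. rewrite <- (sqrt_sqrt x) at 1 by lra. nra.
Qed.

Lemma lim0_plus f g a b : lim0 f a -> lim0 g b -> lim0 (fun x => f x + g x)%C (a + b)%C.
Proof.
  intros [K1 [HK1 H1]] [K2 [HK2 H2]]. exists (K1 + K2). split; [lra|]. intros x Hx.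
  replace (f x + g x - (a + b))%C with ((f x - a) + (g x - b))%C by ring.
  eapply Rle_trans; [apply Cmod_triangle|]. specialize (H1 x Hx). specialize (H2 x Hx). lra.
Qed.

Lemma lim0_mult f g a b : lim0 f a -> lim0 g b -> lim0 (fun x => f x * g x)%C (a * b)%C.
Proof.
  intros [K1 [HK1 H1]] [K2 [HK2 H2]]. exists (K1 * K2 + (K1 * Cmod b + Cmod a * K2)).
  pose proof (Cmod_ge_0 a). pose proof (Cmod_ge_0 b). split; [nra|]. intros x Hx.
  replace (f x * g x - a * b)%C with ((f x - a) * (g x - b) + ((f x - a) * b + a * (g x - b)))%C by ring.
  eapply Rle_trans; [apply Cmod_triangle|]. eapply Rle_trans; [apply Rplus_le_compat_l, Cmod_triangle|].
  rewrite !Cmod_mult. specialize (H1 x Hx). specialize (H2 x Hx). destruct (sqrt_le_1' x Hx) as [S _].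
  pose proof (Cmod_ge_0 (f x - a)). pose proof (Cmod_ge_0 (g x - b)).
  assert (Cmod (f x - a) * Cmod (g x - b) <= K1 * sqrt x * (K2 * sqrt x)) by (apply Rmult_le_compat; assumption).
  assert (K1 * sqrt x * (K2 * sqrt x) <= K1 * K2 * sqrt x).
  { replace (K1 * sqrt x * (K2 * sqrt x)) with (K1 * K2 * sqrt x * sqrt x) by ring.
    rewrite <- (Rmult_1_r (K1 * K2 * sqrt x)) at 2. apply Rmult_le_compat_l; [|lra]. apply Rmult_le_pos; [nra|lra]. }
  assert (Cmod (f x - a) * Cmod b <= K1 * sqrt x * Cmod b) by (apply Rmult_le_compat_r; lra).
  assert (Cmod a * Cmod (g x - b) <= Cmod a * (K2 * sqrt x)) by (apply Rmult_le_compat_l; lra).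
  lra.
Qed.

Lemma lim0_const c : lim0 (fun _ => c) c.
Proof.
  exists 0. split; [lra|]. intros x _. replace (c - c)%C with (RtoC 0) by ring. rewrite Cmod_0. lra.
Qed.

Lemma lim0_minus f g a b : lim0 f a -> lim0 g b -> lim0 (fun x => f x - g x)%C (a - b)%C.
Proof.
  intros Hf Hg. replace (a - b)%C with (a + RtoC (-1) * b)%C by ring.
  replace (fun x => f x - g x)%C with (fun x => f x + RtoC (-1) * g x)%C by (apply functional_extensionality; intros; ring).
  apply lim0_plus; [exact Hf|]. apply lim0_mult; [apply lim0_const|exact Hg].
Qed.

Lemma lim0_x_bounded f : (exists K, 0 <= K /\ forall x, 0 < x <= 1 -> Cmod (f x) <= K) -> lim0 (fun x => RtoC x * f x)%C (RtoC 0).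
Proof.
  intros [K [HK H]]. exists K. split; [exact HK|]. intros x Hx.
  replace (RtoC x * f x - RtoC 0)%C with (RtoC x * f x)%C by ring. rewrite Cmod_mult, Cmod_RtoC_pos by lra.
  destruct (sqrt_le_1' x Hx) as [_ S]. specialize (H x Hx). nra.
Qed.

Lemma lim0_X s : 1 <= Re s -> lim0 (X s) (Gam s).
Proof.
  intros Hs. exists (XR (Re s - / 2) 0). split; [left; apply XR_pos, kcond_0; lra|].
  intros x Hx. rewrite Rmult_comm. apply (X_at_0 s x); lra.
Qed.

Lemma Ser_bounded01 a : factdecay a -> exists K, 0 <= K /\ forall x, 0 < x <= 1 -> Cmod (Ser a x) <= K.
Proof. intros H. destruct (Ser_bound_uniform a H) as [K [HK Hb]]. exists K. split; [exact HK|]. intros x Hx. apply Hb. lra. Qed.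

Lemma lim0_solU s : 1 <= Re (RtoC 1 - s)%C -> lim0 (solU s) s.
Proof.
  intros Hc. assert (H := factdecay_fc _ Hc). assert (H1 := factdecay_dcoef _ H).
  replace s with (s * RtoC 1 - RtoC 0)%C at 2 by ring. apply lim0_minus.
  - apply lim0_mult; [apply lim0_const|].
    replace (F01 (RtoC 1 - s)) with (fun x => RtoC 1 + RtoC x * Ser (fun j => fc (RtoC 1 - s) (S j)) x)%C.
    + pose proof (lim0_plus _ _ _ _ (lim0_const (RtoC 1))
        (lim0_x_bounded _ (Ser_bounded01 _ (factdecay_shift _ H)))) as L.
      replace (RtoC 1 + RtoC 0)%C with (RtoC 1) in L by ring. exact L.
    + apply functional_extensionality. intros x. unfold F01. rewrite (Ser_unfold _ x H). f_equal.
      unfold fc, poch; simpl. field.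
  - apply lim0_x_bounded, Ser_bounded01, H1.
Qed.

Lemma lim0_solW s : Re s = 0 -> lim0 (solW s) (RtoC 0).
Proof.
  intros Hs. assert (Hc : 1 <= Re (RtoC 1 - s)%C) by (unfold Re in *; simpl; lra).
  assert (H := factdecay_fc _ Hc). assert (H1 := factdecay_dcoef _ H).
  replace (solW s) with (fun x => RtoC x * (- Ser (dcoef (fc (RtoC 1 - s))) x / Rcpow x s))%C.
  - apply lim0_x_bounded. destruct (Ser_bounded01 _ H1) as [K [HK Hb]]. exists K. split; [exact HK|].
    intros x Hx. rewrite Cmod_div by apply Rcpow_neq_0. rewrite Cmod_opp, Cmod_Rcpow, Hs, Rmult_0_l, exp_0.
    unfold Rdiv. rewrite Rinv_1, Rmult_1_r. now apply Hb.
  - apply functional_extensionality. intros x. unfold solW. field. apply Rcpow_neq_0.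
Qed.

Lemma lim0_isD_const f l x : (forall x, 0 < x -> isD f x (RtoC 0)) -> lim0 f l -> 0 < x -> f x = l.
Proof.
  intros HD [K [HK H]] Hx. apply Cmod_small_eq. intros e He.
  set (d := Rmin 1 (Rmin x ((e / (K + 1)) ^ 2))).
  assert (He' : 0 < e / (K + 1)) by (apply Rdiv_lt_0_compat; lra).
  assert (Hd : 0 < d) by (apply Rmin_glb_lt; [lra|apply Rmin_glb_lt; [exact Hx|apply pow_lt; exact He']]).
  assert (Hd1 : d <= 1) by apply Rmin_l.
  assert (Hd2 : d <= x) by (eapply Rle_trans; [apply Rmin_r|apply Rmin_l]).
  assert (Hd3 : d <= (e / (K + 1)) ^ 2) by (eapply Rle_trans; [apply Rmin_r|apply Rmin_r]).
  rewrite (isD_zero_const f d x Hd2) by (intros u Hu; apply HD; lra).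
  eapply Rle_trans; [apply H; lra|].
  assert (sqrt d <= e / (K + 1)) by (rewrite <- (sqrt_pow2 (e / (K + 1))) by lra; apply sqrt_le_1; nra).
  apply Rle_trans with (K * (e / (K + 1))); [apply Rmult_le_compat_l; lra|].
  apply Rle_trans with ((K + 1) * (e / (K + 1))); [nra|right; field; lra].
Qed.

(** The Wronskians are constant, so they are read off at 0, where the three solutions tend to
    [(Gam (1 + s), Gam (1 - s))], [(s, 0)] and [(0, - s)]. Cramer's rule then expresses the first
    through the others. On the line [Re s = 0] the power [x^s] has modulus 1, which the limits
    use. *)
Lemma X_connection s x : Re s = 0 -> s <> RtoC 0 -> 0 < x ->
  (s * X s x = Gam (RtoC 1 + s) * F01 (RtoC 1 - s) x - Rcpow x s * Gam (RtoC 1 - s) * F01 (RtoC 1 + s) x)%C.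
Proof.
  intros Hs Hs0 Hx.
  assert (Hs0' : (- s)%C <> RtoC 0).
  { intros E. apply Hs0. replace s with (- - s)%C by ring. rewrite E. ring. }
  assert (Hsm : Re (- s)%C = 0) by (unfold Re in *; simpl; lra).
  assert (Hc1 : 1 <= Re (RtoC 1 - s)%C) by (unfold Re in *; simpl; lra).
  assert (Hc2 : 1 <= Re (RtoC 1 - - s)%C) by (unfold Re in *; simpl; lra).
  assert (Hc3 : 1 <= Re (RtoC 1 + s)%C) by (unfold Re in *; simpl; lra).
  set (U := X (RtoC 1 + s)). set (W := X (RtoC 1 - s)).
  set (U1 := solU s). set (W1 := solW s). set (U2 := solW (- s)). set (W2 := solU (- s)).
  assert (B : bsys s U W) by now apply bsys_X.
  assert (B1 : bsys s U1 W1) by now apply bsys_F.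
  assert (B2 : bsys s U2 W2).
  { replace s with (- - s)%C by ring. apply bsys_swap; [exact Hs0'|]. now apply bsys_F. }
  assert (LU : lim0 U (Gam (RtoC 1 + s))) by now apply lim0_X.
  assert (LW : lim0 W (Gam (RtoC 1 - s))) by now apply lim0_X.
  assert (LU1 : lim0 U1 s) by now apply lim0_solU.
  assert (LW1 : lim0 W1 (RtoC 0)) by now apply lim0_solW.
  assert (LU2 : lim0 U2 (RtoC 0)) by now apply lim0_solW.
  assert (LW2 : lim0 W2 (- s)%C) by now apply lim0_solU.
  assert (D1 : (U x * W1 x - U1 x * W x = - s * Gam (RtoC 1 - s))%C).
  { rewrite (lim0_isD_const (fun x => U x * W1 x - U1 x * W x)%C (Gam (RtoC 1 + s) * RtoC 0 - s * Gam (RtoC 1 - s))%C x); [ring| |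
      apply lim0_minus; now apply lim0_mult|exact Hx].
    intros v Hv. now apply bsys_wronskian with s. }
  assert (D2 : (U x * W2 x - U2 x * W x = - s * Gam (RtoC 1 + s))%C).
  { rewrite (lim0_isD_const (fun x => U x * W2 x - U2 x * W x)%C (Gam (RtoC 1 + s) * - s - RtoC 0 * Gam (RtoC 1 - s))%C x); [ring| |
      apply lim0_minus; now apply lim0_mult|exact Hx].
    intros v Hv. now apply bsys_wronskian with s. }
  assert (D12 : (U1 x * W2 x - U2 x * W1 x = - s * s)%C).
  { rewrite (lim0_isD_const (fun x => U1 x * W2 x - U2 x * W1 x)%C (s * - s - RtoC 0 * RtoC 0)%C x); [ring| |
      apply lim0_minus; now apply lim0_mult|exact Hx].
    intros v Hv. now apply bsys_wronskian with s. }
  set (p := Rcpow x s) in *.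
  assert (Hp : p <> RtoC 0) by apply Rcpow_neq_0.
  assert (E0 : (s * X s x = U x - p * W x)%C).
  { pose proof (X_derive (RtoC 1 + s) x Hx) as Da. destruct (B x Hx) as [Db _].
    assert (Ed : (- X (RtoC 1 + s + RtoC (-1)) x = (- U x + p * W x) / s)%C).
    { destruct Da as [Da1 Da2]. destruct Db as [Db1 Db2]. apply C_ext.
      - apply is_derive_unique in Da1. apply is_derive_unique in Db1. exact (eq_trans (eq_sym Da1) Db1).
      - apply is_derive_unique in Da2. apply is_derive_unique in Db2. exact (eq_trans (eq_sym Da2) Db2). }
    replace (RtoC 1 + s + RtoC (-1))%C with s in Ed by ring.
    replace (s * X s x)%C with (- (s * (- X s x)))%C by ring. rewrite Ed. field. exact Hs0. }
  assert (E1 : (U1 x - p * W1 x = s * F01 (RtoC 1 - s) x)%C).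
  { unfold U1, W1, solU, solW. fold p. field. exact Hp. }
  assert (E2 : (U2 x - p * W2 x = p * s * F01 (RtoC 1 + s) x)%C).
  { unfold U2, W2, solU, solW. rewrite Rcpow_opp. fold p.
    replace (RtoC 1 - - s)%C with (RtoC 1 + s)%C by ring. field. exact Hp. }
  (* The linear relation among three vectors of a plane, paired with the functional [(1, - p)]. *)
  assert (E3 : ((U x - p * W x) * (- s * s) = (U1 x - p * W1 x) * (- s * Gam (RtoC 1 + s)) - (U2 x - p * W2 x) * (- s * Gam (RtoC 1 - s)))%C).
  { rewrite <- D12, <- D1, <- D2. ring. }
  rewrite E1, E2, <- E0 in E3.
  replace (s * X s x)%C with (s * X s x * (- s * s) / (- s * s))%C by (field; repeat split; assumption).
  rewrite E3. field. repeat split; assumption.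
Qed.

(** * The function [CF] *)

Definition al (m : nat) : R := PI * (2 * INR m + 1).

Lemma al_pos m : 0 < al m.
Proof. unfold al. pose proof PI_RGT_0. pose proof (pos_INR m). nra. Qed.

Lemma al_ge_PI m : PI <= al m.
Proof. unfold al. pose proof PI_RGT_0. pose proof (pos_INR m). nra. Qed.

Lemma al_le m k : (m <= k)%nat -> al m <= al k.
Proof. intros H. apply le_INR in H. unfold al. pose proof PI_RGT_0. nra. Qed.

Definition dsum (n : nat) (f : nat -> nat -> C) : C := CS (fun m => CS (fun k => f m k) (S n)) (S n).

Lemma dsum_ext n f g : (forall m k, (m <= n)%nat -> (k <= n)%nat -> f m k = g m k) -> dsum n f = dsum n g.
Proof. intros H. apply CS_ext. intros m Hm. apply CS_ext. intros k Hk. apply H; lia. Qed.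

Lemma dsum_swap n f : dsum n f = dsum n (fun m k => f k m).
Proof. apply CS_swap. Qed.

Lemma dsum_conj n f : Cconj (dsum n f) = dsum n (fun m k => Cconj (f m k)).
Proof. unfold dsum. rewrite CS_conj. apply CS_ext. intros m _. apply CS_conj. Qed.

Lemma dsum_scal n c f : dsum n (fun m k => c * f m k)%C = (c * dsum n f)%C.
Proof. unfold dsum. rewrite <- CS_scal. apply CS_ext. intros m _. apply CS_scal. Qed.

Lemma dsum_plus n f g : dsum n (fun m k => f m k + g m k)%C = (dsum n f + dsum n g)%C.
Proof. unfold dsum. rewrite <- CS_plus. apply CS_ext. intros m _. apply CS_plus. Qed.

Lemma dsum_Cmod n f (g : nat -> nat -> R) : (forall m k, (m <= n)%nat -> (k <= n)%nat -> Cmod (f m k) <= g m k) ->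
  Cmod (dsum n f) <= RS (fun m => RS (fun k => g m k) (S n)) (S n).
Proof. intros H. apply CS_Cmod_le. intros m Hm. apply CS_Cmod_le. intros k Hk. apply H; lia. Qed.

Lemma phiF_dsum n a t : phiF n a t = dsum n (fun m k => a m * Cconj (a k) * RtoC (exp (- al m * exp t - al k * exp (- t))))%C.
Proof.
  unfold phiF. rewrite !Csum_CS. rewrite <- Cmult_assoc, <- CS_scal_r, <- CS_scal.
  apply CS_ext. intros m _. rewrite Cmult_comm, <- Cmult_assoc, <- !CS_scal_r, <- !CS_scal.
  apply CS_ext. intros k _.
  replace (- al m * exp t - al k * exp (- t)) with
    (- 2 * PI * cosh t + - 2 * PI * INR m * exp t + - 2 * PI * INR k * exp (- t)) by (unfold al, cosh; field).
  rewrite !exp_plus, !RtoC_mult. ring.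
Qed.

Lemma phiF_kernel n a s t : (phiF n a t * cexp (s * RtoC t))%C = dsum n (fun m k => a m * Cconj (a k) * ker (al m) (al k) s t)%C.
Proof.
  rewrite phiF_dsum, Cmult_comm, <- dsum_scal. apply dsum_ext. intros m k _ _.
  unfold ker. rewrite cexp_plus, cexp_R. ring.
Qed.

Lemma goodC_ker_al m k s : goodC (ker (al m) (al k) s).
Proof. apply goodC_ker. split; [apply al_pos|left; apply al_pos]. Qed.

Lemma goodC_phiF n a s : goodC (fun t => phiF n a t * cexp (s * RtoC t))%C.
Proof.
  apply goodC_ext with (fun t => dsum n (fun m k => a m * Cconj (a k) * ker (al m) (al k) s t)%C); [intros; symmetry; apply phiF_kernel|].
  apply (goodC_CS (fun m t => CS (fun k => a m * Cconj (a k) * ker (al m) (al k) s t)%C (S n))). intros m _.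
  apply (goodC_CS (fun k t => a m * Cconj (a k) * ker (al m) (al k) s t)%C). intros k _.
  apply (goodC_scal (a m * Cconj (a k)) (ker (al m) (al k) s)), goodC_ker_al.
Qed.

Lemma CF_IntC n a s : CF n a s = IntC (fun t => phiF n a t * cexp (s * RtoC t))%C.
Proof.
  unfold CF, XiF. rewrite <- IntC_RInt_gen by apply goodC_phiF. f_equal.
  apply functional_extensionality. intros t. do 2 f_equal.
  replace (Ci * (- Ci * s))%C with (- (Ci * Ci) * s)%C by ring.
  replace (Ci * Ci)%C with (RtoC (-1)) by (apply C_ext; simpl; ring).
  apply C_ext; simpl; ring.
Qed.

Definition cmk (a : nat -> C) (m k : nat) : C := (a m * Cconj (a k))%C.

Lemma CF_dsum n a s : CF n a s = dsum n (fun m k => cmk a m k * (Rcpow (al m) (- s) * X s (al m * al k)))%C.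
Proof.
  rewrite CF_IntC.
  rewrite (IntC_ext _ (fun t => dsum n (fun m k => a m * Cconj (a k) * ker (al m) (al k) s t)%C)) by (intros; apply phiF_kernel).
  unfold dsum.
  rewrite (IntC_CS (fun m t => CS (fun k => a m * Cconj (a k) * ker (al m) (al k) s t)%C (S n))).
  - apply CS_ext. intros m _. rewrite (IntC_CS (fun k t => a m * Cconj (a k) * ker (al m) (al k) s t)%C).
    + apply CS_ext. intros k _. rewrite (IntC_scal (a m * Cconj (a k)) (ker (al m) (al k) s)) by apply goodC_ker_al.
      f_equal. apply IntC_ker_scale; [apply al_pos|]. split; [apply al_pos|left; apply al_pos].
    + intros k _. apply (goodC_scal (a m * Cconj (a k)) (ker (al m) (al k) s)), goodC_ker_al.
  - intros m _. apply (goodC_CS (fun k t => a m * Cconj (a k) * ker (al m) (al k) s t)%C). intros k _.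
    apply (goodC_scal (a m * Cconj (a k)) (ker (al m) (al k) s)), goodC_ker_al.
Qed.

Lemma al2_pos m k : 0 < al m * al k.
Proof. apply Rmult_lt_0_compat; apply al_pos. Qed.

(** Conjugation exchanges [m] and [k] in the double sum, and [X_reflect] undoes the exchange. Hence
    [CF] is real on the imaginary axis and its zeros are symmetric about it. *)
Lemma CF_conj n a s : Cconj (CF n a s) = CF n a (- Cconj s).
Proof.
  rewrite !CF_dsum, dsum_conj, dsum_swap. apply dsum_ext. intros m k _ _. unfold cmk.
  rewrite !Cmult_conj, Cconj_conj, Rcpow_conj, X_conj by apply kcond_pos, al2_pos.
  rewrite (X_reflect (Cconj s) _ (al2_pos k m)), Rcpow_mult by apply al_pos.
  replace (Cconj (- s))%C with (- Cconj s)%C by (apply C_ext; simpl; ring).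
  replace (- - Cconj s)%C with (Cconj s) by ring.
  rewrite (Rmult_comm (al k) (al m)), Rcpow_opp. field. apply Rcpow_neq_0.
Qed.

Lemma CF_real n a y : Im (CF n a (Ci * RtoC y)%C) = 0.
Proof.
  pose proof (CF_conj n a (Ci * RtoC y)%C) as H.
  replace (- Cconj (Ci * RtoC y))%C with (Ci * RtoC y)%C in H by (apply C_ext; simpl; ring).
  apply (f_equal Im) in H. rewrite im_conj in H. lra.
Qed.

(** The maximum is at [e^t = c / pi]; with [v] the displacement from it, the inequality is
    [e^v >= 1 + v]. *)
Lemma kernel_max c t : 0 < c -> - PI * exp t + c * t <= c * (ln c - 1 - ln PI).
Proof.
  intros Hc. pose proof PI_RGT_0 as HP. set (v := t + ln PI - ln c).
  assert (E : PI * exp t = c * exp v).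
  { unfold v, Rminus. rewrite !exp_plus, exp_ln, exp_Ropp, exp_ln by assumption. field. lra. }
  pose proof (exp_ineq1_le v) as H. replace (- PI * exp t) with (- (PI * exp t)) by ring. rewrite E.
  assert (c * (1 + v) <= c * exp v) by (apply Rmult_le_compat_l; lra). unfold v in *. lra.
Qed.

(** The maximum of the kernel is taken with exponent [Re s + 1]; the spare unit leaves the
    integrable factor [exp (- pi e^(-t) - t)]. Negative [Re s] follows from [CF_conj]. *)
Lemma CF_growth n a : exists D, forall s,
  Cmod (CF n a s) <= exp ((Rabs (Re s) + 1) * (ln (Rabs (Re s) + 1) - 1 - ln PI) + D).
Proof.
  set (S1 := RS (fun m => RS (fun k => Cmod (cmk a m k)) (S n)) (S n)).
  assert (HS1 : 0 <= S1) by (apply RS_nonneg; intros; apply RS_nonneg; intros; apply Cmod_ge_0).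
  set (g := fun t => kerR PI 0 1 (- t)).
  assert (Gg : goodR g).
  { apply goodR_opp. apply goodR_kerR. split; [apply PI_RGT_0|right; lra]. }
  assert (HIg : 0 < IntR g) by (apply IntR_pos; [exact Gg|intros; apply kerR_pos]).
  exists (ln ((S1 + 1) * IntR g)).
  assert (Hp : forall s, 0 <= Re s -> Cmod (CF n a s) <= exp ((Rabs (Re s) + 1) * (ln (Rabs (Re s) + 1) - 1 - ln PI) + ln ((S1 + 1) * IntR g))).
  { intros s Hs. rewrite Rabs_pos_eq by exact Hs. rewrite exp_plus, exp_ln by nra.
    set (M := exp ((Re s + 1) * (ln (Re s + 1) - 1 - ln PI))).
    assert (HM : 0 < M) by apply exp_pos.
    rewrite CF_IntC. replace (M * ((S1 + 1) * IntR g)) with (M * (S1 + 1) * IntR g) by ring.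
    rewrite <- (IntR_scal (M * (S1 + 1)) g) by exact Gg.
    apply IntC_bound; [apply goodC_phiF|now apply goodR_scal|].
    intros t. rewrite phiF_kernel.
    assert (Hk : forall m k, kerR (al m) (al k) (Re s) t <= M * g t).
    { intros m k. unfold M, g, kerR. rewrite <- exp_plus. apply exp_mono.
      pose proof (kernel_max (Re s + 1) t ltac:(lra)). rewrite Ropp_involutive.
      pose proof (al_ge_PI m). pose proof (al_ge_PI k). pose proof (exp_pos t). pose proof (exp_pos (- t)).
      assert (PI * exp t <= al m * exp t) by (apply Rmult_le_compat_r; lra).
      assert (PI * exp (- t) <= al k * exp (- t)) by (apply Rmult_le_compat_r; lra). lra. }
    assert (HMg : 0 < M * g t) by (apply Rmult_lt_0_compat; [exact HM|apply kerR_pos]).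
    eapply Rle_trans.
    - apply (dsum_Cmod n _ (fun m k => M * g t * Cmod (cmk a m k))). intros m k _ _.
      rewrite Cmod_mult, Cmod_ker, Rmult_comm. apply Rmult_le_compat_r; [apply Cmod_ge_0|apply Hk].
    - rewrite (RS_ext _ (fun m => M * g t * RS (fun k => Cmod (cmk a m k)) (S n))) by (intros; apply RS_scal).
      rewrite RS_scal. fold S1. nra. }
  intros s. destruct (Rle_lt_dec 0 (Re s)) as [h|h]; [now apply Hp|].
  rewrite <- Cmod_conj, CF_conj.
  assert (E : Re (- Cconj s)%C = - Re s) by (unfold Re; simpl; ring).
  specialize (Hp (- Cconj s)%C). rewrite E, Rabs_Ropp in Hp. apply Hp. lra.
Qed.

Lemma exp_pow x k : exp x ^ k = exp (INR k * x).
Proof.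
  induction k as [|k IH]; [simpl; now rewrite Rmult_0_l, exp_0|].
  rewrite S_INR. simpl pow. rewrite IH, <- exp_plus. f_equal. ring.
Qed.

Lemma goodR_exp_abs B : goodR (fun t => B * exp (- Rabs t)).
Proof.
  split.
  - apply contR_mult; [apply contR_const|]. intros t. apply (continuous_comp (fun t => - Rabs t) exp); [|apply continuous_exp].
    apply (contR_opp Rabs). intros u. apply continuous_Rabs.
  - exists (Rabs B), 1. split; [lra|]. intros t. rewrite Rabs_mult, (Rabs_pos_eq (exp _)) by (left; apply exp_pos).
    right. do 2 f_equal. ring.
Qed.

(* Truncate the exponential series. *)
Lemma ent_laplace phi : contC phi -> (forall d, exists B, 0 < B /\ forall t, Cmod (phi t) <= B * exp (- d * Rabs t)) ->
  ent (fun s => IntC (fun t => phi t * cexp (s * RtoC t))%C).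
Proof.
  intros Hc Hd. apply ent_lim. intros r' e He.
  set (r := Rabs r'). assert (Hr : 0 <= r) by apply Rabs_pos.
  (* The Taylor remainder is at most [2^(-K) exp (3 r |t|)]; the last unit of decay is left for
     integrability. *)
  destruct (Hd (3 * r + 1)) as [B [HB Hb]].
  set (g := fun t => B * exp (- Rabs t)).
  assert (Gg : goodR g) by apply goodR_exp_abs.
  destruct (is_lim_pow2 (IntR g)) with (P := fun x : R => Rabs x < e) as [K HK].
  { exists (mkposreal e He). intros y Hy. change (Rabs (y - 0) < e) in Hy. now rewrite Rminus_0_r in Hy. }
  specialize (HK K (Nat.le_refl K)).
  assert (Gk : forall k, goodC (fun t => phi t * RtoC (t ^ k))%C).
  { intros k. destruct (Hd (INR k + 1)) as [Bk [HBk Hbk]].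
    apply goodC_le with (fun t => (Bk * INR (fact k) * exp (INR k)) * exp (- Rabs t)).
    - apply contC_mult; [exact Hc|]. apply contC_RtoC. apply contR_derive. intros t. auto_derive. trivial.
    - apply goodR_exp_abs.
    - intros t. rewrite Cmod_mult, Cmod_R, <- RPow_abs.
      assert (Hp : Rabs t ^ k <= exp (INR k * Rabs t)).
      { rewrite <- exp_pow. apply pow_incr. split; [apply Rabs_pos|]. pose proof (exp_ineq1_le (Rabs t)). lra. }
      assert (H1 : 1 <= INR (fact k) * exp (INR k)).
      { assert (1 <= INR (fact k)) by (apply (le_INR 1); pose proof (lt_O_fact k); lia).
        pose proof (exp_ineq1_le (INR k)). pose proof (pos_INR k). nra. }
      apply Rle_trans with (Bk * exp (- (INR k + 1) * Rabs t) * exp (INR k * Rabs t)).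
      + apply Rmult_le_compat; try apply Cmod_ge_0; [apply pow_le, Rabs_pos|apply Hbk|exact Hp].
      + rewrite Rmult_assoc, <- exp_plus. replace (- (INR k + 1) * Rabs t + INR k * Rabs t) with (- Rabs t) by ring.
        pose proof (exp_pos (- Rabs t)).
        replace (Bk * INR (fact k) * exp (INR k) * exp (- Rabs t)) with ((INR (fact k) * exp (INR k)) * (Bk * exp (- Rabs t))) by ring.
        rewrite <- (Rmult_1_l (Bk * exp (- Rabs t))) at 1. apply Rmult_le_compat_r; [|exact H1]. nra. }
  exists (fun s => CS (fun k => (RtoC (/ INR (fact k)) * IntC (fun t => phi t * RtoC (t ^ k))) * s ^ k)%C K). split.
  { apply (ent_CS (fun k s => (RtoC (/ INR (fact k)) * IntC (fun t => phi t * RtoC (t ^ k))) * s ^ k)%C). intros k _.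
    apply ent_scal. apply ent_pow, ent_id. }
  intros s Hs. assert (Hsr : Cmod s <= r) by (eapply Rle_trans; [exact Hs|apply RRle_abs]).
  set (F := fun k t => (RtoC (/ INR (fact k)) * s ^ k * (phi t * RtoC (t ^ k)))%C).
  assert (GF : forall k, goodC (F k)) by (intros k; apply (goodC_scal (RtoC (/ INR (fact k)) * s ^ k) (fun t => phi t * RtoC (t ^ k))%C), Gk).
  replace (CS (fun k => RtoC (/ INR (fact k)) * IntC (fun t => phi t * RtoC (t ^ k)) * s ^ k)%C K)
    with (IntC (fun t => CS (fun k => F k t) K)).
  2:{ rewrite (IntC_CS F) by (intros; apply GF). apply CS_ext. intros k _. unfold F.
      rewrite (IntC_scal (RtoC (/ INR (fact k)) * s ^ k) (fun t => phi t * RtoC (t ^ k))%C) by apply Gk. ring. }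
  assert (Gs : goodC (fun t => CS (fun k => F k t) K)) by (apply goodC_CS; intros; apply GF).
  assert (Hst : forall t, Cmod (s * RtoC t) <= r * Rabs t).
  { intros t. rewrite Cmod_mult, Cmod_R. apply Rmult_le_compat_r; [apply Rabs_pos|exact Hsr]. }
  assert (G1 : goodC (fun t => phi t * cexp (s * RtoC t))%C).
  { apply goodC_le with g; [|exact Gg|].
    - apply contC_mult; [exact Hc|]. apply contC_cexp, contC_mult; [apply contC_const|]. apply contC_RtoC. apply contR_derive. intros t. auto_derive. trivial.
    - intros t. rewrite Cmod_mult, Cmod_cexp.
      apply Rle_trans with (B * exp (- (3 * r + 1) * Rabs t) * exp (r * Rabs t)).
      + apply Rmult_le_compat; [apply Cmod_ge_0|left; apply exp_pos|apply Hb|]. apply exp_mono.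
        eapply Rle_trans; [apply RRle_abs|]. eapply Rle_trans; [apply re_le_Cmod|apply Hst].
      + rewrite Rmult_assoc, <- exp_plus. apply Rmult_le_compat_l; [lra|]. apply exp_mono. pose proof (Rabs_pos t). nra. }
  rewrite <- (IntC_minus (fun t => phi t * cexp (s * RtoC t))%C (fun t => CS (fun k => F k t) K)) by assumption.
  apply Rle_trans with (IntR (fun t => (/ 2) ^ K * g t)).
  2:{ rewrite (IntR_scal ((/ 2) ^ K) g) by exact Gg. rewrite Rmult_comm. pose proof (RRle_abs (IntR g * (/ 2) ^ K)). lra. }
  apply IntC_bound.
  - apply goodC_ext with (fun t => RtoC 1 * (phi t * cexp (s * RtoC t)) + RtoC (-1) * CS (fun k => F k t) K)%C; [intros; ring|].
    now apply (goodC_lin2 (RtoC 1) (RtoC (-1)) (fun t => phi t * cexp (s * RtoC t))%C (fun t => CS (fun k => F k t) K)).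
  - now apply goodR_scal.
  - intros t.
    replace (phi t * cexp (s * RtoC t) - CS (fun k => F k t) K)%C with (phi t * (cexp (s * RtoC t) - expT K (s * RtoC t)))%C.
    2:{ replace (phi t * (cexp (s * RtoC t) - expT K (s * RtoC t)))%C with (phi t * cexp (s * RtoC t) - phi t * expT K (s * RtoC t))%C by ring.
        f_equal. unfold expT. rewrite <- CS_scal. apply CS_ext. intros k _. unfold F. rewrite Cpow_mult_distr, RtoC_pow. ring. }
    rewrite Cmod_mult.
    pose proof (cexp_taylor_abs (s * RtoC t)%C K) as T.
    set (q := r * Rabs t) in *. assert (Hq : 0 <= q) by (apply Rmult_le_pos; [exact Hr|apply Rabs_pos]).
    pose proof (INR_fact_lt_0 K) as Hf.
    assert (T2 : Cmod (cexp (s * RtoC t) - expT K (s * RtoC t)) <= (/ 2) ^ K * exp (3 * q)).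
    { eapply Rle_trans; [exact T|].
      apply Rle_trans with (q ^ K / INR (fact K) * exp q).
      - apply Rmult_le_compat.
        + apply Rmult_le_pos; [apply pow_le, Cmod_ge_0|left; now apply Rinv_0_lt_compat].
        + left; apply exp_pos.
        + apply Rmult_le_compat_r; [left; now apply Rinv_0_lt_compat|]. apply pow_incr. split; [apply Cmod_ge_0|apply Hst].
        + apply exp_mono, Hst.
      - pose proof (pow_fact_le_exp (2 * q) K ltac:(lra)) as P. rewrite Rpow_mult_distr in P.
        replace (3 * q) with (2 * q + q) by ring. rewrite exp_plus, <- Rmult_assoc. apply Rmult_le_compat_r; [left; apply exp_pos|].
        rewrite pow_inv. apply Rmult_le_reg_l with (2 ^ K); [apply pow_lt; lra|].
        rewrite <- Rmult_assoc, Rinv_r, Rmult_1_l by (apply pow_nonzero; lra).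
        unfold Rdiv in *. rewrite <- Rmult_assoc. exact P. }
    apply Rle_trans with (B * exp (- (3 * r + 1) * Rabs t) * ((/ 2) ^ K * exp (3 * q))).
    + apply Rmult_le_compat; try apply Cmod_ge_0; [apply Hb|exact T2].
    + unfold g. replace (B * exp (- (3 * r + 1) * Rabs t) * ((/ 2) ^ K * exp (3 * q)))
        with ((/ 2) ^ K * (B * (exp (- (3 * r + 1) * Rabs t) * exp (3 * q)))) by ring.
      rewrite <- exp_plus. right. do 3 f_equal. unfold q. ring.
Qed.

Lemma contC_phiF n a : contC (phiF n a).
Proof.
  pose proof (goodC_contC _ (goodC_phiF n a (RtoC 0))) as H.
  replace (phiF n a) with (fun t => phiF n a t * cexp (RtoC 0 * RtoC t))%C; [exact H|].
  apply functional_extensionality. intros t. replace (RtoC 0 * RtoC t)%C with (RtoC 0) by ring. rewrite cexp_0. ring.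
Qed.

Lemma phiF_decay n a d : exists B, 0 < B /\ forall t, Cmod (phiF n a t) <= B * exp (- d * Rabs t).
Proof.
  set (S1 := RS (fun m => RS (fun k => Cmod (cmk a m k)) (S n)) (S n)).
  assert (HS1 : 0 <= S1) by (apply RS_nonneg; intros; apply RS_nonneg; intros; apply Cmod_ge_0).
  pose proof PI_RGT_0 as HP.
  destruct (kerR_decay PI PI 0 d HP HP) as [B [HB Hb]]. exists ((S1 + 1) * B). split; [nra|]. intros t.
  rewrite phiF_dsum. specialize (Hb t).
  assert (Hk0 : 0 < kerR PI PI 0 t) by apply kerR_pos.
  eapply Rle_trans.
  - apply (dsum_Cmod n _ (fun m k => kerR PI PI 0 t * Cmod (cmk a m k))). intros m k _ _.
    rewrite Cmod_mult, Cmod_RtoC_pos, Rmult_comm by (left; apply exp_pos). apply Rmult_le_compat_r; [apply Cmod_ge_0|].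
    apply exp_mono. pose proof (al_ge_PI m). pose proof (al_ge_PI k). pose proof (exp_pos t). pose proof (exp_pos (- t)).
    assert (PI * exp t <= al m * exp t) by (apply Rmult_le_compat_r; lra).
    assert (PI * exp (- t) <= al k * exp (- t)) by (apply Rmult_le_compat_r; lra). lra.
  - rewrite (RS_ext _ (fun m => kerR PI PI 0 t * RS (fun k => Cmod (cmk a m k)) (S n))) by (intros; apply RS_scal).
    rewrite RS_scal. fold S1.
    apply Rle_trans with (B * exp (- d * Rabs t) * (S1 + 1)); [apply Rmult_le_compat; lra|]. right. ring.
Qed.

Lemma ent_CF n a : ent (CF n a).
Proof.
  apply ent_ext with (fun s => IntC (fun t => phiF n a t * cexp (s * RtoC t))%C); [intros; symmetry; apply CF_IntC|].
  apply ent_laplace; [apply contC_phiF|apply phiF_decay].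
Qed.

(** * A zero-free sector *)

Lemma least_nat (P : nat -> Prop) : (exists n, P n) -> exists n, P n /\ forall m, (m < n)%nat -> ~ P m.
Proof.
  intros [n Hn]. revert Hn. induction n as [n IH] using lt_wf_ind. intros Hn.
  destruct (classic (exists m, (m < n)%nat /\ P m)) as [[m [Hm Pm]]|h].
  - now apply (IH m).
  - exists n. split; [exact Hn|]. intros m Hm Pm. apply h. now exists m.
Qed.

Lemma LP_peval l : exists p, forall s, peval p s = LP l s.
Proof.
  induction l as [|z l [p Hp]].
  - exists (RtoC 1 :: nil). intros s. simpl. ring.
  - destruct (peval_mult ((- z)%C :: RtoC 1 :: nil) p) as [q Hq]. exists q. intros s. rewrite Hq, Hp. simpl. ring.
Qed.

(* Test the moments against a Lagrange polynomial. *)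
Lemma moment_neq_0 n (b : nat -> C) k0 : (k0 <= n)%nat -> b k0 <> RtoC 0 ->
  exists j, CS (fun k => b k * RtoC (al k ^ j))%C (S n) <> RtoC 0.
Proof.
  intros Hk0 Hb. apply NNPP. intros Hn. apply Hb.
  assert (H0 : forall j, CS (fun k => b k * RtoC (al k ^ j))%C (S n) = RtoC 0).
  { intros j. apply NNPP. intros h. apply Hn. now exists j. }
  assert (HP : forall p j, CS (fun k => b k * (RtoC (al k ^ j) * peval p (RtoC (al k))))%C (S n) = RtoC 0).
  { induction p as [|c p IH]; intros j.
    - apply CS_zero. intros k _. simpl. ring.
    - rewrite (CS_ext _ (fun k => c * (b k * RtoC (al k ^ j)) + b k * (RtoC (al k ^ S j) * peval p (RtoC (al k))))%C).
      + rewrite CS_plus, CS_scal, H0, IH. ring.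
      + intros k _. change (al k ^ S j) with (al k * al k ^ j). rewrite RtoC_mult. simpl. ring. }
  set (zs := map (fun k => RtoC (al k)) (remove Nat.eq_dec k0 (seq 0 (S n)))).
  destruct (LP_peval zs) as [p Hp]. specialize (HP p O).
  assert (Hne : LP zs (RtoC (al k0)) <> RtoC 0).
  { apply LP_neq_0. intros Hi. apply in_map_iff in Hi. destruct Hi as [k [Ek Hk]]. apply in_remove in Hk.
    apply RtoC_inj in Ek. apply (proj2 Hk). apply INR_eq. unfold al in Ek. pose proof PI_RGT_0. nra. }
  assert (Hs : CS (fun k => b k * (RtoC (al k ^ 0) * peval p (RtoC (al k))))%C (S n) = (b k0 * LP zs (RtoC (al k0)))%C).
  { assert (G : forall f N, (k0 < N)%nat -> (forall k, (k < N)%nat -> k <> k0 -> f k = RtoC 0) -> CS f N = f k0).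
    { clear. intros f N. induction N as [|N IH]; intros H H0; [lia|]. rewrite CS_S.
      destruct (Nat.eq_dec k0 N) as [->|ne].
      - rewrite CS_zero; [ring|]. intros k Hk. apply H0; lia.
      - rewrite IH by (try lia; intros; apply H0; lia). rewrite (H0 N) by lia. ring. }
    rewrite G with (f := fun k => (b k * (RtoC (al k ^ 0) * peval p (RtoC (al k))))%C); [|lia|].
    - rewrite Hp. simpl. ring.
    - intros k Hk Hne'. rewrite Hp, LP_in_0; [ring|]. apply in_map_iff. exists k. split; [reflexivity|].
      apply in_in_remove; [exact Hne'|]. apply in_seq. lia. }
  rewrite Hs in HP. destruct (Cmult_eq_0 _ _ HP); [assumption|contradiction].
Qed.

Lemma CS_main_term (f : nat -> C) (g : nat -> R) j0 J : (j0 < J)%nat -> (forall j, (j < j0)%nat -> f j = RtoC 0) ->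
  (forall j, (j0 < j < J)%nat -> Cmod (f j) <= g (j - S j0)%nat) ->
  Cmod (CS f J - f j0) <= RS g (J - S j0).
Proof.
  intros HJ H0 Hg.
  assert (H : forall i, (S j0 + i <= J)%nat -> Cmod (CS f (S j0 + i) - f j0) <= RS g i).
  { induction i as [|i IH]; intros Hi.
    - rewrite Nat.add_0_r, CS_S, CS_zero by exact H0.
      replace (0 + f j0 - f j0)%C with (RtoC 0) by ring. rewrite Cmod_0. simpl. lra.
    - rewrite Nat.add_succ_r, CS_S, RS_S.
      replace (CS f (S j0 + i) + f (S j0 + i)%nat - f j0)%C with ((CS f (S j0 + i) - f j0) + f (S j0 + i)%nat)%C by ring.
      eapply Rle_trans; [apply Cmod_triangle|]. apply Rplus_le_compat; [apply IH; lia|].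
      eapply Rle_trans; [apply Hg; lia|]. right. f_equal. lia. }
  specialize (H (J - S j0)%nat ltac:(lia)). replace (S j0 + (J - S j0))%nat with J in H by lia. exact H.
Qed.

Lemma RS_geom_half h N : 0 <= h <= / 2 -> RS (fun i => h ^ S i) N <= 2 * h.
Proof.
  intros Hh. assert (H : RS (fun i => h ^ S i) N <= 2 * h - 2 * h * (/ 2) ^ N).
  { induction N as [|N IH]; [simpl; lra|]. rewrite RS_S. simpl pow in *.
    assert (h ^ N <= (/ 2) ^ N) by (apply pow_incr; lra).
    assert (h * h ^ N <= h * (/ 2) ^ N) by (apply Rmult_le_compat_l; lra). lra. }
  assert (0 <= h * (/ 2) ^ N) by (apply Rmult_le_pos; [lra|apply pow_le; lra]). lra.
Qed.

(** Each unit step to the left divides the modulus by at least [H], as long as the real part does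
    not drop below [H]. *)
Lemma Gam_descend s j0 i H : 0 < H -> H + INR (j0 + i) <= Re s ->
  H ^ i * Cmod (Gam (s + RtoC (- INR (j0 + i)))%C) <= Cmod (Gam (s + RtoC (- INR j0))%C).
Proof.
  intros HH. induction i as [|i IH]; intros Hs.
  - rewrite Nat.add_0_r. lra.
  - rewrite Nat.add_succ_r in *. rewrite S_INR in Hs.
    eapply Rle_trans; [|apply IH; lra].
    set (w := (s + RtoC (- INR (S (j0 + i))))%C).
    assert (Hw : H <= Re w) by (unfold w; rewrite S_INR; unfold Re in *; simpl; lra).
    replace (s + RtoC (- INR (j0 + i)))%C with (w + RtoC 1)%C.
    + rewrite Gam_rec by lra. rewrite Cmod_mult. simpl pow.
      replace (H * H ^ i * Cmod (Gam w)) with (H ^ i * (H * Cmod (Gam w))) by ring.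
      apply Rmult_le_compat_l; [apply pow_le; lra|]. apply Rmult_le_compat_r; [apply Cmod_ge_0|].
      eapply Rle_trans; [exact Hw|]. eapply Rle_trans; [apply RRle_abs|apply re_le_Cmod].
    + unfold w. rewrite S_INR. apply C_ext; simpl; ring.
Qed.

Lemma GamR_descend c j0 i H : 0 < H -> H + INR (j0 + i) <= c ->
  H ^ i * GamR (c - INR (j0 + i)) <= GamR (c - INR j0).
Proof.
  intros HH. induction i as [|i IH]; intros Hs.
  - rewrite Nat.add_0_r. lra.
  - rewrite Nat.add_succ_r in *. rewrite S_INR in *.
    eapply Rle_trans; [|apply IH; lra].
    set (w := c - (INR (j0 + i) + 1)).
    replace (c - INR (j0 + i)) with (w + 1) by (unfold w; ring).
    assert (Hw : H <= w) by (unfold w; lra).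
    rewrite GamR_rec by lra. simpl pow.
    replace (H * H ^ i * GamR w) with (H ^ i * (H * GamR w)) by ring.
    apply Rmult_le_compat_l; [apply pow_le; lra|]. apply Rmult_le_compat_r; [|exact Hw].
    left. apply GamR_pos. lra.
Qed.

(** The Dirichlet polynomial with terms [a_m al_m^(j - s)]; far to the right it is dominated by the
    first nonzero [a_m]. *)
Definition dirichlet (n : nat) (a : nat -> C) (j : nat) (s : C) : C := CS (fun m => a m * (Rcpow (al m) (- s) * RtoC (al m ^ j)))%C (S n).

Definition moment (n : nat) (a : nat -> C) (j : nat) : C :=
  (RtoC ((-1) ^ j / INR (fact j)) * CS (fun k => Cconj (a k) * RtoC (al k ^ j))%C (S n))%C.

(** Expanding in powers of [e^(-t)] separates the variables: the sum over [k] becomes a moment, the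
    sum over [m] a Dirichlet polynomial and the integral a Gamma value. *)
Lemma CF_expand n a s J : INR J < Re s ->
  CF n a s = (CS (fun j => moment n a j * dirichlet n a j s * Gam (s + RtoC (- INR j)))%C J
    + dsum n (fun m k => cmk a m k * (Rcpow (al m) (- s) *
       (X s (al m * al k) - CS (fun j => RtoC ((- (al m * al k)) ^ j / INR (fact j)) * X (s + RtoC (- INR j)) 0)%C J))))%C.
Proof.
  intros HJ.
  assert (E : CS (fun j => moment n a j * dirichlet n a j s * Gam (s + RtoC (- INR j)))%C J =
     dsum n (fun m k => cmk a m k * (Rcpow (al m) (- s) *
       CS (fun j => RtoC ((- (al m * al k)) ^ j / INR (fact j)) * X (s + RtoC (- INR j)) 0)%C J))%C).
  { unfold dsum.
    rewrite (CS_ext _ (fun m => CS (fun j => CS (fun k => cmk a m k * (Rcpow (al m) (- s) *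
        (RtoC ((- (al m * al k)) ^ j / INR (fact j)) * X (s + RtoC (- INR j)) 0)))%C (S n)) J) (S n)).
    2:{ intros m _. rewrite <- CS_swap. apply CS_ext. intros k _. rewrite CS_scal. f_equal. symmetry. apply CS_scal. }
    rewrite CS_swap. apply CS_ext. intros j _. unfold moment, dirichlet.
    rewrite <- (CS_scal (RtoC ((-1) ^ j / INR (fact j)))).
    rewrite (Cmult_comm (CS _ (S n))), <- CS_scal_r, <- CS_scal_r. apply CS_ext. intros m _.
    replace (a m * (Rcpow (al m) (- s) * RtoC (al m ^ j)) * CS (fun k => RtoC ((-1) ^ j / INR (fact j)) * (Cconj (a k) * RtoC (al k ^ j)))%C (S n) * Gam (s + RtoC (- INR j)))%C
      with (CS (fun k => RtoC ((-1) ^ j / INR (fact j)) * (Cconj (a k) * RtoC (al k ^ j)))%C (S n) * (a m * (Rcpow (al m) (- s) * RtoC (al m ^ j)) * Gam (s + RtoC (- INR j))))%C by ring.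
    rewrite <- CS_scal_r. apply CS_ext. intros k _. unfold cmk, Gam.
    replace (- (al m * al k)) with (-1 * al m * al k) by ring. rewrite !Rpow_mult_distr.
    unfold Rdiv. rewrite !RtoC_mult. ring. }
  rewrite E, <- dsum_plus, CF_dsum. apply dsum_ext. intros m k _ _. ring.
Qed.

Lemma moment_bound n a j B A : 1 <= B -> al n <= B -> RS (fun k => Cmod (a k)) (S n) <= A -> Cmod (moment n a j) <= A * B ^ j.
Proof.
  intros HB Hal HA. unfold moment. rewrite Cmod_mult.
  assert (H1 : Cmod (RtoC ((-1) ^ j / INR (fact j))) <= 1).
  { rewrite Cmod_R. unfold Rdiv. rewrite Rabs_mult, pow_1_abs, Rmult_1_l, Rabs_inv.
    rewrite Rabs_pos_eq by (left; apply INR_fact_lt_0). rewrite <- Rinv_1. apply Rinv_le_contravar; [lra|].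
    apply (le_INR 1). pose proof (lt_O_fact j). lia. }
  assert (H2 : Cmod (CS (fun k => Cconj (a k) * RtoC (al k ^ j))%C (S n)) <= A * B ^ j).
  { eapply Rle_trans; [apply (CS_Cmod_le _ (fun k => B ^ j * Cmod (a k)))|].
    - intros k Hk. rewrite Cmod_mult, Cmod_conj, Rmult_comm. apply Rmult_le_compat_r; [apply Cmod_ge_0|].
      pose proof (al_pos k). rewrite Cmod_RtoC_pos by (apply pow_le; lra). apply pow_incr.
      pose proof (al_le k n ltac:(lia)). lra.
    - rewrite RS_scal, Rmult_comm. apply Rmult_le_compat_r; [apply pow_le; lra|exact HA]. }
  rewrite <- (Rmult_1_l (A * B ^ j)). apply Rmult_le_compat; try apply Cmod_ge_0; assumption.
Qed.

Lemma coef_Rcpow_bound n a m0 m s : (forall k, (k < m0)%nat -> a k = RtoC 0) -> (m <= n)%nat -> 0 <= Re s ->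
  Cmod (a m * Rcpow (al m) (- s)) <= Cmod (a m) * exp (- Re s * ln (al m0)).
Proof.
  intros H0 Hm Hs. rewrite Cmod_mult. destruct (Nat.lt_ge_cases m m0) as [h|h].
  - rewrite (H0 m h), Cmod_0. lra.
  - apply Rmult_le_compat_l; [apply Cmod_ge_0|]. rewrite Cmod_Rcpow. apply exp_mono.
    change (Re (- s)%C) with (- Re s).
    assert (ln (al m0) <= ln (al m)) by (apply ln_le; [apply al_pos|now apply al_le]). nra.
Qed.

Lemma dirichlet_bound n a m0 j s B A : 1 <= B -> al n <= B -> RS (fun k => Cmod (a k)) (S n) <= A ->
  (forall k, (k < m0)%nat -> a k = RtoC 0) -> 0 <= Re s ->
  Cmod (dirichlet n a j s) <= A * B ^ j * exp (- Re s * ln (al m0)).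
Proof.
  intros HB Hal HA H0 Hs. set (E := exp (- Re s * ln (al m0))).
  assert (HE : 0 < E) by apply exp_pos.
  eapply Rle_trans; [apply (CS_Cmod_le _ (fun k => (B ^ j * E) * Cmod (a k)))|].
  - intros k Hk. rewrite Cmult_assoc, Cmod_mult.
    pose proof (coef_Rcpow_bound n a m0 k s H0 ltac:(lia) Hs) as C1.
    pose proof (al_pos k). pose proof (al_le k n ltac:(lia)).
    rewrite Cmod_RtoC_pos by (apply pow_le; lra).
    assert (al k ^ j <= B ^ j) by (apply pow_incr; lra).
    assert (0 <= al k ^ j) by (apply pow_le; lra).
    replace (B ^ j * E * Cmod (a k)) with (Cmod (a k) * E * B ^ j) by ring.
    apply Rmult_le_compat; try assumption. apply Cmod_ge_0.
  - rewrite RS_scal. replace (A * B ^ j * E) with (B ^ j * E * A) by ring.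
    apply Rmult_le_compat_l; [|exact HA]. apply Rmult_le_pos; [apply pow_le; lra|lra].
Qed.

Lemma dirichlet_lower n a m0 j : (m0 <= n)%nat -> a m0 <> RtoC 0 -> (forall k, (k < m0)%nat -> a k = RtoC 0) ->
  exists d s1, 0 < d /\ 0 <= s1 /\ forall s, s1 <= Re s -> d * exp (- Re s * ln (al m0)) <= Cmod (dirichlet n a j s).
Proof.
  intros Hm0 Ha H0. pose proof (al_pos m0) as Hp0. pose proof (Cmod_pos _ Ha) as Hc.
  set (c := Cmod (a m0) * al m0 ^ j). assert (Hcp : 0 < c) by (apply Rmult_lt_0_compat; [exact Hc|now apply pow_lt]).
  set (K := RS (fun k => Cmod (a k) * al k ^ j) (S n) + 1).
  assert (HK : 0 < K).
  { assert (0 <= RS (fun k => Cmod (a k) * al k ^ j) (S n)); [|unfold K; lra]. apply RS_nonneg. intros k _.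
    apply Rmult_le_pos; [apply Cmod_ge_0|apply pow_le; left; apply al_pos]. }
  set (L := ln (al (S m0)) - ln (al m0)).
  assert (HL : 0 < L).
  { unfold L. assert (al m0 < al (S m0)) by (unfold al; rewrite S_INR; pose proof PI_RGT_0; nra).
    pose proof (ln_increasing _ _ Hp0 H). lra. }
  (* The leading term has modulus [c E], the others together at most [K E exp (- Re s L)]; the
     threshold makes the latter at most half of the former. *)
  exists (c / 2), (Rmax 0 (ln (2 * K / c) / L)). split; [lra|]. split; [apply Rmax_l|]. intros s Hs.
  assert (Hs0 : 0 <= Re s) by (eapply Rle_trans; [apply Rmax_l|exact Hs]).
  assert (Hs1 : ln (2 * K / c) / L <= Re s) by (eapply Rle_trans; [apply Rmax_r|exact Hs]).
  assert (Hs2 : exp (- Re s * L) <= c / (2 * K)).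
  { apply Rle_trans with (exp (- ln (2 * K / c))).
    - apply exp_mono. assert (ln (2 * K / c) / L * L <= Re s * L) by (apply Rmult_le_compat_r; lra).
      replace (ln (2 * K / c) / L * L) with (ln (2 * K / c)) in H by (field; lra). lra.
    - rewrite exp_Ropp, exp_ln by (apply Rdiv_lt_0_compat; lra). right. field. lra. }
  set (E := exp (- Re s * ln (al m0))). assert (HE : 0 < E) by apply exp_pos.
  assert (HD : Cmod (dirichlet n a j s - a m0 * (Rcpow (al m0) (- s) * RtoC (al m0 ^ j))) <= K * (E * exp (- Re s * L))).
  {
    assert (G : forall N, (m0 < N)%nat -> Cmod (CS (fun m => a m * (Rcpow (al m) (- s) * RtoC (al m ^ j)))%C N - a m0 * (Rcpow (al m0) (- s) * RtoC (al m0 ^ j)))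
        <= RS (fun k => Cmod (a k) * al k ^ j) N * (E * exp (- Re s * L))).
    { assert (Hpp : 0 < E * exp (- Re s * L)) by (apply Rmult_lt_0_compat; [exact HE|apply exp_pos]).
      induction N as [|N IH]; intros HN; [lia|]. rewrite CS_S, RS_S. destruct (Nat.eq_dec m0 N) as [<-|ne].
      - rewrite CS_zero.
        + match goal with |- Cmod ?z <= _ => replace z with (RtoC 0) by ring end. rewrite Cmod_0.
          apply Rmult_le_pos; [|lra]. apply Rplus_le_le_0_compat.
          * apply RS_nonneg. intros k _. apply Rmult_le_pos; [apply Cmod_ge_0|apply pow_le; left; apply al_pos].
          * apply Rmult_le_pos; [apply Cmod_ge_0|apply pow_le; lra].
        + intros k Hk. rewrite H0 by exact Hk. ring.
      - match goal with |- Cmod (?u + ?v - ?w) <= _ => replace (u + v - w)%C with ((u - w) + v)%C by ring end.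
        eapply Rle_trans; [apply Cmod_triangle|]. rewrite Rmult_plus_distr_r. apply Rplus_le_compat; [apply IH; lia|].
        rewrite !Cmod_mult, Cmod_Rcpow. change (Re (- s)%C) with (- Re s).
        rewrite Cmod_RtoC_pos by (apply pow_le; left; apply al_pos).
        replace (Cmod (a N) * (exp (- Re s * ln (al N)) * al N ^ j)) with (Cmod (a N) * al N ^ j * exp (- Re s * ln (al N))) by ring.
        apply Rmult_le_compat_l; [apply Rmult_le_pos; [apply Cmod_ge_0|apply pow_le; left; apply al_pos]|].
        unfold E. rewrite <- exp_plus. apply exp_mono. unfold L.
        assert (ln (al (S m0)) <= ln (al N)) by (apply ln_le; [apply al_pos|apply al_le; lia]). nra. }
    eapply Rle_trans; [apply G; lia|]. apply Rmult_le_compat_r; [|unfold K; lra].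
    apply Rmult_le_pos; [lra|left; apply exp_pos]. }
  assert (HM : Cmod (a m0 * (Rcpow (al m0) (- s) * RtoC (al m0 ^ j))) = c * E).
  { rewrite !Cmod_mult, Cmod_Rcpow. change (Re (- s)%C) with (- Re s). rewrite Cmod_RtoC_pos by (apply pow_le; lra).
    unfold c, E. ring. }
  pose proof (Cmod_sub_le (a m0 * (Rcpow (al m0) (- s) * RtoC (al m0 ^ j)))%C (dirichlet n a j s)) as T.
  rewrite Cmod_sub_sym, HM in T.
  assert (K * (E * exp (- Re s * L)) <= K * (E * (c / (2 * K)))).
  { apply Rmult_le_compat_l; [lra|]. apply Rmult_le_compat_l; [lra|exact Hs2]. }
  replace (K * (E * (c / (2 * K)))) with (c / 2 * E) in H by (field; lra). lra.
Qed.

(** Here [sg > Re s / 2], so in the sector the exponent [(Im s)^2 / (2 sg)] of [Gam_lower] is at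
    most [Re s], and only an exponential factor is lost. *)
Lemma Gam_sector s j0 : 2 * (INR j0 + 1) < Re s -> Rabs (Im s) <= Re s ->
  GamR (Re s - INR j0) * exp (- Re s) <= Cmod (Gam (s + RtoC (- INR j0))%C).
Proof.
  intros Hs Hy. pose proof (pos_INR j0) as Hj. set (sg := Re s - INR j0 - 1). assert (Hsg : 0 < sg) by (unfold sg; lra).
  pose proof (Gam_lower sg (Im s) Hsg) as L.
  replace (RtoC 1 + (RtoC sg + Ci * RtoC (Im s)))%C with (s + RtoC (- INR j0))%C in L.
  2:{ unfold sg. destruct s as [x y]. apply C_ext; simpl; ring. }
  replace (1 + sg) with (Re s - INR j0) in L by (unfold sg; ring).
  eapply Rle_trans; [|exact L]. apply Rmult_le_compat_l; [left; apply GamR_pos; lra|].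
  apply exp_mono. apply Ropp_le_contravar.
  assert (Hq : Im s ^ 2 <= Re s ^ 2) by (rewrite <- pow2_abs; apply pow_incr; split; [apply Rabs_pos|exact Hy]).
  apply Rmult_le_reg_r with (2 * sg); [lra|]. unfold Rdiv. rewrite Rmult_assoc, Rinv_l by lra. unfold sg. nra.
Qed.

(** In [CF_expand] the term of the first nonvanishing moment dominates. Every further term loses a
    factor [B^2 / H] with [H = Re s / 2]. Truncation at the integer part [J] of [H] leaves a
    relative error of order [Q^J / H^(J - j0)], where [Q] absorbs the exponential loss of
    [Gam_sector]. Both errors are [O(1 / H)]. *)
Lemma CF_zero_free_right n a : (exists m, (m <= n)%nat /\ a m <> RtoC 0) ->
  exists C0, forall s, C0 <= Re s -> Rabs (Im s) <= Re s -> CF n a s <> RtoC 0.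
Proof.
  intros Ha.
  destruct (least_nat (fun m => (m <= n)%nat /\ a m <> RtoC 0) Ha) as [m0 [[Hm0 Ham0] Hmin]].
  assert (H0 : forall k, (k < m0)%nat -> a k = RtoC 0).
  { intros k Hk. apply NNPP. intros h. apply (Hmin k Hk). split; [lia|exact h]. }
  assert (Hex : exists j, moment n a j <> RtoC 0).
  { destruct (moment_neq_0 n (fun k => Cconj (a k)) m0 Hm0) as [j Hj].
    - intros E. apply Ham0. rewrite <- (Cconj_conj (a m0)), E. apply C_ext; simpl; ring.
    - exists j. apply Cmult_neq_0'; [|exact Hj]. apply RtoC_neq_0.
      apply Rmult_integral_contrapositive_currified; [apply pow_nonzero; lra|apply Rinv_neq_0_compat, INR_fact_neq_0]. }
  destruct (least_nat _ Hex) as [j0 [Hj0 Hjmin]].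
  assert (Hj0' : forall j, (j < j0)%nat -> moment n a j = RtoC 0).
  { intros j Hj. apply NNPP. now apply Hjmin. }
  pose proof (Cmod_pos _ Hj0) as Hmu. set (mu := Cmod (moment n a j0)) in *.
  set (B := al n). assert (HB : 1 <= B) by (unfold B; pose proof (al_ge_PI n); pose proof PI2_1; lra).
  set (A := RS (fun k => Cmod (a k)) (S n)).
  assert (HA : 0 <= A) by (apply RS_nonneg; intros; apply Cmod_ge_0).
  destruct (dirichlet_lower n a m0 j0 Hm0 Ham0 H0) as [d [s1 [Hd [Hs1 HD]]]].
  set (Q := B ^ 2 * exp 2).
  assert (He2 : 1 <= exp 2) by (pose proof (exp_ineq1_le 2); lra).
  assert (HB2 : 1 <= B ^ 2) by (rewrite <- (pow1 2); apply pow_incr; lra).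
  assert (HQB : B ^ 2 <= Q) by (unfold Q; nra).
  set (Z := A ^ 2 * (2 * Q ^ S j0 + exp 2 * Q ^ S j0)).
  (* The thresholds serve the lower bound of the Dirichlet polynomial, the inequalities [h <= 1 / 2]
     and [Q <= H], the inequality [j0 < J], and the final contradiction with [H <= Z / (mu d)]. *)
  exists (Rmax (Rmax s1 (4 * Q)) (Rmax (2 * INR j0 + 4) (2 * (Z / (mu * d)) + 2))). intros s Hs Hy E0.
  assert (C1 : s1 <= Re s) by (eapply Rle_trans; [|exact Hs]; eapply Rle_trans; [|apply Rmax_l]; apply Rmax_l).
  assert (C2 : 4 * Q <= Re s) by (eapply Rle_trans; [|exact Hs]; eapply Rle_trans; [|apply Rmax_l]; apply Rmax_r).
  assert (C3 : 2 * INR j0 + 4 <= Re s) by (eapply Rle_trans; [|exact Hs]; eapply Rle_trans; [|apply Rmax_r]; apply Rmax_l).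
  assert (C4 : 2 * (Z / (mu * d)) + 2 <= Re s) by (eapply Rle_trans; [|exact Hs]; eapply Rle_trans; [|apply Rmax_r]; apply Rmax_r).
  set (H := Re s / 2). assert (HH : 2 <= H) by (unfold H; lra).
  destruct (nfloor_ex H ltac:(lra)) as [J [HJ1 HJ2]].
  assert (HJj : (j0 < J)%nat).
  { apply INR_lt. unfold H in HJ2. lra. }
  set (E := exp (- Re s * ln (al m0))). assert (HE : 0 < E) by apply exp_pos.
  set (G0 := Cmod (Gam (s + RtoC (- INR j0))%C)).
  assert (HGs : GamR (Re s - INR j0) * exp (- Re s) <= G0) by (apply Gam_sector; [lra|exact Hy]).
  assert (HG0 : 0 < G0).
  { eapply Rlt_le_trans; [|exact HGs]. apply Rmult_lt_0_compat; [apply GamR_pos; lra|apply exp_pos]. }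
  assert (HJs : INR J < Re s) by (unfold H in HJ1; lra).
  rewrite (CF_expand n a s J HJs) in E0.
  set (f := fun j => (moment n a j * dirichlet n a j s * Gam (s + RtoC (- INR j)))%C) in *.
  set (h := B ^ 2 / H).
  assert (HHi : 0 < / H) by (apply Rinv_0_lt_compat; lra).
  assert (Hh : 0 <= h <= / 2).
  { unfold h. split; [apply Rmult_le_pos; lra|]. apply Rmult_le_reg_r with H; [lra|].
    unfold Rdiv. rewrite Rmult_assoc, Rinv_l by lra. unfold H. nra. }
  assert (HfM : mu * d * E * G0 <= Cmod (f j0)).
  { unfold f. rewrite !Cmod_mult. fold mu. fold G0. apply Rmult_le_compat_r; [lra|]. rewrite Rmult_assoc.
    apply Rmult_le_compat_l; [lra|]. apply HD. exact C1. }
  assert (HfT : Cmod (CS f J - f j0) <= A ^ 2 * E * G0 * B ^ (2 * j0) * (2 * h)).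
  { eapply Rle_trans.
    - apply (CS_main_term f (fun i => A ^ 2 * E * G0 * B ^ (2 * j0) * h ^ S i) j0 J HJj).
      + intros j Hj. unfold f. rewrite Hj0' by exact Hj. ring.
      + intros j Hj. unfold f. rewrite !Cmod_mult.
        set (i := (j - j0)%nat). assert (Ej : j = (j0 + i)%nat) by (unfold i; lia).
        replace (S (j - S j0)) with i by (unfold i; lia).
        pose proof (Gam_descend s j0 i H ltac:(lra)) as GD. rewrite <- Ej in GD. fold G0 in GD.
        assert (HjJ : INR j <= INR J) by (apply le_INR; lia).
        specialize (GD ltac:(unfold H in *; lra)).
        assert (GD' : Cmod (Gam (s + RtoC (- INR j))%C) <= G0 * (/ H) ^ i).
        { assert (Hp : 0 < H ^ i) by (apply pow_lt; lra). apply Rmult_le_reg_l with (H ^ i); [exact Hp|].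
          replace (H ^ i * (G0 * (/ H) ^ i)) with (G0 * (H ^ i * (/ H) ^ i)) by ring.
          rewrite <- Rpow_mult_distr, Rinv_r, pow1 by lra. lra. }
        pose proof (moment_bound n a j B A HB (Rle_refl _) (Rle_refl _)) as M1.
        pose proof (dirichlet_bound n a m0 j s B A HB (Rle_refl _) (Rle_refl _) H0 ltac:(lra)) as M2.
        apply Rle_trans with (A * B ^ j * (A * B ^ j * E) * (G0 * (/ H) ^ i)).
        * apply Rmult_le_compat; try apply Cmod_ge_0; [| |exact GD'].
          -- apply Rmult_le_pos; apply Cmod_ge_0.
          -- apply Rmult_le_compat; try apply Cmod_ge_0; assumption.
        * right. rewrite Ej. unfold h, Rdiv. rewrite Rpow_mult_distr, <- pow_mult, pow_add.
          replace (2 * j0)%nat with (j0 + j0)%nat by lia. replace (2 * i)%nat with (i + i)%nat by lia. rewrite !pow_add. ring.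
    - rewrite RS_scal. apply Rmult_le_compat_l.
      + repeat apply Rmult_le_pos; try apply pow_le; lra.
      + apply RS_geom_half, Hh. }
  set (Rm := dsum n _) in E0.
  assert (HRm : Cmod Rm <= A ^ 2 * E * G0 * (exp 2 * Q ^ S j0 * / H)).
  { assert (HX : forall m k, (m <= n)%nat -> (k <= n)%nat ->
       Cmod (X s (al m * al k) - CS (fun j => RtoC ((- (al m * al k)) ^ j / INR (fact j)) * X (s + RtoC (- INR j)) 0)%C J) <= G0 * (exp 2 * Q ^ S j0 * / H)).
    { intros m k Hm Hk. eapply Rle_trans; [apply X_taylor; [exact HJs|apply al2_pos]|].
      pose proof (al_pos m). pose proof (al_pos k). pose proof (al_le m n Hm) as Hmn. pose proof (al_le k n Hk) as Hkn.
      fold B in Hmn, Hkn.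
      assert (X1 : (al m * al k) ^ J / INR (fact J) <= (B ^ 2) ^ J).
      { apply Rle_trans with ((al m * al k) ^ J * 1).
        - apply Rmult_le_compat_l; [apply pow_le; nra|]. rewrite <- Rinv_1. apply Rinv_le_contravar; [lra|].
          apply (le_INR 1). pose proof (lt_O_fact J). lia.
        - rewrite Rmult_1_r. apply pow_incr. split; [nra|]. nra. }
      pose proof (GamR_descend (Re s) j0 (J - j0) H ltac:(lra)) as GD.
      replace (j0 + (J - j0))%nat with J in GD by lia. specialize (GD ltac:(unfold H in *; lra)).
      assert (Hgp : 0 < GamR (Re s - INR J)) by (apply GamR_pos; lra).
      apply Rle_trans with ((B ^ 2) ^ J * GamR (Re s - INR J)); [apply Rmult_le_compat_r; lra|].
      assert (Hp : 0 < H ^ (J - j0)) by (apply pow_lt; lra).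
      apply Rmult_le_reg_l with (H ^ (J - j0)); [exact Hp|].
      apply Rle_trans with ((B ^ 2) ^ J * (G0 * exp (Re s))).
      - replace (H ^ (J - j0) * ((B ^ 2) ^ J * GamR (Re s - INR J))) with ((B ^ 2) ^ J * (H ^ (J - j0) * GamR (Re s - INR J))) by ring.
        apply Rmult_le_compat_l; [apply pow_le; lra|]. eapply Rle_trans; [exact GD|].
        apply Rmult_le_reg_r with (exp (- Re s)); [apply exp_pos|].
        rewrite Rmult_assoc, <- exp_plus, Rplus_opp_r, exp_0. lra.
      (* Because [Re s = 2 H] and [H < J + 1]. *)
      - assert (Eexp : exp (Re s) <= exp 2 * exp 2 ^ J).
        { rewrite exp_pow, <- exp_plus. apply exp_mono. unfold H in HJ2. lra. }
        apply Rle_trans with ((B ^ 2) ^ J * (G0 * (exp 2 * exp 2 ^ J))).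
        + apply Rmult_le_compat_l; [apply pow_le; lra|]. apply Rmult_le_compat_l; lra.
        + replace ((B ^ 2) ^ J * (G0 * (exp 2 * exp 2 ^ J))) with (G0 * exp 2 * Q ^ J) by (unfold Q; rewrite Rpow_mult_distr; ring).
          replace (H ^ (J - j0) * (G0 * (exp 2 * Q ^ S j0 * / H))) with (G0 * exp 2 * (Q ^ S j0 * (H ^ (J - j0) * / H))) by ring.
          apply Rmult_le_compat_l; [nra|].
          replace (J - j0)%nat with (S (J - S j0)) by lia. replace J with (S j0 + (J - S j0))%nat at 1 by lia.
          rewrite pow_add. apply Rmult_le_compat_l; [apply pow_le; lra|].
          replace (H ^ S (J - S j0) * / H) with (H ^ (J - S j0)) by (simpl; field; lra).
          apply pow_incr. unfold H. lra. }
    eapply Rle_trans.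
    - apply (dsum_Cmod n _ (fun m k => G0 * (exp 2 * Q ^ S j0 * / H) * E * Cmod (a m) * Cmod (a k))). intros m k Hm Hk.
      unfold cmk.
      match goal with |- Cmod (a m * Cconj (a k) * (Rcpow (al m) (- s) * ?z)) <= _ =>
        replace (a m * Cconj (a k) * (Rcpow (al m) (- s) * z))%C with ((a m * Rcpow (al m) (- s)) * Cconj (a k) * z)%C by ring end.
      rewrite Cmod_mult, (Cmod_mult _ (Cconj (a k))), Cmod_conj.
      pose proof (coef_Rcpow_bound n a m0 m s H0 Hm ltac:(lra)) as M1.
      replace (G0 * (exp 2 * Q ^ S j0 * / H) * E * Cmod (a m) * Cmod (a k))
        with ((Cmod (a m) * E) * Cmod (a k) * (G0 * (exp 2 * Q ^ S j0 * / H))) by ring.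
      apply Rmult_le_compat; [apply Rmult_le_pos; apply Cmod_ge_0|apply Cmod_ge_0| |now apply HX].
      apply Rmult_le_compat_r; [apply Cmod_ge_0|exact M1].
    - right. rewrite (RS_ext _ (fun m => (G0 * (exp 2 * Q ^ S j0 * / H) * E * A) * Cmod (a m))).
      + rewrite RS_scal. fold A. ring.
      + intros m _. rewrite RS_scal. fold A. ring. }
  assert (HT2 : A ^ 2 * E * G0 * B ^ (2 * j0) * (2 * h) <= A ^ 2 * E * G0 * (2 * Q ^ S j0 * / H)).
  { rewrite Rmult_assoc. apply Rmult_le_compat_l; [repeat apply Rmult_le_pos; first [lra|apply pow_le; lra]|].
    unfold h. replace (B ^ (2 * j0) * (2 * (B ^ 2 / H))) with (2 * ((B ^ 2) ^ S j0) * / H).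
    - apply Rmult_le_compat_r; [lra|]. apply Rmult_le_compat_l; [lra|]. apply pow_incr. lra.
    - rewrite pow_mult. simpl. unfold Rdiv. ring. }
  assert (HFin : Cmod (f j0) <= A ^ 2 * E * G0 * (2 * Q ^ S j0 * / H) + A ^ 2 * E * G0 * (exp 2 * Q ^ S j0 * / H)).
  { replace (f j0) with (- ((CS f J - f j0) + Rm))%C.
    - rewrite Cmod_opp. eapply Rle_trans; [apply Cmod_triangle|]. lra.
    - replace (- (CS f J - f j0 + Rm))%C with (f j0 - (CS f J + Rm))%C by ring. rewrite E0. ring. }
  assert (HFin2 : mu * d * (E * G0) <= Z * / H * (E * G0)).
  { eapply Rle_trans; [|eapply Rle_trans; [exact HFin|]].
    - rewrite <- Rmult_assoc. exact HfM.
    - right. unfold Z. ring. }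
  apply Rmult_le_reg_r in HFin2; [|nra].
  assert (mu * d * H <= Z).
  { apply Rmult_le_compat_r with (r := H) in HFin2; [|lra]. rewrite (Rmult_assoc Z), Rinv_l, Rmult_1_r in HFin2 by lra. exact HFin2. }
  assert (Hmd : 0 < mu * d) by nra.
  assert (Z / (mu * d) * (mu * d) = Z) by (field; lra).
  assert (Z / (mu * d) < H) by (unfold H; lra). nra.
Qed.

Lemma CF_zero_free n a : (exists m, (m <= n)%nat /\ a m <> RtoC 0) ->
  exists C0, forall s, C0 <= Rabs (Re s) -> Rabs (Im s) <= Rabs (Re s) -> CF n a s <> RtoC 0.
Proof.
  intros Ha. destruct (CF_zero_free_right n a Ha) as [C0 H]. exists C0. intros s Hs Hy.
  destruct (Rle_lt_dec 0 (Re s)) as [h|h].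
  - rewrite (Rabs_pos_eq (Re s)) in Hs, Hy by exact h. now apply H.
  - rewrite (Rabs_left (Re s)) in Hs, Hy by exact h. intros E. apply (H (- Cconj s)%C).
    + exact Hs.
    + replace (Im (- Cconj s)%C) with (Im s) by (unfold Im; simpl; ring).
      replace (Re (- Cconj s)%C) with (- Re s) by (unfold Re; simpl; ring). exact Hy.
    + rewrite <- CF_conj, E. apply C_ext; simpl; ring.
Qed.

(** * [CF] on the imaginary axis *)

Lemma poch_conj c j : Cconj (poch c j) = poch (Cconj c) j.
Proof.
  unfold poch. induction j as [|j IH].
  - apply C_ext; simpl; ring.
  - rewrite !CP_S, Cmult_conj, IH, Cplus_conj. f_equal. f_equal. apply C_ext; simpl; ring.
Qed.

Lemma F01_conj c x : 1 <= Re c -> Cconj (F01 c x) = F01 (Cconj c) x.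
Proof.
  intros Hc.
  assert (E : forall j, fc (Cconj c) j = Cconj (fc c j)).
  { intros j. unfold fc. rewrite Cinv_conj by (apply Cmult_neq_0'; [apply INR_fact_C|now apply poch_neq_0]).
    rewrite Cmult_conj, poch_conj. f_equal. f_equal. apply C_ext; simpl; ring. }
  unfold F01. rewrite (Ser_ext _ _ x E). apply C_ext; simpl.
  - apply PSeries_ext. intros j. reflexivity.
  - rewrite <- PSeries_opp. apply PSeries_ext. intros j. reflexivity.
Qed.

Definition Pline (n : nat) (a : nat -> C) (s : C) : C :=
  dsum n (fun m k => cmk a m k * (Rcpow (al m) (- s) * F01 (RtoC 1 - s) (al m * al k)))%C.

(** On the axis the two halves of [X_connection], summed with the indices exchanged in one of them,
    are complex conjugates; so [s CF s] is [2 i] times an imaginary part. *)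
Lemma CF_line n a y : y <> 0 ->
  CF n a (Ci * RtoC y)%C = RtoC (2 / y * Im (Gam (RtoC 1 + Ci * RtoC y) * Pline n a (Ci * RtoC y))).
Proof.
  intros Hy. set (s := (Ci * RtoC y)%C).
  assert (Hre : Re s = 0) by (unfold s, Re; simpl; ring).
  assert (Hs : s <> RtoC 0).
  { intros E. apply Hy. apply (f_equal Im) in E. unfold s, Im in E; simpl in E. lra. }
  assert (Hcs : Cconj s = (- s)%C) by (unfold s; apply C_ext; simpl; ring).
  set (Z := (Gam (RtoC 1 + s) * Pline n a s)%C).
  assert (E : (s * CF n a s = Z - Cconj Z)%C).
  { assert (E1 : (s * CF n a s = Z + (- Gam (RtoC 1 - s)) * dsum n (fun m k => cmk a m k * (Rcpow (al k) s * F01 (RtoC 1 + s) (al m * al k))))%C).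
    { unfold Z, Pline. rewrite CF_dsum, <- !dsum_scal, <- dsum_plus. apply dsum_ext. intros m k _ _.
      replace (s * (cmk a m k * (Rcpow (al m) (- s) * X s (al m * al k))))%C
        with (cmk a m k * Rcpow (al m) (- s) * (s * X s (al m * al k)))%C by ring.
      rewrite (X_connection s _ Hre Hs (al2_pos m k)), Rcpow_mult by apply al_pos.
      rewrite Rcpow_opp. field. apply Rcpow_neq_0. }
    rewrite E1. change (Cconj Z) with (Cconj (Gam (RtoC 1 + s) * Pline n a s)). rewrite Cmult_conj.
    assert (EG : Cconj (Gam (RtoC 1 + s)) = Gam (RtoC 1 - s)).
    { unfold Gam. rewrite X_conj by (apply kcond_0; unfold Re in *; simpl; lra).
      f_equal. rewrite Cplus_conj, Hcs. apply C_ext; simpl; ring. }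
    assert (EP : Cconj (Pline n a s) = dsum n (fun m k => cmk a m k * (Rcpow (al k) s * F01 (RtoC 1 + s) (al m * al k)))%C).
    { unfold Pline. rewrite dsum_conj, dsum_swap.
      apply dsum_ext. intros m k _ _. unfold cmk. rewrite !Cmult_conj, Cconj_conj, Rcpow_conj, F01_conj by (unfold Re in *; simpl; lra).
      replace (Cconj (- s))%C with s by (unfold s; apply C_ext; simpl; ring).
      replace (Cconj (RtoC 1 - s))%C with (RtoC 1 + s)%C by (unfold s; apply C_ext; simpl; ring).
      rewrite (Rmult_comm (al k) (al m)). ring. }
    rewrite EG, EP. ring. }
  replace (CF n a s) with ((s * CF n a s) / s)%C by (field; exact Hs).
  rewrite E. unfold s. rewrite im_alt'. rewrite RtoC_mult, RtoC_div by exact Hy.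
  field. split; [now apply RtoC_neq_0|]. intros Ei. apply (f_equal Im) in Ei. unfold Im in Ei; simpl in Ei. lra.
Qed.

Lemma ent_cexp : ent cexp.
Proof.
  apply ent_lim. intros r' e He. set (r := Rabs r'). assert (Hr : 0 <= r) by apply Rabs_pos.
  pose proof (is_lim_pow2 (exp (3 * r))) as L. apply is_lim_seq_spec in L. destruct (L (mkposreal e He)) as [K HK].
  specialize (HK K (Nat.le_refl K)). simpl in HK. rewrite Rminus_0_r in HK.
  exists (expT K). split.
  - apply (ent_CS (fun k z => RtoC (/ INR (fact k)) * z ^ k)%C). intros k _. apply ent_scal, ent_pow, ent_id.
  - intros s Hs. assert (Hsr : Cmod s <= r) by (eapply Rle_trans; [exact Hs|apply RRle_abs]).
    eapply Rle_trans; [apply cexp_taylor_abs|].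
    apply Rle_trans with (exp (3 * r) * (/ 2) ^ K); [|pose proof (RRle_abs (exp (3 * r) * (/ 2) ^ K)); lra].
    pose proof (INR_fact_lt_0 K) as Hf.
    apply Rle_trans with (r ^ K / INR (fact K) * exp r).
    + apply Rmult_le_compat.
      * apply Rmult_le_pos; [apply pow_le, Cmod_ge_0|left; now apply Rinv_0_lt_compat].
      * left; apply exp_pos.
      * apply Rmult_le_compat_r; [left; now apply Rinv_0_lt_compat|]. apply pow_incr. split; [apply Cmod_ge_0|exact Hsr].
      * now apply exp_mono.
    + pose proof (pow_fact_le_exp (2 * r) K ltac:(lra)) as P. rewrite Rpow_mult_distr in P.
      replace (3 * r) with (2 * r + r) by ring. rewrite exp_plus.
      replace (exp (2 * r) * exp r * (/ 2) ^ K) with ((/ 2) ^ K * exp (2 * r) * exp r) by ring.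
      apply Rmult_le_compat_r; [left; apply exp_pos|].
      rewrite pow_inv. apply Rmult_le_reg_l with (2 ^ K); [apply pow_lt; lra|].
      rewrite <- Rmult_assoc, Rinv_r, Rmult_1_l by (apply pow_nonzero; lra).
      unfold Rdiv in *. rewrite <- Rmult_assoc. exact P.
Qed.

Lemma ent_cexp_lin c : ent (fun s => cexp (c * s)%C).
Proof.
  apply ent_ext with (fun s => cexp (c * s + RtoC 0)%C); [intros; f_equal; ring|].
  apply ent_comp_affine, ent_cexp.
Qed.

Lemma peval_conj l s : Cconj (peval l s) = peval (map Cconj l) (Cconj s).
Proof.
  induction l as [|c l IH]; simpl; [apply C_ext; simpl; ring|]. now rewrite Cplus_conj, Cmult_conj, IH.
Qed.

Lemma ent_conj f : ent f -> ent (fun s => Cconj (f (- Cconj s)%C)).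
Proof.
  intros H r e He. destruct (H r e He) as [l Hl].
  destruct (peval_comp (map Cconj l) (RtoC 0 :: RtoC (-1) :: nil)) as [q Hq]. exists q. intros s Hs. rewrite Hq.
  replace (peval (RtoC 0 :: RtoC (-1) :: nil) s) with (Cconj (- Cconj s))%C by (apply C_ext; simpl; ring).
  rewrite <- peval_conj, <- Cminus_conj, Cmod_conj. apply Hl. now rewrite Cmod_opp, Cmod_conj.
Qed.

(** A maximum principle away from the center, at the price of the constant 2: with
    [f - f w = (s - w) q], the center bound for [q] gives [|f w| <= B + (B + |f w|) / 3]. *)
Lemma ent_weak_max f r B w : ent f -> 0 < r -> (forall t, Cmod (f (RtoC r * unit t)%C) <= B) -> Cmod w <= r / 4 ->
  Cmod (f w) <= 2 * B.
Proof.
  intros Hf Hr HB Hw. destruct (ent_factor f w Hf) as [q [Hq Hfq]].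
  assert (H0 : Cmod (f (RtoC 0)) <= B).
  { apply (ent_center f (RtoC 0) r); [exact Hf|]. intros t. replace (0 + r * unit t)%C with (RtoC r * unit t)%C by ring. apply HB. }
  assert (Hq0 : Cmod (q (RtoC 0)) <= (B + Cmod (f w)) * (4 / (3 * r))).
  { apply (ent_center q (RtoC 0) r); [exact Hq|]. intros t. replace (0 + r * unit t)%C with (RtoC r * unit t)%C by ring.
    set (z := (RtoC r * unit t)%C).
    assert (Hz : Cmod z = r) by (unfold z; rewrite Cmod_mult, Cmod_unit, Cmod_RtoC_pos; lra).
    pose proof (Cmod_sub_le z w) as T. rewrite Hz in T.
    pose proof (f_equal Cmod (Hfq z)) as E. rewrite Cmod_mult in E.
    pose proof (Cmod_sub_triangle (f z) (f w)) as T2. specialize (HB t). fold z in HB.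
    pose proof (Cmod_ge_0 (q z)).
    apply Rmult_le_reg_r with (3 * r / 4); [lra|].
    replace ((B + Cmod (f w)) * (4 / (3 * r)) * (3 * r / 4)) with (B + Cmod (f w)) by (field; lra).
    apply Rle_trans with (Cmod (q z) * Cmod (z - w)); [apply Rmult_le_compat_l; lra|]. lra. }
  pose proof (Hfq (RtoC 0)) as E0. replace (0 - w)%C with (- w)%C in E0 by ring.
  assert (E1 : f w = (f (RtoC 0) + w * q (RtoC 0))%C).
  { replace (f w) with (f (RtoC 0) - (f (RtoC 0) - f w))%C by ring. rewrite E0. ring. }
  pose proof (Cmod_triangle (f (RtoC 0)) (w * q (RtoC 0))%C) as T. rewrite <- E1, Cmod_mult in T.
  assert (Cmod w * Cmod (q (RtoC 0)) <= r / 4 * ((B + Cmod (f w)) * (4 / (3 * r)))) by (apply Rmult_le_compat; try apply Cmod_ge_0; assumption).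
  replace (r / 4 * ((B + Cmod (f w)) * (4 / (3 * r)))) with ((B + Cmod (f w)) / 3) in H by (field; lra). lra.
Qed.

(** * The multiplier [2 sin (pi s) / s] and its quotients *)

(** This is [2 sin (pi s)]; its zeros include the poles [1, 2, ...] of [F01 (1 - s)]. *)
Definition sinker (s : C) : C := (- Ci * (cexp (RtoC PI * Ci * s) - cexp (- (RtoC PI * Ci) * s)))%C.

Lemma ent_sinker : ent sinker.
Proof. apply ent_scal, ent_minus; apply ent_cexp_lin. Qed.

Lemma sinker_int k : sinker (RtoC (INR k)) = RtoC 0.
Proof.
  unfold sinker.
  replace (cexp (RtoC PI * Ci * RtoC (INR k)))%C with (cexp (- (RtoC PI * Ci) * RtoC (INR k)))%C; [ring|].
  unfold cexp; simpl.
  assert (E1 : forall b, cos (2 * INR k * PI + b) = cos b) by (intros b; rewrite Rplus_comm; apply cos_period).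
  assert (E2 : forall b, sin (2 * INR k * PI + b) = sin b) by (intros b; rewrite Rplus_comm; apply sin_period).
  apply C_ext; cbn [fst snd].
  - f_equal; [f_equal; ring|]. rewrite <- E1. f_equal. ring.
  - f_equal; [f_equal; ring|]. rewrite <- E2. f_equal. ring.
Qed.

Lemma sinker_0 : sinker (RtoC 0) = RtoC 0.
Proof. exact (sinker_int 0). Qed.

Lemma sinker_bound s : Cmod (sinker s) <= 2 * exp (PI * Rabs (Im s)).
Proof.
  unfold sinker. rewrite Cmod_mult, Cmod_opp, Cmod_Ci, Rmult_1_l. pose proof PI_RGT_0.
  eapply Rle_trans; [apply Cmod_sub_triangle|]. rewrite !Cmod_cexp.
  assert (forall v, Rabs v = Rabs (Im s) -> exp (PI * v) <= exp (PI * Rabs (Im s))).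
  { intros v Hv. apply exp_mono. rewrite <- Hv. pose proof (RRle_abs v). nra. }
  replace (Re (RtoC PI * Ci * s)) with (PI * (- Im s)) by (unfold Re, Im; simpl; ring).
  replace (Re (- (RtoC PI * Ci) * s)) with (PI * Im s) by (unfold Re, Im; simpl; ring).
  pose proof (H0 (- Im s) (Rabs_Ropp _)). pose proof (H0 (Im s) eq_refl). lra.
Qed.

Lemma sinker_iy y : sinker (Ci * RtoC y)%C = (Ci * RtoC (exp (PI * y) - exp (- (PI * y))))%C.
Proof.
  unfold sinker. replace (RtoC PI * Ci * (Ci * RtoC y))%C with (RtoC (- (PI * y))) by (apply C_ext; simpl; ring).
  replace (- (RtoC PI * Ci) * (Ci * RtoC y))%C with (RtoC (PI * y)) by (apply C_ext; simpl; ring).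
  rewrite !cexp_R, RtoC_minus. ring.
Qed.

Lemma Sf_exists : exists Sf, ent Sf /\ forall s, sinker s = (s * Sf s)%C.
Proof.
  destruct (ent_factor sinker (RtoC 0) ent_sinker) as [q [Hq H]]. exists q. split; [exact Hq|].
  intros s. specialize (H s). rewrite sinker_0 in H. replace (sinker s - 0)%C with (sinker s) in H by ring.
  rewrite H. ring.
Qed.

(** The rising factorial of [1 - s] vanishes at [1, ..., j], where [Sf] vanishes as well; these
    zeros are divided out one at a time, with a sign from [z - s]. *)
Lemma Sq_exists Sf : ent Sf -> (forall s, sinker s = (s * Sf s)%C) ->
  exists S : nat -> C -> C, forall j, ent (S j) /\ forall s, Sf s = (poch (RtoC 1 - s) j * S j s)%C.
Proof.
  intros HS H.
  assert (A : forall j, exists g, ent g /\ forall s, Sf s = (poch (RtoC 1 - s) j * g s)%C).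
  { induction j as [|j [g [Hg IH]]].
    - exists Sf. split; [exact HS|]. intros s. unfold poch; simpl. ring.
    - set (z := RtoC (INR (S j))).
      assert (Hz : z <> RtoC 0) by (apply RtoC_neq_0, not_0_INR; lia).
      assert (HSz : Sf z = RtoC 0).
      { pose proof (H z) as E. unfold z in E at 1. rewrite sinker_int in E. symmetry in E.
        destruct (Cmult_eq_0 _ _ E); [contradiction|assumption]. }
      assert (Hgz : g z = RtoC 0).
      { pose proof (IH z) as E. rewrite HSz in E. symmetry in E. destruct (Cmult_eq_0 _ _ E) as [E1|E1]; [|exact E1].
        exfalso. revert E1. apply CP_neq_0. intros i Hi. unfold z. rewrite <- RtoC_minus, <- RtoC_plus. apply RtoC_neq_0.
        rewrite S_INR. apply lt_INR in Hi. lra. }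
      destruct (ent_factor g z Hg) as [q [Hq Hgq]].
      exists (fun s => RtoC (-1) * q s)%C. split; [now apply ent_scal|].
      intros s. rewrite IH. unfold poch. rewrite CP_S.
      replace (g s) with ((s - z) * q s)%C by (rewrite <- Hgq, Hgz; ring).
      unfold z. rewrite S_INR, RtoC_plus. ring. }
  apply choice in A. destruct A as [S HSj]. now exists S.
Qed.

(** On a circle of radius [K + 1 / 2] every positive integer is at distance at least [1 / 2]. This
    is why the circles for the comparison function have half-integer radii. *)
Lemma poch_circle w j K : Cmod w = INR K + / 2 -> (/ 2) ^ j <= Cmod (poch (RtoC 1 - w) j).
Proof.
  intros Hw. apply CP_Cmod_ge; [lra|]. intros i _.
  replace (RtoC 1 - w + RtoC (INR i))%C with (RtoC (INR (S i)) - w)%C by (rewrite S_INR, RtoC_plus; ring).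
  pose proof (Cmod_sub_le (RtoC (INR (S i))) w) as T1. pose proof (Cmod_sub_le w (RtoC (INR (S i)))) as T2.
  rewrite Cmod_sub_sym in T2. rewrite Cmod_RtoC_pos in T1, T2 by apply pos_INR. rewrite Hw in *.
  destruct (Nat.le_gt_cases (S i) K) as [h|h].
  - apply le_INR in h. lra.
  - assert (INR (S K) <= INR (S i)) by (apply le_INR; lia). rewrite S_INR in H. lra.
Qed.

Lemma Sq_circle Sf S j K w : (forall j, ent (S j) /\ forall s, Sf s = (poch (RtoC 1 - s) j * S j s)%C) ->
  Cmod w = INR K + / 2 -> Cmod (S j w) <= 2 ^ j * Cmod (Sf w).
Proof.
  intros H Hw. destruct (H j) as [_ E]. rewrite E, Cmod_mult. pose proof (poch_circle w j K Hw) as P.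
  pose proof (Cmod_ge_0 (S j w)).
  replace (2 ^ j * (Cmod (poch (RtoC 1 - w) j) * Cmod (S j w))) with ((2 ^ j * Cmod (poch (RtoC 1 - w) j)) * Cmod (S j w)) by ring.
  rewrite <- (Rmult_1_l (Cmod (S j w))) at 1. apply Rmult_le_compat_r; [assumption|].
  apply Rle_trans with (2 ^ j * (/ 2) ^ j).
  - rewrite <- Rpow_mult_distr. replace (2 * / 2) with 1 by field. rewrite pow1. lra.
  - apply Rmult_le_compat_l; [apply pow_le; lra|exact P].
Qed.

(* Poles of [F01 (1 - s) x] are cancelled by the multiplier. *)
Lemma T_exists Sf : ent Sf -> (forall s, sinker s = (s * Sf s)%C) ->
  forall x, 0 < x -> exists T, ent T /\
    (forall y, T (Ci * RtoC y)%C = (Sf (Ci * RtoC y) * F01 (RtoC 1 - Ci * RtoC y) x)%C) /\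
    (forall K w, Cmod w = INR K + / 2 -> Cmod (T w) <= exp (2 * x) * Cmod (Sf w)).
Proof.
  intros HSf Hsf x Hx. destruct (Sq_exists Sf HSf Hsf) as [S HS].
  destruct (ent_complete (fun N s => CS (fun j => RtoC (x ^ j / INR (fact j)) * S j s)%C N)) as [T [HT HL]].
  - intros N. apply (ent_CS (fun j s => RtoC (x ^ j / INR (fact j)) * S j s)%C). intros j _. apply ent_scal, HS.
  (* A half-integer circle of at least four times the radius, so that [ent_weak_max] controls each
     quotient inside. *)
  - intros r. destruct (INR_unbounded (4 * Rabs r)) as [K HK].
    destruct (ent_bounded Sf (INR K + / 2) HSf) as [B [HB Hb]].
    exists (2 * B * exp (4 * x)), O. intros j s _ Hs. rewrite CS_S.
    match goal with |- Cmod (?u + ?v - ?u) <= _ => replace (u + v - u)%C with v by ring end.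
    assert (HSj : Cmod (S j s) <= 2 * (2 ^ j * B)).
    { apply (ent_weak_max (S j) (INR K + / 2)); [apply HS|pose proof (pos_INR K); lra| |].
      - intros t. pose proof (pos_INR K).
        assert (Hw : Cmod (RtoC (INR K + / 2) * unit t) = INR K + / 2) by (rewrite Cmod_mult, Cmod_unit, Cmod_RtoC_pos; lra).
        eapply Rle_trans; [apply (Sq_circle Sf S j K _ HS Hw)|]. apply Rmult_le_compat_l; [apply pow_le; lra|]. apply Hb. lra.
      - pose proof (RRle_abs r). lra. }
    rewrite Cmod_mult. assert (Hxj : 0 <= x ^ j / INR (fact j)).
    { apply Rmult_le_pos; [apply pow_le; lra|left; apply Rinv_0_lt_compat, INR_fact_lt_0]. }
    rewrite Cmod_RtoC_pos by exact Hxj.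
    eapply Rle_trans; [apply Rmult_le_compat_l; [exact Hxj|exact HSj]|].
    pose proof (pow_fact_le_exp (4 * x) j ltac:(lra)) as P.
    replace (x ^ j / INR (fact j) * (2 * (2 ^ j * B))) with (2 * B * ((4 * x) ^ j / INR (fact j)) * (/ 2) ^ j).
    + apply Rmult_le_compat_r; [apply pow_le; lra|]. apply Rmult_le_compat_l; lra.
    + replace (4 * x) with (2 * 2 * x) by ring. rewrite !Rpow_mult_distr, pow_inv.
      field. split; [apply INR_fact_neq_0|apply pow_nonzero; lra].
  - exists T. split; [exact HT|]. split.
    + intros y. set (s := (Ci * RtoC y)%C).
      assert (Hc : 1 <= Re (RtoC 1 - s)%C) by (unfold s, Re; simpl; lra).
      apply is_lim_C_unique with (1 := HL s).
      apply is_lim_C_ext with (fun N => Sf s * CS (fun j => fc (RtoC 1 - s) j * RtoC (x ^ j))%C N)%C.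
      * intros N. rewrite <- CS_scal. apply CS_ext. intros j _. destruct (HS j) as [_ E]. rewrite E.
        unfold fc, Rdiv. rewrite RtoC_mult, RtoC_inv by apply INR_fact_neq_0.
        pose proof (INR_fact_C j). pose proof (poch_neq_0 (RtoC 1 - s) j Hc). field. now split.
      * apply is_lim_C_scal. apply Ser_lim, factdecay_fc, Hc.
    + intros K w Hw. apply (is_lim_C_bound _ _ _ (HL w)). exists O. intros N _.
      eapply Rle_trans.
      * apply (CS_Cmod_le _ (fun j => Cmod (Sf w) * ((2 * x) ^ j / INR (fact j)))). intros j _.
        assert (Hxj : 0 <= x ^ j / INR (fact j)).
        { apply Rmult_le_pos; [apply pow_le; lra|left; apply Rinv_0_lt_compat, INR_fact_lt_0]. }
        rewrite Cmod_mult, Cmod_RtoC_pos by exact Hxj.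
        eapply Rle_trans; [apply Rmult_le_compat_l; [exact Hxj|apply (Sq_circle Sf S j K w HS Hw)]|].
        rewrite Rpow_mult_distr. right. unfold Rdiv. ring.
      * rewrite RS_scal, Rmult_comm. apply Rmult_le_compat_r; [apply Cmod_ge_0|]. apply exp_partial_sum. lra.
Qed.

(** * The comparison function on the imaginary axis *)

(** The identity theorem: the points [i / k] would be infinitely many zeros in the unit disc,
    whereas [ent_zero_list] provides a finite list. *)
Lemma ent_axis_zero f : ent f -> (forall y, 0 < y <= 1 -> f (Ci * RtoC y)%C = RtoC 0) -> forall s, f s = RtoC 0.
Proof.
  intros Hf H. apply NNPP. intros Hn.
  assert (Hex : exists s, f s <> RtoC 0).
  { apply NNPP. intros h. apply Hn. intros s. apply NNPP. intros h'. apply h. now exists s. }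
  destruct (ent_zero_list f (fun z => Cmod z <= 1) 1 Hf Hex Rlt_0_1) as [l [g [Hg [Hfg [_ Hgz]]]]]; [auto|].
  set (p := fun k => (Ci * RtoC (/ INR (S k)))%C).
  assert (Hp : forall k, In (p k) l).
  { intros k. apply NNPP. intros h.
    assert (Hk : 0 < / INR (S k) <= 1).
    { split; [apply Rinv_0_lt_compat, lt_0_INR; lia|]. rewrite <- Rinv_1. apply Rinv_le_contravar; [lra|]. apply (le_INR 1). lia. }
    pose proof (H _ Hk) as E. rewrite Hfg in E.
    destruct (Cmult_eq_0 _ _ E) as [E1|E1].
    - revert E1. now apply LP_neq_0.
    - revert E1. apply Hgz. unfold p. rewrite Cmod_mult, Cmod_Ci, Cmod_RtoC_pos by lra. lra. }
  assert (Hd : NoDup (map p (seq 0 (S (length l))))).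
  { apply Injective_map_NoDup; [|apply seq_NoDup]. intros i j E. unfold p in E. apply (f_equal Im) in E.
    assert (HI : forall y, Im (Ci * RtoC y)%C = y) by (intros; unfold Im; simpl; ring).
    rewrite !HI in E. apply Rinv_eq_reg in E. apply INR_eq in E. lia. }
  assert (Hi : incl (map p (seq 0 (S (length l)))) l).
  { intros z Hz. apply in_map_iff in Hz. destruct Hz as [k [<- _]]. apply Hp. }
  pose proof (NoDup_incl_length Hd Hi) as HL. rewrite length_map, length_seq in HL. lia.
Qed.

(** The geometric mean of [al 0] and [al n]; it places all frequencies [ln (al m)] within
    [ln (2 n + 1) / 2] of [ln (kap n)]. *)
Definition kap (n : nat) : R := PI * sqrt (2 * INR n + 1).

Lemma ln_kap n : ln (kap n) = ln PI + ln (2 * INR n + 1) / 2.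
Proof.
  pose proof (pos_INR n). unfold kap. rewrite ln_mult by (try apply PI_RGT_0; apply sqrt_lt_R0; lra). f_equal.
  assert (E : ln (2 * INR n + 1) = ln (sqrt (2 * INR n + 1)) + ln (sqrt (2 * INR n + 1))).
  { rewrite <- ln_mult by (apply sqrt_lt_R0; lra). now rewrite sqrt_sqrt by lra. }
  lra.
Qed.

Lemma ln_al_kap n m : (m <= n)%nat -> Rabs (ln (al m) - ln (kap n)) <= ln (2 * INR n + 1) / 2.
Proof.
  intros H. rewrite ln_kap. unfold al. pose proof (pos_INR m). apply le_INR in H.
  rewrite ln_mult by (try apply PI_RGT_0; lra).
  assert (0 <= ln (2 * INR m + 1)) by (rewrite <- ln_1; apply ln_le; lra).
  assert (ln (2 * INR m + 1) <= ln (2 * INR n + 1)) by (apply ln_le; lra).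
  apply Rabs_le. lra.
Qed.

Definition tht (n : nat) (y : R) : R := th y - y * ln (kap n).

Lemma unit_INR_PI j : unit (INR j * PI) = RtoC ((-1) ^ j).
Proof.
  induction j as [|j IH].
  - rewrite Rmult_0_l. unfold unit. rewrite cos_0, sin_0. reflexivity.
  - rewrite S_INR. replace ((INR j + 1) * PI) with (INR j * PI + PI) by ring. rewrite unit_plus, IH.
    unfold unit. rewrite cos_PI, sin_PI. apply C_ext; simpl; ring.
Qed.

Lemma Gam_conj_1 y : Cconj (Gam (RtoC 1 + Ci * RtoC y)%C) = Gam (RtoC 1 + Ci * RtoC (- y))%C.
Proof.
  unfold Gam. rewrite X_conj by (apply kcond_0; unfold Re; simpl; lra). f_equal. apply C_ext; simpl; ring.
Qed.

(** On the axis the multiplier is [2 sinh (pi y) / y], positive, so signs are undisturbed. On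
    half-integer circles it accounts for [pi |Im w|], and the centered frequencies account for the
    term in [|Re w|]. *)
Lemma entire_Pline n a : exists P, ent P /\
  (forall y, y <> 0 -> P (Ci * RtoC y)%C = (RtoC ((exp (PI * y) - exp (- (PI * y))) / y) * unit (y * ln (kap n)) * Pline n a (Ci * RtoC y))%C) /\
  exists D, 0 < D /\ forall K w, Cmod w = INR K + / 2 ->
     Cmod (P w) <= D * exp (ln (2 * INR n + 1) / 2 * Rabs (Re w) + PI * Rabs (Im w)).
Proof.
  destruct Sf_exists as [Sf [HSf Hsf]].
  assert (HT : exists T : R -> C -> C, forall x, 0 < x -> ent (T x) /\
    (forall y, T x (Ci * RtoC y)%C = (Sf (Ci * RtoC y) * F01 (RtoC 1 - Ci * RtoC y) x)%C) /\
    (forall K w, Cmod w = INR K + / 2 -> Cmod (T x w) <= exp (2 * x) * Cmod (Sf w))).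
  { destruct (choice (fun x T => 0 < x -> ent T /\
      (forall y, T (Ci * RtoC y)%C = (Sf (Ci * RtoC y) * F01 (RtoC 1 - Ci * RtoC y) x)%C) /\
      (forall K w, Cmod w = INR K + / 2 -> Cmod (T w) <= exp (2 * x) * Cmod (Sf w)))) as [T HT].
    - intros x. destruct (Rlt_dec 0 x) as [h|h].
      + destruct (T_exists Sf HSf Hsf x h) as [T HT]. exists T. auto.
      (* A default value for [x <= 0], where nothing is claimed. *)
      + exists (fun _ => RtoC 0). tauto.
    - now exists T. }
  destruct HT as [T HT].
  set (ell := fun m => ln (al m) - ln (kap n)).
  set (P := fun s => dsum n (fun m k => cmk a m k * (cexp (RtoC (- ell m) * s) * T (al m * al k)%R s))%C).
  exists P. split; [|split].
  - apply (ent_CS (fun m s => CS (fun k => cmk a m k * (cexp (RtoC (- ell m) * s) * T (al m * al k)%R s))%C (S n))). intros m _.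
    apply (ent_CS (fun k s => cmk a m k * (cexp (RtoC (- ell m) * s) * T (al m * al k)%R s))%C). intros k _.
    apply ent_scal, ent_mult; [apply ent_cexp_lin|apply HT, al2_pos].
  - intros y Hy. set (s := (Ci * RtoC y)%C).
    assert (Hs : s <> RtoC 0).
    { intros E. apply Hy. apply (f_equal Im) in E. unfold s, Im in E; simpl in E. lra. }
    assert (ESf : Sf s = RtoC ((exp (PI * y) - exp (- (PI * y))) / y)).
    { replace (Sf s) with (s * Sf s / s)%C by (field; exact Hs). rewrite <- Hsf. unfold s. rewrite sinker_iy, RtoC_div by exact Hy.
      field. split; [now apply RtoC_neq_0|]. intros Ei. apply (f_equal Im) in Ei. unfold Im in Ei; simpl in Ei. lra. }
    unfold P, Pline. rewrite <- ESf, <- dsum_scal. apply dsum_ext. intros m k _ _.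
    destruct (HT _ (al2_pos m k)) as [_ [E _]]. specialize (E y). fold s in E. rewrite E.
    replace (cexp (RtoC (- ell m) * s)) with (unit (y * ln (kap n)) * Rcpow (al m) (- s))%C; [ring|].
    rewrite unit_cexp. unfold Rcpow. rewrite <- cexp_plus. f_equal. unfold ell, s. apply C_ext; simpl; ring.
  - set (D0 := RS (fun m => RS (fun k => Cmod (cmk a m k) * exp (2 * (al m * al k))) (S n)) (S n)).
    assert (HD0 : 0 <= D0).
    { apply RS_nonneg. intros. apply RS_nonneg. intros. apply Rmult_le_pos; [apply Cmod_ge_0|left; apply exp_pos]. }
    exists (4 * D0 + 1). split; [lra|]. intros K w Hw. pose proof (pos_INR K) as HK.
    assert (HSw : Cmod (Sf w) <= 4 * exp (PI * Rabs (Im w))).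
    { pose proof (sinker_bound w) as B. rewrite Hsf, Cmod_mult, Hw in B. pose proof (Cmod_ge_0 (Sf w)). nra. }
    set (E := exp (ln (2 * INR n + 1) / 2 * Rabs (Re w) + PI * Rabs (Im w))).
    assert (HE : 0 < E) by apply exp_pos.
    apply Rle_trans with (4 * E * D0); [|nra].
    eapply Rle_trans.
    + apply (dsum_Cmod n _ (fun m k => 4 * E * (Cmod (cmk a m k) * exp (2 * (al m * al k))))). intros m k Hm Hk.
      rewrite !Cmod_mult. destruct (HT _ (al2_pos m k)) as [_ [_ B]]. specialize (B K w Hw).
      assert (Ce : Cmod (cexp (RtoC (- ell m) * w)) <= exp (ln (2 * INR n + 1) / 2 * Rabs (Re w))).
      { rewrite Cmod_cexp. apply exp_mono. eapply Rle_trans; [apply RRle_abs|].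
        replace (Re (RtoC (- ell m) * w)) with (- ell m * Re w) by (unfold Re; simpl; ring).
        rewrite Rabs_mult, Rabs_Ropp. apply Rmult_le_compat_r; [apply Rabs_pos|]. apply ln_al_kap, Hm. }
      replace (4 * E * (Cmod (cmk a m k) * exp (2 * (al m * al k))))
        with (Cmod (cmk a m k) * (exp (ln (2 * INR n + 1) / 2 * Rabs (Re w)) * (exp (2 * (al m * al k)) * (4 * exp (PI * Rabs (Im w))))))
        by (unfold E; rewrite exp_plus; ring).
      apply Rmult_le_compat_l; [apply Cmod_ge_0|].
      apply Rmult_le_compat; try apply Cmod_ge_0; [exact Ce|].
      eapply Rle_trans; [exact B|]. apply Rmult_le_compat_l; [left; apply exp_pos|exact HSw].
    + right. rewrite (RS_ext _ (fun m => 4 * E * RS (fun k => Cmod (cmk a m k) * exp (2 * (al m * al k))) (S n))) by (intros; apply RS_scal).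
      rewrite RS_scal. reflexivity.
Qed.

(** The difference of [u P] and its reflection in the imaginary axis, divided by [2 i]: an entire
    function whose values on that axis are [Im (u P)]. *)
Definition imfun (u : C) (P : C -> C) (s : C) : C := (- (Ci / 2) * (u * P s - Cconj u * Cconj (P (- Cconj s))))%C.

Lemma ent_imfun u P : ent P -> ent (imfun u P).
Proof.
  intros H. apply ent_scal, ent_minus; apply ent_scal; [exact H|now apply ent_conj].
Qed.

Lemma imfun_axis u P y : imfun u P (Ci * RtoC y)%C = RtoC (Im (u * P (Ci * RtoC y))%C).
Proof.
  unfold imfun. replace (- Cconj (Ci * RtoC y))%C with (Ci * RtoC y)%C by (apply C_ext; simpl; ring).
  rewrite <- Cmult_conj, im_alt'. set (v := Im _).
  replace (- (Ci / 2) * (2 * Ci * v))%C with (- (Ci * Ci) * RtoC v)%C by (field; apply RtoC_neq_0; lra).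
  apply C_ext; simpl; ring.
Qed.

(** The angle [al0] avoids a comparison function that vanishes identically. Only 0 and [pi / 2] are
    tried because there [unit al0] is its own conjugate up to sign, so that the same [h] serves the
    lower half axis, where the phase of Gamma is conjugated. *)
Lemma line_comparison n a : (exists m, (m <= n)%nat /\ a m <> RtoC 0) ->
  exists (al0 : R) (h : C -> C) (D : R), 0 <= al0 <= PI / 2 /\ ent h /\ (exists s, h s <> RtoC 0) /\
   (forall y, Im (h (Ci * RtoC y)%C) = 0) /\
   (forall K t, Cmod (h (RtoC (INR K + / 2) * unit t)%C)
        <= exp (ln (2 * INR n + 1) / 2 * (INR K + / 2) * Rabs (cos t) + PI * (INR K + / 2) * Rabs (sin t) + D)) /\
   (forall eps, eps = 1 \/ eps = -1 -> exists eta, eta <> 0 /\ forall j y, 0 < y -> tht n y = INR j * PI + al0 ->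
      exists c, 0 < c /\ Re (CF n a (Ci * RtoC (eps * y))%C) = eta * (-1) ^ j * c * Re (h (Ci * RtoC (eps * y))%C)).
Proof.
  intros Ha. destruct (entire_Pline n a) as [P [HP [HPl [D [HD HB]]]]].
  pose proof PI_RGT_0 as Hpi.
  assert (Hsig : forall y, y <> 0 -> 0 < (exp (PI * y) - exp (- (PI * y))) / y).
  { assert (A : forall y, 0 < y -> 0 < (exp (PI * y) - exp (- (PI * y))) / y).
    { intros y Hy. apply Rdiv_lt_0_compat; [|exact Hy]. assert (exp (- (PI * y)) < exp (PI * y)) by (apply exp_increasing; nra). lra. }
    intros y Hy. destruct (Rdichotomy _ _ Hy) as [h|h]; [|now apply A].
    specialize (A (- y) ltac:(lra)). replace (- (PI * y)) with (PI * - y) by ring.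
    replace ((exp (PI * y) - exp (PI * - y)) / y) with ((exp (PI * - y) - exp (- (PI * - y))) / - y); [exact A|].
    replace (- (PI * - y)) with (PI * y) by ring. field. exact Hy. }
  assert (HCF : forall y, y <> 0 -> CF n a (Ci * RtoC y)%C =
     RtoC (2 / (y * ((exp (PI * y) - exp (- (PI * y))) / y)) * Im (Gam (RtoC 1 + Ci * RtoC y) * unit (- (y * ln (kap n))) * P (Ci * RtoC y))%C)).
  { intros y Hy. rewrite CF_line by exact Hy. f_equal. rewrite HPl by exact Hy. specialize (Hsig y Hy).
    set (sg := (exp (PI * y) - exp (- (PI * y))) / y) in *.
    replace (Gam (RtoC 1 + Ci * RtoC y) * unit (- (y * ln (kap n))) * (RtoC sg * unit (y * ln (kap n)) * Pline n a (Ci * RtoC y)))%C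
      with (RtoC sg * (Gam (RtoC 1 + Ci * RtoC y) * Pline n a (Ci * RtoC y) * (unit (- (y * ln (kap n))) * unit (y * ln (kap n)))))%C by ring.
    rewrite <- unit_plus, Rplus_opp_l. unfold unit at 1. rewrite cos_0, sin_0.
    set (w := (Gam (RtoC 1 + Ci * RtoC y) * Pline n a (Ci * RtoC y))%C).
    replace (Im (RtoC sg * (w * (1, 0)))) with (sg * Im w) by (unfold Im; simpl; ring). field. split; lra. }
  assert (Hg : forall al0, (al0 = 0 \/ al0 = PI / 2) -> (exists s, imfun (unit al0) P s <> RtoC 0) ->
    exists (al0 : R) (h : C -> C) (D : R), 0 <= al0 <= PI / 2 /\ ent h /\ (exists s, h s <> RtoC 0) /\
     (forall y, Im (h (Ci * RtoC y)%C) = 0) /\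
     (forall K t, Cmod (h (RtoC (INR K + / 2) * unit t)%C)
        <= exp (ln (2 * INR n + 1) / 2 * (INR K + / 2) * Rabs (cos t) + PI * (INR K + / 2) * Rabs (sin t) + D)) /\
     (forall eps, eps = 1 \/ eps = -1 -> exists eta, eta <> 0 /\ forall j y, 0 < y -> tht n y = INR j * PI + al0 ->
      exists c, 0 < c /\ Re (CF n a (Ci * RtoC (eps * y))%C) = eta * (-1) ^ j * c * Re (h (Ci * RtoC (eps * y))%C))).
  { intros al0 Hal0 Hnz. exists al0, (imfun (unit al0) P), (ln D).
    split; [destruct Hal0; subst; lra|]. split; [now apply ent_imfun|]. split; [exact Hnz|].
    split; [intros y; rewrite imfun_axis; reflexivity|]. split.
    - intros K t. set (r := INR K + / 2). pose proof (pos_INR K) as HK. assert (Hr : 0 < r) by (unfold r; lra).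
      set (w := (RtoC r * unit t)%C).
      assert (Hw : Cmod w = r) by (unfold w; rewrite Cmod_mult, Cmod_unit, Cmod_RtoC_pos; lra).
      assert (Rw : Re w = r * cos t) by (unfold w, Re; simpl; ring).
      assert (Iw : Im w = r * sin t) by (unfold w, Im; simpl; ring).
      rewrite exp_plus, exp_ln, Rmult_comm by exact HD.
      replace (ln (2 * INR n + 1) / 2 * r * Rabs (cos t) + PI * r * Rabs (sin t))
        with (ln (2 * INR n + 1) / 2 * Rabs (Re w) + PI * Rabs (Im w)).
      2:{ rewrite Rw, Iw, !Rabs_mult, (Rabs_pos_eq r) by lra. ring. }
      pose proof (HB K w Hw) as B1. pose proof (HB K (- Cconj w)%C) as B2.
      rewrite Cmod_opp, Cmod_conj in B2. specialize (B2 Hw).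
      replace (Re (- Cconj w)) with (- Re w) in B2 by (unfold Re; simpl; ring).
      replace (Im (- Cconj w)) with (Im w) in B2 by (unfold Im; simpl; ring).
      rewrite Rabs_Ropp in B2.
      unfold imfun. rewrite Cmod_mult, Cmod_opp.
      replace (Cmod (Ci / 2)) with (/ 2).
      2:{ rewrite Cmod_div by (apply RtoC_neq_0; lra). rewrite Cmod_Ci, Cmod_RtoC_pos by lra. field. }
      pose proof (Cmod_sub_triangle (unit al0 * P w)%C (Cconj (unit al0) * Cconj (P (- Cconj w)%C))%C) as T.
      rewrite !Cmod_mult, !Cmod_conj, Cmod_unit in T. lra.
    - intros eps Heps.
      (* On the lower half axis [1 / (- y)] changes the sign, and conjugating [unit al0] changes it
         again when [al0 = pi / 2]. *)
      exists (if Rlt_dec 0 eps then 1 else if Rlt_dec 0 al0 then 1 else -1).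
      split; [destruct (Rlt_dec 0 eps); [lra|destruct (Rlt_dec 0 al0); lra]|].
      intros j y Hy Ht.
      assert (Hey : eps * y <> 0) by (destruct Heps; subst; lra).
      rewrite imfun_axis, (HCF _ Hey).
      set (sg := (exp (PI * (eps * y)) - exp (- (PI * (eps * y)))) / (eps * y)).
      assert (Hsg : 0 < sg) by now apply Hsig.
      set (rho := Cmod (Gam (RtoC 1 + Ci * RtoC y))).
      assert (Hrho : 0 < rho) by apply Cmod_pos, Gam_1_iy_neq_0.
      exists (2 * rho / (y * sg)). split; [apply Rdiv_lt_0_compat; nra|].
      set (p := P (Ci * RtoC (eps * y))%C).
      pose proof (Gam_phase y (Rlt_le _ _ Hy)) as G. fold rho in G.
      assert (Hu : unit (th y + - (y * ln (kap n))) = (RtoC ((-1) ^ j) * unit al0)%C).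
      { rewrite <- unit_INR_PI, <- unit_plus. f_equal. exact Ht. }
      destruct Heps as [-> | ->].
      + destruct (Rlt_dec 0 1) as [_|h]; [|lra].
        rewrite !Rmult_1_l in *. rewrite G.
        replace (RtoC rho * unit (th y) * unit (- (y * ln (kap n))) * p)%C
          with (RtoC rho * (unit (th y) * unit (- (y * ln (kap n)))) * p)%C by ring.
        rewrite <- unit_plus, Hu.
        replace (RtoC rho * (RtoC ((-1) ^ j) * unit al0) * p)%C with (RtoC (rho * (-1) ^ j) * (unit al0 * p))%C by (rewrite RtoC_mult; ring).
        set (q := (unit al0 * p)%C).
        change (2 / (y * sg) * Im (RtoC (rho * (-1) ^ j) * q) = (-1) ^ j * (2 * rho / (y * sg)) * Im q).
        replace (Im (RtoC (rho * (-1) ^ j) * q)) with (rho * (-1) ^ j * Im q) by (unfold Im; simpl; ring). field. split; lra.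
      + destruct (Rlt_dec 0 (-1)) as [h|_]; [lra|].
        replace (-1 * y) with (- y) in * by ring.
        rewrite <- Gam_conj_1, G, Cmult_conj.
        replace (- (- y * ln (kap n))) with (y * ln (kap n)) by ring.
        assert (Hcu : (Cconj (unit (th y)) * unit (y * ln (kap n)))%C = (RtoC ((-1) ^ j) * Cconj (unit al0))%C).
        { replace (unit (y * ln (kap n))) with (Cconj (unit (- (y * ln (kap n))))).
          - rewrite <- Cmult_conj, <- unit_plus, Hu, Cmult_conj. f_equal. apply C_ext; simpl; ring.
          - unfold unit. rewrite cos_neg, sin_neg. apply C_ext; simpl; ring. }
        replace (Cconj (RtoC rho) * Cconj (unit (th y)) * unit (y * ln (kap n)) * p)%C
          with (RtoC rho * (Cconj (unit (th y)) * unit (y * ln (kap n))) * p)%C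
          by (replace (Cconj (RtoC rho)) with (RtoC rho) by (apply C_ext; simpl; ring); ring).
        rewrite Hcu.
        assert (Hca : Cconj (unit al0) = (RtoC (if Rlt_dec 0 al0 then -1 else 1) * unit al0)%C).
        { destruct Hal0 as [-> | ->].
          - destruct (Rlt_dec 0 0) as [h|_]; [lra|]. unfold unit. rewrite cos_0, sin_0. apply C_ext; simpl; ring.
          - destruct (Rlt_dec 0 (PI / 2)) as [_|h]; [|lra]. unfold unit. rewrite cos_PI2, sin_PI2. apply C_ext; simpl; ring. }
        rewrite Hca. set (ss := if Rlt_dec 0 al0 then -1 else 1).
        replace (if Rlt_dec 0 al0 then 1 else -1) with (- ss) by (unfold ss; destruct (Rlt_dec 0 al0); ring).
        replace (RtoC rho * (RtoC ((-1) ^ j) * (RtoC ss * unit al0)) * p)%C with (RtoC (rho * (-1) ^ j * ss) * (unit al0 * p))%C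
          by (rewrite !RtoC_mult; ring).
        set (q := (unit al0 * p)%C).
        change (2 / (- y * sg) * Im (RtoC (rho * (-1) ^ j * ss) * q) = - ss * (-1) ^ j * (2 * rho / (y * sg)) * Im q).
        replace (Im (RtoC (rho * (-1) ^ j * ss) * q)) with (rho * (-1) ^ j * ss * Im q) by (unfold Im; simpl; ring). field. split; lra. }
  destruct (classic (exists s, imfun (unit 0) P s <> RtoC 0)) as [h0|h0]; [apply (Hg 0); [now left|exact h0]|].
  destruct (classic (exists s, imfun (unit (PI / 2)) P s <> RtoC 0)) as [h1|h1]; [apply (Hg (PI / 2)); [now right|exact h1]|].
  (* If both angles gave the zero function, [P] would vanish on the axis, hence [CF] everywhere,
     against the zero-free sector. *)
  exfalso. destruct (CF_zero_free n a Ha) as [C0 HC].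
  set (s0 := RtoC (Rabs C0)). apply (HC s0).
  - unfold s0, Re; simpl. rewrite Rabs_Rabsolu. apply RRle_abs.
  - unfold s0, Re, Im; simpl. rewrite Rabs_R0. apply Rabs_pos.
  - apply (ent_axis_zero (CF n a) (ent_CF n a)). intros y Hy. rewrite HCF by lra.
    assert (E0 : P (Ci * RtoC y)%C = RtoC 0).
    { assert (A : forall u, ~ (exists s, imfun u P s <> RtoC 0) -> Im (u * P (Ci * RtoC y))%C = 0).
      { intros u h. apply NNPP. intros h'. apply h. exists (Ci * RtoC y)%C. rewrite imfun_axis. now apply RtoC_neq_0. }
      pose proof (A _ h0) as A0. pose proof (A _ h1) as A1. unfold unit in A0, A1.
      rewrite cos_0, sin_0 in A0. rewrite cos_PI2, sin_PI2 in A1. unfold Im in A0, A1; simpl in A0, A1.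
      apply C_ext; simpl; lra. }
    rewrite E0, Cmult_0_r. change (Im (RtoC 0)) with 0. f_equal. ring.
Qed.

(** * Crossing points of the phase and the zeros they force *)

(** The first crossing is taken because [crossings_sum] needs the phase to stay below the level
    until then. Continuity is asked on the half line only, where [th] is controlled. *)
Lemma first_crossing (f : R -> R) c b :
  (forall x, 0 <= x -> forall e, 0 < e -> exists d, 0 < d /\ forall v, 0 <= v -> Rabs (v - x) < d -> Rabs (f v - f x) < e) ->
  f 0 < c -> 0 < b -> c <= f b -> exists x, 0 < x /\ f x = c /\ forall v, 0 <= v < x -> f v < c.
Proof.
  intros Hc H0 Hb Hfb.
  set (E := fun x => 0 <= x /\ forall v, 0 <= v <= x -> f v < c).
  assert (HE0 : E 0). { split; [lra|]. intros v Hv. replace v with 0 by lra. exact H0. }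
  assert (Hbd : bound E).
  { exists b. intros x [Hx Hxv]. destruct (Rle_lt_dec x b) as [h|h]; [exact h|]. specialize (Hxv b ltac:(lra)). lra. }
  destruct (completeness E Hbd (ex_intro _ 0 HE0)) as [m [Hm1 Hm2]].
  assert (Hm0 : 0 <= m) by (apply Hm1; exact HE0).
  assert (Hlt : forall v, 0 <= v < m -> f v < c).
  { intros v Hv. apply NNPP. intros h.
    assert (m <= v); [|lra]. apply Hm2. intros x [Hx Hxv]. destruct (Rle_lt_dec x v) as [g|g]; [exact g|].
    exfalso. apply h. apply Hxv. lra. }
  assert (Hfm : f m = c).
  { destruct (Rtotal_order (f m) c) as [h|[h|h]]; [|exact h|].
    - exfalso. destruct (Hc m Hm0 (c - f m) ltac:(lra)) as [d [Hd Hv]].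
      assert (m + d / 2 <= m); [|lra]. apply Hm1. split; [lra|]. intros v Hv'.
      destruct (Rlt_le_dec v m) as [g|g]; [apply Hlt; lra|].
      specialize (Hv v ltac:(lra)). assert (Rabs (v - m) < d) by (apply Rabs_lt_between; lra).
      specialize (Hv H). apply Rabs_lt_between in Hv. lra.
    - exfalso. destruct (Hc m Hm0 (f m - c) ltac:(lra)) as [d [Hd Hv]].
      destruct (Rle_lt_or_eq_dec 0 m Hm0) as [g|g]; [|subst m; lra].
      set (v := Rmax (m / 2) (m - d / 2)).
      assert (Hv1 : 0 <= v < m).
      { split; [eapply Rle_trans; [|apply Rmax_l]; lra|apply Rmax_lub_lt; lra]. }
      assert (Hv2 : m - d / 2 <= v) by apply Rmax_r.
      specialize (Hlt v Hv1). specialize (Hv v ltac:(lra)). assert (Rabs (v - m) < d) by (apply Rabs_lt_between; lra).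
      specialize (Hv H). apply Rabs_lt_between in Hv. lra. }
  exists m. split; [|split; [exact Hfm|exact Hlt]].
  destruct (Rle_lt_or_eq_dec 0 m Hm0) as [g|g]; [exact g|]. subst m. lra.
Qed.

Lemma tht_cont n x : 0 <= x -> forall e, 0 < e -> exists d, 0 < d /\ forall v, 0 <= v -> Rabs (v - x) < d -> Rabs (tht n v - tht n x) < e.
Proof.
  intros Hx e He. set (K := 1 + (x + 1) ^ 2 + Rabs (ln (kap n))).
  assert (HK : 1 <= K) by (unfold K; pose proof (pow2_ge_0 (x + 1)); pose proof (Rabs_pos (ln (kap n))); lra).
  exists (Rmin 1 (e / K)). split; [apply Rmin_glb_lt; [lra|apply Rdiv_lt_0_compat; lra]|].
  intros v Hv Hd.
  assert (Hd1 : Rabs (v - x) < 1) by (eapply Rlt_le_trans; [exact Hd|apply Rmin_l]).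
  assert (Hd2 : Rabs (v - x) < e / K) by (eapply Rlt_le_trans; [exact Hd|apply Rmin_r]).
  assert (Hth : Rabs (th v - th x) <= Rabs (v - x) * (1 + (x + 1) ^ 2)).
  { destruct (Rle_lt_dec x v) as [h|h].
    - eapply Rle_trans; [apply (th_lip x v Hx h)|]. rewrite Rabs_pos_eq in * by lra.
      apply Rmult_le_compat_l; [lra|]. apply Rplus_le_compat_l. apply pow_incr. lra.
    - rewrite Rabs_minus_sym. eapply Rle_trans; [apply (th_lip v x Hv); lra|]. rewrite (Rabs_left (v - x)) by lra.
      replace (- (v - x)) with (x - v) by ring.
      apply Rmult_le_compat_l; [lra|]. apply Rplus_le_compat_l. apply pow_incr. lra. }
  unfold tht.
  replace (th v - v * ln (kap n) - (th x - x * ln (kap n))) with ((th v - th x) + - ((v - x) * ln (kap n))) by ring.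
  eapply Rle_lt_trans; [apply Rabs_triang|]. rewrite Rabs_Ropp, Rabs_mult.
  apply Rle_lt_trans with (Rabs (v - x) * K); [unfold K; lra|].
  apply Rlt_le_trans with (e / K * K); [apply Rmult_lt_compat_r; lra|]. right. field. lra.
Qed.

Lemma tht_0 n : tht n 0 = 0.
Proof. unfold tht. rewrite th_0. ring. Qed.

Lemma tht_lower n y : 0 < y -> y * ln y - y - PI / 2 - y * ln (kap n) <= tht n y.
Proof. intros Hy. unfold tht. pose proof (th_lower y Hy). lra. Qed.

Lemma tht_upper n y : 0 <= y -> tht n y <= y * (1 + y ^ 2) + y * Rabs (ln (kap n)).
Proof.
  intros Hy. unfold tht. pose proof (th_lip 0 y (Rle_refl 0) Hy) as L. rewrite th_0 in L.
  apply Rabs_le_between in L. pose proof (RRle_abs (- ln (kap n))) as A. rewrite Rabs_Ropp in A. nra.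
Qed.

(** The levels start at [pi + al0], which exceeds [tht n 0 = 0] even when [al0 = 0]. *)
Lemma crossings n al0 : 0 <= al0 -> exists Y : nat -> R,
  (forall j, 0 < Y j) /\ (forall j, Y j < Y (S j)) /\
  (forall j, tht n (Y j) = INR (S j) * PI + al0) /\
  (forall j v, 0 <= v < Y j -> tht n v < INR (S j) * PI + al0) /\
  (forall r, exists j, r < Y j).
Proof.
  intros Hal. pose proof PI_RGT_0 as HP.
  assert (HS : forall j, 1 <= INR (S j)) by (intros; apply (le_INR 1); lia).
  assert (A : forall j, exists x, 0 < x /\ tht n x = INR (S j) * PI + al0 /\ forall v, 0 <= v < x -> tht n v < INR (S j) * PI + al0).
  { intros j. specialize (HS j). set (c := INR (S j) * PI + al0). assert (Hc : 0 < c) by (unfold c; nra).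
    (* Beyond [exp (2 + ln (kap n))] the quantity [y ln y - y - y ln (kap n)] is at least [y], so
       the summand [c + pi / 2] suffices to reach the level [c]. *)
    set (b := exp (2 + ln (kap n)) + (c + PI / 2)). pose proof (exp_pos (2 + ln (kap n))) as He.
    apply (first_crossing (tht n) c b); [intros; now apply tht_cont|rewrite tht_0; exact Hc|unfold b; lra|].
    eapply Rle_trans; [|apply tht_lower; unfold b; lra].
    assert (Hl : 2 + ln (kap n) <= ln b).
    { rewrite <- (ln_exp (2 + ln (kap n))). apply ln_le; [exact He|unfold b; lra]. }
    assert (b * (2 + ln (kap n)) <= b * ln b) by (apply Rmult_le_compat_l; [unfold b; lra|exact Hl]).
    unfold b in *. lra. }
  apply choice in A. destruct A as [Y HY]. exists Y.
  assert (Hinc : forall j, Y j < Y (S j)).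
  { intros j. destruct (HY j) as [P1 [E1 L1]]. destruct (HY (S j)) as [P2 [E2 L2]].
    rewrite (S_INR (S j)) in E2. destruct (Rlt_le_dec (Y j) (Y (S j))) as [h|h]; [exact h|].
    destruct (Rle_lt_or_eq_dec _ _ h) as [g|g].
    - specialize (L1 (Y (S j)) ltac:(lra)). nra.
    - rewrite g in E2. nra. }
  split; [intros j; apply HY|]. split; [exact Hinc|]. split; [intros j; apply HY|]. split; [intros j; apply HY|].
  (* A crossing below [r] has its level bounded by [tht_upper], so sufficiently high levels are
     crossed beyond [r]. *)
  intros r. destruct (INR_unbounded (Rabs r * (1 + Rabs r ^ 2) + Rabs r * Rabs (ln (kap n)))) as [j Hj]. exists j.
  destruct (HY j) as [P1 [E1 _]]. destruct (Rlt_le_dec r (Y j)) as [h|h]; [exact h|]. exfalso.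
  pose proof (tht_upper n (Y j) ltac:(lra)) as U. rewrite E1, S_INR in U.
  assert (Hr : Y j <= Rabs r) by (pose proof (RRle_abs r); lra).
  assert (Y j ^ 2 <= Rabs r ^ 2) by (apply pow_incr; lra).
  pose proof (Rabs_pos (ln (kap n))).
  pose proof PI2_1. pose proof (pos_INR j). nra.
Qed.

(** An antiderivative of the lower bound [(x ln x - x - x ln (kap n)) / pi - 2] for the number of
    crossings up to [x], divided by [x]. The 2 collects the [pi / 2] of [th_lower], the
    [al0 <= pi / 2] and one full level. *)
Definition Psi (n : nat) (v : R) : R := / PI * (v * ln v - 2 * v - v * ln (kap n)) - 2 * ln v.

Lemma Psi_step n (m : R) u v : 0 < u -> u <= v ->
  (forall x, u < x < v -> x * ln x - x - x * ln (kap n) - 2 * PI <= m * PI) -> Psi n v - Psi n u <= m * ln (v / u).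
Proof.
  intros Hu Huv H. pose proof PI_RGT_0 as HP.
  set (G := fun x => m * ln x - Psi n x).
  assert (HG : forall x, 0 < x -> is_derive G x (/ (PI * x) * (m * PI - (x * ln x - x - x * ln (kap n) - 2 * PI)))).
  { intros x Hx. unfold G, Psi. auto_derive; [lra|]. field. lra. }
  assert (Hm : G u <= G v).
  { destruct (Rle_lt_or_eq_dec _ _ Huv) as [h|h]; [|subst; lra].
    destruct (MVT_cor2 G (fun x => / (PI * x) * (m * PI - (x * ln x - x - x * ln (kap n) - 2 * PI))) u v h) as [c [Ec Hc]].
    - intros c Hc. apply is_derive_Reals, HG. lra.
    - specialize (H c Hc). assert (0 < / (PI * c)) by (apply Rinv_0_lt_compat; nra).
      assert (0 <= / (PI * c) * (m * PI - (c * ln c - c - c * ln (kap n) - 2 * PI))) by (apply Rmult_le_pos; lra). nra. }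
  unfold G in Hm. unfold Rdiv. rewrite ln_mult, ln_Rinv by (try apply Rinv_0_lt_compat; lra). lra.
Qed.

(* Abel summation of the crossing points against the lower bound for the phase. *)
Lemma crossings_sum n al0 Y : 0 <= al0 <= PI / 2 -> (forall j, 0 < Y j) -> (forall j, Y j < Y (S j)) ->
  (forall j v, 0 <= v < Y j -> tht n v < INR (S j) * PI + al0) ->
  forall M v, Y M <= v <= Y (S M) -> Psi n v - Psi n (Y O) <= RS (fun i => ln (v / Y i)) (S M).
Proof.
  intros Hal Hpos Hinc Hlt.
  assert (Hstep : forall M v, Y M <= v <= Y (S M) -> Psi n v - Psi n (Y M) <= INR (S M) * ln (v / Y M)).
  { intros M v Hv. apply Psi_step; [apply Hpos|lra|]. intros x Hx.
    specialize (Hpos M). pose proof (tht_lower n x ltac:(lra)) as L. specialize (Hlt (S M) x ltac:(lra)).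
    rewrite (S_INR (S M)) in Hlt. lra. }
  assert (Hre : forall M u v, 0 < u -> 0 < v -> RS (fun i => ln (v / Y i)) M = RS (fun i => ln (u / Y i)) M + INR M * ln (v / u)).
  { intros M u v Hu Hv. rewrite <- RS_const, <- RS_plus. apply RS_ext. intros i _. specialize (Hpos i).
    unfold Rdiv. rewrite !ln_mult, !ln_Rinv by (try apply Rinv_0_lt_compat; lra). ring. }
  assert (Hdiag : forall M, RS (fun i => ln (Y M / Y i)) (S M) = RS (fun i => ln (Y M / Y i)) M).
  { intros M. rewrite RS_S. replace (Y M / Y M) with 1 by (field; specialize (Hpos M); lra). rewrite ln_1. ring. }
  induction M as [|M IH]; intros v Hv.
  - pose proof (Hpos O). rewrite (Hre 1%nat (Y O) v) by lra. rewrite Hdiag. simpl RS at 1.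
    specialize (Hstep O v Hv). lra.
  - pose proof (Hpos (S M)). rewrite (Hre (S (S M)) (Y (S M)) v) by lra. rewrite Hdiag.
    specialize (Hstep (S M) v Hv). specialize (IH (Y (S M)) ltac:(specialize (Hinc M); lra)). lra.
Qed.

Lemma IVT_open (f : R -> R) a b : continuity f -> a < b -> f a * f b < 0 -> exists x, a < x < b /\ f x = 0.
Proof.
  intros Hc Hab H.
  destruct (IVT_gen f a b 0 Hc) as [x [Hx E]].
  - destruct (Rle_lt_dec (f a) (f b)) as [h|h].
    + rewrite Rmin_left, Rmax_right by exact h. nra.
    + rewrite Rmin_right, Rmax_left by lra. nra.
  - rewrite Rmin_left, Rmax_right in Hx by lra. exists x. split; [|exact E].
    destruct (Req_dec x a) as [->|n1]; [rewrite E in H; lra|].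
    destruct (Req_dec x b) as [->|n2]; [rewrite E in H; lra|]. lra.
Qed.

Lemma sign_step (f h : R -> R) a b e c c' : continuity f -> continuity h -> a < b -> e <> 0 -> 0 < c -> 0 < c' ->
  f a = e * c * h a -> f b = - (e * c' * h b) ->
  (exists x, a <= x < b /\ f x = 0) \/ (exists x, a < x <= b /\ h x = 0).
Proof.
  intros Hf Hh Hab He Hc Hc' Ea Eb.
  destruct (Req_dec (h b) 0) as [hb|hb]; [right; exists b; split; [lra|exact hb]|].
  destruct (Req_dec (f a) 0) as [fa|fa]; [left; exists a; split; [lra|exact fa]|].
  assert (ha : h a <> 0) by (intros E; apply fa; rewrite Ea, E; ring).
  destruct (Rlt_le_dec (f a * f b) 0) as [s|s].
  - left. destruct (IVT_open f a b Hf Hab s) as [x [Hx E]]. exists x. split; [lra|exact E].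
  - right. destruct (IVT_open h a b Hh Hab) as [x [Hx E]]; [|exists x; split; [lra|exact E]].
    rewrite Ea, Eb in s. assert (He2 : 0 < e * e * (c * c')) by (apply Rmult_lt_0_compat; nra).
    assert (Hm : h a * h b <> 0) by now apply Rmult_integral_contrapositive_currified.
    destruct (Rlt_le_dec (h a * h b) 0) as [g|g]; [exact g|]. nra.
Qed.

Definition axis (eps x : R) : C := (Ci * RtoC (eps * x))%C.

Lemma Cmod_axis eps x : eps = 1 \/ eps = -1 -> 0 < x -> Cmod (axis eps x) = x.
Proof.
  intros He Hx. unfold axis. rewrite Cmod_mult, Cmod_Ci, Cmod_R, Rmult_1_l.
  destruct He as [-> | ->]; [rewrite Rabs_pos_eq by lra; ring|rewrite Rabs_left by lra; ring].
Qed.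

Lemma axis_inj eps x y : eps = 1 \/ eps = -1 -> axis eps x = axis eps y -> x = y.
Proof.
  intros He E. apply (f_equal Im) in E. unfold axis, Im in E; simpl in E. destruct He as [-> | ->]; lra.
Qed.

(** Each gap yields a zero of [f] or of [h] at height at most [Y (S i)], hence with weight at least
    [ln (V / Y (S i))]; both lists enter the sum, so it is irrelevant which function vanishes. *)
Lemma select_zeros (f h : R -> R) (Y : nat -> R) eta eps : continuity f -> continuity h -> eta <> 0 -> (eps = 1 \/ eps = -1) ->
  (forall j, 0 < Y j) -> (forall j, Y j < Y (S j)) ->
  (forall j, exists c, 0 < c /\ f (Y j) = eta * (-1) ^ j * c * h (Y j)) ->
  forall M, exists lf lh : list R, NoDup lf /\ NoDup lh /\
    (forall x, In x lf -> f x = 0 /\ Y O <= x < Y M) /\ (forall x, In x lh -> h x = 0 /\ Y O <= x <= Y M) /\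
    forall V, Y M <= V -> RS (fun i => ln (V / Y (S i))) M <=
       LS (fun z => ln (V / Cmod z)) (map (axis eps) lf) + LS (fun z => ln (V / Cmod z)) (map (axis eps) lh).
Proof.
  intros Hf Hh Heta Heps Hpos Hinc Hsig. induction M as [|M [lf [lh [Nf [Nh [If [Ih HS]]]]]]].
  - exists nil, nil. split; [constructor|]. split; [constructor|]. split; [intros x []|]. split; [intros x []|].
    intros V _. simpl. lra.
  - assert (HY0 : Y O <= Y M) by (clear -Hinc; induction M as [|M IH]; [lra|specialize (Hinc M); lra]).
    pose proof (Hinc M) as HM.
    destruct (Hsig M) as [c [Hc Ec]]. destruct (Hsig (S M)) as [c' [Hc' Ec']].
    assert (Hadd : forall x, Y M <= x <= Y (S M) -> forall V, Y (S M) <= V -> ln (V / Y (S M)) <= ln (V / Cmod (axis eps x))).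
    { intros x Hx V HV. pose proof (Hpos M). rewrite Cmod_axis by (auto; lra).
      apply ln_le; [apply Rdiv_lt_0_compat; lra|]. apply Rmult_le_compat_l; [lra|]. apply Rinv_le_contravar; lra. }
    assert (He : eta * (-1) ^ M <> 0) by (apply Rmult_integral_contrapositive_currified; [exact Heta|apply pow_nonzero; lra]).
    destruct (sign_step f h (Y M) (Y (S M)) (eta * (-1) ^ M) c c' Hf Hh HM He Hc Hc' Ec) as [[x [Hx Ex]]|[x [Hx Ex]]].
    + rewrite Ec'. simpl. ring.
    + exists (x :: lf), lh. split; [|split; [exact Nh|split; [|split]]].
      * constructor; [|exact Nf]. intros Hi. apply If in Hi. lra.
      * intros z [<-|Hz]; [split; [exact Ex|lra]|]. destruct (If z Hz). split; [assumption|lra].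
      * intros z Hz. destruct (Ih z Hz). split; [assumption|lra].
      * intros V HV. rewrite RS_S. simpl LS.
        specialize (HS V ltac:(lra)). specialize (Hadd x ltac:(lra) V HV). lra.
    + exists lf, (x :: lh). split; [exact Nf|split; [|split; [|split]]].
      * constructor; [|exact Nh]. intros Hi. apply Ih in Hi. lra.
      * intros z Hz. destruct (If z Hz). split; [assumption|lra].
      * intros z [<-|Hz]; [split; [exact Ex|lra]|]. destruct (Ih z Hz). split; [assumption|lra].
      * intros V HV. rewrite RS_S. simpl LS.
        specialize (HS V ltac:(lra)). specialize (Hadd x ltac:(lra) V HV). lra.
Qed.

Lemma ent_axis_continuity f eps : ent f -> continuity (fun x => Re (f (axis eps x))).
Proof.
  intros Hf x. destruct (ent_lipschitz f (axis eps x) Hf) as [B [HB Hb]].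
  intros e He. set (K := (Rabs eps + 1)). assert (HK : 1 <= K) by (unfold K; pose proof (Rabs_pos eps); lra).
  exists (Rmin (/ K) (e / (B * K))). split.
  - apply Rmin_glb_lt; [apply Rinv_0_lt_compat; lra|apply Rdiv_lt_0_compat; nra].
  - intros v [_ Hv].
    assert (Hd1 : Rabs (v - x) < / K) by (eapply Rlt_le_trans; [exact Hv|apply Rmin_l]).
    assert (Hd2 : Rabs (v - x) < e / (B * K)) by (eapply Rlt_le_trans; [exact Hv|apply Rmin_r]).
    assert (HE : Cmod (axis eps v - axis eps x) <= K * Rabs (v - x)).
    { replace (axis eps v - axis eps x)%C with (Ci * RtoC (eps * (v - x)))%C by (unfold axis; apply C_ext; simpl; ring).
      rewrite Cmod_mult, Cmod_Ci, Cmod_R, Rmult_1_l, Rabs_mult. apply Rmult_le_compat_r; [apply Rabs_pos|unfold K; lra]. }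
    assert (H1 : K * Rabs (v - x) <= 1).
    { apply Rle_trans with (K * / K); [apply Rmult_le_compat_l; lra|right; field; lra]. }
    specialize (Hb (axis eps v) ltac:(lra)).
    apply Rle_lt_trans with (B * (K * Rabs (v - x))).
    + eapply Rle_trans; [|eapply Rle_trans; [exact Hb|apply Rmult_le_compat_l; lra]].
      apply (re_le_Cmod (f (axis eps v) - f (axis eps x))%C).
    + apply Rlt_le_trans with (B * K * (e / (B * K))); [rewrite <- Rmult_assoc; apply Rmult_lt_compat_l; nra|].
      right. field. lra.
Qed.

(** * Counting *)

Lemma NoDup_axis eps l : eps = 1 \/ eps = -1 -> NoDup l -> NoDup (map (axis eps) l).
Proof. intros He. apply Injective_map_NoDup. intros x y. now apply axis_inj. Qed.

Lemma LS_incl_list w l l' : NoDup l -> incl l l' -> (forall z, In z l' -> 0 <= w z) -> LS w l <= LS w l'.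
Proof.
  intros Hn Hi Hw. rewrite (LS_count w l' (nodup C_dec l') (NoDup_nodup _ _)) by (intros z Hz; now apply nodup_In).
  eapply Rle_trans; [apply (LS_incl w l (nodup C_dec l')); [exact Hn|apply NoDup_nodup| |]|].
  - intros z Hz. apply nodup_In. auto.
  - intros z Hz. apply Hw. now apply nodup_In in Hz.
  - apply LS_le. intros z Hz. apply nodup_In in Hz.
    pose proof (proj1 (count_occ_In C_dec l' z) Hz) as Hc.
    assert (Hc1 : 1 <= INR (count_occ C_dec l' z)) by (apply (le_INR 1); lia). specialize (Hw z Hz).
    rewrite <- (Rmult_1_l (w z)) at 1. apply Rmult_le_compat_r; assumption.
Qed.

Lemma RS_shift_ge (f : nat -> R) M : RS f (S M) = f O + RS (fun i => f (S i)) M.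
Proof. induction M as [|M IH]; [simpl; ring|]. rewrite RS_S, IH, RS_S. ring. Qed.

(** The two half axes give the factor 2. There is one gap fewer than crossings, which costs [ln V]
    on each of them. *)
Lemma axis_zeros_lower n a : (exists m, (m <= n)%nat /\ a m <> RtoC 0) ->
  exists (h : C -> C) (D D' : R), ent h /\ (exists s, h s <> RtoC 0) /\
   (forall K t, Cmod (h (RtoC (INR K + / 2) * unit t)%C)
        <= exp (ln (2 * INR n + 1) / 2 * (INR K + / 2) * Rabs (cos t) + PI * (INR K + / 2) * Rabs (sin t) + D)) /\
   exists r0, 1 <= r0 /\ forall V, r0 <= V -> exists LF LH : list C, NoDup LF /\ NoDup LH /\
     (forall z, In z LF -> CF n a z = RtoC 0 /\ Re z = 0 /\ z <> RtoC 0 /\ Cmod z <= V) /\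
     (forall z, In z LH -> h z = RtoC 0 /\ z <> RtoC 0 /\ Cmod z <= V) /\
     2 * (Psi n V - ln V) - D' <= LS (fun z => ln (V / Cmod z)) LF + LS (fun z => ln (V / Cmod z)) LH.
Proof.
  intros Ha. destruct (line_comparison n a Ha) as [al0 [h [D [Hal [Hh [Hnz [Him [Hb Hsig]]]]]]]].
  destruct (crossings n al0 (proj1 Hal)) as [Y [Hpos [Hinc [HY [Hlt Hunb]]]]].
  exists h, D, (2 * (Psi n (Y O) - ln (Y O))). split; [exact Hh|]. split; [exact Hnz|]. split; [exact Hb|].
  exists (Rmax 1 (Y O)). split; [apply Rmax_l|]. intros V HV.
  assert (HV2 : Y O <= V) by (eapply Rle_trans; [apply Rmax_r|exact HV]).
  assert (HM : exists M, Y M <= V <= Y (S M)).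
  { destruct (least_nat (fun j => V < Y j) (Hunb V)) as [j [Hj Hmin]].
    destruct j as [|j]; [lra|]. exists j. split; [|lra].
    destruct (Rle_lt_dec (Y j) V) as [g|g]; [exact g|]. exfalso. apply (Hmin j); [lia|exact g]. }
  destruct HM as [M [HM1 HM2]].
  assert (Hone : forall eps, eps = 1 \/ eps = -1 -> exists lf lh : list R, NoDup lf /\ NoDup lh /\
     (forall x, In x lf -> Re (CF n a (axis eps x)) = 0 /\ 0 < x <= V) /\ (forall x, In x lh -> Re (h (axis eps x)) = 0 /\ 0 < x <= V) /\
     Psi n V - Psi n (Y O) - ln (V / Y O) <= LS (fun z => ln (V / Cmod z)) (map (axis eps) lf) + LS (fun z => ln (V / Cmod z)) (map (axis eps) lh)).
  { intros eps Heps. destruct (Hsig eps Heps) as [eta [Heta Hs]].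
    (* The sign is [- eta] because [Y j] sits at level [S j]. *)
    destruct (select_zeros (fun x => Re (CF n a (axis eps x))) (fun x => Re (h (axis eps x))) Y (- eta) eps
       (ent_axis_continuity _ _ (ent_CF n a)) (ent_axis_continuity _ _ Hh) ltac:(lra) Heps Hpos Hinc) with (M := M)
       as [lf [lh [Nf [Nh [If [Ih HS]]]]]].
    { intros j. destruct (Hs (S j) (Y j) (Hpos j) (HY j)) as [c [Hc E]]. exists c. split; [exact Hc|].
      unfold axis. rewrite E. simpl pow. ring. }
    exists lf, lh. split; [exact Nf|]. split; [exact Nh|]. pose proof (Hpos O) as H0. split; [|split].
    - intros x Hx. destruct (If x Hx). split; [assumption|lra].
    - intros x Hx. destruct (Ih x Hx). split; [assumption|lra].
    - pose proof (crossings_sum n al0 Y Hal Hpos Hinc Hlt M V (conj HM1 HM2)) as S1.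
      rewrite RS_shift_ge in S1. specialize (HS V HM1). lra. }
  destruct (Hone 1 (or_introl eq_refl)) as [lf1 [lh1 [Nf1 [Nh1 [If1 [Ih1 HS1]]]]]].
  destruct (Hone (-1) (or_intror eq_refl)) as [lf2 [lh2 [Nf2 [Nh2 [If2 [Ih2 HS2]]]]]].
  assert (Him_axis : forall eps x, Im (axis eps x) = eps * x) by (intros; unfold axis, Im; simpl; ring).
  assert (Hnd : forall l1 l2, NoDup l1 -> NoDup l2 -> (forall x, In x l1 -> 0 < x) -> (forall x, In x l2 -> 0 < x) ->
     NoDup (map (axis 1) l1 ++ map (axis (-1)) l2)).
  { intros l1 l2 N1 N2 P1 P2. apply NoDup_app.
    - apply NoDup_axis; auto.
    - apply NoDup_axis; auto.
    - intros z Hz1 Hz2. apply in_map_iff in Hz1. apply in_map_iff in Hz2.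
      destruct Hz1 as [x [<- Hx]]. destruct Hz2 as [y [E Hy]]. apply (f_equal Im) in E. rewrite !Him_axis in E.
      specialize (P1 x Hx). specialize (P2 y Hy). lra. }
  exists (map (axis 1) lf1 ++ map (axis (-1)) lf2), (map (axis 1) lh1 ++ map (axis (-1)) lh2).
  split; [apply Hnd; try assumption; intros x Hx; [apply If1 in Hx|apply If2 in Hx]; lra|].
  split; [apply Hnd; try assumption; intros x Hx; [apply Ih1 in Hx|apply Ih2 in Hx]; lra|].
  assert (Hax : forall eps x, eps = 1 \/ eps = -1 -> 0 < x <= V -> Re (axis eps x) = 0 /\ axis eps x <> RtoC 0 /\ Cmod (axis eps x) <= V).
  { intros eps x He Hx. split; [unfold axis, Re; simpl; ring|]. rewrite Cmod_axis by (auto; lra). split; [|lra].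
    intros E. apply (f_equal Im) in E. rewrite Him_axis in E. change (Im (RtoC 0)) with 0 in E. destruct He as [-> | ->]; lra. }
  assert (HCF : forall eps x, Re (CF n a (axis eps x)) = 0 -> CF n a (axis eps x) = RtoC 0).
  { intros eps x E. apply C_ext; [exact E|]. exact (CF_real n a (eps * x)). }
  assert (Hhz : forall eps x, Re (h (axis eps x)) = 0 -> h (axis eps x) = RtoC 0).
  { intros eps x E. apply C_ext; [exact E|]. exact (Him (eps * x)). }
  split; [|split].
  - intros z Hz. apply in_app_or in Hz. destruct Hz as [Hz|Hz]; apply in_map_iff in Hz; destruct Hz as [x [<- Hx]].
    + destruct (If1 x Hx) as [E1 E2]. split; [now apply HCF|]. apply Hax; auto.
    + destruct (If2 x Hx) as [E1 E2]. split; [now apply HCF|]. apply Hax; auto.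
  - intros z Hz. apply in_app_or in Hz. destruct Hz as [Hz|Hz]; apply in_map_iff in Hz; destruct Hz as [x [<- Hx]].
    + destruct (Ih1 x Hx) as [E1 E2]. split; [now apply Hhz|]. apply Hax; auto.
    + destruct (Ih2 x Hx) as [E1 E2]. split; [now apply Hhz|]. apply Hax; auto.
  - rewrite !LS_app. pose proof (Hpos O). unfold Rdiv in HS1, HS2 |- *.
    rewrite ln_mult, ln_Rinv in HS1, HS2 by (try apply Rinv_0_lt_compat; lra). lra.
Qed.

(** The multiplicity, lowered by one on the axis: on listed zeros it vanishes exactly at the simple
    zeros of the axis and weighs what has to be bounded. *)
Definition bad (l : list C) (z : C) : R := INR (count_occ C_dec l z) - (if Req_EM_T (Re z) 0 then 1 else 0).

Lemma bad_nonneg l z : In z l -> 0 <= bad l z.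
Proof.
  intros H. unfold bad. pose proof (proj1 (count_occ_In C_dec l z) H) as Hc.
  assert (1 <= INR (count_occ C_dec l z)) by (apply (le_INR 1); lia).
  destruct (Req_EM_T (Re z) 0); lra.
Qed.

(** Jensen's sum is split into one copy of each axis zero and the [bad] remainder. The single copies
    cover [LF]; the remainder has weight at least [ln 2] at zeros within [r <= V / 2]. There is no
    sine term because the growth of [CF] depends on [Re s] only. *)
Lemma bad_jensen (f : C -> C) l1 g V r A D LF : ent g -> (forall s, f s = (LP l1 s * g s)%C) -> f (RtoC 0) <> RtoC 0 ->
  0 < r -> 2 * r <= V -> 0 <= A -> (forall z, In z l1 -> Cmod z <= V) ->
  (forall t, Cmod (f (RtoC V * unit t)%C) <= exp (A * Rabs (cos t) + 0 * Rabs (sin t) + D)) ->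
  NoDup LF -> (forall z, In z LF -> In z l1 /\ Re z = 0) ->
  forall zs, NoDup zs -> (forall z, In z zs -> In z l1 /\ Cmod z <= r) ->
  ln 2 * LS (bad l1) zs + LS (fun z => ln (V / Cmod z)) LF + ln (Cmod (f (RtoC 0))) <= 2 / PI * A + D.
Proof.
  intros Hg Hf Hf0 Hr HrV HA Hl1 Hb NLF HLF zs Nzs Hzs.
  pose proof (jensen f g l1 V A 0 D Hg Hf ltac:(lra) HA (Rle_refl 0) Hf0 Hb) as J. rewrite Rplus_0_r in J.
  set (w := fun z => ln (V / Cmod z)) in *.
  assert (Hz0 : forall z, In z l1 -> 0 < Cmod z).
  { intros z Hz. apply Cmod_pos. intros ->. apply Hf0. rewrite Hf, LP_in_0 by exact Hz. ring. }
  assert (Hw0 : forall z, In z l1 -> 0 <= w z).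
  { intros z Hz. rewrite <- ln_1. apply ln_le; [lra|]. specialize (Hz0 z Hz). specialize (Hl1 z Hz).
    apply Rmult_le_reg_r with (Cmod z); [exact Hz0|]. unfold Rdiv. rewrite Rmult_assoc, Rinv_l by lra. lra. }
  set (nd := nodup C_dec l1).
  assert (Nnd : NoDup nd) by apply NoDup_nodup.
  assert (Ind : forall z, In z nd <-> In z l1) by (intros z; apply nodup_In).
  assert (E1 : LS w l1 = LS (fun z => bad l1 z * w z) nd + LS (fun z => if Req_EM_T (Re z) 0 then w z else 0) nd).
  { rewrite (LS_count w l1 nd Nnd) by (intros z Hz; now apply Ind). rewrite <- LS_plus. apply LS_ext. intros z Hz.
    unfold bad. destruct (Req_EM_T (Re z) 0); ring. }
  assert (E2 : LS w LF <= LS (fun z => if Req_EM_T (Re z) 0 then w z else 0) nd).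
  { rewrite (LS_ext w (fun z => if Req_EM_T (Re z) 0 then w z else 0) LF).
    - apply LS_incl; [exact NLF|exact Nnd| |].
      + intros z Hz. apply Ind. now apply HLF.
      + intros z Hz. apply Ind in Hz. destruct (Req_EM_T (Re z) 0); [now apply Hw0|lra].
    - intros z Hz. destruct (HLF z Hz) as [_ E]. destruct (Req_EM_T (Re z) 0); [reflexivity|contradiction]. }
  assert (E3 : ln 2 * LS (bad l1) zs <= LS (fun z => bad l1 z * w z) nd).
  { rewrite <- LS_scal. apply Rle_trans with (LS (fun z => bad l1 z * w z) zs).
    - apply LS_le. intros z Hz. destruct (Hzs z Hz) as [Hzl Hzr].
      rewrite Rmult_comm. apply Rmult_le_compat_l; [now apply bad_nonneg|].
      apply ln_le; [lra|]. specialize (Hz0 z Hzl). apply Rmult_le_reg_r with (Cmod z); [exact Hz0|].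
      unfold Rdiv. rewrite Rmult_assoc, Rinv_l by lra. lra.
    - apply LS_incl; [exact Nzs|exact Nnd| |].
      + intros z Hz. apply Ind. now apply Hzs.
      + intros z Hz. apply Ind in Hz. apply Rmult_le_pos; [now apply bad_nonneg|now apply Hw0]. }
  lra.
Qed.

Lemma ln_absorb c d : 0 < c -> 0 < d -> exists K, forall x, 0 < x -> c * ln x <= d * x + K.
Proof.
  intros Hc Hd. set (e := d / c). assert (He : 0 < e) by (apply Rdiv_lt_0_compat; lra).
  exists (c * (- 1 - ln e)). intros x Hx.
  assert (H : ln x <= e * x - 1 - ln e).
  { assert (H : ln (e * x) <= e * x - 1).
    { rewrite <- (ln_exp (e * x - 1)). apply ln_le; [nra|]. pose proof (exp_ineq1_le (e * x - 1)). lra. }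
    rewrite ln_mult in H by assumption. lra. }
  apply Rle_trans with (c * (e * x - 1 - ln e)); [apply Rmult_le_compat_l; lra|].
  right. unfold e. field. lra.
Qed.

Lemma ln_2_ge : / 2 <= ln 2.
Proof. pose proof ln_lt_2. lra. Qed.

Definition in_strip (T : R) (z : C) : bool := if Rlt_dec (Rabs (Im z)) T then true else false.
Definition simple_axis (p : C * nat) : bool := if Req_EM_T (Re (fst p)) 0 then Nat.eqb (snd p) 1 else false.

Lemma length_filter_simple_cons p ps : length (filter simple_axis (p :: ps)) =
  ((if simple_axis p then 1 else 0) + length (filter simple_axis ps))%nat.
Proof. simpl. now destruct (simple_axis p). Qed.

Lemma strip_count (f g : C -> C) l T : ent g -> (forall s, f s = (LP l s * g s)%C) ->
  (forall z, f z = RtoC 0 -> Rabs (Im z) < T -> g z <> RtoC 0) ->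
  let zs := filter (in_strip T) (nodup C_dec l) in let ks := map (count_occ C_dec l) zs in
  NoDup zs /\ (forall s, In s zs <-> (f s = RtoC 0 /\ Rabs (Im s) < T)) /\ Forall2 (zero_order f) zs ks /\
  0 <= INR (sum_nat_list ks) - INR (length (filter simple_axis (combine zs ks))) <= 2 * LS (bad l) zs.
Proof.
  intros Hg Hf Hgz zs ks.
  assert (Hin : forall z, In z zs -> In z l /\ Rabs (Im z) < T).
  { intros z Hz. apply filter_In in Hz. destruct Hz as [Hz1 Hz2]. apply nodup_In in Hz1.
    split; [exact Hz1|]. unfold in_strip in Hz2. destruct (Rlt_dec (Rabs (Im z)) T); [assumption|discriminate]. }
  assert (Hl0 : forall z, In z l -> f z = RtoC 0) by (intros z Hz; rewrite Hf, LP_in_0 by exact Hz; ring).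
  split; [apply NoDup_filter, NoDup_nodup|]. split; [|split].
  - intros s. split.
    + intros Hs. destruct (Hin s Hs). split; [now apply Hl0|assumption].
    + intros [Hs1 Hs2]. apply filter_In. split.
      * apply nodup_In. apply NNPP. intros h. specialize (Hgz s Hs1 Hs2).
        apply (Cmult_neq_0' _ _ (LP_neq_0 l s h) Hgz). now rewrite <- Hf.
      * unfold in_strip. destruct (Rlt_dec (Rabs (Im s)) T); [reflexivity|contradiction].
  - unfold ks. revert Hin. generalize zs. intros ys Hin. induction ys as [|z ys IH]; simpl; constructor.
    + destruct (Hin z) as [H1 H2]; [now left|]. apply zero_order_list with g; auto.
    + apply IH. intros y Hy. apply Hin. now right.
  - unfold ks. revert Hin. generalize zs. intros ys Hin. induction ys as [|z ys IH]; [simpl; lra|].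
    destruct IH as [I1 I2]; [intros y Hy; apply Hin; now right|].
    destruct (Hin z) as [Hz _]; [now left|]. pose proof (proj1 (count_occ_In C_dec l z) Hz) as Hc.
    simpl combine. simpl LS. unfold sum_nat_list in *. simpl fold_right. rewrite plus_INR.
    unfold bad at 1. set (k := count_occ C_dec l z) in *.
    assert (Hk : 1 <= INR k) by (apply (le_INR 1); lia).
    rewrite length_filter_simple_cons. set (rest := length _) in *. unfold simple_axis. simpl fst. simpl snd.
    destruct (Req_EM_T (Re z) 0) as [E|E].
    + destruct (Nat.eqb_spec k 1) as [K|K].
      * rewrite plus_INR. simpl (INR 1). lra.
      (* A zero of multiplicity [k >= 2] on the axis counts [k] on the left and [2 (k - 1) >= k] on
         the right; the factor 2 is needed here. *)
      * assert (2 <= INR k) by (apply (le_INR 2); lia). rewrite plus_INR. simpl (INR 0). lra.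
    + rewrite plus_INR. simpl (INR 0). lra.
Qed.

Lemma LS_single_le zs z c : NoDup zs -> 0 <= c -> LS (fun y => if C_dec z y then c else 0) zs <= c.
Proof.
  intros Hn Hc. destruct (classic (In z zs)) as [h|h]; [rewrite LS_single by assumption; lra|].
  transitivity 0; [right|exact Hc]. transitivity (LS (fun _ => 0 * 0) zs); [|rewrite LS_scal; ring].
  apply LS_ext. intros y Hy. destruct (C_dec z y) as [->|_]; [contradiction|ring].
Qed.

Lemma count_repeat_neq (z y : C) k : y <> z -> count_occ C_dec (repeat z k) y = O.
Proof.
  intros H. induction k as [|k IH]; [reflexivity|]. simpl. destruct (C_dec z y) as [E|_]; [congruence|exact IH].
Qed.

Lemma count_repeat_eq (z : C) k : count_occ C_dec (repeat z k) z = k.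
Proof. induction k as [|k IH]; [reflexivity|]. simpl. destruct (C_dec z z) as [_|h]; [now rewrite IH|congruence]. Qed.

(** The terms in [V ln V] and in [V ln pi] cancel. Of the linear coefficient, 2 comes from the
    multiplier in [h], [2 L / pi] in equal parts from the frequencies of [h] and from [ln (kap n)],
    and [2 / pi] is [4 / pi] from [Psi] less [2 / pi] from [Lam]. The outer factor 2 comes from
    [ln 2 >= 1 / 2]. *)
Lemma counting_numeric n V B SF SH cf ch Df Dh D' : 1 <= V ->
  let L := ln (2 * INR n + 1) in let Lam := ln (V + 1) - 1 - ln PI in
  ln 2 * B + SF + cf <= 2 / PI * (V * Lam) + (Lam + Df) ->
  SH + ch <= 2 / PI * (L / 2 * V + PI * V) + Dh ->
  2 * (Psi n V - ln V) - D' <= SF + SH -> 0 <= B ->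
  B <= 2 * (V * (2 + 2 / PI + 2 * L / PI) + 7 * ln V + (Rabs cf + Rabs ch + Rabs Df + Rabs Dh + Rabs D' + 3)).
Proof.
  intros HV L Lam H1 H2 H3 HB. pose proof PI2_3_2 as HP3.
  assert (Hln : ln (V + 1) - ln V <= / V).
  { assert (E : ln (V + 1) - ln V = ln (1 + / V)).
    { unfold Rminus. rewrite <- ln_Rinv, <- ln_mult by (try apply Rinv_0_lt_compat; lra). f_equal. field. lra. }
    rewrite E. rewrite <- (ln_exp (/ V)) at 2. apply ln_le; [|apply exp_ineq1_le].
    assert (0 < / V) by (apply Rinv_0_lt_compat; lra). lra. }
  assert (HVln : V * (ln (V + 1) - ln V) <= 1).
  { apply Rle_trans with (V * / V); [apply Rmult_le_compat_l; lra|right; field; lra]. }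
  assert (HiV : / V <= 1) by (rewrite <- Rinv_1; apply Rinv_le_contravar; lra).
  assert (HlnPI : 0 <= ln PI) by (rewrite <- ln_1; apply ln_le; lra).
  assert (HiP : 0 < / PI <= / 3) by (split; [apply Rinv_0_lt_compat; lra|apply Rinv_le_contravar; lra]).
  unfold Psi in H3. rewrite ln_kap in H3. fold L in H3.
  pose proof (RRle_abs (- cf)) as A1. pose proof (RRle_abs (- ch)) as A2. rewrite Rabs_Ropp in A1, A2.
  pose proof (RRle_abs Df) as A3. pose proof (RRle_abs Dh) as A4. pose proof (RRle_abs D') as A5.
  pose proof ln_2_ge as H2l.
  assert (HB2 : / 2 * B <= ln 2 * B) by (apply Rmult_le_compat_r; lra).
  assert (Key : ln 2 * B <= 2 * / PI * (V * (ln (V + 1) - ln V)) + V * (2 + 2 / PI + 2 * L / PI) + 6 * ln V + Lam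
     + (Rabs cf + Rabs ch + Rabs Df + Rabs Dh + Rabs D')).
  { assert (E : 2 / PI * (V * Lam) + 2 / PI * (L / 2 * V + PI * V)
       - 2 * (/ PI * (V * ln V - 2 * V - V * (ln PI + L / 2)) - 2 * ln V - ln V)
       = 2 * / PI * (V * (ln (V + 1) - ln V)) + V * (2 + 2 / PI + 2 * L / PI) + 6 * ln V).
    { unfold Lam. field. lra. }
    lra. }
  assert (HLam : Lam <= ln V) by (unfold Lam; lra).
  assert (2 * / PI * (V * (ln (V + 1) - ln V)) <= 1).
  {
    nra. }
  lra.
Qed.

Lemma bad_count_bound n a : (exists m, (m <= n)%nat /\ a m <> RtoC 0) ->
  exists K0 C1, 2 <= C1 /\ forall T, 2 <= T -> exists l g V, ent g /\ (forall s, CF n a s = (LP l s * g s)%C) /\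
    (forall z, CF n a z = RtoC 0 -> Rabs (Im z) < T -> g z <> RtoC 0) /\ 1 <= V <= 3 * (T + C1) + 1 /\
    LS (bad l) (filter (in_strip T) (nodup C_dec l)) <=
      2 * (V * (2 + 2 / PI + 2 * ln (2 * INR n + 1) / PI) + 7 * ln V) + K0.
Proof.
  intros Ha.
  destruct (CF_zero_free n a Ha) as [C0 HC0].
  destruct (axis_zeros_lower n a Ha) as [h [Dh [D' [Hh [Hhnz [Hhb [r0 [Hr0 Hax]]]]]]]].
  destruct (CF_growth n a) as [Df HDf].
  assert (Hnz : exists s, CF n a s <> RtoC 0).
  { exists (RtoC (Rabs C0)). apply HC0; unfold Re, Im; simpl.
    - rewrite Rabs_Rabsolu. apply RRle_abs.
    - rewrite Rabs_R0. apply Rabs_pos. }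
  destruct (ent_zero_order (CF n a) (RtoC 0) (ent_CF n a) Hnz) as [k0 [f1 [Hf1 [Hf10 Hfk]]]].
  destruct (ent_zero_order h (RtoC 0) Hh Hhnz) as [kh [h1 [Hh1 [Hh10 Hhk]]]].
  set (cf := ln (Cmod (f1 (RtoC 0)))). set (ch := ln (Cmod (h1 (RtoC 0)))).
  (* The summands respect the zero-free sector, the threshold of [axis_zeros_lower] and, through
     [exp (1 + ln PI)], the sign of [Lam]. *)
  set (C1 := 2 + Rabs C0 + r0 + exp (1 + ln PI)).
  pose proof (Rabs_pos C0) as HC0p. pose proof (exp_pos (1 + ln PI)) as Hep.
  exists (2 * (Rabs cf + Rabs ch + Rabs Df + Rabs Dh + Rabs D' + 3) + INR k0), C1.
  split; [unfold C1; lra|]. intros T HT.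
  (* By the zero-free sector the zeros of the strip lie in the square of half-side [T'], thus within
     [sqrt 2 T'], which is below [3 T' / 2]. *)
  set (T' := T + C1). set (r := 3 / 2 * T').
  assert (HT' : C1 <= T') by (unfold T'; lra). assert (HC1 : 3 <= C1) by (unfold C1; lra).
  (* [V] is a half-integer, as the bound for [h] requires, and at least [2 r], so that zeros of the
     strip weigh at least [ln 2]. *)
  destruct (nfloor_ex (2 * r + / 2)) as [K [HK1 HK2]]; [unfold r; lra|].
  set (V := INR K + / 2). assert (HV : 2 * r <= V <= 2 * r + 1) by (unfold V; lra).
  assert (HV1 : 1 <= V) by (unfold r in HV; lra).
  set (U := fun z => Cmod z <= V).
  assert (Hf1nz : exists s, f1 s <> RtoC 0) by (exists (RtoC 0); exact Hf10).
  assert (Hh1nz : exists s, h1 s <> RtoC 0) by (exists (RtoC 0); exact Hh10).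
  destruct (ent_zero_list f1 U V Hf1 Hf1nz ltac:(lra) ltac:(auto)) as [l1 [g1 [Hg1 [Hfl1 [Hl1 Hg1z]]]]].
  destruct (ent_zero_list h1 U V Hh1 Hh1nz ltac:(lra) ltac:(auto)) as [lh [gh [Hgh [Hhlh [Hlh Hghz]]]]].
  set (l := repeat (RtoC 0) k0 ++ l1).
  assert (Hfl : forall s, CF n a s = (LP l s * g1 s)%C).
  { intros s. unfold l. rewrite LP_app, LP_repeat, Hfk, Hfl1. ring. }
  assert (Hstrip : forall z, CF n a z = RtoC 0 -> Rabs (Im z) < T -> Cmod z <= r).
  { intros z Hz1 Hz2.
    assert (Hre : Rabs (Re z) <= T').
    { apply Rnot_lt_le. intros g. apply (HC0 z); [|unfold T' in *; lra|exact Hz1].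
      pose proof (RRle_abs C0). unfold C1 in *. lra. }
    apply Rsqr_incr_0; [|apply Cmod_ge_0|unfold r; lra]. unfold Rsqr.
    replace (Cmod z * Cmod z) with (Cmod z ^ 2) by ring. rewrite Cmod_sqr.
    rewrite <- (pow2_abs (Re z)), <- (pow2_abs (Im z)).
    assert (Rabs (Im z) <= T') by (unfold T' in *; lra).
    pose proof (Rabs_pos (Re z)). pose proof (Rabs_pos (Im z)). unfold r. nra. }
  exists l, g1, V. split; [exact Hg1|]. split; [exact Hfl|]. split.
  { intros z Hz1 Hz2. apply Hg1z. unfold U. specialize (Hstrip z Hz1 Hz2). lra. }
  split; [unfold T' in *; unfold r in HV; lra|].
  set (zs := filter (in_strip T) (nodup C_dec l)).
  assert (Nzs : NoDup zs) by apply NoDup_filter, NoDup_nodup.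
  assert (H0l1 : ~ In (RtoC 0) l1).
  { intros Hi. apply Hf10. rewrite Hfl1, LP_in_0 by exact Hi. ring. }
  assert (Hzsl : forall z, In z zs -> In z l /\ Cmod z <= r).
  { intros z Hz. apply filter_In in Hz. destruct Hz as [Hz1 Hz2]. apply nodup_In in Hz1.
    split; [exact Hz1|]. unfold in_strip in Hz2. destruct (Rlt_dec (Rabs (Im z)) T) as [h0|]; [|discriminate].
    apply Hstrip; [|exact h0]. rewrite Hfl, LP_in_0 by exact Hz1. ring. }
  set (nz := fun z => if C_dec (RtoC 0) z then false else true).
  set (zs' := filter nz zs).
  assert (Hzs' : forall z, In z zs' -> In z l1 /\ Cmod z <= r).
  { intros z Hz. apply filter_In in Hz. destruct Hz as [Hz1 Hz2]. unfold nz in Hz2.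
    destruct (C_dec (RtoC 0) z) as [|hne]; [discriminate|]. destruct (Hzsl z Hz1) as [Hzl Hzr]. split; [|exact Hzr].
    apply in_app_or in Hzl. destruct Hzl as [Hzl|Hzl]; [|exact Hzl]. apply repeat_spec in Hzl. congruence. }
  (* Jensen's inequality applies to [f1], from which the zero at the origin is removed; its
     multiplicity [k0] returns as a constant. *)
  assert (Hbad : LS (bad l) zs <= LS (bad l1) zs' + INR k0).
  { unfold zs'. rewrite LS_filter.
    apply Rle_trans with (LS (fun z => (if nz z then bad l1 z else 0) + (if C_dec (RtoC 0) z then INR k0 else 0)) zs).
    - apply LS_le. intros z Hz. unfold nz, bad, l. rewrite count_occ_app, plus_INR.
      destruct (C_dec (RtoC 0) z) as [<-|hne].
      + rewrite count_repeat_eq. rewrite (proj1 (count_occ_not_In C_dec l1 (RtoC 0)) H0l1). simpl INR.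
        destruct (Req_EM_T (Re (RtoC 0)) 0); lra.
      + rewrite count_repeat_neq by congruence. simpl INR at 1. lra.
    - rewrite LS_plus. apply Rplus_le_compat_l. apply LS_single_le; [exact Nzs|apply pos_INR]. }
  destruct (Hax V) as [LF [LH [NLF [NLH [HLF [HLH HLow]]]]]]; [unfold C1, r in *; lra|].
  assert (Hpow : forall (z : C) k, z <> RtoC 0 -> ((z - 0) ^ k)%C <> RtoC 0).
  { intros z k hz. apply Cmod_gt_0. rewrite Cmod_pow. apply pow_lt, Cmod_pos.
    intros E. apply hz. replace z with (z - 0)%C by ring. exact E. }
  assert (HLF1 : forall z, In z LF -> In z l1 /\ Re z = 0).
  { intros z Hz. destruct (HLF z Hz) as [E1 [E2 [E3 E4]]]. split; [|exact E2].
    apply NNPP. intros hi. rewrite Hfk, Hfl1 in E1.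
    destruct (Cmult_eq_0 _ _ E1) as [E|E]; [now apply (Hpow z k0 E3)|].
    destruct (Cmult_eq_0 _ _ E) as [E'|E']; [now apply (LP_neq_0 l1 z hi)|now apply (Hg1z z E4)]. }
  assert (HLH1 : incl LH lh).
  { intros z Hz. destruct (HLH z Hz) as [E1 [E3 E4]].
    apply NNPP. intros hi. rewrite Hhk, Hhlh in E1.
    destruct (Cmult_eq_0 _ _ E1) as [E|E]; [now apply (Hpow z kh E3)|].
    destruct (Cmult_eq_0 _ _ E) as [E'|E']; [now apply (LP_neq_0 lh z hi)|now apply (Hghz z E4)]. }
  assert (Hcirc : forall t, Cmod (RtoC V * unit t) = V) by (intros t; rewrite Cmod_mult, Cmod_unit, Cmod_RtoC_pos; lra).
  (* Division by a power of [s] does not increase the modulus on a circle of radius at least 1. *)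
  assert (Hdiv : forall (F G : C -> C) k w, (forall s, F s = ((s - 0) ^ k * G s)%C) -> Cmod w = V -> Cmod (G w) <= Cmod (F w)).
  { intros F G k w HFG Hw. rewrite HFG, Cmod_mult, Cmod_pow. replace (w - 0)%C with w by ring. rewrite Hw.
    assert (1 <= V ^ k) by (rewrite <- (pow1 k); apply pow_incr; lra). pose proof (Cmod_ge_0 (G w)). nra. }
  set (Lam := ln (V + 1) - 1 - ln PI).
  assert (HLam : 0 <= Lam).
  { unfold Lam. assert (1 + ln PI <= ln (V + 1)); [|lra]. rewrite <- (ln_exp (1 + ln PI)). apply ln_le; [exact Hep|].
    unfold C1, r in *. lra. }
  assert (J1 : ln 2 * LS (bad l1) zs' + LS (fun z => ln (V / Cmod z)) LF + cf <= 2 / PI * (V * Lam) + (Lam + Df)).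
  { apply (bad_jensen f1 l1 g1 V r (V * Lam) (Lam + Df) LF Hg1 Hfl1 Hf10); try assumption.
    - unfold r. lra.
    - lra.
    - apply Rmult_le_pos; lra.
    - intros t. eapply Rle_trans; [apply (Hdiv (CF n a) f1 k0); [exact Hfk|apply Hcirc]|].
      eapply Rle_trans; [apply HDf|]. apply exp_mono.
      replace (Re (RtoC V * unit t)) with (V * cos t) by (unfold Re; simpl; ring).
      rewrite Rabs_mult, (Rabs_pos_eq V) by lra.
      pose proof (Rabs_pos (cos t)) as Hc0.
      assert (Hc1 : Rabs (cos t) <= 1) by (apply Rabs_le; pose proof (COS_bound t); lra).
      assert (HVc : 0 <= V * Rabs (cos t) <= V) by (split; [apply Rmult_le_pos; lra|]; rewrite <- (Rmult_1_r V) at 2; apply Rmult_le_compat_l; lra).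
      assert (Hll : ln (V * Rabs (cos t) + 1) <= ln (V + 1)) by (apply ln_le; lra).
      assert ((V * Rabs (cos t) + 1) * (ln (V * Rabs (cos t) + 1) - 1 - ln PI) <= (V * Rabs (cos t) + 1) * Lam)
        by (apply Rmult_le_compat_l; [lra|unfold Lam; lra]).
      lra.
    - apply NoDup_filter, Nzs. }
  assert (J2 : LS (fun z => ln (V / Cmod z)) LH + ch <= 2 / PI * (ln (2 * INR n + 1) / 2 * V + PI * V) + Dh).
  { apply Rle_trans with (LS (fun z => ln (V / Cmod z)) lh + ch).
    - apply Rplus_le_compat_r. apply LS_incl_list; [exact NLH|exact HLH1|].
      intros z Hz. assert (Hz0 : 0 < Cmod z).
      { apply Cmod_pos. intros ->. apply Hh10. rewrite Hhlh, LP_in_0 by exact Hz. ring. }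
      rewrite <- ln_1. apply ln_le; [lra|]. specialize (Hlh z Hz). unfold U in Hlh.
      apply Rmult_le_reg_r with (Cmod z); [exact Hz0|]. unfold Rdiv. rewrite Rmult_assoc, Rinv_l by lra. lra.
    - assert (HL0 : 0 <= ln (2 * INR n + 1)) by (rewrite <- ln_1; apply ln_le; pose proof (pos_INR n); lra).
      pose proof PI_RGT_0 as HP.
      apply (jensen h1 gh lh V (ln (2 * INR n + 1) / 2 * V) (PI * V) Dh Hgh Hhlh); try assumption; try lra.
      + apply Rmult_le_pos; lra.
      + apply Rmult_le_pos; lra.
      + intros t. eapply Rle_trans; [apply (Hdiv h h1 kh); [exact Hhk|apply Hcirc]|]. apply Hhb. }
  assert (HB0 : 0 <= LS (bad l1) zs').
  { apply LS_nonneg. intros z Hz. apply bad_nonneg. now apply Hzs'. }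
  pose proof (counting_numeric n V (LS (bad l1) zs') _ _ cf ch Df Dh D' HV1 J1 J2 HLow HB0) as Fin.
  lra.
Qed.

(** Write [q = ln (2 n + 1) / pi]. Doubling the previous bound gives
    [V (8 + 8 / pi + 8 q) + 28 ln V] up to a constant, and for [n >= 1], where [q > 0], the
    logarithm is absorbed by [2 q V]. With [V <= 3 T + c] the coefficient of [T] is
    [24 + 24 / pi + 30 q], at most [32 n + 32 q] because [1 / pi <= 1 / 3]. *)
Lemma off_axis_bound_pos n a : (1 <= n)%nat -> (exists m, (m <= n)%nat /\ a m <> RtoC 0) ->
  exists K : R, forall T : R, 2 <= T -> exists l g, ent g /\ (forall s, CF n a s = (LP l s * g s)%C) /\
    (forall z, CF n a z = RtoC 0 -> Rabs (Im z) < T -> g z <> RtoC 0) /\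
    2 * LS (bad l) (filter (in_strip T) (nodup C_dec l)) <= (32 * INR n + 32 * ln (2 * INR n + 1) / PI) * T + K.
Proof.
  intros Hn Ha. destruct (bad_count_bound n a Ha) as [K0 [C1 [HC1 H]]].
  set (L := ln (2 * INR n + 1)). assert (Hn1 : 1 <= INR n) by now apply (le_INR 1).
  assert (HL : 0 < L) by (unfold L; rewrite <- ln_1; apply ln_increasing; lra).
  pose proof PI2_3_2 as HP3.
  assert (HiP : 0 < / PI <= / 3) by (split; [apply Rinv_0_lt_compat; lra|apply Rinv_le_contravar; lra]).
  assert (HLP : 0 < L / PI) by (apply Rdiv_lt_0_compat; lra).
  destruct (ln_absorb 28 (2 * L / PI)) as [K1 HK1]; [lra|unfold Rdiv in *; lra|].
  set (c := 3 * C1 + 1).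
  exists (c * (8 + 8 / PI + 10 * L / PI) + K1 + 2 * K0). intros T HT.
  destruct (H T HT) as [l [g [V [Hg [Hf [Hgz [HV HB]]]]]]]. exists l, g.
  split; [exact Hg|]. split; [exact Hf|]. split; [exact Hgz|].
  fold L in HB. specialize (HK1 V ltac:(lra)).
  set (q := L / PI) in *.
  replace (2 * L / PI) with (2 * q) in * by (unfold q; field; lra).
  replace (10 * L / PI) with (10 * q) by (unfold q; field; lra).
  replace (32 * L / PI) with (32 * q) by (unfold q; field; lra).
  unfold Rdiv in *. set (p := / PI) in *.
  assert (HV' : V <= 3 * T + c) by (unfold c; lra).
  assert (HVm : V * (8 + 8 * p + 10 * q) <= (3 * T + c) * (8 + 8 * p + 10 * q)) by (apply Rmult_le_compat_r; lra).
  assert (HTm : (24 + 24 * p + 30 * q) * T <= (32 * INR n + 32 * q) * T) by (apply Rmult_le_compat_r; lra).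
  lra.
Qed.

(** * The case [n = 0] *)

(** For [r > 0] this is [2 K_s(2 r)]. *)
Definition J (s : C) (r : R) : C := IntC (ker r r s).

Lemma goodC_ker_diag r s : 0 < r -> goodC (ker r r s).
Proof. intros H. apply goodC_ker. split; [exact H|now left]. Qed.

Lemma goodR_kerR_diag r c : 0 < r -> goodR (kerR r r c).
Proof. intros H. apply goodR_kerR. split; [exact H|now left]. Qed.

Lemma ker_diag_split r s t : ker r r s t = (ker 0 0 s t * RtoC (exp (- r * (exp t + exp (- t)))))%C.
Proof. unfold ker. rewrite <- cexp_R, <- cexp_plus. f_equal. apply C_ext; simpl; ring. Qed.

Lemma ker_diag_cosh r s t : (RtoC (exp t + exp (- t)) * ker r r s t)%C = (RtoC 1 * ker r r (s + RtoC 1) t + RtoC 1 * ker r r (s + RtoC (-1)) t)%C.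
Proof.
  rewrite <- !ker_shift_s, !cexp_R, RtoC_plus.
  replace (1 * t) with t by ring. replace (-1 * t) with (- t) by ring. ring.
Qed.

Lemma J_derive s r : 0 < r -> isD (J s) r (- (J (s + RtoC 1) r + J (s + RtoC (-1)) r))%C.
Proof.
  intros Hr.
  pose proof (IntC_param (ker 0 0 s) (fun t => exp t + exp (- t)) r (r / 2) ltac:(lra) (contC_ker _ _ _)) as H.
  apply (isD_ext (fun y => IntC (fun t => ker 0 0 s t * RtoC (exp (- y * (exp t + exp (- t)))))%C)).
  { intros u. apply IntC_ext. intros t. symmetry. apply ker_diag_split. }
  assert (E : forall t, (RtoC (exp t + exp (- t)) * (ker 0 0 s t * RtoC (exp (- r * (exp t + exp (- t))))))%C =
     (RtoC 1 * ker r r (s + RtoC 1) t + RtoC 1 * ker r r (s + RtoC (-1)) t)%C).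
  { intros t. now rewrite <- ker_diag_split, ker_diag_cosh. }
  eapply isD_eq; [apply H; clear H|].
  - apply contR_derive. intros t. auto_derive. trivial.
  - intros t. left. pose proof (exp_pos t). pose proof (exp_pos (- t)). lra.
  - replace (fun t => Cmod (ker 0 0 s t) * (exp t + exp (- t)) ^ 2 * exp (- (r - r / 2) * (exp t + exp (- t)))) with
      (fun t => (kerR (r / 2) (r / 2) (Re s + 2) t + 2 * kerR (r / 2) (r / 2) (Re s) t) + kerR (r / 2) (r / 2) (Re s - 2) t).
    + assert (G : forall c, goodR (kerR (r / 2) (r / 2) c)) by (intros c; apply goodR_kerR_diag; lra).
      apply (goodR_plus (fun t => kerR (r / 2) (r / 2) (Re s + 2) t + 2 * kerR (r / 2) (r / 2) (Re s) t)); [|apply G].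
      apply (goodR_plus (kerR (r / 2) (r / 2) (Re s + 2)) (fun t => 2 * kerR (r / 2) (r / 2) (Re s) t)); [apply G|].
      apply goodR_scal, G.
    + apply functional_extensionality. intros t. rewrite Cmod_ker.
      set (m := exp (Re s * t) * exp (- (r - r / 2) * (exp t + exp (- t)))).
      assert (Ec : forall c, kerR (r / 2) (r / 2) (Re s + c) t = exp (c * t) * m).
      { intros c. unfold kerR, m. rewrite <- !exp_plus. f_equal. field. }
      replace (Re s - 2) with (Re s + (-2)) by ring. rewrite !Ec. rewrite <- (Rplus_0_r (Re s)) at 1. rewrite Ec.
      replace (kerR 0 0 (Re s) t) with (exp (Re s * t)) by (unfold kerR; f_equal; ring).
      replace (2 * t) with (t + t) by ring. replace (-2 * t) with (- t + - t) by ring. rewrite !exp_plus, Rmult_0_l, exp_0.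
      assert (exp t * exp (- t) = 1) by (rewrite <- exp_plus, Rplus_opp_r; apply exp_0).
      transitivity ((exp t ^ 2 + 2 * (exp t * exp (- t)) + exp (- t) ^ 2) * m); [|unfold m; ring]. rewrite H. ring.
  - intros y Hy. apply Rabs_le_between in Hy.
    apply goodC_ext with (ker y y s); [intros t; apply ker_diag_split|]. apply goodC_ker_diag. lra.
  - apply goodC_ext with (fun t => RtoC 1 * ker r r (s + RtoC 1) t + RtoC 1 * ker r r (s + RtoC (-1)) t)%C; [intros; symmetry; apply E|].
    apply goodC_lin2; now apply goodC_ker_diag.
  - f_equal. rewrite (IntC_ext _ _ E). rewrite (IntC_lin2 (RtoC 1) (RtoC 1) (ker r r (s + RtoC 1)) (ker r r (s + RtoC (-1)))) by now apply goodC_ker_diag.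
    unfold J. ring.
Qed.

Lemma J_rec s r : 0 < r -> (s * J s r = RtoC r * (J (s + RtoC 1) r - J (s + RtoC (-1)) r))%C.
Proof.
  intros Hr. set (k1 := ker r r (s + RtoC 1)). set (k2 := ker r r (s + RtoC (-1))). set (k0 := ker r r s).
  assert (G : forall s, goodC (ker r r s)) by (intros; now apply goodC_ker_diag).
  assert (D : forall t, isD k0 t (s * k0 t + (RtoC (- r) * k1 t + RtoC r * k2 t))%C).
  { intros t. eapply isD_eq; [apply isD_ker|]. fold k0 k1 k2. rewrite RtoC_opp. ring. }
  pose proof (IntC_derive k0 (fun t => s * k0 t + (RtoC (- r) * k1 t + RtoC r * k2 t))%C D) as H.
  rewrite (IntC_lin3 s (RtoC (- r)) (RtoC r) k0 k1 k2) in H by apply G.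
  change (J s r) with (IntC k0). change (J (s + RtoC 1) r) with (IntC k1). change (J (s + RtoC (-1)) r) with (IntC k2).
  apply Csub_eq_0. rewrite <- H.
  - rewrite RtoC_opp. ring.
  - apply goodC_contC, goodC_lin3; apply G.
  - apply goodR_Cmod_ker. split; [exact Hr|now left].
Qed.

Lemma J_conj s r : 0 < r -> Cconj (J s r) = J (Cconj s) r.
Proof.
  intros H. unfold J. rewrite IntC_conj by now apply goodC_ker_diag. apply IntC_ext. intros t. apply ker_conj.
Qed.

Lemma J_bound s r : 0 < r -> Cmod (J s r) <= IntR (kerR r r (Re s)).
Proof.
  intros H. apply IntC_bound; [now apply goodC_ker_diag|now apply goodR_kerR_diag|].
  intros t. rewrite Cmod_ker. lra.
Qed.

Lemma kerR_diag_decay r0 r c t : r0 <= r -> kerR r r c t <= exp (- 2 * (r - r0)) * kerR r0 r0 c t.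
Proof.
  intros H. unfold kerR. rewrite <- exp_plus. apply exp_mono.
  pose proof (two_cosh_ge t).
  nra.
Qed.

Lemma isD_comp f (g : R -> R) x l m : isD f (g x) l -> is_derive g x m -> isD (fun u => f (g u)) x (RtoC m * l)%C.
Proof.
  intros [A B] Hg. split.
  - eapply is_derive_eq; [exact (is_derive_comp (fun u => Re (f u)) g x _ _ A Hg)|]. unfold scal, Re; simpl. unfold mult; simpl. ring.
  - eapply is_derive_eq; [exact (is_derive_comp (fun u => Im (f u)) g x _ _ B Hg)|]. unfold scal, Im; simpl. unfold mult; simpl. ring.
Qed.

Lemma isD_contR_sqr f f' : (forall u, isD f u (f' u)) -> contR (fun u => Cmod (f u) ^ 2).
Proof.
  intros H. replace (fun u => Cmod (f u) ^ 2) with (fun u => Re (f u) * Re (f u) + Im (f u) * Im (f u)).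
  - assert (A : contR (fun u => Re (f u))) by (apply contR_derive; intros u; eexists; apply (H u)).
    assert (B : contR (fun u => Im (f u))) by (apply contR_derive; intros u; eexists; apply (H u)).
    apply (contR_plus (fun u => Re (f u) * Re (f u)) (fun u => Im (f u) * Im (f u))); now apply contR_mult.
  - apply functional_extensionality. intros u. rewrite Cmod_sqr. ring.
Qed.

(** Vanishing is known only to the right of the starting point, so the derivative there is tested
    with right difference quotients. *)
Lemma is_derive_right_zero (f : R -> R) x l : is_derive f x l -> (forall u, x <= u -> f u = 0) -> l = 0.
Proof.
  intros H H0. apply is_derive_Reals in H. apply NNPP. intros hl.
  destruct (H (Rabs l)) as [d Hd]; [now apply Rabs_pos_lt|].
  pose proof (cond_pos d) as Hdp. specialize (Hd (d / 2) ltac:(lra)).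
  rewrite Rabs_pos_eq in Hd by lra. specialize (Hd ltac:(lra)).
  rewrite (H0 (x + d / 2)), (H0 x) in Hd by lra.
  replace ((0 - 0) / (d / 2) - l) with (- l) in Hd by (field; lra). rewrite Rabs_Ropp in Hd. lra.
Qed.

Lemma isD_right_zero f x l : isD f x l -> (forall u, x <= u -> f u = RtoC 0) -> l = RtoC 0.
Proof.
  intros [A B] H. apply C_ext.
  - apply (is_derive_right_zero _ _ _ A). intros u Hu. now rewrite H.
  - apply (is_derive_right_zero _ _ _ B). intros u Hu. now rewrite H.
Qed.

(* In the variable [u = ln r] the Bessel equation has no first-order term. *)
Definition JE (s : C) (u : R) : C := J s (exp u).

(** The derivative of [JE s], written through its neighbours so that its decay follows from
    theirs. *)
Definition WE (s : C) (u : R) : C := (- RtoC (exp u) * (JE (s + RtoC 1) u + JE (s + RtoC (-1)) u))%C.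

Lemma is_derive_exp u : is_derive exp u (exp u).
Proof. apply is_derive_Reals, derivable_pt_lim_exp. Qed.

Lemma JE_derive s u : isD (JE s) u (WE s u).
Proof.
  eapply isD_eq; [exact (isD_comp (J s) exp u _ _ (J_derive s _ (exp_pos u)) (is_derive_exp u))|]. unfold WE, JE. ring.
Qed.

Lemma JE_rec s u : (s * JE s u = RtoC (exp u) * (JE (s + RtoC 1) u - JE (s + RtoC (-1)) u))%C.
Proof. apply J_rec, exp_pos. Qed.

Lemma JE_conj s u : Cconj (JE s u) = JE (Cconj s) u.
Proof. apply J_conj, exp_pos. Qed.

(** Differentiation brings in the neighbours at distance two; [JE_rec] at [s + 1] and [s - 1]
    removes them, and [JE_rec] at [s] removes the rest. *)
Lemma WE_derive s u : isD (WE s) u ((RtoC (4 * exp u ^ 2) + s * s) * JE s u)%C.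
Proof.
  set (e := RtoC (exp u)).
  eapply isD_eq.
  - apply (isD_mult (fun u => - RtoC (exp u))%C (fun u => JE (s + RtoC 1) u + JE (s + RtoC (-1)) u)%C).
    + apply (isD_ext (fun u => RtoC (-1) * RtoC (exp u))%C); [intros; ring|].
      apply isD_scal, isD_RtoC, is_derive_exp.
    + apply isD_plus; apply JE_derive.
  - unfold WE. fold e.
    pose proof (JE_rec s u) as R0. pose proof (JE_rec (s + RtoC 1) u) as R1. pose proof (JE_rec (s + RtoC (-1)) u) as R2.
    fold e in R0, R1, R2.
    replace (s + RtoC 1 + RtoC (-1))%C with s in * by ring. replace (s + RtoC (-1) + RtoC 1)%C with s in * by ring.
    replace (RtoC (4 * exp u ^ 2)) with (4 * (e * e))%C by (unfold e; rewrite <- !RtoC_mult; f_equal; ring).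
    set (j0 := JE s u) in *. set (j1 := JE (s + RtoC 1) u) in *. set (j2 := JE (s + RtoC (-1)) u) in *.
    set (j3 := JE (s + RtoC 1 + RtoC 1) u) in *. set (j4 := JE (s + RtoC (-1) + RtoC (-1)) u) in *.
    assert (E3 : (e * j3 = (s + RtoC 1) * j1 + e * j0)%C) by (rewrite R1; ring).
    assert (E4 : (e * j4 = e * j0 - (s + RtoC (-1)) * j2)%C) by (rewrite R2; ring).
    transitivity (- e * (j1 + j2) + e * (e * j3 + (2 * e * j0 + e * j4)))%C; [ring|].
    rewrite E3, E4.
    transitivity (4 * (e * e) * j0 + s * (e * (j1 - j2)))%C; [ring|]. rewrite <- R0. ring.
Qed.

Lemma JE_decay_exp s u0 : exists A, 0 < A /\ forall u, u0 <= u -> Cmod (JE s u) <= A * exp (- 2 * (exp u - exp u0)).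
Proof.
  assert (H0 := exp_pos u0).
  assert (G : goodR (kerR (exp u0) (exp u0) (Re s))) by now apply goodR_kerR_diag.
  exists (IntR (kerR (exp u0) (exp u0) (Re s))). split; [apply IntR_pos; [exact G|intros; apply kerR_pos]|].
  intros u Hu. eapply Rle_trans; [apply J_bound, exp_pos|]. rewrite Rmult_comm, <- IntR_scal by exact G.
  apply IntR_le; [apply goodR_kerR_diag, exp_pos|now apply goodR_scal|]. intros t. apply kerR_diag_decay. now apply exp_mono.
Qed.

Lemma exp_increment u0 u : exp u0 * (u - u0) <= exp u - exp u0.
Proof.
  replace u with (u0 + (u - u0)) at 2 by ring. rewrite exp_plus. pose proof (exp_ineq1_le (u - u0)). pose proof (exp_pos u0). nra.
Qed.

Lemma JE_decay s u0 : exists A, 0 < A /\ forall u, u0 <= u -> Cmod (JE s u) <= A * exp (- exp u0 * (u - u0)).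
Proof.
  destruct (JE_decay_exp s u0) as [A [HA H]]. exists A. split; [exact HA|]. intros u Hu.
  eapply Rle_trans; [now apply H|]. apply Rmult_le_compat_l; [lra|]. apply exp_mono. pose proof (exp_increment u0 u).
  assert (exp u0 <= exp u) by now apply exp_mono. lra.
Qed.

(** One half of the double-exponential decay absorbs the factor [e^u], the other half gives the
    stated rate. *)
Lemma WE_decay s u0 : exists A, 0 < A /\ forall u, u0 <= u -> Cmod (WE s u) <= A * exp (- exp u0 * (u - u0)).
Proof.
  destruct (JE_decay_exp (s + RtoC 1) u0) as [A [HA H]]. destruct (JE_decay_exp (s + RtoC (-1)) u0) as [B [HB H']].
  exists ((A + B) * exp (exp u0)). split; [apply Rmult_lt_0_compat; [lra|apply exp_pos]|]. intros u Hu.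
  specialize (H u Hu). specialize (H' u Hu). unfold WE. rewrite Cmod_mult, Cmod_opp, Cmod_RtoC_pos by (left; apply exp_pos).
  set (y := exp u) in *. set (c := exp u0) in *.
  assert (Hy : c * (u - u0) <= y - c) by apply exp_increment.
  assert (E1 : y <= exp c * exp (y - c)).
  { rewrite <- exp_plus. replace (c + (y - c)) with y by ring. pose proof (exp_ineq1_le y). lra. }
  assert (E2 : exp (- 2 * (y - c)) = exp (- (y - c)) * exp (- (y - c))) by (rewrite <- exp_plus; f_equal; ring).
  assert (E3 : exp (y - c) * exp (- (y - c)) = 1) by (rewrite <- exp_plus, Rplus_opp_r; apply exp_0).
  assert (E4 : exp (- (y - c)) <= exp (- c * (u - u0))) by (apply exp_mono; lra).
  assert (HS : Cmod (JE (s + RtoC 1) u + JE (s + RtoC (-1)) u) <= (A + B) * exp (- 2 * (y - c))).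
  { eapply Rle_trans; [apply Cmod_triangle|]. lra. }
  assert (Hy0 : 0 < y) by apply exp_pos. pose proof (exp_pos (- (y - c))) as Hp. pose proof (exp_pos c) as Hc.
  apply Rle_trans with (y * ((A + B) * exp (- 2 * (y - c)))); [apply Rmult_le_compat_l; lra|].
  rewrite E2. apply Rle_trans with (exp c * exp (y - c) * ((A + B) * (exp (- (y - c)) * exp (- (y - c))))).
  - apply Rmult_le_compat_r; [|exact E1]. apply Rmult_le_pos; [lra|]. apply Rmult_le_pos; lra.
  - replace (exp c * exp (y - c) * ((A + B) * (exp (- (y - c)) * exp (- (y - c))))) with
      (exp c * (exp (y - c) * exp (- (y - c))) * ((A + B) * exp (- (y - c)))) by ring.
    rewrite E3. replace (exp c * 1 * ((A + B) * exp (- (y - c)))) with ((A + B) * exp c * exp (- (y - c))) by ring.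
    apply Rmult_le_compat_l; [|exact E4]. apply Rmult_le_pos; lra.
Qed.

(** Uniformity in [u >= u0] allows [w] to approach [s] under the integral in [JE_vanish]. The factor
    [e^(2 |t|)] from the difference is covered by the kernels with [Re s] shifted by 2 in either
    direction. *)
Lemma JE_lipschitz s u0 : exists G, 0 < G /\ forall w, Cmod (w - s) <= 1 -> forall u, u0 <= u -> Cmod (JE w u - JE s u) <= G * Cmod (w - s).
Proof.
  set (r0 := exp u0). assert (H0 : 0 < r0) by apply exp_pos.
  set (k := fun t => kerR r0 r0 (Re s + 2) t + kerR r0 r0 (Re s - 2) t).
  assert (Gk : goodR k) by (apply (goodR_plus (kerR r0 r0 (Re s + 2)) (kerR r0 r0 (Re s - 2))); now apply goodR_kerR_diag).
  exists (IntR k). split.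
  { apply IntR_pos; [exact Gk|]. intros t. unfold k. pose proof (kerR_pos r0 r0 (Re s + 2) t). pose proof (kerR_pos r0 r0 (Re s - 2) t). lra. }
  intros w Hw u Hu. unfold JE, J. set (r := exp u). assert (Hr0 : r0 <= r) by now apply exp_mono. assert (Hr : 0 < r) by lra.
  rewrite <- (IntC_minus (ker r r w) (ker r r s)) by now apply goodC_ker_diag.
  rewrite Rmult_comm, <- IntR_scal by exact Gk. set (h := Cmod (w - s)) in *.
  assert (Hh : 0 <= h) by apply Cmod_ge_0.
  apply IntC_bound; [|now apply goodR_scal|].
  - apply goodC_ext with (fun t => RtoC 1 * ker r r w t + RtoC (-1) * ker r r s t)%C; [intros; ring|].
    apply goodC_lin2; now apply goodC_ker_diag.
  - intros t. replace (ker r r w t - ker r r s t)%C with (ker r r s t * (cexp ((w - s) * RtoC t) - 1))%C.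
    + rewrite Cmod_mult, Cmod_ker.
      pose proof (cexp_taylor_abs ((w - s) * RtoC t) 1) as HT. unfold expT in HT.
      replace (CS (fun k => RtoC (/ INR (fact k)) * ((w - s) * RtoC t) ^ k)%C 1) with (RtoC 1) in HT
        by (simpl; rewrite Rinv_1; ring).
      rewrite Cmod_mult, Cmod_R in HT.
      assert (HT2 : (h * Rabs t) ^ 1 / 1 * exp (h * Rabs t) <= h * exp (2 * Rabs t)).
      { replace (2 * Rabs t) with (Rabs t + Rabs t) by ring. rewrite exp_plus.
        pose proof (Rabs_pos t) as Ht. pose proof (exp_ineq1_le (Rabs t)).
        assert (exp (h * Rabs t) <= exp (Rabs t)) by (apply exp_mono; nra).
        replace ((h * Rabs t) ^ 1 / 1 * exp (h * Rabs t)) with (h * (Rabs t * exp (h * Rabs t))) by field.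
        apply Rmult_le_compat_l; [exact Hh|]. apply Rmult_le_compat; try lra. left; apply exp_pos. }
      assert (HK : kerR r r (Re s) t * exp (2 * Rabs t) <= k t).
      { apply Rle_trans with (kerR r0 r0 (Re s) t * exp (2 * Rabs t)).
        - apply Rmult_le_compat_r; [left; apply exp_pos|]. pose proof (kerR_diag_decay r0 r (Re s) t Hr0).
          assert (exp (- 2 * (r - r0)) <= 1) by (rewrite <- exp_0; apply exp_mono; lra).
          pose proof (kerR_pos r0 r0 (Re s) t). nra.
        - unfold k. pose proof (kerR_pos r0 r0 (Re s + 2) t). pose proof (kerR_pos r0 r0 (Re s - 2) t).
          unfold kerR in *. rewrite <- exp_plus. destruct (Rle_lt_dec 0 t) as [ht|ht].
          + rewrite Rabs_pos_eq by exact ht.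
            replace (- r0 * exp t - r0 * exp (- t) + Re s * t + 2 * t) with (- r0 * exp t - r0 * exp (- t) + (Re s + 2) * t) by ring. lra.
          + rewrite Rabs_left by exact ht.
            replace (- r0 * exp t - r0 * exp (- t) + Re s * t + 2 * - t) with (- r0 * exp t - r0 * exp (- t) + (Re s - 2) * t) by ring. lra. }
      pose proof (kerR_pos r r (Re s) t) as Hkp.
      apply Rle_trans with (kerR r r (Re s) t * (h * exp (2 * Rabs t))); [apply Rmult_le_compat_l; [lra|]; eapply Rle_trans; [exact HT|exact HT2]|].
      replace (kerR r r (Re s) t * (h * exp (2 * Rabs t))) with (h * (kerR r r (Re s) t * exp (2 * Rabs t))) by ring.
      now apply Rmult_le_compat_l.
    + unfold ker. replace (RtoC (- r * exp t - r * exp (- t)) + w * RtoC t)%C with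
        ((RtoC (- r * exp t - r * exp (- t)) + s * RtoC t) + (w - s) * RtoC t)%C by ring.
      rewrite (cexp_plus _ ((w - s) * RtoC t)). ring.
Qed.

Lemma exp_decay_small c u0 u2 e : 0 < c -> 0 < e -> exists u, u2 <= u /\ u0 <= u /\ exp (- c * (u - u0)) <= e.
Proof.
  intros Hc He. exists (Rmax (Rmax u0 u2) (u0 + / (c * e))).
  pose proof (Rmax_l (Rmax u0 u2) (u0 + / (c * e))) as H1. pose proof (Rmax_r (Rmax u0 u2) (u0 + / (c * e))) as H2.
  pose proof (Rmax_l u0 u2). pose proof (Rmax_r u0 u2).
  set (u := Rmax (Rmax u0 u2) (u0 + / (c * e))) in *.
  split; [lra|]. split; [lra|].
  assert (H3 : / e <= c * (u - u0)).
  { replace (/ e) with (c * / (c * e)) by (field; lra). apply Rmult_le_compat_l; lra. }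
  replace (- c * (u - u0)) with (- (c * (u - u0))) by ring. rewrite exp_Ropp. rewrite <- (Rinv_inv e).
  apply Rinv_le_contravar; [apply Rinv_0_lt_compat; lra|]. pose proof (exp_ineq1_le (c * (u - u0))). lra.
Qed.

Lemma wronskian_derive s w u : isD (fun u => WE s u * JE w u - JE s u * WE w u)%C u ((s * s - w * w) * (JE s u * JE w u))%C.
Proof.
  apply (isD_ext (fun u => WE s u * JE w u + RtoC (-1) * (JE s u * WE w u))%C); [intros; ring|].
  eapply isD_eq.
  - apply (isD_plus (fun u => WE s u * JE w u)%C (fun u => RtoC (-1) * (JE s u * WE w u))%C).
    + apply isD_mult; [apply WE_derive|apply JE_derive].
    + apply isD_scal, isD_mult; [apply JE_derive|apply WE_derive].
  - ring.
Qed.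

(* Let [v] be the Wronskian of [JE s] and [JE (Cconj w)] divided by [s^2 - (Cconj w)^2]: its derivative is
   [JE s * JE (Cconj w)], close to [|JE s|^2], it tends to [0] at infinity and it is small at [u0].
   Taking [w = s] covers zeros with [s^2] not real, and [w] near [s] covers multiple zeros. *)
Lemma JE_vanish s u0 : JE s u0 = RtoC 0 ->
  (forall e, 0 < e -> exists w, Cmod (w - s) <= e /\ (s * s - Cconj w * Cconj w)%C <> RtoC 0 /\
     Cmod (JE w u0) <= e * Cmod (s * s - Cconj w * Cconj w)) ->
  forall u, u0 <= u -> JE s u = RtoC 0.
Proof.
  intros Hs Hw.
  set (c := exp u0). assert (Hc : 0 < c) by apply exp_pos.
  destruct (JE_decay s u0) as [A [HA HAu]]. destruct (WE_decay s u0) as [A' [HA' HAu']].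
  destruct (JE_lipschitz s u0) as [G [HG HGu]].
  set (g := fun u => Cmod (JE s u) ^ 2).
  assert (Cg : contR g) by exact (isD_contR_sqr _ _ (JE_derive s)).
  set (P := fun u => RInt g u0 u).
  assert (DP : forall u, is_derive P u (g u)).
  { intros u. apply (is_derive_RInt g P u0 u); [|apply Cg].
    exists (mkposreal 1 Rlt_0_1). intros b _. apply (RInt_correct g), contR_ex_RInt, Cg. }
  assert (HP0 : P u0 = 0) by exact (RInt_point u0 g).
  assert (Hmono : forall u v, u <= v -> P u <= P v).
  { intros u v Huv. unfold P. assert (E := RInt_Chasles g u0 u v (contR_ex_RInt g u0 u Cg) (contR_ex_RInt g u v Cg)).
    rewrite <- E. unfold plus; simpl. assert (0 <= RInt g u v); [|lra].
    apply RInt_ge_0; [exact Huv|apply contR_ex_RInt, Cg|]. intros; apply pow2_ge_0. }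
  set (K := Cmod (WE s u0) + A * G / c).
  assert (HK : 0 <= K).
  { unfold K. pose proof (Cmod_ge_0 (WE s u0)). assert (0 < A * G / c) by (apply Rdiv_lt_0_compat; [now apply Rmult_lt_0_compat|exact Hc]). lra. }
  (* The constant [K] depends on [s] and [u0] but not on [w], so [e] can afterwards tend to 0. *)
  assert (Main : forall u2 e, u0 <= u2 -> 0 < e <= 1 -> P u2 <= e * (K + 1)).
  { intros u2 e Hu2 He. destruct (Hw e ltac:(lra)) as [w [Hw1 [Hw2 Hw3]]].
    set (d := (s * s - Cconj w * Cconj w)%C) in *.
    assert (Hd : 0 < Cmod d) by now apply Cmod_pos.
    destruct (JE_decay (Cconj w) u0) as [B [HB HBu]]. destruct (WE_decay (Cconj w) u0) as [B' [HB' HBu']]. fold c in HBu, HBu'.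
    set (v := fun u => (/ d * (WE s u * JE (Cconj w) u - JE s u * WE (Cconj w) u))%C).
    (* Subtracting the integral of [|JE s|^2] leaves the derivative [JE s conj (JE w - JE s)], of
       order [e] and exponentially decaying. *)
    set (f := fun u => (v u + RtoC (-1) * RtoC (P u))%C).
    assert (Df : forall u, isD f u (JE s u * Cconj (JE w u - JE s u))%C).
    { intros u. eapply isD_eq.
      - apply (isD_plus v (fun u => RtoC (-1) * RtoC (P u))%C).
        + apply isD_scal, wronskian_derive.
        + apply isD_scal, isD_RtoC, DP.
      - fold d. unfold g. rewrite Cmod2_conj, Cminus_conj, !JE_conj. field. exact Hw2. }
    set (M := A * G * e).
    assert (HM : 0 < M) by (unfold M; apply Rmult_lt_0_compat; [now apply Rmult_lt_0_compat|lra]).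
    assert (HMV : forall R, u0 <= R -> Cmod (f R - f u0) <= M / c).
    { intros R HR. set (H := fun u => - (M / c) * exp (- c * (u - u0))).
      eapply Rle_trans; [apply (isD_mean_value f (fun u => JE s u * Cconj (JE w u - JE s u))%C H (fun u => M * exp (- c * (u - u0))) u0 R HR)|].
      - intros u _. apply Df.
      - intros u _. unfold H. auto_derive; [trivial|]. unfold Rminus. field. lra.
      - intros u Hu. rewrite Cmod_mult, Cmod_conj. specialize (HAu u ltac:(lra)).
        specialize (HGu w ltac:(lra) u ltac:(lra)).
        replace (M * exp (- c * (u - u0))) with (A * exp (- c * (u - u0)) * (G * e)) by (unfold M; ring).
        apply Rmult_le_compat; try apply Cmod_ge_0; [exact HAu|]. eapply Rle_trans; [exact HGu|]. apply Rmult_le_compat_l; lra.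
      - unfold H. replace (u0 - u0) with 0 by ring. rewrite Rmult_0_r, exp_0. pose proof (exp_pos (- c * (R - u0))).
        assert (0 < M / c) by (apply Rdiv_lt_0_compat; lra). nra. }
    assert (Hv0 : Cmod (v u0) <= Cmod (WE s u0) * e).
    { unfold v. rewrite Hs. replace (/ d * (WE s u0 * JE (Cconj w) u0 - RtoC 0 * WE (Cconj w) u0))%C with (WE s u0 * (/ d * JE (Cconj w) u0))%C by ring.
      rewrite !Cmod_mult, Cmod_inv, <- JE_conj, Cmod_conj by exact Hw2. apply Rmult_le_compat_l; [apply Cmod_ge_0|].
      apply Rmult_le_reg_l with (Cmod d); [exact Hd|]. rewrite <- Rmult_assoc, Rinv_r by lra. lra. }
    set (Q := A' * B + A * B'). assert (HQ : 0 < Q) by (unfold Q; apply Rplus_lt_0_compat; now apply Rmult_lt_0_compat).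
    (* [R] is chosen after [w], so the boundary term can beat the possibly small denominator [d]. *)
    destruct (exp_decay_small c u0 u2 (e * Cmod d / Q) Hc) as [R [HR2 [HR0 HR]]].
    { apply Rdiv_lt_0_compat; [apply Rmult_lt_0_compat; lra|exact HQ]. }
    assert (HvR : Cmod (v R) <= e).
    { unfold v. rewrite Cmod_mult, Cmod_inv by exact Hw2.
      apply Rmult_le_reg_l with (Cmod d); [exact Hd|]. rewrite <- Rmult_assoc, Rinv_r, Rmult_1_l by lra.
      eapply Rle_trans; [apply Cmod_sub_triangle|]. rewrite !Cmod_mult.
      set (E := exp (- c * (R - u0))) in *.
      assert (HE1 : E <= 1) by (unfold E; rewrite <- exp_0; apply exp_mono; nra).
      specialize (HAu R HR0). specialize (HAu' R HR0). specialize (HBu R HR0). specialize (HBu' R HR0). fold E in HAu, HAu', HBu, HBu'.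
      assert (T1 : Cmod (WE s R) * Cmod (JE (Cconj w) R) <= (A' * E) * B).
      { apply Rmult_le_compat; try apply Cmod_ge_0; [exact HAu'|]. nra. }
      assert (T2 : Cmod (JE s R) * Cmod (WE (Cconj w) R) <= (A * E) * B').
      { apply Rmult_le_compat; try apply Cmod_ge_0; [exact HAu|]. nra. }
      apply Rle_trans with (Q * E); [unfold Q; lra|].
      apply Rle_trans with (Q * (e * Cmod d / Q)); [apply Rmult_le_compat_l; lra|]. right. field. lra. }
    apply Rle_trans with (P R); [now apply Hmono|].
    specialize (HMV R HR0).
    assert (Ep : RtoC (P R) = ((v R - v u0) - (f R - f u0))%C) by (unfold f; rewrite HP0; ring).
    assert (Hp : P R <= Cmod (RtoC (P R))) by (rewrite Cmod_R; apply RRle_abs).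
    rewrite Ep in Hp.
    pose proof (Cmod_sub_triangle (v R - v u0) (f R - f u0)). pose proof (Cmod_sub_triangle (v R) (v u0)).
    assert (M / c = A * G / c * e) by (unfold M; field; lra). unfold K. nra. }
  assert (HPz : forall u, u0 <= u -> P u = 0).
  { intros u Hu. apply Rle_antisym.
    - apply Rnot_lt_le. intros h.
      assert (He : 0 < Rmin 1 (P u / (2 * (K + 1))) <= 1).
      { split; [apply Rmin_glb_lt; [lra|]; apply Rdiv_lt_0_compat; lra|apply Rmin_l]. }
      specialize (Main u _ Hu He). pose proof (Rmin_r 1 (P u / (2 * (K + 1)))) as Hm.
      assert (P u / (2 * (K + 1)) * (K + 1) = P u / 2) by (field; lra). nra.
    - rewrite <- HP0. now apply Hmono. }
  intros u Hu.
  assert (g u = 0).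
  { apply (is_derive_right_zero P u (g u) (DP u)). intros v Hv. apply HPz. lra. }
  apply Cmod_le_0. unfold g in H. nra.
Qed.

(* The derivative and the recurrence determine [JE (s + 1)] and [JE (s - 1)] from [JE s]. *)
Lemma JE_vanish_shift s u0 : (forall u, u0 <= u -> JE s u = RtoC 0) ->
  forall N u, u0 <= u -> JE (s + RtoC (INR N)) u = RtoC 0.
Proof.
  intros H N. induction N as [|N IH].
  - intros u Hu. replace (s + RtoC (INR 0))%C with s by (simpl; ring). now apply H.
  - intros u Hu. rewrite S_INR, RtoC_plus, Cplus_assoc. set (w := (s + RtoC (INR N))%C) in *.
    pose proof (exp_pos u) as He.
    assert (E1 : WE w u = RtoC 0).
    { apply (isD_right_zero (JE w) u _ (JE_derive w u)). intros v Hv. apply IH. lra. }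
    pose proof (JE_rec w u) as E2. rewrite IH in E2 by exact Hu. unfold WE in E1.
    set (e := RtoC (exp u)) in *. set (j1 := JE (w + RtoC 1) u) in *. set (j2 := JE (w + RtoC (-1)) u) in *.
    assert (E : (e * (j1 + j1) = RtoC 0)%C).
    { transitivity (e * (j1 - j2) - (- e * (j1 + j2)))%C; [ring|]. rewrite E1, <- E2. ring. }
    destruct (Cmult_eq_0 _ _ E) as [h|h]; [exfalso; revert h; apply RtoC_neq_0; lra|].
    transitivity (RtoC (/ 2) * (j1 + j1))%C; [|rewrite h; ring].
    transitivity (RtoC (/ 2 + / 2) * j1)%C; [replace (/ 2 + / 2) with 1 by field; ring|rewrite RtoC_plus; ring].
Qed.

Lemma CF_0_JE a s : CF 0 a s = (a O * Cconj (a O) * JE s (ln PI))%C.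
Proof.
  rewrite CF_IntC. rewrite (IntC_ext _ (fun t => a O * Cconj (a O) * ker PI PI s t)%C).
  - rewrite (IntC_scal (a O * Cconj (a O)) (ker PI PI s)) by apply goodC_ker_diag, PI_RGT_0.
    unfold JE, J. now rewrite exp_ln by apply PI_RGT_0.
  - intros t. rewrite phiF_kernel. unfold dsum. simpl.
    replace (al 0) with PI by (unfold al; simpl; ring). ring.
Qed.

Lemma ker_diag_real r c t : ker r r (RtoC c) t = RtoC (kerR r r c t).
Proof. unfold ker, kerR. rewrite <- RtoC_mult, <- RtoC_plus. apply cexp_R. Qed.

Lemma JE_real_pos c u : JE (RtoC c) u <> RtoC 0.
Proof.
  set (r := exp u). intros h. apply (f_equal Re) in h.
  assert (H : 0 < IntR (kerR r r c)) by (apply IntR_pos; [apply goodR_kerR_diag, exp_pos|intros; apply kerR_pos]).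
  change (IntR (fun t => Re (ker r r (RtoC c) t)) = 0) in h. revert h.
  rewrite (IntR_ext (fun t => Re (ker r r (RtoC c) t)) (kerR r r c)); [lra|].
  intros t. now rewrite ker_diag_real.
Qed.

(** By [JE_vanish_shift] the vanishing would pass to [s + N], which for large [N] lies in the
    zero-free sector of [CF 0]. *)
Lemma JE_not_vanish s : (forall u, ln PI <= u -> JE s u = RtoC 0) -> False.
Proof.
  intros H.
  destruct (CF_zero_free_right 0 (fun _ => RtoC 1)) as [C0 HC0]; [exists O; split; [lia|apply RtoC_neq_0; lra]|].
  destruct (INR_unbounded (Rabs C0 + Rabs (Re s) + Rabs (Im s))) as [N HN].
  apply (HC0 (s + RtoC (INR N))%C).
  - pose proof (RRle_abs C0). pose proof (RRle_abs (- Re s)). rewrite Rabs_Ropp in *. pose proof (Rabs_pos (Im s)).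
    unfold Re in *; simpl. lra.
  - replace (Im (s + RtoC (INR N))) with (Im s) by (unfold Im; simpl; ring).
    pose proof (Rabs_pos C0). pose proof (RRle_abs (- Re s)). rewrite Rabs_Ropp in *. unfold Re in *; simpl. lra.
  - rewrite CF_0_JE, (JE_vanish_shift s (ln PI)) by (assumption || lra). ring.
Qed.

Lemma CF_0_zero a s : a O <> RtoC 0 -> CF 0 a s = RtoC 0 -> JE s (ln PI) = RtoC 0.
Proof.
  intros Ha. rewrite CF_0_JE. intros H. destruct (Cmult_eq_0 _ _ H) as [h|h]; [|exact h].
  destruct (Cmult_eq_0 _ _ h) as [h'|h']; [contradiction|].
  exfalso. apply Ha. apply (f_equal Cconj) in h'. rewrite Cconj_conj in h'. rewrite h'. apply C_ext; simpl; ring.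
Qed.

(** Off both axes [s^2] is not real and [w = s] is admissible in [JE_vanish]; real [s] are excluded
    by the positivity of the integrand. *)
Lemma CF_0_axis a s : a O <> RtoC 0 -> CF 0 a s = RtoC 0 -> Re s = 0.
Proof.
  intros Ha H0. apply CF_0_zero in H0; [|exact Ha]. apply NNPP. intros hr.
  destruct (Req_dec (Im s) 0) as [hi|hi].
  - apply (JE_real_pos (Re s) (ln PI)). replace (RtoC (Re s)) with s; [exact H0|]. apply C_ext; [reflexivity|exact hi].
  - apply (JE_not_vanish s). apply JE_vanish; [exact H0|]. intros e He. exists s. split; [|split].
    + replace (s - s)%C with (RtoC 0) by ring. rewrite Cmod_0. lra.
    + intros h. apply (f_equal Im) in h. unfold Re, Im in *; simpl in h.
      assert (fst s * snd s <> 0) by (apply Rmult_integral_contrapositive; now split). lra.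
    + rewrite H0, Cmod_0. apply Rmult_le_pos; [lra|apply Cmod_ge_0].
Qed.

(** At a multiple zero [JE w] is of order [eta^2] for [w = (1 + eta) z], whereas [z^2 - (conj w)^2]
    is of exact order [eta], since [z] is imaginary and nonzero. This is the smallness that
    [JE_vanish] asks for. *)
Lemma CF_0_simple a l g z : a O <> RtoC 0 -> ent g -> (forall s, CF 0 a s = (LP l s * g s)%C) -> (2 <= count_occ C_dec l z)%nat -> False.
Proof.
  intros Ha Hg Hf Hk. set (k := count_occ C_dec l z) in *.
  set (b := (a O * Cconj (a O))%C).
  assert (Hb : b <> RtoC 0).
  { apply Cmult_neq_0'; [exact Ha|]. intros h. apply Ha. apply (f_equal Cconj) in h. rewrite Cconj_conj in h. rewrite h. apply C_ext; simpl; ring. }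
  set (Q := fun s => ((s - z) ^ (k - 2) * (LP (remove C_dec z l) s * g s))%C).
  assert (HQ : forall s, CF 0 a s = ((s - z) * (s - z) * Q s)%C).
  { intros s. rewrite Hf, (LP_remove l z s). fold k. replace k with (S (S (k - 2))) at 1 by lia. rewrite !Cpow_S. unfold Q. ring. }
  assert (EQ : ent Q).
  { apply ent_mult; [apply ent_pow, ent_sub_const|]. apply ent_mult; [apply ent_LP|exact Hg]. }
  assert (Hz : CF 0 a z = RtoC 0) by (rewrite HQ; ring).
  pose proof (CF_0_axis a z Ha Hz) as Hre. apply CF_0_zero in Hz; [|exact Ha].
  assert (Hz0 : z <> RtoC 0) by (intros ->; now apply (JE_real_pos 0 (ln PI))).
  assert (Hm : 0 < Cmod z) by now apply Cmod_pos. set (m := Cmod z) in *.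
  destruct (ent_bounded Q (2 * m) EQ) as [B [HB HBQ]].
  assert (Hbm : 0 < Cmod b) by now apply Cmod_pos.
  assert (Hcz : (Cconj z * Cconj z = z * z)%C).
  { unfold Re in Hre. apply C_ext; simpl; rewrite Hre; ring. }
  apply (JE_not_vanish z). apply JE_vanish; [exact Hz|]. intros e He.
  (* The bound [e / m] keeps [w] within [e] of [z]; [e |b| / B] makes the quotient small; the bound
     1 keeps [w] in the disc where [B] bounds [Q]. *)
  set (eta := Rmin 1 (Rmin (e / m) (e * Cmod b / B))).
  assert (He0 : 0 < eta).
  { apply Rmin_glb_lt; [lra|]. apply Rmin_glb_lt; apply Rdiv_lt_0_compat; try lra. now apply Rmult_lt_0_compat. }
  assert (He1 : eta <= 1) by apply Rmin_l.
  assert (He2 : eta * m <= e).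
  { apply Rle_trans with (e / m * m); [|right; field; lra]. apply Rmult_le_compat_r; [lra|].
    eapply Rle_trans; [apply Rmin_r|apply Rmin_l]. }
  assert (He3 : eta * B <= e * Cmod b).
  { apply Rle_trans with (e * Cmod b / B * B); [|right; field; lra]. apply Rmult_le_compat_r; [lra|].
    eapply Rle_trans; [apply Rmin_r|apply Rmin_r]. }
  exists (RtoC (1 + eta) * z)%C.
  assert (Ed : (RtoC (1 + eta) * z - z = RtoC eta * z)%C) by (rewrite RtoC_plus; ring).
  assert (Es : (z * z - Cconj (RtoC (1 + eta) * z) * Cconj (RtoC (1 + eta) * z) = RtoC (- (eta * (2 + eta))) * (z * z))%C).
  { rewrite Cmult_conj. replace (Cconj (RtoC (1 + eta))) with (RtoC (1 + eta)) by (apply C_ext; simpl; ring).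
    transitivity (z * z - RtoC (1 + eta) * RtoC (1 + eta) * (Cconj z * Cconj z))%C; [ring|]. rewrite Hcz.
    rewrite <- RtoC_mult. replace (- (eta * (2 + eta))) with (1 - (1 + eta) * (1 + eta)) by ring. rewrite RtoC_minus. ring. }
  split; [|split].
  - rewrite Ed, Cmod_mult, Cmod_RtoC_pos by lra. exact He2.
  - rewrite Es. apply Cmult_neq_0'; [apply RtoC_neq_0; nra|now apply Cmult_neq_0'].
  - rewrite Es, !Cmod_mult, Cmod_R, Rabs_Ropp, Rabs_pos_eq by nra. fold m.
    assert (HJ : Cmod b * Cmod (JE (RtoC (1 + eta) * z) (ln PI)) <= (eta * m) * (eta * m) * B).
    { rewrite <- Cmod_mult. unfold b. rewrite <- CF_0_JE, HQ, Ed, !Cmod_mult, Cmod_RtoC_pos by lra.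
      apply Rmult_le_compat_l; [apply Rmult_le_pos; apply Rmult_le_pos; lra|]. apply HBQ.
      rewrite Cmod_mult, Cmod_RtoC_pos by lra. apply Rmult_le_compat_r; lra. }
    apply Rmult_le_reg_l with (Cmod b); [exact Hbm|]. eapply Rle_trans; [exact HJ|].
    assert (Hmm : 0 <= eta * (m * m)) by (apply Rmult_le_pos; [lra|apply Rmult_le_pos; lra]).
    apply Rle_trans with (eta * (m * m) * (eta * B)); [right; ring|].
    apply Rle_trans with (eta * (m * m) * (e * Cmod b)); [now apply Rmult_le_compat_l|].
    replace (Cmod b * (e * (eta * (2 + eta) * (m * m)))) with (eta * (m * m) * (e * Cmod b) * (2 + eta)) by ring.
    assert (0 <= eta * (m * m) * (e * Cmod b)) by (apply Rmult_le_pos; [exact Hmm|apply Rmult_le_pos; lra]). nra.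
Qed.

Lemma CF_0_bad a l g z : a O <> RtoC 0 -> ent g -> (forall s, CF 0 a s = (LP l s * g s)%C) -> In z l -> bad l z <= 0.
Proof.
  intros Ha Hg Hf Hz. unfold bad.
  assert (Hc : (count_occ C_dec l z <= 1)%nat) by (apply Nat.nlt_ge; intros h; now apply (CF_0_simple a l g z)).
  apply le_INR in Hc. simpl (INR 1) in Hc.
  rewrite (CF_0_axis a z Ha) by (rewrite Hf, LP_in_0 by exact Hz; ring).
  destruct (Req_EM_T 0 0); [lra|congruence].
Qed.

Lemma CF_strip_factor n a T : (exists m, (m <= n)%nat /\ a m <> RtoC 0) -> exists l g, ent g /\
  (forall s, CF n a s = (LP l s * g s)%C) /\ (forall z, CF n a z = RtoC 0 -> Rabs (Im z) < T -> g z <> RtoC 0).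
Proof.
  intros Ha. destruct (CF_zero_free n a Ha) as [C0 HC0].
  set (r := Rabs C0 + Rabs T + Rabs T + 1).
  pose proof (Rabs_pos C0). pose proof (Rabs_pos T). pose proof (RRle_abs C0). pose proof (RRle_abs T).
  destruct (ent_zero_list (CF n a) (fun z => Cmod z <= r) r (ent_CF n a)) as [l [g [Hg [Hf [_ Hgz]]]]].
  - exists (RtoC (Rabs C0)). apply HC0; unfold Re, Im; simpl; [rewrite Rabs_Rabsolu; lra|rewrite Rabs_R0; apply Rabs_pos].
  - unfold r; lra.
  - auto.
  - exists l, g. split; [exact Hg|]. split; [exact Hf|]. intros z Hz1 Hz2. apply Hgz.
    assert (Rabs (Re z) <= Rabs C0 + Rabs T).
    { apply Rnot_lt_le. intros h. apply (HC0 z); [lra|lra|exact Hz1]. }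
    eapply Rle_trans; [apply Cmod_le_re_im|]. unfold r. lra.
Qed.

Lemma off_axis_bound_0 a : a O <> RtoC 0 ->
  forall T, exists l g, ent g /\ (forall s, CF 0 a s = (LP l s * g s)%C) /\
    (forall z, CF 0 a z = RtoC 0 -> Rabs (Im z) < T -> g z <> RtoC 0) /\
    LS (bad l) (filter (in_strip T) (nodup C_dec l)) <= 0.
Proof.
  intros Ha T. destruct (CF_strip_factor 0 a T) as [l [g [Hg [Hf Hgz]]]]; [exists O; split; [lia|exact Ha]|].
  exists l, g. split; [exact Hg|]. split; [exact Hf|]. split; [exact Hgz|].
  apply Rle_trans with (LS (fun _ => 0 * 0) (filter (in_strip T) (nodup C_dec l))).
  - apply LS_le. intros z Hz. rewrite Rmult_0_l. apply filter_In in Hz. destruct Hz as [Hz _]. apply nodup_In in Hz.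
    now apply (CF_0_bad a l g).
  - rewrite (LS_scal 0 (fun _ => 0)). lra.
Qed.

Theorem theorem1 (n : nat) (a : nat -> C)
  (Ha : exists m : nat, (m <= n)%nat /\ a m <> 0%C) :
  exists K : R, forall T : R, 2 <= T ->
    exists (zs : list C) (ks : list nat),
      NoDup zs /\
      (forall s : C, In s zs <-> (CF n a s = 0%C /\ Rabs (Im s) < T)) /\
      Forall2 (zero_order (CF n a)) zs ks /\
      let N := sum_nat_list ks in
      let N1 := length (filter (fun p : C * nat =>
                   if Req_EM_T (Re (fst p)) 0 then Nat.eqb (snd p) 1 else false)
                   (combine zs ks)) in
      0 <= INR N - INR N1 <=
        (32 * INR n + 32 * ln (2 * INR n + 1) / PI) * T + K.
Proof.
  assert (H : exists K, forall T, 2 <= T -> exists l g, ent g /\ (forall s, CF n a s = (LP l s * g s)%C) /\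
    (forall z, CF n a z = RtoC 0 -> Rabs (Im z) < T -> g z <> RtoC 0) /\
    2 * LS (bad l) (filter (in_strip T) (nodup C_dec l)) <= (32 * INR n + 32 * ln (2 * INR n + 1) / PI) * T + K).
  { destruct n as [|n].
    - assert (Ha0 : a O <> RtoC 0).
      { destruct Ha as [m [Hm Hm0]]. now replace m with O in Hm0 by lia. }
      (* For [n = 0] the coefficient of [T] is zero, and all zeros are simple and on the axis, so
         the constant is 0. *)
      exists 0. intros T HT. destruct (off_axis_bound_0 a Ha0 T) as [l [g [H1 [H2 [H3 H4]]]]].
      exists l, g. split; [exact H1|]. split; [exact H2|]. split; [exact H3|].
      replace (2 * INR 0 + 1) with 1 by (simpl; ring). rewrite ln_1. simpl INR. lra.
    - apply off_axis_bound_pos; [lia|exact Ha]. }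
  destruct H as [K HK]. exists K. intros T HT. destruct (HK T HT) as [l [g [Hg [Hf [Hgz HB]]]]].
  destruct (strip_count (CF n a) g l T Hg Hf Hgz) as [A1 [A2 [A3 [A4 A5]]]].
  exists (filter (in_strip T) (nodup C_dec l)), (map (count_occ C_dec l) (filter (in_strip T) (nodup C_dec l))).
  split; [exact A1|]. split; [exact A2|]. split; [exact A3|].
  split; [exact A4|]. eapply Rle_trans; [exact A5|exact HB].
Qed.
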